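(* Let $\psi_0\in\overline X$, put $\Delta_0(v,r)=\psi_0(v)-\psi_0(v-r)$ for $(v,r)\in\mathbb R\times\mathbb R_+$, and let $\psi_t=S_0(t)\psi_0=e^{-t\overline L_3}\psi_0\in L^2(\nu)$ for $t\ge 0$. Then there exists $T^*>0$ such that for all $t\in[0,T^*]$ $$\big|\psi_t(v)-\psi_t(v-r)\big|\le C\,\Gamma_t(v,r)\,\|\Delta_0\|_{\overline Y}\qquad\text{for }\nu\text{-almost every }(v,r)\in\mathbb R\times\mathbb R_+ ,$$ where $C<\infty$ is a constant depending only on the parameters appearing in the weight function $\Gamma_t$ (and on the fixed auxiliary parameters), not on $\psi_0$.
   Context: Throughout $\mathbb R_+=(0,\infty)$ for the variable $r$. ''$\nu$-almost every $(v,r)$'' means almost every with respect to $\nu(dv)\,dr$ (equivalently, Lebesgue measure). Parameters: $\bar n>0$, $1/9<\alpha<1/6.5$, $\mu\in[1/3,7/16]$, $c_0=0.52$, $a\ge 9$, $\gamma_0\in(0,1/8]$, $\kappa\ge 7$, $1\le\beta\le\kappa/4$ (in particular $0<\alpha<1/6$, $\mu<\frac12-\frac38\alpha$, $\mu c_0\in(\alpha,1/4)$). Operator and semigroup: $\nu(dw)=e^{-w}(\ln(1+e^w))^{5/2}\,dw$ on $\mathbb R$, and $$\overline K_3(u,v)=4\bar n\,[\ln(1+e^u)\ln(1+e^v)]^{-3/2}\,\frac{e^{-|u-v|}}{1+e^{-\min(u,v)}+e^{-\max(u,v)}}\;\frac{2+e^{\max(u,v)}}{1-e^{-|u-v|}}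 .$$ Let $\tilde Q(\phi,\psi)=\frac12\int_{\mathbb R^2}\nu(du)\nu(dv)\overline K_3(u,v)(\phi(u)-\phi(v))^*(\psi(u)-\psi(v))$, $Q(\phi,\psi)=\tilde Q(\phi,\psi)+(\phi,\psi)_{L^2(\nu)}$, with domain $D(Q)=\{\psi\in L^2(\nu):Q(\psi,\psi)<\infty\}$. $\overline L_3$ is the non-negative self-adjoint operator on $L^2(\nu)$ (Friedrichs extension) with domain $\{\psi\in D(Q):\exists C<\infty,\ |Q(\phi,\psi)|\le C\|\phi\|_{L^2(\nu)}\ \forall\phi\in D(Q)\}$ and $(\phi,\overline L_3\psi)=Q(\phi,\psi)-(\phi,\psi)$ for all $\phi\in D(Q)$. $S_0(t)=e^{-t\overline L_3}$. Weights and spaces: $f(v)=\max\big((\ln(1+e^v))^{-\alpha},(\ln 2)^{-\alpha}\big)$, $\tilde\Gamma(v)=f(v)\exp[\mu\max(a,c_0v)]$, and for $t\ge0$ $$\Gamma_t(v,r)=(f(v)+f(v-r))\exp[\mu\max(a,c_0v,v-r)]\,(1-e^{-\kappa r})^{\gamma_t(v,r)},$$ $$\gamma_t(v,r)=\gamma_0+\frac{\bar a(t)}{1+e^{\beta(v-r)}},\qquad \bar a(t)=\tfrac18\min(1,\bar n)\frac{t}{1+t}.$$ (So at $t=0$ the exponent is $\gamma_0$; this is $\Gamma_0$.) $\overline X$ is the Banach space of continuous functions $\psi$ on $\mathbb R$ with $\sup_v|\psi(v)|/\tilde\Gamma(v)+\sup_{(v,r)\in\mathbb R\times\mathbb R_+}|\psi(v)-\psi(v-r)|/\Gamma_0(v,r)<\infty$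 (one has $\overline X\subset D(\overline L_3)\subset L^2(\nu)$). $\overline Y$ is the Banach space of continuous functions $\Delta$ on $\mathbb R\times\mathbb R_+$ with $\|\Delta\|_{\overline Y}=\sup_{(v,r)}|\Delta(v,r)|/\Gamma_0(v,r)<\infty$. *)

(* Defs.v *)
From HB Require Import structures.
From mathcomp Require Import all_boot all_order all_algebra complex.
From mathcomp Require Import all_classical all_reals all_analysis measurable_realfun.

Set Implicit Arguments.
Unset Strict Implicit.
Unset Printing Implicit Defensive.
Import Order.TTheory GRing.Theory Num.Theory.
Import numFieldNormedType.Exports.
Local Open Scope classical_set_scope.
Local Open Scope ring_scope.
Local Open Scope complex_scope.

Notation cabs := ComplexField.Normc.normc.

Section nu_measure.
Context {R : realType}.

Definition nu_density (w : R) : R :=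
  expR (- w) * (ln (1 + expR w)) `^ (5 / 2).

Definition nu (A : set R) : \bar R :=
  (\int[lebesgue_measure]_(w in A) (nu_density w)%:E)%E.

Lemma nu_density_ge0 w : 0 <= nu_density w.
Proof. by rewrite mulr_ge0 ?expR_ge0 ?powR_ge0. Qed.

Lemma measurable_nu_density : measurable_fun [set: R] nu_density.
Proof.
apply: measurable_funM.
  by apply: measurableT_comp => //; exact: measurable_funN.
apply: (measurableT_comp (measurable_powR _)).
apply: measurableT_comp => //.
exact: measurable_funD.
Qed.

Let nu0 : nu set0 = 0%E.
Proof. by rewrite /nu integral_set0. Qed.

Let nu_ge0 A : (0 <= nu A)%E.
Proof. by apply: integral_ge0 => x _; rewrite lee_fin nu_density_ge0. Qed.

Let nu_sigma_additive : semi_sigma_additive nu.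
Proof.
move=> /= F mF tF mUF; rewrite /nu; apply: cvg_toP.
  apply: ereal_nondecreasing_is_cvgn => m n mn.
  apply: lee_sum_nneg_natr => // k _ _; apply: integral_ge0 => /= x Fkx.
  by rewrite lee_fin nu_density_ge0.
rewrite ge0_integral_bigcup//=.
- apply/measurable_funTS/measurableT_comp => //.
  exact: measurable_nu_density.
- by move=> x _; rewrite lee_fin nu_density_ge0.
Qed.

HB.instance Definition _ := isMeasure.Build _ _ _
  nu nu0 nu_ge0 nu_sigma_additive.

Let nu_sigma_finite : sigma_finite [set: R] nu.
Proof.
exists (fun k : nat => `] (- k%:R)%R, k%:R]%classic); first by rewrite bigcup_itvT.
move=> k; split => //=; rewrite /nu.
pose M : R := expR k%:R * (expR k%:R) `^ (5 / 2).
apply: (@le_lt_trans _ (\bar R)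
  (\int[lebesgue_measure]_(w in `](- k%:R)%R, k%:R]%classic) M%:E)%E).
  apply: ge0_le_integral => //=.
  - by move=> x _; rewrite lee_fin nu_density_ge0.
  - apply/measurable_funTS/measurableT_comp => //.
    exact: measurable_nu_density.
  - move=> x; rewrite in_itv/= => /andP[x1 x2]; rewrite lee_fin.
    apply: ler_pM; rewrite ?expR_ge0 ?powR_ge0//.
      by rewrite ler_expR lerNl ltW.
    have lnb : ln (1 + expR x) <= expR x.
      rewrite -[leRHS]expRK ler_ln ?posrE ?expR_gt0 ?addr_gt0 ?expR_gt0//.
      exact: expR_ge1Dx.
    apply: ge0_ler_powR; rewrite ?nnegrE ?expR_ge0//.
      by rewrite ln_ge0// lerDl expR_ge0.
    by apply: (le_trans lnb); rewrite ler_expR.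
rewrite integral_cst//= lebesgue_measure_itv/=.
by case: ifP => _; rewrite -?EFinB ?mule0 -?EFinM ltry.
Qed.

HB.instance Definition _ := Measure_isSigmaFinite.Build _ _ _
  nu nu_sigma_finite.

End nu_measure.

Section weights.
Context {R : realType}.
Variables (nbar alpha mu a gamma0 kappa beta : R).

Definition c0 : R := 52 / 100.

Definition f_weight (v : R) : R :=
  Num.max ((ln (1 + expR v)) `^ (- alpha)) ((ln 2) `^ (- alpha)).

Definition Gamma_tilde (v : R) : R :=
  f_weight v * expR (mu * Num.max a (c0 * v)).

Definition abar (t : R) : R := 1 / 8 * Num.min 1 nbar * (t / (1 + t)).

Definition gamma (t v r : R) : R :=
  gamma0 + abar t / (1 + expR (beta * (v - r))).

Definition Gamma (t v r : R) : R :=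
  (f_weight v + f_weight (v - r)) * expR (mu * Num.max a (Num.max (c0 * v) (v - r))) *
  (1 - expR (- (kappa * r))) `^ gamma t v r.

Definition difference (psi : R -> R[i]) (z : R * R) : R[i] :=
  psi z.1 - psi (z.1 - z.2).

Definition Ynorm (Delta : R * R -> R[i]) : \bar R :=
  ereal_sup [set (cabs (Delta z) / Gamma 0 z.1 z.2)%:E
            | z in [set z : R * R | 0 < z.2]].

Definition Xnorm (psi : R -> R[i]) : \bar R :=
  (ereal_sup [set (cabs (psi v) / Gamma_tilde v)%:E | v in [set: R]]
   + Ynorm (difference psi))%E.

Definition in_X (psi : R -> R[i]) : Prop :=
  continuous (psi : R -> R[i]^o) /\ (Xnorm psi < +oo)%E.

End weights.

Section L2.
Context {R : realType}.
Implicit Types phi psi eta : R -> R[i].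

Definition cintegral d (T : measurableType d) (m : {measure set T -> \bar R})
    (g : T -> R[i]) : R[i] :=
  (\int[m]_x complex.Re (g x))%R +i* (\int[m]_x complex.Im (g x))%R.

Definition L2norm psi : \bar R := 'N[nu]_2%:E[EFin \o (@cabs R \o psi)]%E.

(* Elements of L^2(nu) are handled through representatives, identified when
   they agree nu-almost everywhere. *)
Definition in_L2 psi : Prop :=
  [/\ measurable_fun [set: R] (fun v => complex.Re (psi v)),
      measurable_fun [set: R] (fun v => complex.Im (psi v)) &
      (L2norm psi < +oo)%E].

Definition L2dot phi psi : R[i] := cintegral nu (fun v => (phi v)^* * psi v).

End L2.

Section operator.
Context {R : realType}.
Variable nbar : R.
Implicit Types phi psi eta : R -> R[i].

(* On the null set u = v the last denominator vanishes and the quotient is 0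
   by convention. *)
Definition K3 (u v : R) : R :=
  4 * nbar * (ln (1 + expR u) * ln (1 + expR v)) `^ (- (3 / 2)) *
  (expR (- `|u - v|) /
   (1 + expR (- Num.min u v) + expR (- Num.max u v))) *
  ((2 + expR (Num.max u v)) / (1 - expR (- `|u - v|))).

Definition Qtilde phi psi : R[i] :=
  (1 / 2)%:C * cintegral (nu \x nu)%E (fun z =>
    (K3 z.1 z.2)%:C * ((phi z.1 - phi z.2)^* * (psi z.1 - psi z.2))).

Definition Q phi psi : R[i] := Qtilde phi psi + L2dot phi psi.

(* Q(psi, psi) as an element of [0, +oo], defined for every psi in L^2(nu) *)
Definition Qdiag psi : \bar R :=
  ((1 / 2)%:E * \int[nu \x nu]_z
      (K3 z.1 z.2 * cabs (psi z.1 - psi z.2) ^+ 2)%:E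
   + L2norm psi ^+ 2)%E.

Definition in_DQ psi : Prop := in_L2 psi /\ (Qdiag psi < +oo)%E.

Definition in_DL3 psi : Prop :=
  in_DQ psi /\
  exists C : R, forall phi, in_DQ phi ->
    ((cabs (Q phi psi))%:E <= C%:E * L2norm phi)%E.

(* graph of the operator: eta represents L3 psi *)
Definition L3 psi eta : Prop :=
  [/\ in_DL3 psi, in_L2 eta &
      forall phi, in_DQ phi -> L2dot phi eta = Q phi psi - L2dot phi psi].

End operator.

Section semigroup.
Context {R : realType}.
Implicit Types (phi psi eta : R -> R[i]) (S : R -> (R -> R[i]) -> R -> R[i]).

(* strongly continuous semigroup of bounded linear operators on L^2(nu) *)
Definition C0_semigroup S : Prop :=
  (forall t psi, 0 <= t -> in_L2 psi -> in_L2 (S t psi)) /\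
  (forall t (c : R[i]) phi psi, 0 <= t -> in_L2 phi -> in_L2 psi ->
     {ae nu, forall v,
       S t (fun x => c * phi x + psi x) v = c * S t phi v + S t psi v}) /\
  (forall t, 0 <= t -> exists M : R, forall psi, in_L2 psi ->
     (L2norm (S t psi) <= M%:E * L2norm psi)%E) /\
  (forall psi, in_L2 psi -> {ae nu, forall v, S 0 psi v = psi v}) /\
  (forall s t psi, 0 <= s -> 0 <= t -> in_L2 psi ->
     {ae nu, forall v, S (s + t) psi v = S s (S t psi) v}) /\
  (forall psi, in_L2 psi ->
     L2norm (fun v => S t psi v - psi v) @[t --> 0^'+] --> 0%E).

(* S t = e^{-tA}: the generator of S, with its full domain, is -A; the
   operator A is given by its graph. *)
Definition is_exp_semigroup (A : (R -> R[i]) -> (R -> R[i]) -> Prop) S : Prop :=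
  C0_semigroup S /\
  forall psi eta, in_L2 psi -> in_L2 eta ->
    (A psi eta <->
     L2norm (fun v => (t^-1)%:C * (S t psi v - psi v) + eta v)
       @[t --> 0^'+] --> 0%E).

End semigroup.

(* Main.v *)
(** The kernel is regularised to one of bounded jump rate, and the semigroup is
    approximated by the explicit Euler scheme [phi - h A_e phi].  Let [r = |x - y|],
    let [Ginf] be a weight equivalent to [Gamma 0] without its last factor, and put
      [G_th x y = Ginf x y * min(1, r/d)^gamma0 * exp(-th (q x + q y) ln^+(d/(r+e)))].
    A bound [|phi x - phi y| <= M G_th x y] becomes, after one Euler step,
    the same bound with [M exp(C h)] and [th + h], uniformly in [e] and [h].  Indeed
    the jumps that the kernel makes from [x] and from [y] to a common point cancel
    in the difference; their rate, integrated over jump sizes between [r] and [d], is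
    of order [(q x + q y) ln(d/r)] and pays for the growth of [th].  All other terms are
    bounded by a drift estimate [int k(v,u) (Ginf u w - Ginf v w) du <= C Ginf v w].
    The regularised generators converge to the true one in [L^2(nu)] on functions
    of this regularity, and a strongly continuous semigroup is bounded near time [0], so
    the scheme converges in [L^2(nu)] to the semigroup, for small times, and
    the bound passes to the limit almost everywhere. *)

Require Import Defs.
From HB Require Import structures.
From mathcomp Require Import all_boot all_order all_algebra complex.
From mathcomp Require Import all_classical all_reals all_analysis measurable_realfun.
From mathcomp Require Import ring lra.
Set Implicit Arguments.
Unset Strict Implicit.
Unset Printing Implicit Defensive.
Import Order.TTheory GRing.Theory Num.Theory.
Import numFieldNormedType.Exports.
Local Open Scope classical_set_scope.
Local Open Scope ring_scope.

(** * Softplus and the Bose factor *)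

(** Near the diagonal the kernel is of the order of the reciprocal of the jump size, so the total
    jump rate is infinite. Once it is finite, the new difference at a pair of points is, for small
    [h], a combination of old differences with nonnegative coefficients. The cancellation of common
    jumps is imperfect: it leaves a loss, a fixed multiple of [rho], that does not vanish as the two
    points approach. The scale [d] is there to beat it. Common jumps of size between [d] and 1/100
    contribute [ln(1 / (100 d))] times the same [rho], and [d] is so small that this exceeds the
    loss; sizes between [r] and [d] are then free to pay for [th]. The other obstacle is [rho 0 v],
    of order [exp(-v/2)] at [-oo]. The drift bound survives there only because jumps of equal length
    up and down nearly balance, and the consistency bound spends a small part of the integrability
    margin of the weights in [L^2(nu)]. The semigroup is known only through strong continuity and
    its generator. The iterates and the points between them lie in the domain of the generator,
    because their bounds make the singular integral converge. *)

Section softplus.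
Context {R : realType}.
Implicit Types x y z t r e : R.

(** The difference of the two sides vanishes at 0 and has derivative [z^2 / ((1 + z) (2 + z)^2)].
    This accuracy matters in [jump_ff_nonpos], which needs [softplus x * (1 + 2 exp(-x)) >= 2], an
    equality in the limit at [-oo]. *)
Lemma ln1p_ge z : 0 <= z -> 2 * z / (2 + z) <= ln (1 + z).
Proof.
move=> z0.
pose F : R -> R := (@ln R \o (cst 1 + @idfun R)) - cst 2 + 4 \*: (fun y => ((cst 2 + @idfun R) y)^-1).
have FE x : 0 <= x -> F x = ln (1 + x) - 2 * x / (2 + x).
  move=> x0; transitivity (ln (1 + x) - 2 + 4 * (2 + x)^-1) => //.
  by field; rewrite gt_eqF//; lra.
have dF x : 0 <= x -> is_derive x 1 F ((1 + x)^-1 - 4 / (2 + x) ^+ 2).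
  move=> x0.
  have x1 : 0 < 1 + x by lra.
  have x2 : (cst 2 + @idfun R) x != 0 by rewrite gt_eqF// fctE /=; lra.
  have d0 : is_derive ((cst 1 + @idfun R) x) 1 (@ln R) (1 + x)^-1.
    exact: is_derive1_ln.
  have d2 : is_derive x 1 (fun y => ((cst 2 + @idfun R) y)^-1) (- ((2 + x) ^- 2)).
    have d1 : is_derive x 1 (cst 2 + @idfun R) (0 + 1) by exact: is_deriveD.
    have := is_deriveV x2 d1; rewrite add0r => d3.
    by apply: (is_derive_eq d3); rewrite /GRing.scale/= mulr1.
  have d1 : is_derive x 1 (cst 1 + @idfun R) (0 + 1) by exact: is_deriveD.
  have dc : is_derive x 1 (@cst R R 2) 0 by exact: is_derive_cst.
  apply: (is_derive_eq (is_deriveD (is_deriveB (is_derive1_comp d0 d1) dc)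
    (is_deriveZ 4 d2))).
  by rewrite /GRing.scale/=; ring.
have := @ger0_derive1_ndecry _ F 0 _ _ _ 0 z (lexx _) z0.
rewrite !FE// !(addr0, mulr0, mul0r, ln1, subr0) subr_ge0; apply.
- by move=> x; rewrite in_itv/= andbT => /ltW x0; have [] := dF _ x0.
- move=> x; rewrite in_itv/= andbT => /ltW x0; have [_] := dF _ x0.
  rewrite -derive1E => ->.
  have x1 : 0 < 1 + x by lra.
  have x2 : 0 < (2 + x) ^+ 2 by rewrite exprn_gt0//; lra.
  rewrite subr_ge0 ler_pdivrMr// -ler_pdivrMl ?invr_gt0// invrK; nra.
- apply: derivable_within_continuous => x; rewrite in_itv/= andbT => x0.
  by have [] := dF _ x0.
Qed.

Definition softplus x := ln (1 + expR x).

Lemma expR1_gt0 x : 0 < 1 + expR x :> R.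
Proof. by rewrite addr_gt0 ?expR_gt0. Qed.

Lemma softplus_gt0 x : 0 < softplus x.
Proof. by rewrite ln_gt0// ltrDl expR_gt0. Qed.

Lemma softplus_ge0 x : 0 <= softplus x.
Proof. exact: ltW (softplus_gt0 x). Qed.

Lemma softplus_le_expR x : softplus x <= expR x.
Proof. by apply: le_ln1Dx; rewrite (@lt_le_trans _ _ 0) ?expR_ge0//; lra. Qed.

Lemma softplus_ge x : 2 * expR x / (2 + expR x) <= softplus x.
Proof. by apply: ln1p_ge; exact: expR_ge0. Qed.

Lemma softplus_nd x y : x <= y -> softplus x <= softplus y.
Proof.
by move=> xy; rewrite ler_ln ?posrE ?expR1_gt0// lerD2l ler_expR.
Qed.

Lemma softplus_lip x y : x <= y -> softplus y <= softplus x + (y - x).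
Proof.
move=> xy; rewrite -[y - x]expRK /softplus -lnM ?posrE ?expR_gt0 ?expR1_gt0//.
rewrite ler_ln ?posrE ?mulr_gt0 ?expR_gt0 ?expR1_gt0// mulrDl mul1r -expRD subrKC.
by rewrite lerD2r -[1]expR0 ler_expR subr_ge0.
Qed.

(** Concavity of [ln]: [1 + exp x] is the convex combination of [1 + exp y] and [1] with weight
    [exp(x - y)] on the former, and [ln 1 = 0]. *)
Lemma softplus_loglip x y : x <= y -> softplus y <= expR (y - x) * softplus x.
Proof.
move=> xy; set c := expR (y - x).
have c1 : 1 <= c by rewrite /c -[1]expR0 ler_expR subr_ge0.
have c0 : 0 < c by lra.
have i0 : 0 <= c^-1 by rewrite invr_ge0 ltW.
have i1 : c^-1 <= 1 by rewrite invf_le1.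
have := @concave_ln R (Itv01 i0 i1) (1 + expR y) 1 (expR1_gt0 y) ltr01.
rewrite !convRE/= ln1 mulr0 addr0 /unstable.onem mulr1 -ler_pdivlMl ?invr_gt0// invrK.
suff -> : c^-1 * (1 + expR y) + (1 - c^-1) = 1 + expR x by [].
have -> : expR y = c * expR x by rewrite -expRD subrK.
by field; rewrite gt_eqF.
Qed.

Lemma softplus_expRN x : 1 <= softplus x * (1 + expR (- x)).
Proof.
have := softplus_ge x; have e0 := expR_gt0 x; have l0 := softplus_gt0 x.
rewrite expRN ler_pdivrMr ?addr_gt0// => h.
rewrite mulrDr mulr1 -(ler_pM2r e0) mul1r mulrDl mulfVK ?gt_eqF//.
rewrite /softplus in h l0 *; nra.
Qed.

Lemma softplus0_ge : 2 / 3 <= softplus 0.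
Proof. by have := softplus_ge 0; rewrite expR0 mulr1 (_ : 2 + 1 = 3)//; ring. Qed.

Lemma softplus_le_add x : 0 <= x -> softplus x <= 1 + x.
Proof.
move=> x0; have := softplus_lip x0; have := softplus_le_expR 0.
by rewrite expR0 subr0; lra.
Qed.

(** The Bose-Einstein occupation number. The quotient of [exp(-s)] by [1 - exp(-s)] in [K3] is
    [bose s]. *)
Definition bose t := (expR t - 1)^-1.

Lemma expRB1_gt0 t : 0 < t -> 0 < expR t - 1.
Proof. by move=> t0; rewrite subr_gt0 -expR0 ltr_expR. Qed.

Lemma bose_gt0 t : 0 < t -> 0 < bose t.
Proof. by move=> t0; rewrite invr_gt0 expRB1_gt0. Qed.

Lemma bose_ge0 t : 0 <= t -> 0 <= bose t.
Proof. by move=> t0; rewrite invr_ge0 subr_ge0 -expR0 ler_expR. Qed.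

Lemma bose_nincr s t : 0 < s -> s <= t -> bose t <= bose s.
Proof.
move=> s0 st; rewrite lef_pV2 ?posrE ?expRB1_gt0// ?(lt_le_trans s0)//.
by rewrite lerB// ler_expR.
Qed.

Lemma bose_le_inv t : 0 < t -> bose t <= t^-1.
Proof.
move=> t0; rewrite lef_pV2 ?posrE ?expRB1_gt0//.
by have := expR_ge1Dx t; lra.
Qed.

Lemma expRN_ge_sub t : 1 - t <= expR (- t).
Proof. by have := expR_ge1Dx (- t). Qed.

Lemma bose_le t : 0 < t -> bose t <= expR (- t) * (1 + t^-1).
Proof.
move=> t0; rewrite /bose expRN; have h := expRB1_gt0 t0.
have e0 := expR_gt0 t.
rewrite -(ler_pM2r h) mulVf ?gt_eqF// -(ler_pM2l e0) mulr1.
rewrite !mulrA mulfV ?gt_eqF// mul1r -(ler_pM2l t0).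
rewrite [leRHS](_ : _ = (t + 1) * (expR t - 1)); last by field; rewrite gt_eqF.
have := expR_ge1Dx t; lra.
Qed.

Lemma bose_expR_le t : 0 < t -> expR t * bose t <= 1 + t^-1.
Proof.
move=> t0; rewrite -(ler_pM2l (expR_gt0 (- t))) mulrA -expRD addNr expR0 mul1r.
exact: bose_le.
Qed.

Lemma bose_ge t : 0 < t -> expR (- t) / t <= bose t.
Proof.
move=> t0; rewrite ler_pdivrMr// mulrC /bose -ler_pdivrMr ?invr_gt0 ?expRB1_gt0// invrK.
have := expR_ge1Dx (- t); rewrite expRN => h.
rewrite mulrBr mulr1 mulVf ?gt_eqF ?expR_gt0//; lra.
Qed.

(* [(exp t - 1) / t] has logarithmic derivative at most 1. *)
Lemma bose_shift t r : 0 < t -> 0 <= r ->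
  expR (- r) * (t / (t + r)) * bose t <= bose (t + r).
Proof.
move=> t0 r0.
have tr : 0 < t + r by lra.
have A0 := expRB1_gt0 t0; have B0 := expRB1_gt0 tr.
have h : expR (- r) * t * (expR (t + r) - 1) <= (t + r) * (expR t - 1).
  have -> : expR (- r) * t * (expR (t + r) - 1) = t * (expR t - expR (- r)).
    have e : expR (- r) * expR r = 1 by rewrite -expRD addNr expR0.
    by rewrite expRD -[in RHS](mul1r (expR t)) -[in RHS]e; ring.
  have := expRN_ge_sub r; have := expR_ge1Dx t; nra.
rewrite /bose -[leRHS]mul1r ler_pdivlMr//.
rewrite [leLHS](_ : _ = (expR (- r) * t * (expR (t + r) - 1)) / ((t + r) * (expR t - 1))).
  by rewrite ler_pdivrMr ?mulr_gt0// mul1r.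
by field; rewrite !gt_eqF.
Qed.
End softplus.

Section rates.
Context {R : realType}.
Implicit Types x y u v t r e : R.

(** The part of the jump rate out of [x] that is unbounded as [x] tends to [-oo]; a positive [e]
    caps it at [e^-1]. *)
Definition rho e x := (Num.sqrt (softplus x) + e)^-1.

Lemma rho_den_gt0 e x : 0 <= e -> 0 < Num.sqrt (softplus x) + e.
Proof. by move=> e0; rewrite ltr_pwDl// sqrtr_gt0 softplus_gt0. Qed.

Lemma rho_gt0 e x : 0 <= e -> 0 < rho e x.
Proof. by move=> e0; rewrite invr_gt0 rho_den_gt0. Qed.

Lemma rho_le0 e x : 0 <= e -> rho e x <= rho 0 x.
Proof. by move=> e0; rewrite lef_pV2 ?posrE ?rho_den_gt0// lerD2l. Qed.

Lemma rho_le_inv e x : 0 < e -> rho e x <= e^-1.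
Proof.
move=> e0; rewrite lef_pV2 ?posrE// ?rho_den_gt0 ?(ltW e0)//.
by rewrite lerDr sqrtr_ge0.
Qed.

Lemma expR_loglip (f : R -> R) : (forall x, 0 <= f x) ->
  (forall x y, x <= y -> f x <= f y) ->
  (forall x y, x <= y -> f y <= expR (y - x) * f x) ->
  forall x y, f y <= expR `|x - y| * f x.
Proof.
move=> f0 fnd flip x y; have [xy|/ltW yx] := leP x y.
  by rewrite distrC ger0_norm ?subr_ge0// flip.
rewrite (le_trans (fnd _ _ yx))// -[leLHS]mul1r ler_wpM2r//.
by rewrite -expR0 ler_expR.
Qed.

Lemma softplus_loglip_norm x y : softplus y <= expR `|x - y| * softplus x.
Proof.
apply: expR_loglip; [exact: softplus_ge0|exact: softplus_nd|exact: softplus_loglip].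
Qed.

Lemma expR_norm_ge1 x : 1 <= expR `|x|.
Proof. by rewrite -expR0 ler_expR. Qed.

Lemma rho_loglip e x y : 0 <= e -> rho e x <= expR `|x - y| * rho e y.
Proof.
move=> e0; rewrite ler_pdivlMr ?rho_den_gt0// mulrC ler_pdivrMr ?rho_den_gt0//.
rewrite mulrDr lerD//; last by rewrite -[leLHS]mul1r ler_wpM2r// expR_norm_ge1.
rewrite (le_trans (ler_wsqrtr (softplus_loglip_norm x y)))//.
rewrite sqrtrM ?expR_ge0// ler_wpM2r ?sqrtr_ge0//.
rewrite -[leRHS](ger0_norm (expR_ge0 _)) -[leRHS]sqrtr_sqr ler_wsqrtr//.
by rewrite expr2 -[leLHS]mul1r ler_wpM2r ?expR_ge0// expR_norm_ge1.
Qed.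

Lemma expRhalf_sqr x : expR (x / 2) ^+ 2 = expR x.
Proof. by rewrite expr2 -expRD; congr expR; lra. Qed.

Lemma softplus_ge_expR x : x <= 0 -> 2 / 3 * expR x <= softplus x.
Proof.
move=> x0; apply: le_trans (softplus_ge x).
have := expR_gt0 x; have : expR x <= 1 by rewrite -expR0 ler_expR.
move=> h1 h0; rewrite ler_pdivlMr; last lra. nra.
Qed.

Lemma rho_le_expR x : rho 0 x <= 2 * expR (Num.max 0 (- x) / 2).
Proof.
rewrite /rho addr0 -[leRHS]invrK lef_pV2 ?posrE ?sqrtr_gt0 ?softplus_gt0//; last first.
  by rewrite invr_gt0 mulr_gt0 ?expR_gt0.
rewrite invfM -expRN.
set m := Num.max 0 (- x).
have p0 : 0 <= 2^-1 * expR (- (m / 2)) by rewrite mulr_ge0 ?expR_ge0.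
rewrite -[leLHS](ger0_norm p0) -sqrtr_sqr ler_wsqrtr//.
rewrite exprMn -mulNr expRhalf_sqr (_ : 2^-1 ^+ 2 = 4^-1 :> R); last by field.
have [x0|/ltW x0] := leP 0 x.
  have -> : m = 0 by rewrite /m max_l//; lra.
  rewrite oppr0 expR0; have := softplus_nd x0; have := @softplus0_ge R; lra.
have -> : m = - x by rewrite /m max_r//; lra.
have := softplus_ge_expR x0; have := expR_gt0 x; rewrite opprK; lra.
Qed.

(** What remains of [K3 v u] times the density of [nu] at [u] once [4 * n], [rho 0 v] and the Bose
    factor are taken out. It is normalised: [mm u u = 1]. *)
Definition mm v u := expR (- u) * softplus u *
  ((2 + expR (Num.max u v)) / (1 + expR (- u) + expR (- v))) / softplus v.

(** For jumps down, [mm v u] is at most [2 exp(v - u)] times the ratio [pp u / pp v]. The function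
    [pp] increases and is of order [exp(2 x)] at [-oo]. *)
Definition pp x := softplus x / (1 + 2 * expR (- x)).

Lemma mm_den_gt0 u v : 0 < 1 + expR (- u) + expR (- v) :> R.
Proof. by rewrite !addr_gt0 ?expR_gt0. Qed.

Lemma pp_den_gt0 v : 0 < 1 + 2 * expR (- v) :> R.
Proof. by rewrite addr_gt0 ?mulr_gt0 ?expR_gt0. Qed.

Lemma mm_gt0 v u : 0 < mm v u.
Proof.
by rewrite !mulr_gt0 ?invr_gt0 ?mm_den_gt0 ?softplus_gt0 ?addr_gt0 ?expR_gt0.
Qed.

Lemma mm_ge0 v u : 0 <= mm v u. Proof. exact: ltW (mm_gt0 v u). Qed.

Lemma expRNK x : expR (- x) * expR x = 1 :> R.
Proof. by rewrite -expRD addNr expR0. Qed.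

Lemma mm_up v u : v <= u ->
  mm v u = softplus u * (1 + 2 * expR (- u)) /
           (softplus v * (1 + expR (- u) + expR (- v))).
Proof.
move=> vu; rewrite /mm max_l//.
have -> : 1 + 2 * expR (- u) = expR (- u) * (2 + expR u).
  by rewrite mulrDr expRNK; ring.
by field; rewrite !gt_eqF ?mm_den_gt0 ?softplus_gt0.
Qed.

Lemma mm_dn v u : u <= v ->
  mm v u = expR (v - u) * (softplus u * (1 + 2 * expR (- v)) /
           (softplus v * (1 + expR (- u) + expR (- v)))).
Proof.
move=> uv; rewrite /mm max_r//.
have -> : 1 + 2 * expR (- v) = expR (- v) * (2 + expR v).
  by rewrite mulrDr expRNK; ring.
have -> : expR (- u) = expR (v - u) * expR (- v) by rewrite -expRD; congr expR; lra.
by field; rewrite !gt_eqF ?softplus_gt0//; rewrite !addr_gt0 ?mulr_gt0 ?expR_gt0.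
Qed.

Lemma mm_up_le v u : v <= u -> mm v u <= 3 + (u - v).
Proof.
move=> vu; rewrite mm_up// ler_pdivrMr ?mulr_gt0 ?mm_den_gt0 ?softplus_gt0//.
have h1 := softplus_lip vu; have h2 := softplus_le_expR u.
have h3 := softplus_expRN v; have h4 := expRNK u.
have e0 := expR_gt0 (- u); have e1 := expR_gt0 (- v); have l0 := softplus_gt0 v.
have l1 := softplus_gt0 u.
have h5 : softplus u * expR (- u) <= 1.
  by rewrite -h4 mulrC ler_wpM2l ?(ltW e0).
have h6 : softplus v <= softplus v * (1 + expR (- u) + expR (- v)).
  by rewrite ler_peMr ?(ltW l0)//; lra.
have h7 : 1 <= softplus v * (1 + expR (- u) + expR (- v)).
  by apply: (le_trans h3); rewrite ler_wpM2l ?(ltW l0)//; lra.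
have h8 : u - v <= (u - v) * (softplus v * (1 + expR (- u) + expR (- v))).
  by rewrite ler_peMr// subr_ge0.
nra.
Qed.

Lemma mm_dn_le v u : u <= v -> mm v u <= 2 * expR (v - u) * (pp u / pp v).
Proof.
move=> uv; rewrite mm_dn// [leRHS](_ : _ = expR (v - u) * (2 * (pp u / pp v))); last by ring.
rewrite ler_wpM2l ?expR_ge0// /pp.
have e0 := expR_gt0 (- u); have e1 := expR_gt0 (- v).
have l0 := softplus_gt0 v; have l1 := softplus_gt0 u.
have := mm_den_gt0 u v; have := pp_den_gt0 u => d0 d1.
rewrite [leLHS](_ : _ = softplus u / softplus v * (1 + 2 * expR (- v)) *
  (1 + expR (- u) + expR (- v))^-1); last by field; rewrite !gt_eqF.
rewrite [leRHS](_ : _ = softplus u / softplus v * (1 + 2 * expR (- v)) *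
  (2 * (1 + 2 * expR (- u))^-1)); last by field; rewrite !gt_eqF.
rewrite ler_wpM2l ?mulr_ge0 ?invr_ge0 ?softplus_ge0 ?(ltW (pp_den_gt0 v))//.
rewrite ler_pdivlMr// mulrC ler_pdivrMr//; lra.
Qed.

Lemma pp_gt0 x : 0 < pp x.
Proof. by rewrite divr_gt0 ?softplus_gt0 ?pp_den_gt0. Qed.

Lemma pp_nd x y : x <= y -> pp x <= pp y.
Proof.
move=> xy; apply: ler_pM; rewrite ?softplus_ge0 ?invr_ge0 ?softplus_nd//.
by rewrite lef_pV2 ?posrE ?pp_den_gt0// lerD2l ler_pM2l// ler_expR lerN2.
Qed.

Lemma expRD2 x : expR (2 * x) = expR x * expR x :> R.
Proof. by rewrite -expRD; congr expR; lra. Qed.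

Lemma pp_le_expR x : pp x <= expR (2 * x).
Proof.
rewrite ler_pdivrMr ?pp_den_gt0// (le_trans (softplus_le_expR x))//.
have := expRNK x; have := expR_gt0 x; rewrite expRD2 => h0 h; nra.
Qed.

Lemma pp_ge_expR x : x <= 0 -> 2 / 9 * expR (2 * x) <= pp x.
Proof.
move=> x0; rewrite ler_pdivlMr ?pp_den_gt0//.
apply: le_trans (softplus_ge_expR x0).
have := expRNK x; have := expR_gt0 x; rewrite expRD2 => h0 h.
have : expR x <= 1 by rewrite -expR0 ler_expR.
nra.
Qed.

Lemma mm_diag u : mm u u = 1.
Proof.
rewrite mm_up// -[RHS](@mulfV _ (softplus u * (1 + 2 * expR (- u)))).
  by congr (_ / (_ * _)); lra.
by rewrite gt_eqF ?mulr_gt0 ?softplus_gt0 ?pp_den_gt0.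
Qed.

(** Three factors of [mm x u] depend on [x], and each has a 1-Lipschitz logarithm; hence the
    constant 3. *)
Lemma mm_loglip x y u : mm x u <= expR (3 * `|x - y|) * mm y u.
Proof.
have -> : expR (3 * `|x - y|) = expR `|x - y| * expR `|x - y| * expR `|x - y|.
  by rewrite -!expRD; congr expR; lra.
have h1 : 2 + expR (Num.max u x) <= expR `|x - y| * (2 + expR (Num.max u y)).
  have : expR (Num.max u x) <= expR `|x - y| * expR (Num.max u y).
    rewrite -expRD ler_expR ge_max; apply/andP; split.
      by rewrite -[leLHS]add0r lerD// le_max lexx.
    rewrite (@le_trans _ _ (`|x - y| + y))//.
      by rewrite -lerBlDr ler_norm.
    by rewrite lerD2l le_max lexx orbT.
  have := expR_norm_ge1 (x - y); lra.
have h2 : (1 + expR (- u) + expR (- x))^-1 <=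
    expR `|x - y| * (1 + expR (- u) + expR (- y))^-1.
  rewrite ler_pdivlMr ?mm_den_gt0// mulrC ler_pdivrMr ?mm_den_gt0//.
  have : expR (- y) <= expR `|x - y| * expR (- x).
    by rewrite -expRD ler_expR; have := ler_norm (x - y); lra.
  have := expR_norm_ge1 (x - y); have := expR_gt0 (- u); nra.
have h3 : (softplus x)^-1 <= expR `|x - y| * (softplus y)^-1.
  rewrite ler_pdivlMr ?softplus_gt0// mulrC ler_pdivrMr ?softplus_gt0//.
  exact: softplus_loglip_norm.
rewrite /mm.
rewrite [leRHS](_ : _ = expR (- u) * softplus u *
  ((expR `|x - y| * (2 + expR (Num.max u y))) *
   (expR `|x - y| * (1 + expR (- u) + expR (- y))^-1)) *
  (expR `|x - y| * (softplus y)^-1)); last by ring.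
have p (a : R) : 0 <= 2 + expR a by rewrite addr_ge0 ?expR_ge0.
apply: ler_pM => //; rewrite ?mulr_ge0 ?invr_ge0 ?softplus_ge0 ?expR_ge0 ?p//.
rewrite ler_wpM2l ?mulr_ge0 ?expR_ge0 ?softplus_ge0//.
by apply: ler_pM.
Qed.

Lemma mm_ge v u : expR (- (3 * `|v - u|)) <= mm v u.
Proof.
have := mm_loglip u v u; rewrite mm_diag distrC => h.
by rewrite expRN -[leLHS]mul1r ler_pdivrMr ?expR_gt0// mulrC.
Qed.
End rates.

(** * Weights and single jumps *)

Section weights.
Context {R : realType}.
Implicit Types x y u v s t r e m alpha mu : R.

Definition ff alpha x := 1 + expR (- (alpha * x)).

Definition EE m x := expR (m * Num.max 0 x).

(** With [m = mu * c0] this is equivalent to [Gamma 0] without its last factor. A symmetric sum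
    replaces the maximum of [Gamma] because, with one argument frozen, every summand is a constant
    times a function of the other argument alone, or depends on it monotonically through the
    minimum; drift can then be estimated summand by summand. *)
Definition Ginf alpha m mu x y :=
  ff alpha x * EE m y + ff alpha y * EE m x + EE mu (Num.min x y).

Lemma ff_ge1 alpha x : 1 <= ff alpha x.
Proof. by rewrite lerDl expR_ge0. Qed.

Lemma ff_gt0 alpha x : 0 < ff alpha x.
Proof. by apply: lt_le_trans (ff_ge1 _ _). Qed.

Lemma ff_ninc alpha x y : 0 <= alpha -> x <= y -> ff alpha y <= ff alpha x.
Proof. by move=> a0 xy; rewrite lerD2l ler_expR lerN2 ler_wpM2l. Qed.

Lemma ff_loglip alpha x y : 0 <= alpha <= 1 ->
  ff alpha x <= expR `|x - y| * ff alpha y.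
Proof.
move=> /andP[a0 a1]; rewrite mulrDr mulr1 lerD ?expR_norm_ge1//.
rewrite -expRD ler_expR.
have := ler_norm (- (x - y)); rewrite normrN => h1; have h2 := normr_ge0 (x - y).
have : alpha * (y - x) <= alpha * `|x - y| by rewrite ler_wpM2l//; lra.
have : alpha * `|x - y| <= 1 * `|x - y| by rewrite ler_wpM2r.
lra.
Qed.

Lemma EE_gt0 m x : 0 < EE m x. Proof. exact: expR_gt0. Qed.

Lemma EE_ge1 m x : 0 <= m -> 1 <= EE m x.
Proof. by move=> m0; rewrite -expR0 ler_expR mulr_ge0// le_max lexx. Qed.

Lemma EE_nd m x y : 0 <= m -> x <= y -> EE m x <= EE m y.
Proof.
move=> m0 xy; rewrite ler_expR ler_wpM2l// ge_max !le_max lexx/=.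
by rewrite xy orbT.
Qed.

Lemma EE_lip m x y : 0 <= m -> EE m x <= expR (m * `|x - y|) * EE m y.
Proof.
move=> m0; rewrite -expRD ler_expR -mulrDr ler_wpM2l// ge_max; apply/andP; split.
  by rewrite addr_ge0// le_max lexx.
have : y <= Num.max 0 y by rewrite le_max lexx orbT.
have := ler_norm (x - y); lra.
Qed.

Lemma EE_loglip m x y : 0 <= m <= 1 -> EE m x <= expR `|x - y| * EE m y.
Proof.
move=> /andP[m0 m1]; apply: (le_trans (EE_lip _ y m0)).
by rewrite ler_wpM2r ?expR_ge0// ler_expR -[leRHS]mul1r ler_wpM2r.
Qed.

Lemma EE_neg m x : x <= 0 -> EE m x = 1.
Proof. by move=> x0; rewrite /EE max_l// mulr0 expR0. Qed.

Lemma EE_pos m x : 0 <= x -> EE m x = expR (m * x).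
Proof. by move=> x0; rewrite /EE max_r. Qed.

Lemma min_lip x y z : `|Num.min x z - Num.min y z| <= `|x - y|.
Proof.
wlog xy : x y / x <= y.
  move=> H; have [/H//|/ltW /H] := leP x y.
  by rewrite distrC [leRHS]distrC.
have h : Num.min x z <= Num.min y z by rewrite le_min !ge_min xy lexx orbT.
rewrite distrC ger0_norm ?subr_ge0// distrC ger0_norm ?subr_ge0//.
rewrite /Num.min; case: ltP => h1; case: ltP => h2; lra.
Qed.

Section Ginf.
Context (alpha m mu : R).
Hypotheses (halpha : 1 / 10 <= alpha <= 1 / 6) (hm : 0 <= m <= 1 / 4)
  (hmu : m + 1 / 10 <= mu <= 1 / 2).
Let G := Ginf alpha m mu.

Let a0 : 0 <= alpha. Proof. by case/andP: halpha => ? ?; lra. Qed.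
Let a1 : alpha <= 1 / 6. Proof. by case/andP: halpha. Qed.
Let m0 : 0 <= m. Proof. by case/andP: hm. Qed.
Let m1 : m <= 1 / 4. Proof. by case/andP: hm. Qed.
Let mmu : m + 1 / 10 <= mu. Proof. by case/andP: hmu. Qed.
Let mu1 : mu <= 1 / 2. Proof. by case/andP: hmu. Qed.
Let mu0 : 0 <= mu. Proof. have := m0; have := mmu; lra. Qed.
Let a01 : 0 <= alpha <= 1. Proof. by rewrite a0 (le_trans a1)//; lra. Qed.
Let m01 : 0 <= m <= 1. Proof. by rewrite m0 (le_trans m1)//; lra. Qed.
Let mu01 : 0 <= mu <= 1. Proof. by rewrite mu0 (le_trans mu1)//; lra. Qed.
Let EE0 k x : 0 <= EE k x. Proof. exact: ltW (EE_gt0 _ _). Qed.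
Let ff0 x : 0 <= ff alpha x. Proof. exact: ltW (ff_gt0 _ _). Qed.

Ltac params := have ? := a0; have ? := a1; have ? := m0; have ? := m1;
  have ? := mmu; have ? := mu1; have ? := mu0.

Lemma GinfC x y : Ginf alpha m mu x y = Ginf alpha m mu y x.
Proof. by rewrite /Ginf minC; congr (_ + _); rewrite addrC. Qed.

Lemma Ginf_ge1 x y : 1 <= Ginf alpha m mu x y.
Proof.
rewrite /Ginf; have := EE_ge1 (Num.min x y) mu0.
by move=> h; rewrite (le_trans h)// lerDr addr_ge0// mulr_ge0.
Qed.

Lemma Ginf_gt0 x y : 0 < Ginf alpha m mu x y.
Proof. exact: lt_le_trans (Ginf_ge1 x y). Qed.

Lemma Ginf_loglip x y z : Ginf alpha m mu x z <= expR `|x - y| * Ginf alpha m mu y z.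
Proof.
rewrite /Ginf !mulrDr !mulrA lerD//; first rewrite lerD//.
- by rewrite ler_wpM2r// ff_loglip.
- by rewrite [leRHS]mulrAC mulrC ler_wpM2r// EE_loglip.
- apply: (@le_trans _ _ (expR `|Num.min x z - Num.min y z| * EE mu (Num.min y z))).
    exact: EE_loglip.
  by rewrite ler_wpM2r// ler_expR min_lip.
Qed.

Lemma Ginf_up v u : v <= u -> G u v <= expR (m * (u - v)) * G v v.
Proof.
move=> vu; rewrite /G /Ginf min_r// minxx.
have e1 : 1 <= expR (m * (u - v)) by rewrite -expR0 ler_expR mulr_ge0// subr_ge0.
have := EE_lip u v m0; rewrite ger0_norm ?subr_ge0// => h.
move: e1 h; set c := expR _ => e1 h.
rewrite !mulrDr lerD//; last by rewrite ler_peMl.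
rewrite lerD//.
  rewrite (@le_trans _ _ (ff alpha v * EE m v))//.
    by rewrite ler_wpM2r// ff_ninc.
  by rewrite ler_peMl// mulr_ge0.
by rewrite mulrCA ler_wpM2l.
Qed.

(** For [v <= 0] the ratio of [pp] decays like [exp(-2 (v - u))], faster than [G] can grow. For
    [v > 0] it need not decay before [u] becomes negative; the decay then comes from comparing
    [G v v >= exp(mu v)] with [exp(m v)], and this is the role of the gap [mu >= m + 1/10]. *)
Lemma pp_Ginf_dn v u : u <= v ->
  pp u / pp v * G u v <= 45 / 2 * expR (- ((v - u) / 10)) * G v v.
Proof.
move=> uv; params; have p0 := pp_gt0 v; have pu := pp_gt0 u.
have Gv := Ginf_gt0 v v; have Gu := Ginf_gt0 u v.
have [v0|/ltW v0] := leP v 0.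
  have h1 : pp u / pp v <= 9 / 2 * expR (- (2 * (v - u))).
    rewrite ler_pdivrMr//; have := pp_ge_expR v0; have := pp_le_expR u.
    have -> : expR (2 * u) = expR (- (2 * (v - u))) * expR (2 * v).
      by rewrite -expRD; congr expR; lra.
    have := expR_gt0 (- (2 * (v - u))); nra.
  have h2 := Ginf_loglip u v v; rewrite distrC ger0_norm ?subr_ge0// in h2.
  have h3 : expR (- (2 * (v - u))) * expR (v - u) <= expR (- ((v - u) / 10)).
    by rewrite -expRD ler_expR; lra.
  apply: (@le_trans _ _ (9 / 2 * expR (- (2 * (v - u))) * (expR (v - u) * G v v))).
    by apply: ler_pM => //; [rewrite divr_ge0// ltW|exact: ltW].
  rewrite mulrA ler_wpM2r ?(ltW Gv)//; have := expR_gt0 (- ((v - u) / 10)); nra.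
have fv : ff alpha v <= 2.
  by rewrite /ff lerD2l -expR0 ler_expR oppr_le0 mulr_ge0.
have Gvv : expR (mu * v) <= G v v.
  by rewrite /G /Ginf minxx -EE_pos// lerDr addr_ge0// mulr_ge0.
have hmv : expR (m * v) <= expR (mu * v) * expR (- (v / 10)).
  by rewrite -expRD ler_expR; nra.
set q := expR (- ((v - u) / 10)).
have q0 : 0 < q by exact: expR_gt0.
have ev : 0 < expR (mu * v) by exact: expR_gt0.
have [u0|/ltW u0] := leP 0 u.
  have fu : ff alpha u <= 2.
    by rewrite /ff lerD2l -expR0 ler_expR oppr_le0 mulr_ge0.
  have h1 : pp u / pp v <= 1 by rewrite ler_pdivrMr// mul1r pp_nd.
  apply: (@le_trans _ _ (1 * G u v)); first by rewrite ler_wpM2r// ltW.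
  rewrite mul1r.
  have hq : expR (- (v / 10)) <= q by rewrite ler_expR; lra.
  have hmu1 : expR (mu * u) <= expR (mu * v) * q by rewrite -expRD ler_expR; nra.
  have hmu2 : expR (m * u) <= expR (m * v) by rewrite ler_expR ler_wpM2l.
  have : G u v <= 5 * (expR (mu * v) * q).
    rewrite /G /Ginf min_l// !EE_pos//.
    have := expR_gt0 (m * u); have := expR_gt0 (m * v).
    have := expR_gt0 (- (v / 10)).
    nra.
  nra.
have h1 : pp u / pp v <= 9 / 2 * expR (2 * u).
  rewrite ler_pdivrMr//; have := pp_le_expR u; have := pp_nd v0.
  have := @pp_ge_expR R 0 (lexx _); rewrite mulr0 expR0.
  have := expR_gt0 (2 * u); nra.
have eu : 1 <= expR (- u) by rewrite -expR0 ler_expR; lra.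
have h2 : G u v <= 5 * (expR (- u) * expR (m * v)).
  have emv : 1 <= expR (m * v) by rewrite -expR0 ler_expR mulr_ge0.
  rewrite /G /Ginf min_l// !(EE_neg _ u0) (EE_pos _ v0).
  have : ff alpha u <= 2 * expR (- u).
    by rewrite /ff mulr2n mulrDl mul1r lerD// ler_expR; nra.
  nra.
apply: (@le_trans _ _ (9 / 2 * expR (2 * u) * (5 * (expR (- u) * expR (m * v))))).
  by apply: ler_pM => //; [rewrite divr_ge0// ltW|exact: ltW].
have e3 : expR (2 * u) * (expR (- u) * (expR (mu * v) * expR (- (v / 10)))) <=
    q * expR (mu * v).
  by rewrite -!expRD ler_expR; nra.
have e4 : expR (2 * u) * (expR (- u) * expR (m * v)) <= q * G v v.
  apply: (@le_trans _ _ (expR (2 * u) * (expR (- u) * (expR (mu * v) * expR (- (v / 10)))))).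
    by rewrite !ler_pM2l ?expR_gt0.
  by rewrite (le_trans e3)// ler_pM2l.
lra.
Qed.

Lemma poly_le_expR8 x : 0 <= x -> 3 + x <= 8 * expR (x / 8).
Proof. by move=> x0; have := expR_ge1Dx (x / 8); lra. Qed.

(** Upwards, the decay [exp(-s)] of the Bose factor beats the linear growth of [mm] and the growth
    [exp(m s)] of the weight. Downwards, that decay is used up by the factor [exp s] of [mm], and
    [pp_Ginf_dn] supplies the rest. *)
Lemma mm_bose_Ginf v u : u != v ->
  mm v u * bose `|u - v| * G u v <=
  45 * ((1 + `|u - v|^-1) * expR (- (`|u - v| / 10))) * G v v.
Proof.
move=> uv; params; set s := `|u - v|; have s0 : 0 < s by rewrite normr_gt0 subr_eq0.
have Gv := Ginf_gt0 v v; have Gu := Ginf_gt0 u v.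
have w0 : 0 < 1 + s^-1 by rewrite addr_gt0 ?invr_gt0.
have [vu|/ltW vu] := leP v u.
  have sE : s = u - v by rewrite /s ger0_norm ?subr_ge0.
  have h1 := mm_up_le vu; rewrite -sE in h1.
  have h2 := Ginf_up vu; rewrite -sE in h2.
  have h3 := poly_le_expR8 (ltW s0); have h4 := bose_le s0.
  apply: (@le_trans _ _ ((8 * expR (s / 8)) * (expR (- s) * (1 + s^-1)) *
    (expR (m * s) * G v v))).
    have M0 := mm_ge0 v u; have b0 := bose_ge0 (ltW s0).
    apply: ler_pM => //; rewrite ?(mulr_ge0 M0 b0) ?(ltW Gu)//.
    by apply: ler_pM => //; apply: le_trans h3.
  rewrite mulrA ler_wpM2r ?(ltW Gv)//.
  rewrite [leLHS](_ : _ = 8 * ((1 + s^-1) * (expR (s / 8) * expR (- s) * expR (m * s)))).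
    2: by ring.
  have h5 : expR (s / 8) * expR (- s) * expR (m * s) <= expR (- (s / 10)).
    by rewrite -!expRD ler_expR; nra.
  have := expR_gt0 (- (s / 10)); nra.
have sE : s = v - u by rewrite /s distrC ger0_norm ?subr_ge0.
have h1 := mm_dn_le vu; rewrite -sE in h1.
have h2 := pp_Ginf_dn vu; rewrite -sE in h2.
have h4 := bose_expR_le s0; have b0 := bose_gt0 s0.
have pp0 : 0 <= pp u / pp v by rewrite divr_ge0 ?ltW ?pp_gt0.
apply: (@le_trans _ _ ((2 * expR s * (pp u / pp v)) * bose s * G u v)).
  by rewrite !ler_wpM2r ?(ltW Gu) ?(ltW b0).
rewrite [leLHS](_ : _ = 2 * ((expR s * bose s) * (pp u / pp v * G u v))); last by ring.
rewrite [leRHS](_ : _ = 2 * ((1 + s^-1) * (45 / 2 * expR (- (s / 10)) * G v v))).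
  2: by field; rewrite gt_eqF.
rewrite ler_pM2l//; apply: ler_pM => //; first by rewrite mulr_ge0 ?expR_ge0 ?ltW.
by rewrite mulr_ge0// ltW.
Qed.
End Ginf.

Lemma jump_EE m v u : 0 <= m <= 1 / 2 ->
  rho 0 v * (mm v u * bose `|u - v|) * Num.max 0 (EE m u - EE m v) <=
  64 * expR (- (`|u - v| / 4)) * EE m v.
Proof.
move=> /andP[m0 m1]; set s := `|u - v|.
have rhs0 : 0 <= 64 * expR (- (s / 4)) * EE m v by rewrite !mulr_ge0 ?expR_ge0.
have [uv|vu] := leP u v.
  by rewrite max_l ?mulr0// subr_le0 EE_nd.
have sE : s = u - v by rewrite /s ger0_norm// subr_ge0 ltW.
have [u0|u0] := leP u 0.
  by rewrite !EE_neg ?subrr ?maxxx ?mulr0 -?[1 * _]mulr1//; first lra; rewrite mulr_ge0 ?expR_ge0.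
have s0 : 0 < s by rewrite sE subr_gt0.
(* The length of the jump pays for [rho 0 v], of order [exp(-v/2)] for negative [v]: the increment
   vanishes unless [u > 0], and then [s] exceeds [-v]. *)
have key : rho 0 v * Num.max 0 (EE m u - EE m v) <= s * expR (s / 2) * EE m v.
  have inc x : 0 <= x -> expR (m * x) - 1 <= m * x * expR (m * x).
    move=> x0; have := expRN_ge_sub (m * x); have := expRNK (m * x).
    by have := expR_gt0 (m * x); nra.
  rewrite max_r ?subr_ge0 ?EE_nd ?(ltW vu)//.
  have r0 := @rho_gt0 R 0 v (lexx _); have := rho_le_expR v.
  have [v0|/ltW v0] := leP 0 v.
    rewrite max_l; last lra. rewrite mul0r expR0 mulr1 => r2.
    rewrite (EE_pos _ v0) (EE_pos _ (ltW u0)).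
    have -> : expR (m * u) = expR (m * s) * expR (m * v).
      by rewrite -expRD; congr expR; rewrite sE; ring.
    have i := inc s (ltW s0).
    have e1 : expR (m * s) <= expR (s / 2) by rewrite ler_expR; nra.
    have e0 := expR_gt0 (m * v); have e2 := expR_gt0 (m * s).
    rewrite [leLHS](_ : _ = rho 0 v * (expR (m * s) - 1) * expR (m * v)); last by ring.
    rewrite ler_wpM2r ?(ltW e0)//.
    have i2 : expR (m * s) - 1 <= s / 2 * expR (s / 2).
      by apply: (le_trans i); apply: ler_pM => //; nra.
    have i0 : 0 <= expR (m * s) - 1 by rewrite subr_ge0 -expR0 ler_expR mulr_ge0 ?(ltW s0).
    apply: (@le_trans _ _ (2 * (s / 2 * expR (s / 2)))); first exact: ler_pM (ltW _) _ _ _.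
    lra.
  rewrite max_r; last lra. move=> r2.
  rewrite (EE_neg _ v0) (EE_pos _ (ltW u0)) mulr1.
  have i := inc u (ltW u0).
  have i0 : 0 <= expR (m * u) - 1 by rewrite subr_ge0 -expR0 ler_expR mulr_ge0 ?(ltW u0).
  have i2 : expR (m * u) - 1 <= s / 2 * expR (u / 2).
    apply: (le_trans i); apply: ler_pM; rewrite ?mulr_ge0 ?expR_ge0 ?(ltW u0) ?ler_expR//.
      by rewrite sE; nra.
    nra.
  apply: (@le_trans _ _ ((2 * expR (- v / 2)) * (s / 2 * expR (u / 2)))).
    by apply: ler_pM => //; exact: ltW.
  rewrite [leLHS](_ : _ = s * (expR (- v / 2) * expR (u / 2))); last by field.
  by rewrite -expRD ler_pM2l// ler_expR sE; lra.
have h1 := mm_up_le (ltW vu); rewrite -sE in h1.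
have h3 := poly_le_expR8 (ltW s0); have h4 := bose_le s0.
have hs : bose s * s <= 8 * expR (s / 8) * expR (- s).
  apply: (@le_trans _ _ (expR (- s) * (1 + s^-1) * s)); first by rewrite ler_wpM2r// ltW.
  rewrite [leLHS](_ : _ = expR (- s) * (1 + s)); last by field; rewrite gt_eqF.
  have := expR_gt0 (- s); nra.
have hm : mm v u <= 8 * expR (s / 8) by lra.
rewrite mulrAC mulrC.
have b0 := bose_gt0 s0; have mm0 := mm_gt0 v u; have E0 := EE_gt0 m v.
apply: (@le_trans _ _ (mm v u * bose s * (s * expR (s / 2) * EE m v))).
  by rewrite ler_wpM2l// mulr_ge0 ?ltW.
rewrite [leLHS](_ : _ = (mm v u * (bose s * s)) * expR (s / 2) * EE m v); last by ring.
rewrite ler_wpM2r ?(ltW E0)//.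
apply: (@le_trans _ _ ((8 * expR (s / 8)) * (8 * expR (s / 8) * expR (- s)) * expR (s / 2))).
  by rewrite ler_wpM2r ?expR_ge0//; apply: ler_pM => //; rewrite ?(ltW mm0) ?(mulr_ge0 (ltW b0) (ltW s0)).
rewrite [leLHS](_ : _ = 64 * (expR (s / 8) * expR (s / 8) * expR (- s) * expR (s / 2))).
  2: by ring.
by rewrite -!expRD ler_pM2l// ler_expR; lra.
Qed.

Lemma one_sub_expRN_le alpha s : 0 <= alpha <= 1 -> 0 <= s ->
  0 <= 1 - expR (- (alpha * s)) <= 1 - expR (- s).
Proof.
move=> /andP[a0 a1] s0; rewrite subr_ge0 -{1}expR0 ler_expR lerB ?ler_expR//; nra.
Qed.

Lemma bose_mul s : 0 < s -> (1 - expR (- s)) * bose s = expR (- s).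
Proof.
move=> s0; rewrite /bose expRN; field.
by rewrite !gt_eqF ?expR_gt0 ?expRB1_gt0.
Qed.

(** The increment carries a factor at most [1 - exp(-s)], which turns the Bose factor into [exp(-s)]
    and cancels [exp s] in [mm]. The remaining decay is in [|u|] and not in the jump length, since
    [ff u - ff v] is of order [exp(-alpha u)] for every [u] far below [v]. *)
Lemma jump_ff_nonneg alpha v u : 1 / 10 <= alpha -> alpha <= 1 / 6 -> 0 <= v ->
  rho 0 v * (mm v u * bose `|u - v|) * Num.max 0 (ff alpha u - ff alpha v) <=
  18 * expR (- (`|u| / 10)).
Proof.
move=> a0 a1 v0; set s := `|u - v|.
have [vu|uv] := leP v u.
  by rewrite max_l ?mulr0 ?mulr_ge0 ?expR_ge0// subr_le0 ff_ninc//; lra.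
have sE : s = v - u by rewrite /s distrC ger0_norm// subr_ge0 ltW.
have s0 : 0 < s by rewrite sE subr_gt0.
rewrite max_r; last by rewrite subr_ge0 ff_ninc ?(ltW uv)//; lra.
have fE : ff alpha u - ff alpha v = expR (- (alpha * u)) * (1 - expR (- (alpha * s))).
  rewrite /ff mulrBr mulr1 -expRD sE.
  have -> : - (alpha * u) - alpha * (v - u) = - (alpha * v) by ring.
  by ring.
have /andP[i0 i1] : 0 <= 1 - expR (- (alpha * s)) <= 1 - expR (- s).
  by apply: one_sub_expRN_le (ltW s0); apply/andP; split; lra.
have b0 := bose_gt0 s0; have bm := bose_mul s0.
have h1 := mm_dn_le (ltW uv); rewrite -sE in h1.
have r0 := @rho_gt0 R 0 v (lexx _).
have r2 : rho 0 v <= 2.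
  by have := rho_le_expR v; rewrite max_l ?mul0r ?expR0 ?mulr1//; lra.
have p0 : 0 < pp u / pp v by rewrite divr_gt0 ?pp_gt0.
have e0 := expR_gt0 (- (alpha * u)); have mm0 := mm_gt0 v u.
have k1 : mm v u * bose s * (1 - expR (- (alpha * s))) <= 2 * (pp u / pp v).
  apply: (@le_trans _ _ ((2 * expR s * (pp u / pp v)) * (bose s * (1 - expR (- s))))).
    rewrite -mulrA; apply: ler_pM => //; rewrite ?(ltW mm0) ?(mulr_ge0 (ltW b0) i0)//.
    by rewrite ler_pM2l.
  by rewrite [bose s * _]mulrC bm mulrAC -[2 * _ * _]mulrA -expRD subrr expR0 mulr1.
apply: (@le_trans _ _ (2 * ((2 * (pp u / pp v)) * expR (- (alpha * u))))).
  rewrite fE [leLHS](_ : _ = rho 0 v * ((mm v u * bose s * (1 - expR (- (alpha * s)))) *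
    expR (- (alpha * u)))); last by ring.
  apply: ler_pM => //; first exact: ltW.
    by rewrite mulr_ge0 ?(ltW e0)// mulr_ge0// mulr_ge0 ?(ltW b0) ?(ltW mm0).
  by rewrite ler_pM2r.
have [u0|/ltW u0] := leP 0 u.
  rewrite ger0_norm//.
  have : pp u / pp v <= 1 by rewrite ler_pdivrMr ?pp_gt0// mul1r pp_nd// ltW.
  have : expR (- (alpha * u)) <= expR (- (u / 10)) by rewrite ler_expR; nra.
  nra.
rewrite ler0_norm//.
have h2 : pp u / pp v <= 9 / 2 * expR (2 * u).
  rewrite ler_pdivrMr ?pp_gt0//; have := pp_le_expR u; have := pp_nd v0.
  have := @pp_ge_expR R 0 (lexx _); rewrite mulr0 expR0.
  have := expR_gt0 (2 * u); nra.
have h3 : expR (2 * u) * expR (- (alpha * u)) <= expR (- (- u / 10)).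
  by rewrite -expRD ler_expR; nra.
nra.
Qed.

(* For [v <= 0] the rate out of [v] is unbounded, but jumps from [v] to [v + s]
   and to [v - s] compensate each other up to a bounded error. *)
Lemma jump_ff_nonpos alpha v s k : 1 / 10 <= alpha -> alpha <= 1 / 6 -> v <= 0 -> 0 < s ->
  0 <= k <= rho 0 v * bose s ->
  - (9 * expR (- s)) * ff alpha v <=
  k * (mm v (v + s) * (ff alpha v - ff alpha (v + s)) +
       mm v (v - s) * (ff alpha v - ff alpha (v - s))).
Proof.
move=> a0 a1 v0 s0 /andP[k0 k1].
set y := expR v; have y0 : 0 < y by exact: expR_gt0.
have y1 : y <= 1 by rewrite -expR0 ler_expR.
set L := softplus v; have L0 : 0 < L by exact: softplus_gt0.
have yL : y / L <= 3 / 2.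
  by rewrite ler_pdivrMr//; have := softplus_ge_expR v0; rewrite -/y -/L; lra.
set q := expR (- s); have q0 : 0 < q by exact: expR_gt0.
have q1 : q < 1 by rewrite expR_lt1; lra.
set w := 1 - expR (- (alpha * s)).
have /andP[w0 w1] : 0 <= w <= 1 - q by apply: one_sub_expRN_le (ltW s0); apply/andP; split; lra.
have qy : y^-1 = expR (- v) by rewrite expRN.
have es : expR s = q^-1 by rewrite /q expRN invrK.
have up : y / L * (2 / (1 + y + q)) <= mm v (v + s).
  rewrite mm_up ?lerDl ?(ltW s0)// -/L.
  have -> : expR (- (v + s)) = q / y by rewrite opprD expRD mulrC -expRN.
  rewrite -qy.
  have h : 2 <= softplus (v + s) * (1 + 2 * (q / y)).
    have := softplus_ge (v + s); rewrite ler_pdivrMr ?addr_gt0 ?expR_gt0// => h.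
    have e : expR (v + s) * (q / y) = 1.
      by rewrite expRD -/y es; field; rewrite !gt_eqF.
    have : 0 < q / y by rewrite divr_gt0.
    have := expR_gt0 (v + s); have := softplus_gt0 (v + s); nra.
  rewrite [leRHS](_ : _ = (softplus (v + s) * (1 + 2 * (q / y))) * (y / (L * (1 + y + q)))).
    2: by field; rewrite !gt_eqF//; lra.
  rewrite [leLHS](_ : _ = 2 * (y / (L * (1 + y + q)))).
    2: by field; rewrite !gt_eqF//; lra.
  by rewrite ler_wpM2r// divr_ge0 ?mulr_ge0 ?ltW//; lra.
have dn : mm v (v - s) <= y / L * ((y + 2) / (q^-1 + 1)).
  rewrite mm_dn; last by rewrite gerBl ltW.
  have -> : v - (v - s) = s by ring.
  have -> : expR (- (v - s)) = q^-1 / y.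
    by rewrite opprB expRB es.
  rewrite -qy -/L es.
  have h : softplus (v - s) <= q * y by rewrite mulrC -expRD; exact: softplus_le_expR.
  have i0 : 0 < q^-1 by rewrite invr_gt0.
  apply: (@le_trans _ _ (q^-1 * (q * y * (1 + 2 / y) / (L * (q^-1 / y + y^-1))))).
    rewrite ler_pM2l//; apply: ler_pM.
    - by rewrite mulr_ge0 ?softplus_ge0// addr_ge0// divr_ge0// ltW.
    - by rewrite invr_ge0 mulr_ge0 ?(ltW L0)// !addr_ge0 ?mulr_ge0 ?invr_ge0 ?(ltW q0) ?(ltW y0).
    - by rewrite ler_wpM2r// addr_ge0// divr_ge0// ltW.
    - rewrite lef_pV2 ?posrE ?mulr_gt0 ?addr_gt0 ?invr_gt0 ?mulr_gt0 ?invr_gt0//.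
      by rewrite ler_pM2l//; lra.
  rewrite le_eqVlt; apply/orP; left; apply/eqP; field.
  by rewrite !gt_eqF//; lra.
have fup : ff alpha v - ff alpha (v + s) = expR (- (alpha * v)) * w.
    rewrite /ff /w; have -> : - (alpha * (v + s)) = - (alpha * v) + - (alpha * s) by ring.
  by rewrite expRD; ring.
have fdn : ff alpha v - ff alpha (v - s) = - (expR (- (alpha * v)) * (expR (alpha * s) * w)).
  rewrite /ff /w; have eE := expRNK (alpha * s).
  have -> : - (alpha * (v - s)) = - (alpha * v) + alpha * s by ring.
  by rewrite expRD mulrBr mulr1 [expR (alpha * s) * expR _]mulrC eE; ring.
set B := mm v (v + s) - expR (alpha * s) * mm v (v - s).
rewrite fup fdn.
rewrite [leRHS](_ : _ = k * w * expR (- (alpha * v)) * B); last by rewrite /B; ring.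
have ea := expR_gt0 (- (alpha * v)).
(* Both rates have the main term [y / L * 2 / (1 + q)], so they balance up to an error of order
   [y = exp v]. This absorbs [rho 0 v], which is only of order [y ^ (-1/2)]. *)
have kB : - (9 / 2 * y) <= B.
  have i0 : 0 < q^-1 by rewrite invr_gt0.
  have c : expR (alpha * s) / (q^-1 + 1) <= (1 + q)^-1.
    have -> : (1 + q)^-1 = q^-1 / (q^-1 + 1) by field; rewrite !gt_eqF//; lra.
    by rewrite ler_pM2r ?invr_gt0 ?addr_gt0// -es ler_expR; nra.
  have c1 : 2 / (1 + q) - 2 * y <= 2 / (1 + y + q).
    rewrite -subr_ge0 [X in 0 <= X](_ : _ =
      2 * y * (1 - ((1 + q) * (1 + y + q))^-1)); last by clear - y0 q0; field; rewrite !gt_eqF//; lra.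
    clear - y0 q0; apply: mulr_ge0; first by rewrite mulr_ge0// ltW.
    by rewrite subr_ge0 invf_le1 ?mulr_gt0//; nra.
  have i2 : (1 + q)^-1 <= 1 by clear - q0; rewrite invf_le1; lra.
  have d2 : expR (alpha * s) * mm v (v - s) <= y / L * ((y + 2) / (1 + q)).
    apply: (@le_trans _ _ (expR (alpha * s) * (y / L * ((y + 2) / (q^-1 + 1))))).
      by rewrite ler_wpM2l ?expR_ge0.
    rewrite [leLHS](_ : _ = y / L * ((y + 2) * (expR (alpha * s) / (q^-1 + 1)))).
      2: by ring.
    by rewrite ler_wpM2l ?divr_ge0 ?(ltW y0) ?(ltW L0)// ler_wpM2l//; lra.
  have yL0 : 0 < y / L by rewrite divr_gt0.
  have i3 : y * (1 + q)^-1 <= y by rewrite ler_piMr// ltW.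
  have i4 : - (3 * y) <= 2 / (1 + y + q) - (y + 2) / (1 + q) by clear - c1 i3; lra.
  have i5 : y / L * - (3 * y) <= y / L * (2 / (1 + y + q) - (y + 2) / (1 + q)).
    by rewrite ler_wpM2l ?(ltW yL0).
  have i6 : y / L * y <= 3 / 2 * y by rewrite ler_wpM2r ?(ltW y0).
  by rewrite /B; lra.
have kw : k * w <= 2 * expR (- v / 2) * q.
  have := rho_le_expR v; rewrite max_r; last lra.
  move=> r2; have bm := bose_mul s0; have b0 := bose_gt0 s0.
  apply: (@le_trans _ _ (rho 0 v * bose s * (1 - q))); first exact: ler_pM.
  by rewrite -mulrA [bose s * _]mulrC bm ler_wpM2r// ltW.
have kw0 : 0 <= k * w by rewrite mulr_ge0.
have yv : expR (- v / 2) * y <= 1.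
  by rewrite -expRD -[leRHS]expR0 ler_expR; lra.
have fe : expR (- (alpha * v)) <= ff alpha v by rewrite lerDr.
have kwy : k * w * y <= 2 * q.
  apply: (@le_trans _ _ (2 * expR (- v / 2) * q * y)); first by rewrite ler_pM2r.
  rewrite [leLHS](_ : _ = 2 * q * (expR (- v / 2) * y)); last by ring.
  by rewrite -[leRHS]mulr1 ler_pM2l// mulr_gt0.
apply: (@le_trans _ _ (k * w * expR (- (alpha * v)) * - (9 / 2 * y))).
  2: by rewrite ler_wpM2l// mulr_ge0// ltW.
rewrite [leRHS](_ : _ = - (9 / 2 * (k * w * y) * expR (- (alpha * v)))); last by ring.
rewrite mulNr lerN2; apply: ler_pM => //; last lra.
by rewrite !mulr_ge0 ?(ltW y0).
Qed.
End weights.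

(** * Integrals over the real line *)

Section integrals.
Context {R : realType}.
Local Notation leb := (@lebesgue_measure R).
Implicit Types F H : R -> R.

Definition itg F := leb.-integrable setT (EFin \o F).

Lemma itg_measurable F : itg F -> measurable_fun setT F.
Proof. by move=> /measurable_int /measurable_EFinP. Qed.

Lemma itg_le F H : measurable_fun setT F -> (forall x, `|F x| <= H x) ->
  itg H -> itg F.
Proof.
move=> mF FH iH; apply: (le_integrable _ _ _ iH) => //.
  exact/measurable_EFinP.
by move=> x _; rewrite /= lee_fin (le_trans (FH x))// ler_norm.
Qed.

Lemma itgD F H : itg F -> itg H -> itg (fun x => F x + H x).
Proof. by move=> iF iH; exact: (integrableD measurableT iF iH). Qed.

Lemma itgB F H : itg F -> itg H -> itg (fun x => F x - H x).
Proof. by move=> iF iH; exact: (integrableB measurableT iF iH). Qed.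

Lemma itgZ (c : R) F : itg F -> itg (fun x => c * F x).
Proof. by move=> iF; exact: (integrableZl measurableT c iF). Qed.

Lemma RintD F H : itg F -> itg H ->
  \int[leb]_x (F x + H x) = \int[leb]_x F x + \int[leb]_x H x.
Proof. exact: RintegralD. Qed.

Lemma RintB F H : itg F -> itg H ->
  \int[leb]_x (F x - H x) = \int[leb]_x F x - \int[leb]_x H x.
Proof. exact: RintegralB. Qed.

Lemma RintZ (c : R) F : itg F -> \int[leb]_x (c * F x) = c * \int[leb]_x F x.
Proof. by move=> iF; exact: RintegralZl. Qed.

Lemma Rint_le F H : itg F -> itg H -> (forall x, F x <= H x) ->
  \int[leb]_x F x <= \int[leb]_x H x.
Proof. by move=> iF iH FH; exact: le_Rintegral. Qed.

Lemma Rint_norm_le F H : itg F -> itg H -> (forall x, `|F x| <= H x) ->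
  `|\int[leb]_x F x| <= \int[leb]_x H x.
Proof.
move=> iF iH FH; apply: (le_trans (le_normr_Rintegral measurableT iF)).
apply: Rint_le => //; apply: itg_le iH; last by move=> x; rewrite normr_id.
by apply: measurableT_comp => //; exact: itg_measurable.
Qed.

Lemma EFin_Rint F : itg F -> (\int[leb]_x F x)%:E = (\int[leb]_x (F x)%:E)%E.
Proof. by move=> iF; rewrite fineK//; exact: integrable_fin_num iF. Qed.

Lemma itg_ge0_fin F (B : R) : measurable_fun setT F -> (forall x, 0 <= F x) ->
  (\int[leb]_x (F x)%:E <= B%:E)%E -> itg F /\ \int[leb]_x F x <= B.
Proof.
move=> mF F0 FB; have iF : itg F.
  apply/integrableP; split; first exact/measurable_EFinP.
  under eq_integral do rewrite /= ger0_norm//.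
  exact: le_lt_trans FB (ltry _).
by split => //; rewrite -lee_fin EFin_Rint.
Qed.

Section reflection.
Variable c : R.

Let refl := fun u : measurableTypeR R => (c - u : measurableTypeR R).

Lemma measurable_refl : measurable_fun setT refl.
Proof. exact: measurable_funB. Qed.

Definition refl_measure (A : set (measurableTypeR R)) : \bar R := leb (refl @^-1` A).

Let m0 : refl_measure set0 = 0%E.
Proof. by rewrite /refl_measure preimage_set0 measure0. Qed.

Let m_ge0 A : (0 <= refl_measure A)%E.
Proof. exact: measure_ge0. Qed.

Let mpre A : measurable A -> measurable (refl @^-1` A).
Proof. by move=> mA; rewrite -[X in measurable X]setTI; exact: measurable_refl. Qed.

Let m_sigma_additive : semi_sigma_additive refl_measure.
Proof.
move=> F mF tF mUF; rewrite /refl_measure preimage_bigcup.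
apply: measure_semi_sigma_additive.
- by move=> n; exact: mpre.
- apply/trivIsetP => /= i j _ _ ij; rewrite -preimage_setI.
  by move/trivIsetP : tF => /(_ _ _ _ _ ij) ->//; rewrite preimage_set0.
- by rewrite -preimage_bigcup; exact: mpre.
Qed.

HB.instance Definition _ := isMeasure.Build _ _ _ refl_measure m0 m_ge0 m_sigma_additive.

(** Lebesgue measure is determined by its values on half-open intervals; a reflection moves the
    closed end to the other side, which does not change the length. *)
Lemma refl_measureE (A : set (measurableTypeR R)) : measurable A -> leb A = refl_measure A.
Proof.
move=> mA; apply: (@lebesgue_measure_unique R refl_measure) => // X [[a b]/= _ <-].
rewrite /refl_measure.
have -> : refl @^-1` `]a, b]%classic = `[c - b, c - a[%classic.
  by apply/seteqP; split => x /=; rewrite !in_itv/= /refl => /andP[? ?];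
    apply/andP; split; lra.
rewrite !lebesgue_measure_itv/= !lte_fin ltrD2l ltrN2; case: ifP => // _.
by rewrite -!EFinB; congr EFin; lra.
Qed.

Lemma ge0_integral_refl (F : R -> \bar R) : measurable_fun setT F ->
  (forall x, (0 <= F x)%E) -> (\int[leb]_u F (c - u)%R = \int[leb]_u F u)%E.
Proof.
move=> mF F0.
transitivity (\int[pushforward leb refl]_u F u)%E.
  by rewrite ge0_integral_pushforward//; exact: measurable_refl.
apply: (eq_measure_integral leb); first exact: measurable_refl.
by move=> mr A mA _; rewrite [RHS](refl_measureE mA).
Qed.

Lemma itg_refl F : itg F -> itg (fun u => F (c - u)).
Proof.
move=> iF; have mF := itg_measurable iF; apply/integrableP; split.
  apply/measurable_EFinP; apply: (measurableT_comp mF); exact: measurable_refl.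
rewrite (@ge0_integral_refl (fun u => `|(F u)%:E|)%E)//; last first.
  by apply: measurableT_comp => //; exact/measurable_EFinP.
by case/integrableP : iF.
Qed.

Lemma Rint_refl F : itg F -> \int[leb]_u F (c - u) = \int[leb]_u F u.
Proof.
move=> iF; have mF := itg_measurable iF.
rewrite /Rintegral; congr fine.
transitivity (\int[pushforward leb refl]_u (F u)%:E)%E.
  rewrite integral_pushforward//.
  - exact: measurable_refl.
  - exact/measurable_EFinP.
  - exact: itg_refl.
apply: (eq_measure_integral leb); first exact: measurable_refl.
by move=> mr A mA _; rewrite [RHS](refl_measureE mA).
Qed.
End reflection.

(** A translation is a composition of two reflections, so only the invariance under reflections had
    to be proved. *)
Lemma itg_translate x F : itg F -> itg (fun u => F (u - x)).
Proof.
move=> iF; rewrite (_ : (fun _ => _) = (fun u => (fun w => F (- w)) (x - u))).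
  apply: (@itg_refl x (fun w => F (- w))).
  rewrite (_ : (fun _ => _) = (fun u => F (0 - u))); first exact: itg_refl.
  by apply/funext => u; rewrite sub0r.
by apply/funext => u; rewrite opprB.
Qed.

Lemma Rint_translate x F : itg F -> \int[leb]_u F (u - x) = \int[leb]_u F u.
Proof.
move=> iF; rewrite -[RHS](Rint_refl 0 iF) -[RHS](Rint_refl x (itg_refl 0 iF)).
by apply: eq_Rintegral => u _; congr F; ring.
Qed.

Lemma itg_abs H (B : R) : measurable_fun setT H -> (forall s : R, 0 <= s -> 0 <= H s) ->
  (\int[leb]_(s in `]0%R, +oo[) (H s)%:E <= B%:E)%E ->
  forall x, itg (fun u => H `|u - x|) /\ \int[leb]_u H `|u - x| <= 2 * B.
Proof.
move=> mH H0 HB x.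
pose F u := H u * (0 < u)%R%:R.
have mpos : measurable_fun setT (fun u : R => (0 < u)%R%:R : R).
  rewrite (_ : (fun _ => _) = \1_(`]0%R, +oo[%classic : set R)).
    by apply: measurable_indic.
  by apply/funext => u; rewrite indicE mem_setE/= in_itv/= andbT.
have mF : measurable_fun setT F by exact: measurable_funM.
have F0 u : 0 <= F u.
  by rewrite /F; case: ltP => u0; rewrite ?mulr0// mulr1 H0// ltW.
have [iF FB] : itg F /\ \int[leb]_u F u <= B.
  apply: itg_ge0_fin => //; apply: le_trans HB.
  rewrite [leRHS]integral_mkcond le_eqVlt; apply/orP; left; apply/eqP.
  apply: eq_integral => u _; rewrite patchE/= /F mem_setE/= in_itv/= andbT.
  by case: ltP => _; rewrite ?mulr1 ?mulr0.
pose P := fun u : R => F u + F (0 - u).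
have iP : itg P by apply: itgD => //; exact: itg_refl.
have mHa : measurable_fun setT (fun u : R => H `|u|).
  by apply: (measurableT_comp mH); exact: normr_measurable.
have mem_set1 (u : R) : (u \in [set 0 : R]) = (u == 0).
  by apply/idP/eqP; rewrite inE.
(* The point 0 belongs to neither open half line; [Z] carries its null contribution, so that the
   decomposition [HE] holds everywhere. *)
pose Z := fun u : R => H 0 * (u == 0)%R%:R.
have mZ0 : measurable_fun setT (fun u : R => (u == 0)%R%:R : R).
  rewrite (_ : (fun _ => _) = \1_([set 0] : set R)).
    by apply: measurable_indic.
  by apply/funext => u; rewrite indicE mem_set1.
have iZ : itg Z /\ \int[leb]_u Z u <= 0.
  apply: itg_ge0_fin; first exact: measurable_funM.
    by move=> u; rewrite mulr_ge0// H0.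
  rewrite (_ : (\int[leb]_u _)%E = (\int[leb]_(u in [set 0%R]) (H 0)%:E)%E).
    by rewrite integral_set1.
  rewrite [RHS]integral_mkcond; apply: eq_integral => u _.
  by rewrite patchE mem_set1 /Z; case: eqP => _; rewrite ?mulr1 ?mulr0.
have HE u : H `|u| = P u + Z u.
  rewrite /P /Z /F sub0r oppr_gt0; case: (ltgtP u 0) => [u0|u0|->].
  - by rewrite ltr0_norm// !(mulr0, add0r, addr0, mulr1).
  - by rewrite gtr0_norm// !(mulr0, add0r, addr0, mulr1).
  - by rewrite normr0 !(mulr0, add0r, addr0, mulr1).
have iH : itg (fun u : R => H `|u|).
  rewrite (_ : (fun _ => _) = (fun u => P u + Z u)); last by apply/funext.
  by apply: itgD => //; case: iZ.
split; first exact: (@itg_translate x (fun u : R => H `|u|)).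
rewrite (@Rint_translate x (fun u : R => H `|u|))//.
rewrite (_ : (fun u : R => H `|u|) = (fun u => P u + Z u)); last by apply/funext.
rewrite RintD//; last by case: iZ.
have -> : \int[leb]_u P u = \int[leb]_u F u + \int[leb]_u F u.
  by rewrite RintD//; [rewrite Rint_refl|exact: itg_refl].
by case: iZ => _; lra.
Qed.

Lemma integral_itv_FTC (H F : R -> R) (a b : R) : a < b ->
  (forall s, a <= s <= b -> is_derive s 1 F (H s)) ->
  (forall s, a <= s <= b -> {for s, continuous H}) ->
  (\int[leb]_(s in `[a, b]) (H s)%:E = (F b - F a)%:E)%E.
Proof.
move=> ab dF cH; rewrite (@continuous_FTC2 _ H F a b)//.
- apply: continuous_in_subspaceT => s; rewrite inE/= in_itv/= => sab; exact: cH.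
- have c (s : R) : a <= s <= b -> {for s, continuous F}.
    move=> sab; have [d _] := dF s sab.
    exact/differentiable_continuous/derivable1_diffP.
  split.
  + by move=> s; rewrite in_itv/= => /andP[? ?]; case: (dF s) => //; apply/andP; split; lra.
  + by apply: cvg_at_right_filter; apply: c; rewrite lexx ltW.
  + by apply: cvg_at_left_filter; apply: c; rewrite lexx ltW.
- move=> s; rewrite in_itv/= => /andP[? ?].
  by rewrite derive1E; case: (dF s) => // ; apply/andP; split; lra.
Qed.

(** Monotone convergence along compact intervals inside the open half line, where the fundamental
    theorem applies; [H] may be singular at 0. *)
Lemma integral_pos_le (H F : R -> R) (B : R) : measurable_fun setT H ->
  (forall s : R, 0 < s -> 0 <= H s) ->
  (forall s : R, 0 < s -> is_derive s 1 F (H s)) ->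
  (forall s : R, 0 < s -> {for s, continuous H}) ->
  (forall a b : R, 0 < a -> a < b -> F b - F a <= B) ->
  (\int[leb]_(s in `]0%R, +oo[) (H s)%:E <= B%:E)%E.
Proof.
move=> mH H0 dF cH FB.
(* Starting from 2 keeps the left end strictly below the right end for every [n]. *)
pose D (n : nat) : set R := `[n.+2%:R^-1, n.+2%:R]%classic.
have DE : `]0%R, +oo[%classic = \bigcup_n D n.
  apply/seteqP; split => [x /=|x [n _]]; rewrite /D/= !in_itv/= andbT; last first.
    by move=> /andP[h _]; apply: lt_le_trans h; rewrite invr_gt0.
  move=> x0; pose n := `|Num.trunc (x + x^-1)|%N.
  have h : x + x^-1 < n.+2%:R.
    rewrite (@lt_le_trans _ _ (Num.trunc (x + x^-1)).+1%:R)//.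
      by rewrite truncnS_gt.
    by rewrite ler_nat /n absz_nat ltnS leqnSn.
  have xi : 0 < x^-1 by rewrite invr_gt0.
  exists n => //; rewrite /D/= in_itv/=; apply/andP; split; last lra.
  by rewrite -[leRHS]invrK lef_pV2 ?posrE ?invr_gt0//; lra.
have cv : (\int[leb]_(s in D i) (H s)%:E)%E @[i --> \oo] -->
    (\int[leb]_(s in \bigcup_i D i) (H s)%:E)%E.
  apply: ge0_nondecreasing_set_cvg_integral.
  - apply/nondecreasing_seqP => n; rewrite subsetEset => x; rewrite /D/= !in_itv/=.
    move=> /andP[h1 h2]; apply/andP; split.
      by rewrite (le_trans _ h1)// lef_pV2 ?posrE// ler_nat.
    by rewrite (le_trans h2)// ler_nat.
  - by move=> i; exact: measurable_itv.
  - by move=> i; exact/measurable_EFinP/measurable_funTS.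
  - move=> i x; rewrite /D/= in_itv/= => /andP[h _]; rewrite lee_fin H0//.
    by apply: lt_le_trans h; rewrite invr_gt0.
rewrite DE -(cvg_lim _ cv)//; apply: lime_le; first by apply/cvg_ex; eexists; exact: cv.
apply: nearW => n; have n0 : 0 < n.+2%:R^-1 :> R by rewrite invr_gt0.
have n1 : n.+2%:R^-1 < n.+2%:R :> R.
  rewrite (@lt_trans _ _ 1)// ?ltr1n// invf_lt1// ltr1n//.
have dF' (s : R) : n.+2%:R^-1 <= s <= n.+2%:R -> is_derive s 1 F (H s).
  by move=> /andP[h _]; apply: dF; exact: lt_le_trans h.
have cH' (s : R) : n.+2%:R^-1 <= s <= n.+2%:R -> {for s, continuous H}.
  by move=> /andP[h _]; apply: cH; exact: lt_le_trans h.
by rewrite /D (integral_itv_FTC n1 dF' cH') lee_fin FB.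
Qed.

Lemma itg_expRN (c x : R) : 0 < c ->
  itg (fun u => expR (- (c * `|u - x|))) /\
  \int[leb]_u expR (- (c * `|u - x|)) <= 2 / c.
Proof.
move=> c0; have cc (s : R) : {for s, continuous (fun s : R => expR (- (c * s)))}.
  apply: (@continuous_comp _ _ _ (fun s : R => - (c * s)) expR).
    by apply: continuousN; apply: continuousM; [exact: cvg_cst|exact: cvg_id].
  exact: continuous_expR.
apply: (@itg_abs (fun s => expR (- (c * s)))).
- by apply: continuous_measurable_fun => s; exact: cc.
- by move=> s _; exact: expR_ge0.
apply: (@integral_pos_le _ (fun s => - c^-1 * expR (- (c * s)))).
- by apply: continuous_measurable_fun => s; exact: cc.
- by move=> s _; exact: expR_ge0.
- move=> s _.
  have d1 : is_derive s 1 (fun s : R => - (c * s)) (- c).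
    apply: (is_derive_eq (is_deriveN (is_deriveZ c (is_derive_id s 1)))).
    by rewrite /GRing.scale/= mulr1.
  have d2 := @is_derive1_comp _ expR (fun s : R => - (c * s)) s _ _ (is_derive_expR _) d1.
  have := is_deriveZ (- c^-1) d2; rewrite /GRing.scale/= => d3.
  by apply: (is_derive_eq d3); field; rewrite gt_eqF.
- by move=> s _; exact: cc.
- move=> a b a0 ab; rewrite !mulNr opprK addrC.
  have h1 := expR_gt0 (- (c * b)); have : expR (- (c * a)) <= 1.
    by rewrite -expR0 ler_expR oppr_le0 mulr_ge0// ltW.
  by have : 0 < c^-1 by [rewrite invr_gt0]; nra.
Qed.

(** Inversion is discontinuous at 0. Writing [y^-1] as [y] times the power [-1] of [y^2], with value
    0 at 0 on both sides, reduces the claim to the measurability of powers. *)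
Lemma measurable_funV d (T : measurableType d) (f : T -> R) :
  measurable_fun setT f -> measurable_fun setT (fun x => (f x)^-1).
Proof.
move=> mf; rewrite (_ : (fun _ => _) = (fun x => f x * (f x ^+ 2) `^ (-1))).
  apply: measurable_funM => //; apply: (measurableT_comp (measurable_powR _)).
  exact: measurable_funX.
apply/funext => x; rewrite powR_inv1 ?sqr_ge0//.
have [->|fx] := eqVneq (f x) 0; first by rewrite invr0 mul0r.
by field.
Qed.

Lemma measurable_sqrt : measurable_fun setT (@Num.sqrt R).
Proof. by apply: continuous_measurable_fun; exact: sqrt_continuous. Qed.

(** A primitive in the jump size [s] is [-2 * sqrt r / sqrt (r + s)]. The integral is invariant
    under scaling, so its bound does not depend on [r]: this keeps the coupling loss bounded as two
    points approach. *)
Lemma itg_sqrt (r x : R) : 0 < r ->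
  itg (fun u => Num.sqrt r / ((r + `|u - x|) * Num.sqrt (r + `|u - x|))) /\
  \int[leb]_u (Num.sqrt r / ((r + `|u - x|) * Num.sqrt (r + `|u - x|))) <= 4.
Proof.
move=> r0.
have -> : 4 = 2 * 2 :> R by ring.
pose H s := Num.sqrt r / ((r + s) * Num.sqrt (r + s)).
have rs (s : R) : 0 <= s -> 0 < Num.sqrt (r + s) by move=> s0; rewrite sqrtr_gt0; lra.
have cD (s : R) : {for s, continuous (fun s : R => r + s)}.
  by apply: continuousD; [exact: cvg_cst|exact: cvg_id].
have cS (s : R) : {for s, continuous (fun s : R => Num.sqrt (r + s))}.
  by apply: (@continuous_comp _ _ _ (fun s : R => r + s)); [exact: cD|exact: sqrt_continuous].
have cH (s : R) : 0 < s -> {for s, continuous H}.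
  move=> s0; apply: continuousM; first exact: cvg_cst.
  apply: continuousV; first by rewrite gt_eqF// mulr_gt0 ?rs ?(ltW s0)//; lra.
  by apply: continuousM; [exact: cD|exact: cS].
have mH : measurable_fun setT H.
  apply: measurable_funM => //; apply: measurable_funV.
  apply: measurable_funM; first exact: measurable_funD.
  by apply: (measurableT_comp measurable_sqrt); exact: measurable_funD.
have H0 (s : R) : 0 <= s -> 0 <= H s.
  by move=> s0; rewrite divr_ge0 ?mulr_ge0 ?sqrtr_ge0//; lra.
apply: (@itg_abs H) => //.
apply: (@integral_pos_le H (fun s => (-2 * Num.sqrt r) * (Num.sqrt (r + s))^-1)).
- exact: mH.
- by move=> s s0; apply: H0; exact: ltW.
- move=> s s0.
  have d1 : is_derive s 1 (fun s : R => r + s) (0 + 1).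
    by apply: (@is_deriveD _ _ _ (cst r) id).
  have q : 0 < r + s by lra.
  have d2 := @is_derive1_comp _ (@Num.sqrt R) (fun s : R => r + s) s _ _ (is_derive1_sqrt q) d1.
  have n0 : (Num.sqrt \o (fun s : R => r + s)) s != 0 by rewrite /= gt_eqF// sqrtr_gt0.
  have := is_deriveZ (-2 * Num.sqrt r) (is_deriveV n0 d2); rewrite /GRing.scale/= => d3.
  apply: (is_derive_eq d3).
  have q1 : Num.sqrt (r + s) != 0 by rewrite gt_eqF// sqrtr_gt0.
  rewrite /H -[X in _ / (X * _)](sqr_sqrtr (ltW q)).
  by field.
- exact: cH.
- move=> a b a0 ab.
  have p (t : R) : 0 < t -> 0 <= Num.sqrt r / Num.sqrt (r + t) <= 1.
    move=> t0; rewrite divr_ge0 ?sqrtr_ge0//= ler_pdivrMr ?rs ?(ltW t0)// mul1r.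
    by rewrite ler_wsqrtr//; lra.
  have /andP[? ?] := p a a0; have /andP[? ?] := p b (lt_trans a0 ab).
  rewrite -!mulrA; lra.
Qed.

(* [s `^ (g - 1)] near [0] and [s ^- 2] at infinity; it is the derivative of
   [g^-1 * (s / (1 + s)) `^ g]. *)
Definition powint (g s : R) : R := (s / (1 + s)) `^ (g - 1) / (1 + s) ^+ 2.

Lemma measurable_powint g : measurable_fun setT (powint g).
Proof.
have m1 : measurable_fun setT (fun s : R => 1 + s) by exact: measurable_funD.
apply: measurable_funM; last by apply: measurable_funV; exact: measurable_funX.
apply: (measurableT_comp (measurable_powR _)).
by apply: measurable_funM => //; exact: measurable_funV.
Qed.

Lemma powint_ge0 g s : 0 <= powint g s.
Proof. by rewrite divr_ge0 ?powR_ge0 ?sqr_ge0. Qed.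

Lemma itg_powint g (x : R) : 0 < g ->
  itg (fun u => powint g `|u - x|) /\ \int[leb]_u powint g `|u - x| <= 2 * g^-1.
Proof.
move=> g0; apply: itg_abs; first exact: measurable_powint.
  by move=> s _; exact: powint_ge0.
have cp (s : R) : 0 < s -> {for s, continuous (fun s : R => s / (1 + s))}.
  move=> s0; apply: continuousM; first exact: cvg_id.
  apply: continuousV; first by rewrite gt_eqF//; lra.
  by apply: continuousD; [exact: cvg_cst|exact: cvg_id].
have dp (s : R) : 0 < s -> is_derive s 1 (fun s : R => s / (1 + s)) ((1 + s) ^- 2).
  move=> s0; have n0 : 1 + s != 0 by rewrite gt_eqF//; lra.
  have d1 : is_derive s 1 (fun s : R => 1 + s) (0 + 1).
    by apply: (@is_deriveD _ _ _ (cst (1 : R)) id).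
  have n1 : (fun s : R => 1 + s) s != 0 by [].
  have d2 := @is_deriveM _ _ id _ s 1 _ _ (is_derive_id _ _) (is_deriveV n1 d1).
  apply: (is_derive_eq d2); rewrite /GRing.scale/= ; field.
  exact: n0.
have q0 (s : R) : 0 < s -> 0 < s / (1 + s) by move=> s0; rewrite divr_gt0//; lra.
apply: (@integral_pos_le _ (fun s => g^-1 * (s / (1 + s)) `^ g)).
- exact: measurable_powint.
- by move=> s _; exact: powint_ge0.
- move=> s s0; have d1 := @is_derive1_comp _ (fun y : R => y `^ g) (fun s : R => s / (1 + s)) s _ _
    (@is_derive1_powR _ g _ (q0 s s0)) (dp s s0).
  have := is_deriveZ (g^-1) d1; rewrite /GRing.scale/= => d2.
  by apply: (is_derive_eq d2); rewrite /powint !mulrA mulVf ?gt_eqF// mul1r.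
- move=> s s0; apply: continuousM; last first.
    apply: continuousV; first by rewrite gt_eqF// exprn_gt0//; lra.
    apply: (@continuous_comp _ _ _ (fun s : R => 1 + s) (fun s => s ^+ 2)).
      by apply: continuousD; [exact: cvg_cst|exact: cvg_id].
    exact: exprn_continuous.
  apply: (@continuous_comp _ _ _ (fun s : R => s / (1 + s)) (fun s => s `^ (g - 1))).
    exact: cp.
  have [+ _] := @is_derive1_powR _ (g - 1) _ (q0 s s0).
  by move=> ?; exact/differentiable_continuous/derivable1_diffP.
- move=> a b a0 ab.
  have b0 := lt_trans a0 ab.
  have h1 : (b / (1 + b)) `^ g <= 1.
    rewrite -[leRHS](powRr0 (b / (1 + b))); apply: ger_powR; last exact: ltW.
    by rewrite q0//= ler_pdivrMr; lra.
  have h2 := powR_ge0 (a / (1 + a)) g.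
  have : 0 < g^-1 by rewrite invr_gt0.
  nra.
Qed.

(** The source of the logarithmic gain: [ln (u - x + b)] is a primitive of the lower bound on the
    rate. *)
Lemma Rint_inv_ge (x b d : R) (F : R -> R) : 0 < b -> 0 < d -> itg F ->
  (forall u, 0 <= F u) -> (forall u, x <= u <= x + d -> (u - x + b)^-1 <= F u) ->
  ln ((d + b) / b) <= \int[leb]_u F u.
Proof.
move=> b0 d0 iF F0 FH.
have xd : x < x + d by lra.
rewrite -lee_fin EFin_Rint//.
apply: (@le_trans _ _ (\int[leb]_(u in `[x, (x + d)%R]) (F u)%:E)%E); last first.
  apply: ge0_subset_integral => //=.
    by apply/measurable_EFinP; exact: itg_measurable.
  by move=> u _; rewrite lee_fin.
have dF (s : R) : x <= s <= x + d ->
    is_derive s 1 (fun u : R => ln (u - x + b)) (s - x + b)^-1.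
  move=> /andP[s0 _].
  have d1 : is_derive s 1 (fun u : R => u - x + b) (1 - 0 + 0).
    by apply: (@is_deriveD _ _ _ (id - cst x) (cst b)); apply: (@is_deriveB _ _ _ id (cst x)).
  have q : 0 < s - x + b by lra.
  apply: (is_derive_eq (@is_derive1_comp _ (@ln R) (fun u : R => u - x + b) s _ _
    (is_derive1_ln q) d1)).
  by rewrite subr0 addr0 mulr1.
have cH (s : R) : x <= s <= x + d -> {for s, continuous (fun u : R => (u - x + b)^-1)}.
  move=> /andP[s0 _]; apply: continuousV; first by rewrite gt_eqF//; lra.
  apply: continuousD; last exact: cvg_cst.
  by apply: continuousB; [exact: cvg_id|exact: cvg_cst].
apply: (@le_trans _ _ (\int[leb]_(u in `[x, (x + d)%R]) ((u - x + b)^-1)%:E)%E).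
  rewrite (integral_itv_FTC xd dF cH) lee_fin subrr add0r.
  by rewrite ln_div ?posrE//; [rewrite [x + d - x]addrC addKr|lra].
apply: ge0_le_integral => //=.
- by move=> u; rewrite in_itv/= => /andP[h _]; rewrite lee_fin invr_ge0; lra.
- apply/measurable_EFinP; apply: measurable_funTS; apply: measurable_funV.
  by apply: measurable_funD => //; exact: measurable_funB.
- by apply/measurable_EFinP; apply: measurable_funTS; exact: itg_measurable.
Qed.
End integrals.

(** * The regularised kernel *)

(** The field [me] stands for [mu * c0]. The bounds are the rounded parameter ranges in which the
    jump estimates above hold. *)
Record model (R : realType) := Model {
  nb : R; al : R; me : R; mu_ : R;
  nb_gt0 : 0 < nb;
  al_bnd : 1 / 10 <= al <= 1 / 6;
  me_bnd : 0 <= me <= 1 / 4;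
  mu_bnd : me + 1 / 10 <= mu_ <= 1 / 2 }.

Section kernel.
Context {R : realType}.
Local Notation leb := (@lebesgue_measure R).
Implicit Types (x y u v w s t r e : R).

(** The shift by [e] removes the singularity at 0. The exponential makes the total rate bounded
    uniformly in the starting point: for long jumps down, the decay of [bose] is consumed by the
    growth of [mm]. *)
Definition jr e s := expR (- (e * s)) * bose (s + e).

Lemma jr_ge0 e s : 0 <= e -> 0 <= s -> 0 <= jr e s.
Proof. by move=> e0 s0; rewrite mulr_ge0 ?expR_ge0 ?bose_ge0 ?addr_ge0. Qed.

Lemma expRN_le1 x : 0 <= x -> expR (- x) <= 1.
Proof. by move=> x0; rewrite -expR0 ler_expR oppr_le0. Qed.

(** The function [t * bose t] decreases, because [(exp t - 1) / t] increases. *)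
Lemma bose_shift_le e s : 0 <= e -> 0 < s -> bose (s + e) <= bose s * (s / (s + e)).
Proof.
move=> e0 s0; have q : 0 < s + e by lra.
have A0 := expRB1_gt0 s0; have B0 := expRB1_gt0 q.
have h : (expR s - 1) * (s + e) <= s * (expR (s + e) - 1).
  rewrite expRD; have h1 := expR_ge1Dx e; have h2 := expRN_ge_sub s.
  have h3 := expRNK s; have h4 := expR_gt0 s.
  have h5 : expR s - 1 <= s * expR s by nra.
  have h6 : e * expR s <= (expR e - 1) * expR s by rewrite ler_pM2r//; lra.
  nra.
rewrite /bose -[(expR s - 1)^-1 * _](_ : s / ((expR s - 1) * (s + e)) = _).
  rewrite ler_pdivlMr ?mulr_gt0// mulrC ler_pdivrMr//.
by field; rewrite !gt_eqF.
Qed.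

Lemma jr_le_shift e s : 0 <= e -> 0 < s ->
  jr e s <= expR (- (e * s)) * (bose s * (s / (s + e))).
Proof. by move=> e0 s0; rewrite ler_wpM2l ?expR_ge0// bose_shift_le. Qed.

Lemma jr_le e s : 0 <= e -> 0 < s -> jr e s <= bose s.
Proof.
move=> e0 s0; rewrite -[leRHS]mul1r; apply: ler_pM; rewrite ?expR_ge0//.
- by rewrite bose_ge0//; lra.
- by rewrite expRN_le1// mulr_ge0// ltW.
- by rewrite bose_nincr//; lra.
Qed.

Lemma jr_shift e s s' r : 0 < e <= 1 -> 0 <= s -> 0 <= r -> 0 <= s' <= s + r ->
  expR (- (2 * r)) * ((s + e) / (s + e + r)) * jr e s <= jr e s'.
Proof.
move=> /andP[e0 e1] s0 r0 /andP[s'0 s'r].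
have q : 0 < s + e by lra.
have h := bose_shift q r0.
have -> : - (2 * r) = - r + - r by ring.
rewrite expRD /jr [leLHS](_ : _ = (expR (- r) * expR (- (e * s))) *
  (expR (- r) * ((s + e) / (s + e + r)) * bose (s + e))); last by ring.
have q2 : 0 <= (s + e) / (s + e + r) by rewrite divr_ge0//; lra.
apply: ler_pM.
- by rewrite mulr_ge0 ?expR_ge0.
- by rewrite mulr_ge0 ?bose_ge0 ?(ltW q)// mulr_ge0 ?expR_ge0.
- by rewrite -expRD ler_expR; nra.
by apply: (le_trans h); apply: bose_nincr; lra.
Qed.

Lemma jr_ge e s : 0 < e <= 1 -> 0 <= s -> expR (- (2 * s + e)) / (s + e) <= jr e s.
Proof.
move=> /andP[e0 e1] s0; have q : 0 < s + e by lra.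
have h := bose_ge q.
apply: (@le_trans _ _ (expR (- s) * (expR (- (s + e)) / (s + e)))).
  by rewrite mulrA -expRD le_eqVlt; apply/orP; left; apply/eqP; congr (expR _ / _); ring.
apply: ler_pM; rewrite ?expR_ge0 ?divr_ge0 ?expR_ge0 ?(ltW q)//.
by rewrite ler_expR; nra.
Qed.

Lemma measurable_bose : measurable_fun setT (@bose R).
Proof. by apply: measurable_funV; exact: measurable_funB. Qed.

Section measurability.
Context d (T : measurableType d) (x y : T -> R).
Hypotheses (mx : measurable_fun setT x) (my : measurable_fun setT y).

Lemma measurable_softplus : measurable_fun setT (fun z => softplus (x z)).
Proof.
apply: (measurableT_comp (@measurable_ln R)); apply: measurable_funD => //.
exact: measurableT_comp.
Qed.

Lemma measurable_rho e : measurable_fun setT (fun z => rho e (x z)).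
Proof.
apply: measurable_funV; apply: measurable_funD => //.
by apply: (measurableT_comp measurable_sqrt); exact: measurable_softplus.
Qed.

Lemma measurable_jr e : measurable_fun setT (fun z => jr e (x z)).
Proof.
apply: measurable_funM.
  apply: measurableT_comp => //; apply: measurable_funN; exact: measurable_funM.
by apply: (measurableT_comp measurable_bose); exact: measurable_funD.
Qed.

Lemma measurable_dist : measurable_fun setT (fun z => `|x z - y z|).
Proof. by apply: measurableT_comp => //; exact: measurable_funB. Qed.
End measurability.

Lemma measurable_mm d (T : measurableType d) (x y : T -> R) :
  measurable_fun setT x -> measurable_fun setT y ->
  measurable_fun setT (fun z => mm (x z) (y z)).
Proof.
move=> mx my.
have eN (g : T -> R) : measurable_fun setT g -> measurable_fun setT (fun z => expR (- g z)).
  by move=> mg; apply: measurableT_comp => //; exact: measurable_funN.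
apply: measurable_funM; last by apply: measurable_funV; exact: measurable_softplus.
apply: measurable_funM.
  by apply: measurable_funM; [exact: eN|exact: measurable_softplus].
apply: measurable_funM.
  apply: measurable_funD => //; apply: measurableT_comp => //.
  exact: measurable_maxr.
apply: measurable_funV; apply: measurable_funD; last exact: eN.
by apply: measurable_funD => //; exact: eN.
Qed.

Variable P : model R.
Local Notation n := (nb P).
Local Notation G := (Ginf (al P) (me P) (mu_ P)).

(* [kk 0 v u] is [K3 v u] times the density of [nu] at [u]; for [e > 0] the total
   jump rate out of every [v] is finite. *)
Definition kk e v u := 4 * n * (rho e v * mm v u * jr e `|u - v|).

Lemma measurable_kk d (T : measurableType d) (x y : T -> R) e :
  measurable_fun setT x -> measurable_fun setT y ->
  measurable_fun setT (fun z => kk e (x z) (y z)).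
Proof.
move=> mx my; apply: measurable_funM => //; apply: measurable_funM.
  by apply: measurable_funM; [exact: measurable_rho|exact: measurable_mm].
by apply: measurable_jr; exact: measurable_dist.
Qed.

Lemma measurable_ff d (T : measurableType d) (x : T -> R) a :
  measurable_fun setT x -> measurable_fun setT (fun z => ff a (x z)).
Proof.
move=> mx; apply: measurable_funD => //; apply: measurableT_comp => //.
by apply: measurable_funN; exact: measurable_funM.
Qed.

Lemma measurable_EE d (T : measurableType d) (x : T -> R) a :
  measurable_fun setT x -> measurable_fun setT (fun z => EE a (x z)).
Proof.
move=> mx; rewrite /EE; apply: measurableT_comp => //; apply: measurable_funM => //.
exact: measurable_maxr.
Qed.

Lemma measurable_Ginf d (T : measurableType d) (x y : T -> R) :
  measurable_fun setT x -> measurable_fun setT y ->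
  measurable_fun setT (fun z => G (x z) (y z)).
Proof.
move=> mx my; apply: measurable_funD.
  apply: measurable_funD; apply: measurable_funM;
    by [exact: measurable_ff|exact: measurable_EE].
by apply: measurable_EE; exact: measurable_minr.
Qed.

Lemma nb_ge0 : 0 <= n. Proof. exact: ltW (nb_gt0 P). Qed.
Hint Resolve nb_ge0 : core.

Lemma G_gt0 x y : 0 < G x y. Proof. exact: Ginf_gt0 (me_bnd P) (mu_bnd P) x y. Qed.

Lemma G_ge0 x y : 0 <= G x y. Proof. exact: ltW (G_gt0 x y). Qed.

Lemma G_ge1 x y : 1 <= G x y. Proof. exact: Ginf_ge1 (me_bnd P) (mu_bnd P) x y. Qed.

Lemma G_sym x y : G x y = G y x. Proof. exact: GinfC. Qed.

Lemma G_lip x y z : G x z <= expR `|x - y| * G y z.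
Proof. exact: Ginf_loglip (al_bnd P) (me_bnd P) (mu_bnd P) x y z. Qed.

Lemma G_lip2 x y z : G z x <= expR `|x - y| * G z y.
Proof. by rewrite ![G z _]G_sym G_lip. Qed.

Lemma kk_ge0 e v u : 0 <= e -> 0 <= kk e v u.
Proof.
move=> e0; have h1 := ltW (@rho_gt0 _ _ v e0); have h2 := mm_ge0 v u.
have h3 := jr_ge0 e0 (normr_ge0 (u - v)).
by apply: mulr_ge0; [exact: mulr_ge0|apply: mulr_ge0 => //; exact: mulr_ge0].
Qed.

Lemma mm_bose_le v u : u != v ->
  mm v u * bose `|u - v| <= 8 * (1 + `|u - v|^-1).
Proof.
move=> uv; set s := `|u - v|; have s0 : 0 < s by rewrite normr_gt0 subr_eq0.
have w0 : 0 < 1 + s^-1 by rewrite addr_gt0 ?invr_gt0.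
have M0 := mm_ge0 v u; have b0 := bose_ge0 (ltW s0).
have [vu|/ltW vu] := leP v u.
  have sE : s = u - v by rewrite /s ger0_norm ?subr_ge0.
  have h1 := mm_up_le vu; rewrite -sE in h1.
  have h3 := poly_le_expR8 (ltW s0); have h4 := bose_le s0.
  apply: (@le_trans _ _ ((8 * expR (s / 8)) * (expR (- s) * (1 + s^-1)))).
    by apply: ler_pM => //; exact: le_trans h3.
  rewrite -mulrA ler_pM2l// mulrA -expRD -[leRHS]mul1r ler_pM2r//.
  by rewrite -[leRHS]expR0 ler_expR; lra.
have sE : s = v - u by rewrite /s distrC ger0_norm ?subr_ge0.
have h1 := mm_dn_le vu; rewrite -sE in h1.
have h4 := bose_expR_le s0.
have pp1 : pp u / pp v <= 1 by rewrite ler_pdivrMr ?pp_gt0// mul1r pp_nd.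
have pp0 : 0 <= pp u / pp v by rewrite divr_ge0 ?ltW ?pp_gt0.
apply: (@le_trans _ _ ((2 * expR s * (pp u / pp v)) * bose s)).
  by rewrite ler_wpM2r.
rewrite [leLHS](_ : _ = 2 * ((expR s * bose s) * (pp u / pp v))); last by ring.
have : (expR s * bose s) * (pp u / pp v) <= (1 + s^-1) * 1.
  by apply: ler_pM => //; rewrite mulr_ge0 ?expR_ge0.
lra.
Qed.

Lemma shift_le_inv e s : 0 < e <= 1 -> 0 < s -> (1 + s^-1) * (s / (s + e)) <= 1 + e^-1.
Proof.
move=> /andP[e0 e1] s0; have q : 0 < s + e by lra.
rewrite [leLHS](_ : _ = (s + 1) / (s + e)); last by field; rewrite !gt_eqF.
rewrite ler_pdivrMr// [leRHS](_ : _ = s + 1 + s * e^-1 + e); last by field; rewrite gt_eqF.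
have : 0 <= s * e^-1 by apply: divr_ge0; exact: ltW.
lra.
Qed.

Lemma jr_diag e : 0 < e -> jr e 0 <= e^-1.
Proof. by move=> e0; rewrite /jr mulr0 oppr0 expR0 mul1r add0r bose_le_inv. Qed.

(* A bound on [mm v u * bose s] of the order [1 + s^-1] becomes a bound of the
   order [1 + e^-1] after regularisation. *)
Lemma mm_jr_le (Q : R -> R) e v u (c : R) : 0 < e <= 1 -> 1 <= c -> 0 <= Q u ->
  (u != v -> mm v u * bose `|u - v| * Q u <= c * (1 + `|u - v|^-1)) ->
  (u = v -> Q u <= c) ->
  mm v u * jr e `|u - v| * Q u <= c * (1 + e^-1) * expR (- (e * `|u - v|)).
Proof.
move=> he c1 Q0 Qu Qv; have /andP[e0 e1] := he.
have [uv|uv] := eqVneq u v.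
  rewrite uv subrr normr0 mulr0 oppr0 expR0 mulr1 mm_diag mul1r.
  have h := jr_diag e0; have h2 := Qv uv; rewrite uv in h2 Q0.
  have j0 : 0 <= jr e 0 by rewrite jr_ge0// ltW.
  have i0 : 0 < e^-1 by rewrite invr_gt0.
  by apply: (@le_trans _ _ (e^-1 * c)); [exact: ler_pM|lra].
set s := `|u - v|; have s0 : 0 < s by rewrite normr_gt0 subr_eq0.
have h := jr_le_shift (ltW e0) s0; have h2 := Qu uv; have h3 := shift_le_inv he s0.
have M0 := mm_ge0 v u; have ee := expR_gt0 (- (e * s)).
have q : 0 <= s / (s + e) by rewrite divr_ge0//; lra.
apply: (@le_trans _ _ (mm v u * (expR (- (e * s)) * (bose s * (s / (s + e)))) * Q u)).
  by rewrite ler_wpM2r// ler_wpM2l.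
rewrite [leLHS](_ : _ = (mm v u * bose s * Q u * (s / (s + e))) * expR (- (e * s))).
  2: by ring.
rewrite ler_pM2r//.
apply: (@le_trans _ _ (c * (1 + s^-1) * (s / (s + e)))); first by rewrite ler_wpM2r.
by rewrite -mulrA ler_wpM2l//; lra.
Qed.

Lemma kk_le e v u : 0 < e <= 1 ->
  kk e v u <= 4 * n * (e^-1 * (8 * (1 + e^-1))) * expR (- (e * `|u - v|)).
Proof.
move=> he; have /andP[e0 e1] := he.
rewrite [leRHS](_ : _ = 4 * n * (e^-1 * (8 * (1 + e^-1) * expR (- (e * `|u - v|))))).
  2: by ring.
rewrite /kk ler_wpM2l ?mulr_ge0// -mulrA.
have j0 := jr_ge0 (ltW e0) (normr_ge0 (u - v)); have M0 := mm_ge0 v u.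
apply: ler_pM; rewrite ?rho_le_inv ?(ltW (rho_gt0 _ (ltW e0))) ?(mulr_ge0 M0 j0)//.
have := @mm_jr_le (fun=> 1) e v u 8 he; rewrite !mulr1; apply => //.
- by rewrite ler1n.
- exact: mm_bose_le.
- by rewrite ler1n.
Qed.

(** A crude bound of order [e ^ -3]. This is harmless, since it only restricts the step [h], and [e]
    is fixed before [h]. *)
Definition rate e := 4 * n * (e^-1 * (8 * (1 + e^-1))) * (2 / e).

Lemma itg_kk e v : 0 < e <= 1 ->
  itg (kk e v) /\ \int[leb]_u kk e v u <= rate e.
Proof.
move=> he; have /andP[e0 e1] := he.
have [ie Be] := itg_expRN v e0.
have ik : itg (kk e v).
  apply: itg_le (itgZ (4 * n * (e^-1 * (8 * (1 + e^-1)))) ie).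
    exact: measurable_kk.
  by move=> u; rewrite ger0_norm ?kk_le// kk_ge0// ltW.
split => //; apply: le_trans (Rint_le ik (itgZ _ ie) (fun u => kk_le v u he)) _.
rewrite RintZ// ler_wpM2l//.
by rewrite !mulr_ge0 ?addr_ge0 ?invr_ge0// ltW.
Qed.

Lemma rate_ge0 e : 0 < e -> 0 <= rate e.
Proof.
move=> e0; have i0 : 0 <= e^-1 by rewrite invr_ge0 ltW.
by rewrite /rate !mulr_ge0 ?addr_ge0.
Qed.

Lemma kk_G e v u : 0 <= e -> u != v ->
  kk e v u * G u v <=
  180 * n * rho e v * G v v * ((1 + `|u - v|^-1) * expR (- (`|u - v| / 10))).
Proof.
move=> e0 uv; have h := mm_bose_Ginf (al_bnd P) (me_bnd P) (mu_bnd P) uv.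
have s0 : 0 < `|u - v| by rewrite normr_gt0 subr_eq0.
have hj := jr_le e0 s0; have M0 := mm_ge0 v u.
rewrite [leRHS](_ : _ = 4 * n * (rho e v * (45 * ((1 + `|u - v|^-1) *
  expR (- (`|u - v| / 10))) * G v v))); last by ring.
rewrite [leLHS](_ : _ = 4 * n * (rho e v * (mm v u * jr e `|u - v| * G u v))).
  2: by rewrite /kk; ring.
rewrite ler_wpM2l ?mulr_ge0// ler_wpM2l ?(ltW (rho_gt0 _ _))// (le_trans _ h)//.
by rewrite ler_wpM2r ?G_ge0// ler_wpM2l.
Qed.

(** The weight here is [G u u] and not [G u v]. It serves functions known only through a pointwise
    bound by [G u u], such as the image of a function under the regularised generator. No decay in
    the jump length is left; [jr] will provide it. *)
Lemma mm_bose_G_diag v u : u != v ->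
  mm v u * bose `|u - v| * G u u <= 90 * (1 + `|u - v|^-1) * G v v.
Proof.
move=> uv; set s := `|u - v|; have s0 : 0 < s by rewrite normr_gt0 subr_eq0.
have w0 : 0 < 1 + s^-1 by rewrite addr_gt0 ?invr_gt0.
have M0 := mm_ge0 v u; have b0 := bose_ge0 (ltW s0).
have /andP[a0 a1] := al_bnd P; have /andP[m0 m1] := me_bnd P.
have /andP[mu0 mu1] := mu_bnd P.
have [vu|/ltW vu] := leP v u.
  have sE : s = u - v by rewrite /s ger0_norm ?subr_ge0.
  have h1 := mm_up_le vu; rewrite -sE in h1.
  have h3 := poly_le_expR8 (ltW s0); have h4 := bose_le s0.
  have hG : G u u <= expR (s / 2) * G v v.
    have hE k : 0 <= k <= 1 / 2 -> EE k u <= expR (s / 2) * EE k v.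
      move=> /andP[k0 k1]; apply: (le_trans (EE_lip u v k0)).
      rewrite ler_wpM2r ?expR_ge0// ler_expR -/s; nra.
    rewrite /Ginf !minxx !mulrDr lerD ?hE//; last by apply/andP; split; lra.
    have : ff (al P) u * EE (me P) u <= expR (s / 2) * (ff (al P) v * EE (me P) v).
      rewrite mulrCA; apply: ler_pM; rewrite ?expR_ge0 ?(ltW (ff_gt0 _ _))//.
        by rewrite ff_ninc//; lra.
      by apply: hE; apply/andP; split; lra.
    by move=> ?; apply: lerD.
  apply: (@le_trans _ _ ((8 * expR (s / 8)) * (expR (- s) * (1 + s^-1)) *
     (expR (s / 2) * G v v))).
    apply: ler_pM; rewrite ?(mulr_ge0 M0 b0) ?G_ge0//.
    by apply: ler_pM => //; exact: le_trans h3.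
  rewrite mulrA ler_wpM2r ?G_ge0//.
  rewrite [leLHS](_ : _ = 8 * ((1 + s^-1) * (expR (s / 8) * expR (- s) * expR (s / 2)))).
    2: by ring.
  have h5 : expR (s / 8) * expR (- s) * expR (s / 2) <= 1.
    by rewrite -!expRD -[leRHS]expR0 ler_expR; lra.
  nra.
have sE : s = v - u by rewrite /s distrC ger0_norm ?subr_ge0.
have h := mm_bose_Ginf (al_bnd P) (me_bnd P) (mu_bnd P) uv; rewrite -/s in h.
have hG : G u u <= 2 * G u v.
  rewrite /Ginf minxx min_l//.
  have e1 : EE (me P) u <= EE (me P) v by rewrite EE_nd.
  have := ff_gt0 (al P) u; have := ff_gt0 (al P) v.
  have := EE_gt0 (me P) u; have := EE_gt0 (me P) v; have := EE_gt0 (mu_ P) u.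
  nra.
apply: (@le_trans _ _ (mm v u * bose s * (2 * G u v))).
  by rewrite ler_wpM2l// mulr_ge0.
have h6 : expR (- (s / 10)) <= 1 by rewrite expRN_le1//; lra.
have h7 : (1 + s^-1) * expR (- (s / 10)) <= 1 + s^-1 by rewrite ler_piMr// ltW.
have := G_gt0 v v; nra.
Qed.

Lemma kk_G_diag e v u : 0 < e <= 1 ->
  kk e v u * G u u <= 4 * n * (e^-1 * (90 * (1 + e^-1))) * G v v * expR (- (e * `|u - v|)).
Proof.
move=> he; have /andP[e0 e1] := he.
have j0 := jr_ge0 (ltW e0) (normr_ge0 (u - v)); have M0 := mm_ge0 v u.
have Gv := G_gt0 v v.
rewrite [leRHS](_ : _ = 4 * n * (e^-1 * (90 * G v v * (1 + e^-1) *
  expR (- (e * `|u - v|))))); last by ring.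
rewrite [leLHS](_ : _ = 4 * n * (rho e v * (mm v u * jr e `|u - v| * G u u))).
  2: by rewrite /kk; ring.
rewrite ler_wpM2l ?mulr_ge0//.
apply: ler_pM; rewrite ?rho_le_inv ?(ltW (rho_gt0 _ (ltW e0)))//.
  by apply: mulr_ge0; [exact: mulr_ge0|exact: G_ge0].
have g1 := G_ge1 v v.
apply: (@mm_jr_le (fun u => G u u)) => //.
- lra.
- exact: G_ge0.
- by move=> uv; have := mm_bose_G_diag uv; lra.
- by move=> ->; lra.
Qed.

Lemma itg_kk_le (F : R -> R) e v (c : R) : 0 < e <= 1 -> measurable_fun setT F ->
  (forall u, `|F u| <= c * (kk e v u * G u u)) -> itg F.
Proof.
move=> he mF FG; have /andP[e0 e1] := he.
have [ie _] := itg_expRN v e0.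
have iG : itg (fun u => kk e v u * G u u).
  apply: itg_le (itgZ (4 * n * (e^-1 * (90 * (1 + e^-1))) * G v v) ie).
    by apply: measurable_funM; [exact: measurable_kk|exact: measurable_Ginf].
  by move=> u; rewrite ger0_norm ?kk_G_diag// mulr_ge0 ?kk_ge0 ?G_ge0// ltW.
exact: itg_le (itgZ c iG).
Qed.

Definition rateG e := 4 * n * (e^-1 * (90 * (1 + e^-1))) * (2 / e).

Lemma Rint_kk_G_diag e v : 0 < e <= 1 ->
  \int[leb]_u (kk e v u * G u u) <= rateG e * G v v.
Proof.
move=> he; have /andP[e0 e1] := he.
have [ie Be] := itg_expRN v e0.
have iG : itg (fun u => kk e v u * G u u).
  apply: (@itg_kk_le _ e v 1) => //.
    by apply: measurable_funM; [exact: measurable_kk|exact: measurable_Ginf].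
  by move=> u; rewrite mul1r ger0_norm// mulr_ge0 ?kk_ge0 ?G_ge0// ltW.
apply: le_trans (Rint_le iG (itgZ _ ie) (fun u => kk_G_diag v u he)) _.
rewrite RintZ// /rateG [leRHS]mulrAC ler_wpM2l//.
have i0 : 0 <= e^-1 by rewrite invr_ge0 ltW.
by apply: mulr_ge0; [rewrite !mulr_ge0 ?addr_ge0|exact: G_ge0].
Qed.

Lemma G_le_diag x y : G x y <= expR `|x - y| * G x x.
Proof. by have := G_lip2 y x x; rewrite distrC. Qed.

Lemma G_le_diag_cst u w : G u w <= 3 * G w w * G u u.
Proof.
have /andP[a0 a1] := al_bnd P; have /andP[m0 m1] := me_bnd P.
have /andP[mu0 mu1] := mu_bnd P.
have muu : 0 <= mu_ P by lra.
have f1 := ff_ge1 (al P) u; have f2 := ff_ge1 (al P) w.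
have e1 := EE_ge1 u m0; have e2 := EE_ge1 w m0.
have e3 := EE_ge1 u muu; have e4 := EE_ge1 w muu.
have h3 : EE (mu_ P) (Num.min u w) <= EE (mu_ P) u by rewrite EE_nd// ge_min lexx.
rewrite /Ginf !minxx.
set fu := ff (al P) u in f1 *; set fw := ff (al P) w in f2 *.
set eu := EE (me P) u in e1 *; set ew := EE (me P) w in e2 *.
set gu := EE (mu_ P) u in e3 h3 *; set gw := EE (mu_ P) w in e4 *.
set gm := EE _ _ in h3 *.
have a : 1 <= fw * ew by nra.
have b : 1 <= fu * eu by nra.
have c : fu * ew <= (fw * ew) * (fu * eu).
  rewrite [leRHS](_ : _ = (fu * ew) * (fw * eu)); last by ring.
  by rewrite ler_peMr//; nra.
have d : fw * eu <= (fw * ew) * (fu * eu).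
  rewrite [leRHS](_ : _ = (fw * eu) * (fu * ew)); last by ring.
  by rewrite ler_peMr//; nra.
have g : gm <= (fw * ew) * gu by nra.
set A := fw * ew in a c d g *; set B := fu * eu in b c d *.
have : A * gu + 2 * (A * B) <= (A + A + gw) * (B + B + gu) by nra.
nra.
Qed.

Lemma itg_kkG e v w : 0 < e <= 1 -> itg (fun u => kk e v u * G u w).
Proof.
move=> he; have /andP[e0 e1] := he.
apply: (@itg_kk_le _ e v (3 * G w w)) => //.
  by apply: measurable_funM; [exact: measurable_kk|exact: measurable_Ginf].
move=> u; have k0 := kk_ge0 v u (ltW e0).
rewrite ger0_norm; last by apply: mulr_ge0 => //; exact: G_ge0.
rewrite [leRHS](_ : _ = kk e v u * (3 * G w w * G u u)); last by ring.
by rewrite ler_wpM2l// G_le_diag_cst.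
Qed.
End kernel.

(** * Drift of the weights under the regularised kernel *)

Section drift.
Context {R : realType}.
Local Notation leb := (@lebesgue_measure R).
Variable P : model R.
Local Notation n := (nb P).
Local Notation G := (Ginf (al P) (me P) (mu_ P)).
Implicit Types (x y u v w s t r e : R).

Let n0 : 0 <= n. Proof. exact: nb_ge0. Qed.

Lemma kk_le0 e v u : 0 <= e -> u != v ->
  kk P e v u <= 4 * n * (rho 0 v * (mm v u * bose `|u - v|)).
Proof.
move=> e0 uv; have s0 : 0 < `|u - v| by rewrite normr_gt0 subr_eq0.
have hj := jr_le e0 s0; have M0 := mm_ge0 v u; have b0 := bose_ge0 (ltW s0).
have j0 := jr_ge0 e0 (ltW s0).
rewrite /kk; apply: ler_wpM2l; first exact: mulr_ge0.
have r0 := ltW (rho_gt0 v e0); have r1 := rho_le0 v e0.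
have h1 : mm v u * jr e `|u - v| <= mm v u * bose `|u - v| by rewrite ler_wpM2l.
rewrite -mulrA; apply: ler_pM => //; exact: mulr_ge0.
Qed.

Lemma kk_EE e k v u : 0 <= e -> 0 <= k <= 1 / 2 ->
  kk P e v u * Num.max 0 (EE k u - EE k v) <=
  256 * n * expR (- (1 / 20 * `|u - v|)) * EE k v.
Proof.
move=> e0 hk; have c0 : (0 : R) <= 256 by rewrite ler0n.
have rhs : 0 <= 256 * n * expR (- (1 / 20 * `|u - v|)) * EE k v.
  apply: mulr_ge0; last exact: ltW (EE_gt0 _ _).
  by apply: mulr_ge0; [exact: mulr_ge0 c0 n0|exact: expR_ge0].
have [uv|uv] := eqVneq u v.
  by move: rhs; rewrite uv [EE k v - _]subrr maxxx mulr0.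
have h := jump_EE v u hk; have h2 := kk_le0 e0 uv.
have m0 : 0 <= Num.max 0 (EE k u - EE k v) by rewrite le_max lexx.
apply: (@le_trans _ _ (4 * n * (rho 0 v * (mm v u * bose `|u - v|)) *
  Num.max 0 (EE k u - EE k v))); first by rewrite ler_wpM2r.
apply: (@le_trans _ _ (4 * n * (64 * expR (- (`|u - v| / 4)) * EE k v))).
  by rewrite -mulrA ler_wpM2l ?mulr_ge0.
have h3 : expR (- (`|u - v| / 4)) <= expR (- (1 / 20 * `|u - v|)).
  by rewrite ler_expR; have := normr_ge0 (u - v); lra.
rewrite [leLHS](_ : _ = 256 * n * EE k v * expR (- (`|u - v| / 4))); last by ring.
rewrite [leRHS](_ : _ = 256 * n * EE k v * expR (- (1 / 20 * `|u - v|))); last by ring.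
apply: ler_wpM2l; last exact: h3.
by apply: mulr_ge0; [exact: mulr_ge0 c0 n0|exact: ltW (EE_gt0 _ _)].
Qed.

Lemma itg_kk_ff e v : 0 < e <= 1 -> itg (fun u => kk P e v u * (ff (al P) u - ff (al P) v)).
Proof.
move=> he; have /andP[e0 e1] := he.
apply: (@itg_kk_le _ P _ e v (1 + ff (al P) v)) => //.
  apply: measurable_funM; first exact: measurable_kk.
  by apply: measurable_funB => //; exact: measurable_ff.
move=> u; have k0 := kk_ge0 P v u (ltW e0).
rewrite normrM ger0_norm// mulrCA ler_wpM2l//.
have /andP[m0 m1] := me_bnd P; have /andP[mu0 mu1] := mu_bnd P.
have f1 := ff_ge1 (al P) u; have f2 := ff_ge1 (al P) v.
have g1 : ff (al P) u <= G u u.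
  have muu : 0 <= mu_ P by lra.
  have := EE_ge1 u m0; have := EE_ge1 u muu; rewrite /Ginf minxx; nra.
have : `|ff (al P) u - ff (al P) v| <= ff (al P) u + ff (al P) v.
  by rewrite (le_trans (ler_normB _ _))// !gtr0_norm// ?ff_gt0.
nra.
Qed.

(** For [v >= 0] the positive part of each jump is already summable. For [v < 0] absolute values
    would be too large by a factor of order [exp(-v/2)], so the integrand is first averaged with its
    reflection about [v], which pairs the jumps of length [s] up and down as in [jump_ff_nonpos]. *)
Lemma drift_ff e v : 0 < e <= 1 ->
  \int[leb]_u (kk P e v u * (ff (al P) u - ff (al P) v)) <= 2880 * n * ff (al P) v.
Proof.
move=> he; have /andP[e0 e1] := he; have iF := itg_kk_ff v he.
have /andP[a0 a1] := al_bnd P.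
have fv := ff_ge1 (al P) v.
have c0 : (0 : R) < 1 / 20 by lra.
have [v0|/ltW v0] := leP 0 v.
  have [iE BE] := itg_expRN 0 c0.
  apply: (le_trans (Rint_le iF (itgZ (72 * n) iE) _)).
    move=> u; have k0 := kk_ge0 P v u (ltW e0).
    have e2 : expR (- (`|u| / 10)) <= expR (- (1 / 20 * `|u - 0|)).
      by rewrite ler_expR subr0; have := normr_ge0 u; lra.
    have [->|uv] := eqVneq u v.
      by rewrite subrr mulr0 mulr_ge0 ?expR_ge0 ?mulr_ge0.
    apply: (@le_trans _ _ (4 * n * (18 * expR (- (`|u| / 10))))).
      have h := jump_ff_nonneg u a0 a1 v0; have h2 := kk_le0 (ltW e0) uv.
      have m0 : 0 <= Num.max 0 (ff (al P) u - ff (al P) v) by rewrite le_max lexx.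
      apply: (@le_trans _ _ (kk P e v u * Num.max 0 (ff (al P) u - ff (al P) v))).
        by rewrite ler_wpM2l// le_max lexx orbT.
      apply: (@le_trans _ _ (4 * n * (rho 0 v * (mm v u * bose `|u - v|)) *
        Num.max 0 (ff (al P) u - ff (al P) v))); first by rewrite ler_wpM2r.
      by rewrite -mulrA ler_wpM2l ?mulr_ge0.
    have : n * expR (- (`|u| / 10)) <= n * expR (- (1 / 20 * `|u - 0|)) by rewrite ler_wpM2l.
    lra.
  rewrite RintZ//.
  apply: (@le_trans _ _ (72 * n * (2 / (1 / 20)))); first by rewrite ler_wpM2l// mulr_ge0.
  have : n * 1 <= n * ff (al P) v by rewrite ler_wpM2l.
  rewrite [2 / (1 / 20)](_ : _ = 40); last by field. lra.
have c1 : (0 : R) < 1 by [].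
have [iE BE] := itg_expRN v c1.
set F := fun u => kk P e v u * (ff (al P) u - ff (al P) v).
have iFr := itg_refl (2 * v) iF.
have -> : \int[leb]_u F u = 1 / 2 * \int[leb]_u (F u + F (2 * v - u)).
  by rewrite RintD// Rint_refl//; lra.
have hp u : F u + F (2 * v - u) <= 36 * n * ff (al P) v * expR (- (1 * `|u - v|)).
  wlog vu : u / v <= u => [H|].
    have [/H//|/ltW uv] := leP v u.
    have := H (2 * v - u); rewrite (_ : 2 * v - (2 * v - u) = u); last by ring.
    have -> : `|2 * v - u - v| = `|u - v| by rewrite distrC; congr `|_|; ring.
    by rewrite [F (_ - _) + _]addrC; apply; lra.
  have [uv|uv] := eqVneq u v.
    rewrite /F uv (_ : 2 * v - v = v); last by ring.
    by rewrite subrr mulr0 addr0 mulr_ge0 ?expR_ge0// mulr_ge0 ?mulr_ge0// ltW// ff_gt0.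
  set s := u - v; have s0 : 0 < s by rewrite subr_gt0 lt_neqAle eq_sym uv.
  have -> : `|u - v| = s by rewrite ger0_norm ?subr_ge0.
  have uE : u = v + s by rewrite /s; ring.
  have u2 : 2 * v - u = v - s by rewrite /s; ring.
  rewrite /F u2 uE.
  have hk : 0 <= rho e v * jr e s <= rho 0 v * bose s.
    rewrite mulr_ge0 ?jr_ge0 ?(ltW e0) ?(ltW s0) ?(ltW (rho_gt0 _ (ltW e0)))//=.
    apply: ler_pM; rewrite ?jr_ge0 ?(ltW e0) ?(ltW s0) ?(ltW (rho_gt0 _ (ltW e0)))//.
      by rewrite rho_le0// ltW.
    by rewrite jr_le// ltW.
  have h := jump_ff_nonpos a0 a1 v0 s0 hk.
  rewrite /kk (_ : `|v + s - v| = s); last by rewrite [v + s]addrC addrK gtr0_norm.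
  rewrite (_ : `|v - s - v| = s); last by rewrite addrAC subrr add0r normrN gtr0_norm.
  rewrite mul1r.
  move: h; set LHS := (X in _ <= X -> _) => h.
  rewrite [leLHS](_ : _ = 4 * n * - LHS); last by rewrite /LHS; ring.
  rewrite [leRHS](_ : _ = 4 * n * (9 * expR (- s) * ff (al P) v)); last by ring.
  by rewrite ler_wpM2l ?mulr_ge0//; lra.
have iS := itgD iF iFr; have iR := itgZ (36 * n * ff (al P) v) iE.
have := Rint_le iS iR hp; rewrite RintZ// => hI.
have nf : 0 <= n * ff (al P) v by rewrite mulr_ge0// ltW// ff_gt0.
have : 36 * n * ff (al P) v * \int[leb]_u expR (- (1 * `|u - v|)) <=
       36 * n * ff (al P) v * (2 / 1).
  by rewrite ler_wpM2l// -mulrA mulr_ge0.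
rewrite divr1; lra.
Qed.

(** With [w] frozen, the three summands of [G] are treated one by one. The one with [ff u] needs the
    compensation of [drift_ff]; the other two are bounded jump by jump. A jump cannot increase the
    minimum with [w] if [w <= v], and otherwise increases its weight at most as much as that of [u]
    itself. *)
Lemma drift_G e v w : 0 < e <= 1 ->
  \int[leb]_u (kk P e v u * (G u w - G v w)) <= 21920 * n * G v w.
Proof.
move=> he; have /andP[e0 e1] := he.
have c256 : (0 : R) <= 256 by rewrite ler0n.
have /andP[m0 m1] := me_bnd P; have /andP[mu0 mu1] := mu_bnd P.
have muu : 0 <= mu_ P by lra.
have hm : 0 <= me P <= 1 / 2 by rewrite m0 (le_trans m1)//; lra.
have hmu : 0 <= mu_ P <= 1 / 2 by rewrite muu.
have c0 : (0 : R) < 1 / 20 by lra.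
have [iE BE] := itg_expRN v c0.
have [ik _] := itg_kk P v he.
have iG := itg_kkG P v w he.
have iL : itg (fun u => kk P e v u * (G u w - G v w)).
  have := itgB iG (itgZ (G v w) ik); apply: eq_ind; congr itg.
  by apply/funext => u; ring.
have i1 := itgZ (EE (me P) w) (itg_kk_ff v he).
have i2 := itgZ (256 * n * (ff (al P) w * EE (me P) v + EE (mu_ P) (Num.min v w))) iE.
apply: (le_trans (Rint_le iL (itgD i1 i2) _)).
  move=> u; have k0 := kk_ge0 P v u (ltW e0).
  have h1 := kk_EE v u (ltW e0) hm; have h2 := kk_EE v u (ltW e0) hmu.
  set E := expR _ in h1 h2 *.
  have E0 : 0 <= E by exact: expR_ge0.
  have fw := ltW (ff_gt0 (al P) w).
  have j1 : kk P e v u * (EE (me P) u - EE (me P) v) <= 256 * n * E * EE (me P) v.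
    by apply: le_trans h1; rewrite ler_wpM2l// le_max lexx orbT.
  have j2 : kk P e v u * (EE (mu_ P) (Num.min u w) - EE (mu_ P) (Num.min v w)) <=
            256 * n * E * EE (mu_ P) (Num.min v w).
    have [wv|vw] := leP w v.
      apply: (@le_trans _ _ 0).
        rewrite mulr_ge0_le0// subr_le0 EE_nd//.
        by rewrite ge_min lexx orbT.
      by apply: mulr_ge0; [rewrite !mulr_ge0|exact: ltW (EE_gt0 _ _)].
    apply: le_trans h2; rewrite ler_wpM2l// le_max; apply/orP; right.
    by rewrite lerB// EE_nd// ge_min lexx.
  have j3 : ff (al P) w * (kk P e v u * (EE (me P) u - EE (me P) v)) <=
            ff (al P) w * (256 * n * E * EE (me P) v) by rewrite ler_wpM2l.
  rewrite /Ginf; clear - j2 j3; lra.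
rewrite RintD// !RintZ//; last exact: itg_kk_ff.
have h := drift_ff v he.
have ew := EE_gt0 (me P) w; have ev := EE_gt0 (me P) v; have eu := EE_gt0 (mu_ P) (Num.min v w).
have fw := ff_gt0 (al P) w; have fv := ff_gt0 (al P) v.
have k1 : EE (me P) w * \int[leb]_u (kk P e v u * (ff (al P) u - ff (al P) v)) <=
  EE (me P) w * (2880 * n * ff (al P) v) by rewrite ler_pM2l.
rewrite [2 / (1 / 20)](_ : _ = 40) in BE; last by field.
have p0 : 0 <= 256 * n * (ff (al P) w * EE (me P) v + EE (mu_ P) (Num.min v w)).
  apply: mulr_ge0; first exact: mulr_ge0 c256 n0.
  by apply: addr_ge0; [apply: mulr_ge0|]; exact: ltW.
have k2 := ler_wpM2l p0 BE.
have q1 : 0 <= n * (ff (al P) v * EE (me P) w).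
  by apply: mulr_ge0 => //; apply: mulr_ge0; exact: ltW.
have q2 : 0 <= n * (ff (al P) w * EE (me P) v).
  by apply: mulr_ge0 => //; apply: mulr_ge0; exact: ltW.
have q3 : 0 <= n * EE (mu_ P) (Num.min v w).
  by apply: mulr_ge0 => //; exact: ltW.
rewrite /Ginf; clear - k1 k2 q1 q2 q3; lra.
Qed.
End drift.


(** * The smoothing weight *)

Section smoothing_weight.
Context {R : realType}.
Variable P : model R.
Local Notation n := (nb P).
Local Notation G := (Ginf (al P) (me P) (mu_ P)).
Context (e d gam : R).
Hypotheses (e0 : 0 < e) (ed : e <= d) (d1 : d <= 1 / 100) (gam0 : 0 < gam) (gam1 : gam <= 1 / 8).
Implicit Types (x y u v w s t r th : R).

(** The coefficient is twice the 1/8 of [abar], since [1 + exp w] is only at most twice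
    [1 + exp(beta w)]. It is still small enough for [qq_rho], through which the coupling gain pays;
    the [e] in the denominator matches the one in [rho e]. *)
Definition qq x := 1 / 4 * Num.min 1 n / (1 + e + expR x).
(* [Gs th] gains a factor [(r / d) ^ (th * (qq x + qq y))] as [th] grows: this is the
   improvement in time of the exponent in [Gamma t]. *)
Definition Lam r := Num.max 0 (ln (d / (r + e))).
Definition hh r := (Num.min 1 (r / d)) `^ gam.
Definition Bs th x y := hh `|x - y| * expR (- (th * (qq x + qq y) * Lam `|x - y|)).
Definition Gs th x y := G x y * Bs th x y.

Let d0 : 0 < d. Proof. exact: lt_le_trans ed. Qed.
Let mn : 0 < Num.min 1 n <= 1.
Proof. by rewrite lt_min ltr01 nb_gt0/= ge_min lexx. Qed.

Lemma qq_den_gt0 x : 0 < 1 + e + expR x.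
Proof. by rewrite !addr_gt0 ?expR_gt0. Qed.

Lemma qq_ge0 x : 0 <= qq x.
Proof.
have /andP[h _] := mn.
by rewrite divr_ge0 ?(ltW (qq_den_gt0 _))// mulr_ge0 ?(ltW h)//; lra.
Qed.

Lemma qq_le x : qq x <= 1 / 4.
Proof.
have /andP[h h1] := mn; rewrite ler_pdivrMr ?qq_den_gt0//.
have := expR_gt0 x; have := e0; nra.
Qed.

Lemma qq_rho x : qq x <= n / 4 * rho e x.
Proof.
have q : Num.sqrt (softplus x) + e <= 1 + e + expR x.
  have h : Num.sqrt (softplus x) <= 1 + expR x.
    have p : 0 <= 1 + expR x by rewrite addr_ge0 ?expR_ge0.
    rewrite -(ger0_norm p) -sqrtr_sqr ler_wsqrtr//.
    by rewrite (le_trans (softplus_le_expR x))//; have := expR_gt0 x; nra.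
  lra.
rewrite /qq /rho; apply: ler_pM.
- by have /andP[h _] := mn; rewrite mulr_ge0 ?(ltW h)//; lra.
- by rewrite invr_ge0 ltW// qq_den_gt0.
- by have : Num.min 1 n <= n by [rewrite ge_min lexx orbT]; lra.
- by rewrite lef_pV2 ?posrE ?qq_den_gt0 ?rho_den_gt0 ?(ltW e0).
Qed.

Lemma qq_lip x y : qq x - qq y <= `|x - y| / 4.
Proof.
have [xy|/ltW xy] := leP y x.
  have : qq x <= qq y.
    rewrite /qq ler_wpM2l//.
      by have /andP[h _] := mn; rewrite mulr_ge0 ?(ltW h)//; lra.
    by rewrite lef_pV2 ?posrE ?qq_den_gt0// lerD2l ler_expR.
  by have := normr_ge0 (x - y); lra.
rewrite distrC ger0_norm ?subr_ge0//.
have h : expR (- (y - x)) * qq x <= qq y.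
  rewrite /qq mulrCA ler_wpM2l//.
    by have /andP[h _] := mn; rewrite mulr_ge0 ?(ltW h)//; lra.
  rewrite -[leRHS]mul1r ler_pdivlMr ?qq_den_gt0// mulrAC ler_pdivrMr ?qq_den_gt0// mul1r.
  rewrite mulrDr -expRD (_ : - (y - x) + y = x); last by ring.
  rewrite lerD2r -[leRHS]mul1r ler_wpM2r ?expRN_le1 ?subr_ge0//.
  by have := e0; lra.
have := expRN_ge_sub (y - x); have := qq_le x; have := qq_ge0 x; nra.
Qed.

Lemma Lam_ge0 r : 0 <= Lam r. Proof. by rewrite le_max lexx. Qed.

Lemma Lam_ninc r r' : 0 <= r -> r <= r' -> Lam r' <= Lam r.
Proof.
move=> r0 rr; rewrite /Lam ge_max le_max lexx/= le_max; apply/orP; right.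
have := e0; have := d0 => ? ?.
rewrite ler_ln ?posrE ?divr_gt0//; try lra.
by rewrite ler_pM2l// lef_pV2 ?posrE//; lra.
Qed.

Lemma Lam_le_inv r : 0 < r -> Lam r <= r^-1.
Proof.
move=> r0; rewrite /Lam ge_max invr_ge0 (ltW r0)/=.
have := e0; have := d0; have := d1 => ? ? ?.
have q : 0 < d / (r + e) by rewrite divr_gt0//; lra.
apply: (le_trans (ltW (ln_sublinear q))).
by rewrite ler_pdivrMr; [rewrite mulrC -ler_pdivrMr ?invr_gt0// invrK; nra|lra].
Qed.

Lemma Lam_diff r r' z : 0 < r -> 0 <= z -> r' <= r * (1 + z) -> 0 <= r' ->
  Lam r - Lam r' <= ln (1 + z).
Proof.
move=> r0 z0 rr r'0; have := e0; have := d0 => ? ?.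
have l0 : 0 <= ln (1 + z) by rewrite ln_ge0//; lra.
rewrite lerBlDr /Lam ge_max; apply/andP; split.
  by rewrite addr_ge0// le_max lexx.
apply: (@le_trans _ _ (ln (1 + z) + ln (d / (r' + e)))); last first.
  by rewrite lerD2l le_max lexx orbT.
have q1 : 0 < d / (r + e) by apply: divr_gt0; lra.
have q2 : 0 < d / (r' + e) by apply: divr_gt0; lra.
have q3 : 0 < 1 + z by lra.
rewrite -lnM ?posrE// ler_ln ?posrE// ?(mulr_gt0 q3 q2)//.
rewrite mulrA ler_pdivlMr; last lra.
rewrite mulrAC ler_pdivrMr; last lra.
rewrite [leRHS](_ : _ = d * ((1 + z) * (r + e))); last by ring.
by rewrite ler_pM2l//; nra.
Qed.

Lemma hh_ge0 r : 0 <= hh r. Proof. exact: powR_ge0. Qed.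

Lemma hh_le1 r : 0 <= r -> hh r <= 1.
Proof.
move=> r0; have := d0 => ?; apply: (@le_trans _ _ (1 `^ gam)); last by rewrite powR1.
apply: ge0_ler_powR; rewrite ?nnegrE ?(ltW gam0)//.
  by rewrite le_min ler01/= divr_ge0// ltW.
by rewrite ge_min lexx.
Qed.

Lemma Bs_ge0 th x y : 0 <= Bs th x y.
Proof. by rewrite mulr_ge0 ?hh_ge0 ?expR_ge0. Qed.

Lemma Bs_le1 th x y : 0 <= th -> Bs th x y <= 1.
Proof.
move=> th0; rewrite /Bs -[leRHS]mul1r; apply: ler_pM; rewrite ?hh_ge0 ?expR_ge0 ?hh_le1//.
by rewrite expRN_le1// mulr_ge0 ?Lam_ge0// mulr_ge0 ?addr_ge0 ?qq_ge0.
Qed.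

Lemma Bs_far th x y : d <= `|x - y| -> Bs th x y = 1.
Proof.
move=> dr; have := e0; have := d0 => ? ?; rewrite /Bs /hh /Lam.
rewrite min_l; last by rewrite ler_pdivlMr// mul1r.
rewrite powR1 mul1r max_l ?mulr0 ?oppr0 ?expR0//.
by rewrite ln_le0// ler_pdivrMr; lra.
Qed.

Lemma BsC th x y : Bs th x y = Bs th y x.
Proof. by rewrite /Bs distrC [qq x + _]addrC. Qed.

Lemma GsC th x y : Gs th x y = Gs th y x.
Proof. by rewrite /Gs BsC G_sym. Qed.

Lemma Gs_ge0 th x y : 0 <= Gs th x y.
Proof. by rewrite mulr_ge0 ?Bs_ge0 ?G_ge0. Qed.

Lemma Gs_le th x y : 0 <= th -> Gs th x y <= G x y.
Proof. by move=> th0; rewrite /Gs ler_piMr ?G_ge0 ?Bs_le1. Qed.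

Lemma hh_scale r r' z : 0 < r -> 0 <= z -> 0 <= r' -> r' <= r * (1 + z) ->
  hh r' <= expR (gam * ln (1 + z)) * hh r.
Proof.
move=> r0 z0 r'0 rr; have := d0 => ?.
have z1 : 0 < 1 + z by lra.
rewrite [gam * _]mulrC expRM lnK ?posrE// mulrC -powRM; last first.
- by rewrite ltW.
- by rewrite le_min ler01 divr_ge0// ltW.
apply: ge0_ler_powR; rewrite ?nnegrE ?(ltW gam0)//.
- by rewrite le_min ler01/= divr_ge0// ltW.
- by rewrite mulr_ge0 ?(ltW z1)// le_min ler01 divr_ge0// ltW.
rewrite mulrC -ler_pdivrMr// le_min; apply/andP; split.
  by rewrite ler_pdivrMr// mul1r ge_min; apply/orP; left; lra.
rewrite ler_pdivrMr// ge_min; apply/orP; right.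
by rewrite [d^-1 * _]mulrC mulrAC ler_pM2r ?invr_gt0.
Qed.

(** The exponential of half the logarithm is [sqrt (r + s) / sqrt r], whose excess over 1 is at most
    [s / (sqrt r * sqrt (r + s))]. Multiplied by [s^-1] and by [r / (r + s)], this excess becomes
    exactly the integrand of [itg_sqrt]. *)
Lemma exp_budget r s c : 0 < r -> 0 <= s -> 0 <= c -> c <= s / r / 8 -> c <= 1 / 4 ->
  expR (1 / 2 * ln (1 + s / r) + c) <= 1 + 5 / 2 * (s / (Num.sqrt r * Num.sqrt (r + s))).
Proof.
move=> r0 s0 c0 c1 c2.
set a := Num.sqrt r; set b := Num.sqrt (r + s).
have a0 : 0 < a by rewrite sqrtr_gt0.
have b0 : 0 < b by rewrite sqrtr_gt0; lra.
have aa : a ^+ 2 = r by rewrite sqr_sqrtr// ltW.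
have bb : b ^+ 2 = r + s by rewrite sqr_sqrtr//; lra.
have ab : a <= b by rewrite ler_wsqrtr//; lra.
have q0 : 0 < 1 + s / r by have : 0 <= s / r by [rewrite divr_ge0// ltW]; lra.
have -> : expR (1 / 2 * ln (1 + s / r) + c) = b / a * expR c.
  rewrite expRD; congr (_ * _).
  rewrite [1 / 2 * _]mulrC mul1r expRM lnK ?posrE// powR12_sqrt ?(ltW q0)//.
  have -> : 1 + s / r = (b / a) ^+ 2 by rewrite expr_div_n aa bb; field; rewrite gt_eqF.
  by rewrite sqrtr_sqr ger0_norm// divr_ge0// ltW.
have ec : expR c <= 1 + 2 * c.
  have := expRN_ge_sub c; have := expRNK c; have := expR_gt0 c; nra.
have h : b / a * expR c <= b / a * (1 + 2 * c) by rewrite ler_wpM2l// divr_ge0 ?ltW.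
apply: (le_trans h).
have ab0 : 0 < a * b by exact: mulr_gt0.
rewrite -(ler_pM2r ab0).
rewrite [leLHS](_ : _ = b ^+ 2 * (1 + 2 * c)); last by field; rewrite gt_eqF.
rewrite [leRHS](_ : _ = a * b + 5 / 2 * s); last by field; rewrite !gt_eqF.
have h1 : a ^+ 2 <= a * b by rewrite expr2 ler_pM2l.
have h2 : c * r <= s / 8.
  by have : c * r <= s / r / 8 * r by [rewrite ler_wpM2r// ltW]; rewrite mulrAC mulfVK ?gt_eqF.
have h3 : c * s <= 1 / 4 * s by rewrite ler_wpM2r.
rewrite bb; rewrite aa in h1; lra.
Qed.

(** Moving [x] to [u] changes three things: [hh], by at most the power [gam <= 1/8] of [1 + s/r];
    [Lam], by at most [ln (1 + s/r)] with coefficient at most 1/4; and [qq], by at most [s/4], which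
    gives the term [c]. The exponents of [1 + s/r] stay below the 1/2 of [exp_budget]. *)
Lemma Bs_ratio th x y u : 0 <= th <= 1 / 2 -> x != y ->
  Bs th u y <= (1 + 5 / 2 * (`|u - x| / (Num.sqrt `|x - y| * Num.sqrt (`|x - y| + `|u - x|)))) *
               Bs th x y.
Proof.
move=> /andP[th0 th1] xy; have hg1 := gam1; have hg0 := gam0.
set r := `|x - y|; set s := `|u - x|; set r' := `|u - y|.
have r0 : 0 < r by rewrite normr_gt0 subr_eq0.
have s0 : 0 <= s by exact: normr_ge0.
have r'0 : 0 <= r' by exact: normr_ge0.
have rs : r' <= r + s.
  by rewrite /r' (_ : u - y = (x - y) + (u - x)); [exact: ler_normD|ring].
have sr : s <= r + r'.
  rewrite /s (_ : u - x = - (x - y) + (u - y)); last by ring.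
  by rewrite (le_trans (ler_normD _ _))// normrN.
have z0 : 0 <= s / r by rewrite divr_ge0// ltW.
have rz : r' <= r * (1 + s / r) by rewrite mulrDr mulr1 mulrCA mulfV ?mulr1 ?gt_eqF.
set l := ln (1 + s / r).
have l0 : 0 <= l by rewrite ln_ge0// lerDl.
(* Evaluating [Lam] at the larger distance makes both bounds on [c] hold: it is at least [r], and
   [s <= r + r'] is at most twice it. *)
set rho_ := Num.max r r'.
have rho0 : 0 < rho_ by rewrite lt_max r0.
have rr : r <= rho_ by rewrite le_max lexx.
have rr' : r' <= rho_ by rewrite le_max lexx orbT.
pose c := th * (s / 4 * Lam rho_).
have Lr0 := Lam_ge0 rho_; have Li := Lam_le_inv rho0.
have c0 : 0 <= c by rewrite mulr_ge0// mulr_ge0// divr_ge0.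
have cm : c <= s / 8 * rho_^-1.
  apply: (@le_trans _ _ (1 / 2 * (s / 4 * Lam rho_))).
    by rewrite /c ler_wpM2r// mulr_ge0// divr_ge0.
  have : s / 8 * Lam rho_ <= s / 8 * rho_^-1 by rewrite ler_wpM2l// divr_ge0.
  lra.
have c1 : c <= s / r / 8.
  apply: (le_trans cm); rewrite mulrAC ler_pM2r// ler_wpM2l//.
  by rewrite lef_pV2 ?posrE.
have c2 : c <= 1 / 4.
  by apply: (le_trans cm); rewrite ler_pdivrMr//; lra.
have hD := Lam_diff r0 z0 rz r'0; rewrite -/l in hD.
have hexp : th * (qq x + qq y) * Lam r - th * (qq u + qq y) * Lam r' <= 1 / 4 * l + c.
  have qx := qq_le x; have qy := qq_le y; have qx0 := qq_ge0 x; have qy0 := qq_ge0 y.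
  have qu0 := qq_ge0 u; have ql := qq_lip x u; rewrite distrC -/s in ql.
  have k1 : (qq x - qq u) * Lam rho_ <= s / 4 * Lam rho_ by rewrite ler_wpM2r.
  suff k : (qq x + qq y) * Lam r - (qq u + qq y) * Lam r' <= 1 / 2 * l + s / 4 * Lam rho_.
    have k2 : th * ((qq x + qq y) * Lam r - (qq u + qq y) * Lam r') <=
              th * (1 / 2 * l + s / 4 * Lam rho_) by rewrite ler_wpM2l.
    have k3 : th * l <= 1 / 2 * l by rewrite ler_wpM2r.
    by rewrite /c; clear - k2 k3; lra.
  have [r'r|rr1] := leP r' r.
    have E : rho_ = r by rewrite /rho_ max_l.
    have := Lam_ninc r'0 r'r; rewrite E in k1 Lr0 *; clear - k1 qu0 qy0 l0; nra.
  have E : rho_ = r' by rewrite /rho_ max_r// ltW.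
  rewrite E in k1 Lr0 *.
  have k4 : (qq x + qq y) * (Lam r - Lam r') <= (qq x + qq y) * l.
    by rewrite ler_wpM2l// addr_ge0.
  have k5 : (qq x + qq y) * l <= 1 / 2 * l by apply: ler_wpM2r => //; lra.
  clear - k1 k4 k5; lra.
have hb := exp_budget r0 s0 c0 c1 c2; rewrite -/l in hb.
apply: le_trans (ler_wpM2r (Bs_ge0 th x y) hb).
rewrite /Bs -/r -/r'.
have h1 := hh_scale r0 z0 r'0 rz; rewrite -/l in h1.
have h2 : expR (- (th * (qq u + qq y) * Lam r')) <=
   expR (1 / 4 * l + c) * expR (- (th * (qq x + qq y) * Lam r)).
  by rewrite -expRD ler_expR; clear - hexp; lra.
apply: (@le_trans _ _ ((expR (gam * l) * hh r) *
   (expR (1 / 4 * l + c) * expR (- (th * (qq x + qq y) * Lam r))))).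
  by apply: ler_pM; rewrite ?hh_ge0 ?expR_ge0.
rewrite [leLHS](_ : _ = (expR (gam * l) * expR (1 / 4 * l + c)) *
  (hh r * expR (- (th * (qq x + qq y) * Lam r)))); last by ring.
rewrite ler_wpM2r ?mulr_ge0 ?hh_ge0 ?expR_ge0// -expRD ler_expR.
have g8 : gam * l <= 1 / 8 * l by rewrite ler_wpM2r.
by clear - g8 l0; lra.
Qed.

(** The factors are the bound on the kernel, the relative difference of the rates from the two
    points, and the relative growth of the weight along the jump. The last one vanishes to first
    order in [s] and removes the singularity [s^-1]. *)
Lemma decay_budget r s : 0 < r -> r <= 1 -> 0 < s ->
  (1 + s^-1) * expR (- (s / 10)) * (r * (6 + (r + s)^-1)) *
    ((1 - expR (- s)) + 5 / 2 * (s / (Num.sqrt r * Num.sqrt (r + s)))) <=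
  400 * (Num.sqrt r / ((r + s) * Num.sqrt (r + s)) + expR (- (1 / 20 * s))).
Proof.
move=> r0 r1 s0.
set a := Num.sqrt r; set b := Num.sqrt (r + s); set E := expR (- (1 / 20 * s)).
have a0 : 0 < a by rewrite sqrtr_gt0.
have b0 : 0 < b by rewrite sqrtr_gt0; lra.
have aa : a ^+ 2 = r by rewrite sqr_sqrtr// ltW.
have bb : b ^+ 2 = r + s by rewrite sqr_sqrtr//; lra.
have ab : a <= b by rewrite ler_wsqrtr//; lra.
have E0 : 0 < E by exact: expR_gt0.
have E1 : E <= 1 by rewrite expRN_le1//; lra.
have EE2 : expR (- (s / 10)) = E * E by rewrite -expRD; congr expR; lra.
have si : 0 < s^-1 by rewrite invr_gt0.
have rsi : 0 < (r + s)^-1 by rewrite invr_gt0; lra.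
have w1 : r * (6 + (r + s)^-1) <= 7.
  have : r * (r + s)^-1 <= 1 by rewrite ler_pdivrMr; lra.
  lra.
have w0 : 0 <= r * (6 + (r + s)^-1) by rewrite mulr_ge0//; lra.
have p1 : (1 + s^-1) * (1 - expR (- s)) <= 2.
  have h1 := expRN_ge_sub s; have h2 := expR_gt0 (- s).
  have : s^-1 * (1 - expR (- s)) <= 1.
    by rewrite mulrC ler_pdivrMr//; lra.
  lra.
have p10 : 0 <= (1 + s^-1) * (1 - expR (- s)).
  have := expRN_le1 (ltW s0) => h; rewrite mulr_ge0//; lra.
have p2 : (1 + s) * E <= 20.
  have := expR_ge1Dx (1 / 20 * s); have := expRNK (1 / 20 * s); rewrite -/E.
  have := expR_gt0 (1 / 20 * s); nra.
set J := a / ((r + s) * b).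
have J0 : 0 < J by rewrite divr_gt0// mulr_gt0//; lra.
have f1 : (1 + s^-1) * (1 - expR (- s)) * (r * (6 + (r + s)^-1)) * (E * E) <= 14 * E.
  have h : (1 + s^-1) * (1 - expR (- s)) * (r * (6 + (r + s)^-1)) <= 2 * 7 by exact: ler_pM.
  have hE : E * E <= E by rewrite ler_piMr// ltW.
  apply: (@le_trans _ _ (14 * (E * E))).
    by rewrite ler_wpM2r ?mulr_ge0 ?(ltW E0)//; lra.
  lra.
have f2 : (1 + s^-1) * (r * (6 + (r + s)^-1)) * (s / (a * b)) = (1 + s) * (6 * (a / b) + J).
  rewrite /J -bb -{1}aa; field; rewrite !gt_eqF//.
have ab1 : a / b <= 1 by rewrite ler_pdivrMr// mul1r.
have f3 : (1 + s) * E * (E * (6 * (a / b) + J)) <= 20 * (6 * E + J).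
  apply: ler_pM => //.
  - by rewrite mulr_ge0 ?(ltW E0)//; lra.
  - by rewrite mulr_ge0 ?(ltW E0)// addr_ge0 ?(ltW J0)// mulr_ge0// divr_ge0// ltW.
  - have : E * (a / b) <= E by rewrite ler_piMr// ltW.
    have : E * J <= J by rewrite ler_piMl// ltW.
    lra.
rewrite EE2.
rewrite [leLHS](_ : _ = (1 + s^-1) * (1 - expR (- s)) * (r * (6 + (r + s)^-1)) * (E * E) +
  5 / 2 * ((1 + s^-1) * (r * (6 + (r + s)^-1)) * (s / (a * b)) * (E * E))); last by ring.
rewrite f2; lra.
Qed.
End smoothing_weight.

(** * The loss from jumps that are not coupled *)

Section contraction.
Context {R : realType}.
Local Notation leb := (@lebesgue_measure R).
Variable P : model R.
Local Notation n := (nb P).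
Local Notation G := (Ginf (al P) (me P) (mu_ P)).
Local Notation k := (kk P).
Implicit Types (x y u v w s t r th : R).

Let n0 : 0 <= n. Proof. exact: nb_ge0. Qed.

Lemma expR_le_small t : t <= 1 / 3 -> expR t <= 3 / 2.
Proof.
move=> ht; have := expRN_ge_sub t; have := expRNK t; have := expR_gt0 t; nra.
Qed.

(** The constant is 6 = 1 + 3 + 2, from [rho], [mm] and the exponential in [jr_shift]; the term in
    [(r + s)^-1] is the effect of the singularity. The bound is uniform in [e]. *)
Lemma kk_sub_le e x y u : 0 < e <= 1 ->
  k e x u - k e y u <= k e x u * (`|x - y| * (6 + (`|x - y| + `|u - x|)^-1)).
Proof.
move=> he; have /andP[e0 e1] := he.
set r : R := `|x - y|; set s : R := `|u - x|.
have r0 : 0 <= r by exact: normr_ge0.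
have s0 : 0 <= s by exact: normr_ge0.
have kx0 := kk_ge0 P x u (ltW e0).
have [rE|rn] := eqVneq r 0.
  have -> : y = x by apply/eqP; rewrite eq_sym -subr_eq0 -normr_eq0; apply/eqP.
  by rewrite subrr rE mul0r mulr0.
have {rn}r0 : 0 < r by rewrite lt_neqAle eq_sym rn.
have hy : expR (- (6 * r)) * ((s + e) / (s + e + r)) * k e x u <= k e y u.
  have h1 := rho_loglip x y (ltW e0); rewrite -/r in h1.
  have h2 := mm_loglip x y u; rewrite -/r in h2.
  have sy : 0 <= `|u - y| <= s + r.
    rewrite normr_ge0/= (_ : u - y = (u - x) + (x - y)); last by ring.
    exact: ler_normD.
  have h3 := jr_shift he s0 (ltW r0) sy.
  have rx := rho_gt0 x (ltW e0); have ry := rho_gt0 y (ltW e0).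
  have mx := mm_gt0 x u; have my := mm_gt0 y u.
  have h1' : expR (- r) * rho e x <= rho e y.
    by rewrite expRN mulrC ler_pdivrMr ?expR_gt0// mulrC.
  have h2' : expR (- (3 * r)) * mm x u <= mm y u.
    by rewrite expRN mulrC ler_pdivrMr ?expR_gt0// mulrC.
  have j0 := jr_ge0 (ltW e0) s0.
  have q : 0 <= (s + e) / (s + e + r) by apply: divr_ge0; clear - s0 r0 e0; lra.
  have -> : expR (- (6 * r)) = expR (- r) * expR (- (3 * r)) * expR (- (2 * r)).
    by rewrite -!expRD; congr expR; ring.
  rewrite /kk -/s [leLHS](_ : _ = 4 * n * ((expR (- r) * rho e x) *
    (expR (- (3 * r)) * mm x u) * (expR (- (2 * r)) * ((s + e) / (s + e + r)) * jr e s))).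
    2: by ring.
  apply: ler_wpM2l; first exact: mulr_ge0.
  apply: ler_pM => //.
  - by apply: mulr_ge0; apply: mulr_ge0; rewrite ?expR_ge0 ?(ltW rx) ?(ltW mx).
  - by apply: mulr_ge0 => //; apply: mulr_ge0; rewrite ?expR_ge0.
  - apply: ler_pM => //; apply: mulr_ge0; rewrite ?expR_ge0 ?(ltW rx) ?(ltW mx)//.
have h : 1 - expR (- (6 * r)) * ((s + e) / (s + e + r)) <= r * (6 + (r + s)^-1).
  have E1 := expRN_ge_sub (6 * r).
  have q : 0 <= (s + e) / (s + e + r) by apply: divr_ge0; clear - s0 r0 e0; lra.
  have q1 : (s + e) / (s + e + r) <= 1 by rewrite ler_pdivrMr; lra.
  have q2 : 1 - (s + e) / (s + e + r) = r * (s + e + r)^-1.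
    by field; rewrite gt_eqF//; lra.
  have q3 : r * (s + e + r)^-1 <= r * (r + s)^-1.
    by rewrite ler_pM2l// lef_pV2 ?posrE; lra.
  have q4 : (1 - 6 * r) * ((s + e) / (s + e + r)) <=
    expR (- (6 * r)) * ((s + e) / (s + e + r)) by rewrite ler_wpM2r.
  nra.
have := ler_wpM2l kx0 h; lra.
Qed.

Lemma kk_ge e v u : 0 < e <= 1 ->
  4 * n * rho e v * (expR (- (5 * `|u - v| + e)) / (`|u - v| + e)) <= k e v u.
Proof.
move=> he; have /andP[e0 e1] := he.
have s0 := normr_ge0 (u - v).
have h1 := mm_ge v u; rewrite distrC in h1; have h2 := jr_ge he s0.
rewrite /kk -mulrA; apply: ler_wpM2l; first exact: mulr_ge0.
rewrite -mulrA; apply: ler_wpM2l; first exact: ltW (rho_gt0 _ (ltW e0)).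
rewrite [leLHS](_ : _ = expR (- (3 * `|u - v|)) * (expR (- (2 * `|u - v| + e)) / (`|u - v| + e))).
  by apply: ler_pM; rewrite ?expR_ge0// divr_ge0 ?expR_ge0//; lra.
by rewrite mulrA -expRD; congr (expR _ / _); ring.
Qed.

Section params.
Context (e d gam th : R).
Hypotheses (e0 : 0 < e) (ed : e <= d) (d1 : d <= 1 / 100) (gam0 : 0 < gam) (gam1 : gam <= 1 / 8).
Hypotheses (hth : 0 <= th <= 1 / 2).
Local Notation G_ := (Gs P e d gam th).
Local Notation B_ := (Bs P e d gam th).

Let he : 0 < e <= 1. Proof. by rewrite e0 (le_trans ed)// (le_trans d1)//; lra. Qed.
Let d0 : 0 < d. Proof. exact: lt_le_trans ed. Qed.
Let th0 : 0 <= th. Proof. by case/andP: hth. Qed.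

Lemma measurable_Gs d' (T : measurableType d') (x y : T -> R) :
  measurable_fun setT x -> measurable_fun setT y ->
  measurable_fun setT (fun z => G_ (x z) (y z)).
Proof.
move=> mx my.
have mq (g : T -> R) : measurable_fun setT g -> measurable_fun setT (fun z => qq P e (g z)).
  move=> mg; apply: measurable_funM => //; apply: measurable_funV.
  by apply: measurable_funD => //; exact: measurableT_comp.
have md := measurable_dist mx my.
apply: measurable_funM; first exact: measurable_Ginf.
apply: measurable_funM.
  apply: (measurableT_comp (measurable_powR _)); apply: measurable_minr => //.
  exact: measurable_funM.
apply: measurableT_comp => //; apply: measurable_funN; apply: measurable_funM.
  by apply: measurable_funM => //; apply: measurable_funD; exact: mq.
apply: measurable_maxr => //; apply: (measurableT_comp (@measurable_ln R)).
by apply: measurable_funM => //; apply: measurable_funV; exact: measurable_funD.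
Qed.

Lemma itg_kk_Gs (F : R -> R) x y (c : R) : measurable_fun setT F -> 0 <= c ->
  (forall u, `|F u| <= c * (k e x u * G u y)) -> itg F.
Proof. by move=> mF c0 h; exact: itg_le (itgZ c (itg_kkG P x y he)). Qed.

(** Here 1620 is the 180 of [kk_G] times two factors 3 for changing arguments of [G] at distance
    [r], 400 comes from [decay_budget], and 44 = 4 + 40 is the integral of the two terms there. *)
Definition loss_cst : R := 1620 * (400 * 44).

Lemma loss_cst_gt0 : 0 < loss_cst.
Proof. by apply: mulr_gt0; [|apply: mulr_gt0]; rewrite ltr0n. Qed.

(** If both points jump to a common target [u] at rate [min (k x u) (k y u)], then [x] alone jumps
    at the rate given by the first factor. That rate is smaller than [k x u] by a factor of order
    [r / (r + s)] for [s] up to order 1, which keeps the integral bounded as [r] tends to 0. *)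
Lemma loss_pointwise x y u : x != y -> `|x - y| <= d ->
  Num.max 0 (k e x u - k e y u) * Num.max 0 (G_ u y - G_ x y) <=
  1620 * 400 * n * rho e x * G_ x y *
  (Num.sqrt `|x - y| / ((`|x - y| + `|u - x|) * Num.sqrt (`|x - y| + `|u - x|)) +
   expR (- (1 / 20 * `|u - x|))).
Proof.
move=> xy; set r : R := `|x - y| => rd; set s : R := `|u - x|.
have r0 : 0 < r by rewrite normr_gt0 subr_eq0.
have hd1 := d1.
have s0' : 0 <= s by exact: normr_ge0.
have B0 := Bs_ge0 P e d gam th x y.
have G0 := Gs_ge0 P e d gam th x y.
have rx := rho_gt0 x (ltW e0).
set J := Num.sqrt r / ((r + s) * Num.sqrt (r + s)).
have J0 : 0 <= J + expR (- (1 / 20 * s)).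
  by rewrite addr_ge0 ?expR_ge0// divr_ge0 ?mulr_ge0 ?sqrtr_ge0//; lra.
have [ux|ux] := eqVneq u x.
  rewrite [X in _ * Num.max 0 (X - _)](_ : _ = G_ x y) ?ux// subrr maxxx mulr0.
  have c0 : (0 : R) <= 1620 * 400 by apply: mulr_ge0; rewrite ler0n.
  apply: mulr_ge0 J0; apply: mulr_ge0 G0; apply: mulr_ge0 (ltW rx); exact: mulr_ge0 c0 n0.
have s0 : 0 < s by rewrite normr_gt0 subr_eq0.
have kx0 := kk_ge0 P x u (ltW e0).
have w0 : 0 <= r * (6 + (r + s)^-1).
  by have : 0 < (r + s)^-1 by [rewrite invr_gt0; lra]; move=> ?; rewrite mulr_ge0 ?(ltW r0)//; lra.
have hk : Num.max 0 (k e x u - k e y u) <= k e x u * (r * (6 + (r + s)^-1)).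
  by rewrite ge_max mulr_ge0//=; exact: kk_sub_le.
set ratio := s / (Num.sqrt r * Num.sqrt (r + s)).
have ratio0 : 0 <= ratio by rewrite divr_ge0 ?mulr_ge0 ?sqrtr_ge0.
set W := (1 - expR (- s)) + 5 / 2 * ratio.
have es1 := expRN_le1 s0'.
have W0 : 0 <= W by rewrite /W; lra.
have Gu := G_ge0 P u y.
have hG : Num.max 0 (G_ u y - G_ x y) <= G u y * (W * B_ x y).
  rewrite ge_max; apply/andP; split; first by rewrite mulr_ge0// mulr_ge0.
  have h1 := Bs_ratio P e0 ed d1 gam0 gam1 u hth xy; rewrite -/r -/s -/ratio in h1.
  have h2 := ler_wpM2l Gu h1.
  have h3 := G_lip P u x y; rewrite -/s in h3.
  have h4 : expR (- s) * G u y <= G x y.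
    by rewrite expRN mulrC ler_pdivrMr ?expR_gt0// mulrC.
  have h5 := ler_wpM2r B0 h4.
  rewrite /Gs /W; lra.
have m1 : 0 <= Num.max 0 (k e x u - k e y u) by rewrite le_max lexx.
have m2 : 0 <= Num.max 0 (G_ u y - G_ x y) by rewrite le_max lexx.
apply: (le_trans (ler_pM m1 m2 hk hG)).
have er3 : expR r <= 3.
  by have : expR r <= 3 / 2 by [apply: expR_le_small; lra]; lra.
have hA : k e x u * G u y <= 1620 * (n * rho e x * G x y * ((1 + s^-1) * expR (- (s / 10)))).
  have h1 := kk_G P (ltW e0) ux; rewrite -/s in h1.
  have h2 := G_lip2 P y x u; rewrite distrC -/r in h2.
  have h3 := G_le_diag P x y.
  have h3' := G_lip2 P x y x; rewrite -/r in h3'.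
  have g0 := G_ge0 P u x; have g1 := G_ge0 P x y.
  have k1 : G u y <= 3 * G u x by apply: (le_trans h2); rewrite ler_wpM2r.
  have k2 : G x x <= 3 * G x y by apply: (le_trans h3'); rewrite ler_wpM2r.
  apply: (@le_trans _ _ (3 * (k e x u * G u x))).
    by rewrite mulrCA ler_wpM2l.
  set E := (1 + s^-1) * _ in h1 *.
  have E0 : 0 <= E.
    by rewrite mulr_ge0 ?expR_ge0// addr_ge0// invr_ge0.
  have q0 : 0 <= n * rho e x * E.
    by apply: mulr_ge0 E0; exact: mulr_ge0 n0 (ltW rx).
  have := ler_wpM2l q0 k2; lra.
have hb : (1 + s^-1) * expR (- (s / 10)) * (r * (6 + (r + s)^-1)) * W <=
    400 * (J + expR (- (1 / 20 * s))).
  by apply: decay_budget => //; lra.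
rewrite [leLHS](_ : _ = (k e x u * G u y) * (r * (6 + (r + s)^-1) * W * B_ x y)); last by ring.
have q1 : 0 <= r * (6 + (r + s)^-1) * W * B_ x y.
  by apply: mulr_ge0 B0; exact: mulr_ge0.
apply: (le_trans (ler_wpM2r q1 hA)).
rewrite [leLHS](_ : _ = 1620 * (n * rho e x * (G x y * B_ x y)) *
  ((1 + s^-1) * expR (- (s / 10)) * (r * (6 + (r + s)^-1)) * W)); last by ring.
rewrite [leRHS](_ : _ = 1620 * (n * rho e x * (G x y * B_ x y)) *
  (400 * (J + expR (- (1 / 20 * s))))); last by rewrite /Gs; ring.
apply: ler_wpM2l hb.
apply: mulr_ge0; first by rewrite ler0n.
by apply: mulr_ge0; [exact: mulr_ge0 n0 (ltW rx)|exact: G0].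
Qed.

Let itg_loss x y : itg (fun u => Num.max 0 (k e x u - k e y u) * Num.max 0 (G_ u y - G_ x y)).
Proof.
apply: (@itg_kk_Gs _ x y 1) => //.
  apply: measurable_funM; apply: measurable_maxr => //; apply: measurable_funB => //;
    by [exact: measurable_kk|exact: measurable_Gs].
move=> u; rewrite mul1r ger0_norm; last by apply: mulr_ge0; rewrite le_max lexx.
have kx0 := kk_ge0 P x u (ltW e0); have ky0 := kk_ge0 P y u (ltW e0).
apply: ler_pM; rewrite ?le_max ?lexx// ge_max.
  by rewrite kx0/=; lra.
rewrite G_ge0/=; have := Gs_ge0 P e d gam th x y; have := Gs_le P e0 ed gam0 u y th0; lra.
Qed.

Lemma loss_integral x y : x != y -> `|x - y| <= d ->
  \int[leb]_u (Num.max 0 (k e x u - k e y u) * Num.max 0 (G_ u y - G_ x y)) <=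
  loss_cst * (n * rho e x) * G_ x y.
Proof.
move=> xy rd; have r0 : 0 < `|x - y| by rewrite normr_gt0 subr_eq0.
have [i1 b1] := itg_sqrt x r0.
have c0 : (0 : R) < 1 / 20 by lra.
have [i2 b2] := itg_expRN x c0.
have := Rint_le (itg_loss x y) (itgZ _ (itgD i1 i2)) (fun u => loss_pointwise u xy rd).
rewrite RintZ ?RintD//; last exact: itgD.
move/le_trans; apply.
rewrite [leRHS](_ : _ = 1620 * 400 * n * rho e x * G_ x y * (4 + 40)); last first.
  by rewrite /loss_cst; ring.
rewrite [2 / (1 / 20)](_ : _ = 40) in b2; last by field.
apply: ler_wpM2l; last exact: lerD.
have c1 : (0 : R) <= 1620 * 400 by apply: mulr_ge0; rewrite ler0n.
apply: mulr_ge0 (Gs_ge0 _ _ _ _ _ _ _); apply: mulr_ge0 (ltW (rho_gt0 _ (ltW e0))).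
exact: mulr_ge0 c1 n0.
Qed.

Lemma itg_min_kk x y : itg (fun u => Num.min (k e x u) (k e y u)).
Proof.
have [ik _] := itg_kk P x he; apply: itg_le ik.
  by apply: measurable_minr; exact: measurable_kk.
move=> u; rewrite ger0_norm ?ge_min ?lexx// le_min.
by rewrite !kk_ge0 ?(ltW e0).
Qed.

End params.
End contraction.

(** * One Euler step *)

Section gap.
Context {R : realType}.
Local Notation leb := (@lebesgue_measure R).
Variable P : model R.
Local Notation n := (nb P).
Local Notation G := (Ginf (al P) (me P) (mu_ P)).
Local Notation k := (kk P).
Implicit Types (x y u v w s t r th : R).

Let n0 : 0 <= n. Proof. exact: nb_ge0. Qed.

Lemma contract_arith (M g h S I D r : R) : `|D| <= M * g -> 0 <= 1 - h * S -> 0 <= h ->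
  `|r| <= M * I -> `|D * (1 - h * S) + h * r| <= M * (g + h * (I - g * S)).
Proof.
move=> h1 h2 h3 h4; rewrite (le_trans (ler_normD _ _))// !normrM (ger0_norm h2) (ger0_norm h3).
have := ler_wpM2r h2 h1; have := ler_wpM2l h3 h4; lra.
Qed.

(** With [l >= 1 + 2 * c] the constant part of the gain, [8/5 * c], exceeds the loss [c]; its
    logarithmic part, [4/5 * L], exceeds the [1/4 * L] demanded by the terms [qx] and [qy]. *)
Lemma near_arith (a rx ry L g c l T1 T2 I qx qy : R) :
  0 <= a -> 0 <= rx -> 0 <= ry -> 0 <= L -> 0 <= g -> 0 <= c -> 1 + 2 * c <= l ->
  T1 <= c * (a * rx) * g -> T2 <= c * (a * ry) * g ->
  4 / 5 * a * (rx + ry) * (l - 1 + L) <= I ->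
  qx <= a / 4 * rx -> qy <= a / 4 * ry ->
  T1 + T2 - g * I <= - ((qx + qy) * L) * g.
Proof.
move=> a0 rx0 ry0 L0 g0 c0 hl l1 l2 h qxr qyr.
set nr : R := a * (rx + ry).
have nr0 : 0 <= nr by rewrite mulr_ge0// addr_ge0.
have g1 : nr * (8 / 5 * c + 4 / 5 * L) <= I.
  apply: le_trans h; rewrite [leRHS](_ : _ = nr * (4 / 5 * (l - 1 + L))).
    by rewrite ler_wpM2l//; lra.
  by rewrite /nr; ring.
have q1 : (qx + qy) * L <= nr / 4 * L by rewrite ler_wpM2r// /nr; lra.
have q2 : 0 <= nr * c by rewrite mulr_ge0.
have q3 : 0 <= nr * L by rewrite mulr_ge0.
have key : c * nr - I <= - ((qx + qy) * L) by lra.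
have := ler_wpM2r g0 key; rewrite /nr; lra.
Qed.

Lemma rho_add_near e x y : 0 <= e -> `|x - y| <= 1 / 100 ->
  rho e x + rho e y <= 5 / 2 * rho e x.
Proof.
move=> e0 xy; have h1 := rho_loglip y x e0; rewrite distrC in h1.
have h2 : expR `|x - y| <= 3 / 2 by apply: expR_le_small => //; lra.
have h3 : expR `|x - y| * rho e x <= 3 / 2 * rho e x.
  by rewrite ler_wpM2r// ltW// rho_gt0.
lra.
Qed.

Lemma gain_arith (m a b L : R) : 0 <= m * L -> a <= 5 / 2 * b ->
  4 / 5 * m * a * L <= 2 * m * b * L.
Proof. by move=> mL /(ler_wpM2l mL); lra. Qed.

Lemma kk_ge_half e x v u r t : 0 < e <= 1 -> rho e x <= expR t * rho e v ->
  `|u - v| <= u - x + r -> 5 * `|u - v| + e + t <= 1 / 2 ->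
  2 * n * rho e x * (u - x + (r + e))^-1 <= k e v u.
Proof.
move=> he; have /andP[e0 e1] := he.
set A : R := `|u - v| => h1 h2 h3; have A0 : 0 <= A by exact: normr_ge0.
apply: le_trans (kk_ge P v u he); rewrite -/A.
have rx := rho_gt0 x (ltW e0); have rv := rho_gt0 v (ltW e0).
have h4 : 1 / 2 <= expR (- (5 * A + e + t)).
  by have := expRN_ge_sub (5 * A + e + t); clear - h3; lra.
have h5 : expR (- t) * rho e x <= rho e v.
  by rewrite expRN mulrC ler_pdivrMr ?expR_gt0// mulrC.
have i0 : 0 < (u - x + (r + e))^-1 by rewrite invr_gt0; clear - h2 A0 e0; lra.
have h6 : (u - x + (r + e))^-1 <= (A + e)^-1.
  by rewrite lef_pV2 ?posrE; clear - h2 A0 e0; lra.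
have E0 := expR_gt0 (- (5 * A + e)).
have h7 : 1 / 2 * rho e x <= expR (- (5 * A + e)) * rho e v.
  apply: (@le_trans _ _ (expR (- (5 * A + e)) * (expR (- t) * rho e x))).
    rewrite mulrA -expRD (_ : - (5 * A + e) - t = - (5 * A + e + t)); last by ring.
    by apply: ler_wpM2r h4; exact: ltW.
  by apply: ler_wpM2l h5; exact: ltW.
rewrite [leLHS](_ : _ = 4 * n * (1 / 2 * rho e x * (u - x + (r + e))^-1)).
  2: by field; clear - h2 A0 e0; lra.
rewrite [leRHS](_ : _ = 4 * n * (expR (- (5 * A + e)) * rho e v * (A + e)^-1)).
  2: by ring.
have ngt := nb_gt0 P.
rewrite ler_pM2l; last exact: mulr_gt0 (ltr0n _ 4) ngt.
apply: (ler_pM _ (ltW i0) h7 h6).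
by apply: mulr_ge0 (ltW rx); exact: divr_ge0.
Qed.

(** The logarithm splits at [d]. The [- 1] is needed because [r + e] may reach [2 * d], where [Lam]
    is 0 but [ln (d / (r + e))] is as low as [- ln 2]. *)
Lemma log_gain e d c r : 0 < e -> e <= d -> 0 < c -> 0 <= r -> r <= d ->
  ln (c / d) - 1 + Lam e d r <= ln ((c + (r + e)) / (r + e)).
Proof.
move=> e0 ed c0 r0 rd.
have d0 : 0 < d by exact: lt_le_trans ed.
have b0 : 0 < r + e by lra.
have p1 : 0 < c / d by rewrite divr_gt0.
have p2 : 0 < d / (r + e) by rewrite divr_gt0.
have l1 : ln (c / d) + ln (d / (r + e)) <= ln ((c + (r + e)) / (r + e)).
  have p3 : 0 < (c + (r + e)) / (r + e) by apply: divr_gt0 => //; exact: addr_gt0.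
  rewrite -lnM ?posrE// ler_ln ?posrE// ?(mulr_gt0 p1 p2)//.
  by rewrite mulrA mulfVK ?gt_eqF// ler_pM2r ?invr_gt0// lerDl ltW.
have l3 : - 1 <= ln (d / (r + e)).
  have h2 : d / (r + e) = (1 + r / d + (e / d - 1))^-1.
    by field; rewrite !gt_eqF//; lra.
  rewrite h2 lnV ?posrE; last by rewrite -invr_gt0 -h2.
  rewrite lerN2 (_ : 1 + r / d + (e / d - 1) = 1 + (r / d + e / d - 1)); last by ring.
  have r1 : r / d <= 1 by rewrite ler_pdivrMr// mul1r.
  have r2 : e / d <= 1 by rewrite ler_pdivrMr// mul1r.
  have r3 : 0 < r / d + e / d by rewrite -mulrDl divr_gt0.
  by have := @le_ln1Dx _ (r / d + e / d - 1); lra.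
have l2 : Lam e d r - 1 <= ln (d / (r + e)).
  have l4 : 0 <= ln (d / (r + e)) + 1 by lra.
  by rewrite lerBlDr /Lam ge_max l4/=; lra.
lra.
Qed.

Section params.
Context (e d gam th : R).
Hypotheses (e0 : 0 < e) (ed : e <= d) (d1 : d <= 1 / 100) (gam0 : 0 < gam) (gam1 : gam <= 1 / 8).
Hypotheses (hth : 0 <= th <= 1 / 2).
Local Notation G_ := (Gs P e d gam th).
Local Notation B_ := (Bs P e d gam th).

Let he : 0 < e <= 1. Proof. by rewrite e0 (le_trans ed)// (le_trans d1)//; lra. Qed.
Let d0 : 0 < d. Proof. exact: lt_le_trans ed. Qed.
Let th0 : 0 <= th. Proof. by case/andP: hth. Qed.

(** Only targets within 1/100 to the right of both points are counted. There both rates are at least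
    half of their singular main part, because the exponential corrections are close to 1. The factor
    4/5 is 2 * 2/5, where [rho e x] is at least 2/5 of the sum of the two values of [rho]. *)
Lemma gain_integral x y : `|x - y| < d ->
  4 / 5 * n * (rho e x + rho e y) * (ln (1 / 100 / d) - 1 + Lam e d `|x - y|) <=
  \int[leb]_u Num.min (k e x u) (k e y u).
Proof.
wlog yx : x y / y <= x => [H|].
  have [/H//|/ltW xy rd] := leP y x.
  have := H y x xy; rewrite distrC => /(_ rd).
  rewrite [rho e y + _]addrC => h; apply: (le_trans h); rewrite le_eqVlt.
  by apply/orP; left; apply/eqP; apply: eq_Rintegral => u _; rewrite minC.
set r : R := `|x - y| => rd.
have hd1 := d1; have hed := ed; have he0 := e0; have hd0 := d0.
have rE : r = x - y by rewrite /r ger0_norm// subr_ge0.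
have r0 : 0 <= r by exact: normr_ge0.
have b0 : 0 < r + e by lra.
have c0 : (0 : R) < 1 / 100 by lra.
have rx := rho_gt0 x (ltW e0); have ry := rho_gt0 y (ltW e0).
have ngt := nb_gt0 P.
have q0 : 0 < 2 * n * rho e x by rewrite !mulr_gt0.
have q1 : 0 <= (2 * n * rho e x)^-1 by rewrite invr_ge0 ltW.
have im := itg_min_kk P e0 ed d1 x y.
have a1 : forall u, 0 <= (2 * n * rho e x)^-1 * Num.min (k e x u) (k e y u).
  move=> u; apply: mulr_ge0 => //; by rewrite le_min !kk_ge0 ?(ltW e0).
have a2 : forall u, x <= u <= x + 1 / 100 ->
    (u - x + (r + e))^-1 <= (2 * n * rho e x)^-1 * Num.min (k e x u) (k e y u).
  move=> u /andP[u0 u1].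
  rewrite ler_pdivlMl// le_min; apply/andP; split.
    by apply: (@kk_ge_half e x x u r 0 he); rewrite ?expR0 ?mul1r//; rewrite ger0_norm; clear - u0 u1 rd rE r0 hd1 hed he0; lra.
  by apply: (@kk_ge_half e x y u r r he); rewrite ?rho_loglip ?(ltW e0)//; rewrite ger0_norm; clear - u0 u1 rd rE r0 hd1 hed he0; lra.
have := Rint_inv_ge b0 c0 (itgZ _ im) a1 a2; rewrite RintZ// ler_pdivlMl// => h.
apply: le_trans h.
have hL : ln (1 / 100 / d) - 1 + Lam e d r <= ln ((1 / 100 + (r + e)) / (r + e)).
  by apply: log_gain => //; exact: ltW.
have hr : rho e x + rho e y <= 5 / 2 * rho e x.
  by apply: rho_add_near (ltW e0) _; rewrite -/r; exact: le_trans (ltW rd) d1.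
set L := _ + Lam _ _ _ in hL *.
have L0 : 0 <= ln ((1 / 100 + (r + e)) / (r + e)).
  by apply: ln_ge0; rewrite ler_pdivlMr// [leLHS]mul1r lerDr; exact: ltW.
apply: (@le_trans _ _ (4 / 5 * n * (rho e x + rho e y) * ln ((1 / 100 + (r + e)) / (r + e)))).
  apply: ler_wpM2l hL; apply: mulr_ge0; first by rewrite mulr_ge0.
  by rewrite addr_ge0 ?ltW.
by apply: gain_arith hr; exact: mulr_ge0.
Qed.

End params.
End gap.

Section step.
Context {R : realType}.
Local Notation leb := (@lebesgue_measure R).
Variable P : model R.
Local Notation n := (nb P).
Local Notation G := (Ginf (al P) (me P) (mu_ P)).
Local Notation k := (kk P).
Implicit Types (x y u v w s t r th : R).

Let n0 : 0 <= n. Proof. exact: nb_ge0. Qed.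

Definition drift_cst : R := 21920.

Lemma drift_cst_ge0 : 0 <= drift_cst. Proof. exact: ler0n. Qed.

Lemma drift_Gc e v w : 0 < e <= 1 ->
  \int[leb]_u (k e v u * (G u w - G v w)) <= drift_cst * n * G v w.
Proof. exact: drift_G. Qed.

Opaque drift_cst loss_cst.

Section params.
Context (e d gam th : R).
Hypotheses (e0 : 0 < e) (ed : e <= d) (d1 : d <= 1 / 100) (gam0 : 0 < gam) (gam1 : gam <= 1 / 8).
Hypotheses (hth : 0 <= th <= 1 / 2).
Local Notation G_ := (Gs P e d gam th).
Local Notation B_ := (Bs P e d gam th).

Let he : 0 < e <= 1. Proof. by rewrite e0 (le_trans ed)// (le_trans d1)//; lra. Qed.
Let d0 : 0 < d. Proof. exact: lt_le_trans ed. Qed.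
Let th0 : 0 <= th. Proof. by case/andP: hth. Qed.

Section pair.
Context (m : R -> R) (x y : R).
Hypotheses (mm_ : measurable_fun setT m) (m0 : forall u, 0 <= m u)
  (mx : forall u, m u <= k e x u) (my : forall u, m u <= k e y u).

(** The generator of a coupled pair applied to [G_]: only [x] moves at rate [k x - m], only [y] at
    rate [k y - m], and at rate [m] both jump to [u], where the difference is zero. *)
Definition pair_gain u := (k e x u - m u) * (G_ u y - G_ x y) +
  (k e y u - m u) * (G_ u x - G_ x y) - m u * G_ x y.

Let kx0 u : 0 <= k e x u. Proof. exact: kk_ge0 (ltW e0). Qed.
Let ky0 u : 0 <= k e y u. Proof. exact: kk_ge0 (ltW e0). Qed.
Let ikx := (itg_kk P x he).1.
Let iky := (itg_kk P y he).1.
Let GG u w : 0 <= G_ u w <= G u w.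
Proof. by rewrite Gs_ge0/= Gs_le. Qed.
Let mkx : measurable_fun setT (k e x). Proof. exact: measurable_kk. Qed.
Let mky : measurable_fun setT (k e y). Proof. exact: measurable_kk. Qed.

Lemma itg_m : itg m.
Proof. by apply: itg_le ikx => // u; rewrite ger0_norm. Qed.

Lemma itg_sub_Gs z w : (forall u, 0 <= k e z u - m u) -> measurable_fun setT (k e z) ->
  itg (fun u => (k e z u - m u) * G_ u w).
Proof.
move=> h mk; apply: itg_le (itg_kkG P z w he).
  apply: measurable_funM; first exact: measurable_funB.
  exact: measurable_Gs.
move=> u; have /andP[g0 g1] := GG u w.
rewrite ger0_norm; last exact: mulr_ge0.
by apply: ler_pM => //; rewrite lerBlDr lerDl.
Qed.

Let hx u : 0 <= k e x u - m u. Proof. by rewrite subr_ge0. Qed.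
Let hy u : 0 <= k e y u - m u. Proof. by rewrite subr_ge0. Qed.

Lemma itg_pair_sigma : itg (fun u => k e x u + k e y u - m u).
Proof. apply: itgB; [exact: itgD|exact: itg_m]. Qed.

Lemma itg_pair_target :
  itg (fun u => (k e x u - m u) * G_ u y + (k e y u - m u) * G_ u x).
Proof. by apply: itgD; exact: itg_sub_Gs. Qed.

Lemma pair_gainE u : pair_gain u =
  ((k e x u - m u) * G_ u y + (k e y u - m u) * G_ u x) -
  G_ x y * (k e x u + k e y u - m u).
Proof. by rewrite /pair_gain; ring. Qed.

Lemma itg_pair_gain : itg pair_gain.
Proof.
rewrite (_ : pair_gain = fun u =>
  ((k e x u - m u) * G_ u y + (k e y u - m u) * G_ u x) -
  G_ x y * (k e x u + k e y u - m u)); last by apply/funext => u; exact: pair_gainE.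
apply: itgB; first exact: itg_pair_target.
exact: itgZ itg_pair_sigma.
Qed.

(** The values [phi u] weighted by the common rate [m] cancel. What remains is the old difference
    times [1 - h * sigma], with [sigma] the total rate of the coupled pair, plus [h] times
    differences in which one point has moved. The restriction on [h] makes the first coefficient
    nonnegative, so the bound by [M * G_] can be inserted in every term. *)
Lemma euler_contract (phi : R -> R) (M h : R) : measurable_fun setT phi -> 0 <= M ->
  (forall v w, `|phi v - phi w| <= M * G_ v w) -> 0 <= h -> h * (2 * rate P e) <= 1 ->
  `|(phi x - h * \int[leb]_u (k e x u * (phi x - phi u))) -
    (phi y - h * \int[leb]_u (k e y u * (phi y - phi u)))| <=
  M * (G_ x y + h * \int[leb]_u pair_gain u).
Proof.
move=> mphi M0 hphi h0 hr.
have iA z : measurable_fun setT (k e z) -> (forall u, 0 <= k e z u) ->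
    itg (fun u => k e z u * (phi z - phi u)).
  move=> mk k0; apply: itg_le (itgZ M (itg_kkG P z z he)).
    by apply: measurable_funM => //; exact: measurable_funB.
  move=> u; rewrite normrM ger0_norm//.
  rewrite [leRHS](_ : _ = k e z u * (M * G u z)); last by ring.
  apply: ler_wpM2l => //; rewrite distrC; apply: (le_trans (hphi u z)).
  by apply: ler_wpM2l => //; have /andP[] := GG u z.
have iAx := iA x mkx kx0; have iAy := iA y mky ky0.
pose sg u := k e x u + k e y u - m u.
have isg : itg sg := itg_pair_sigma.
pose D := phi x - phi y.
pose r u := (k e x u - m u) * (phi u - phi y) + (k e y u - m u) * (phi x - phi u).
pose g u := (k e x u - m u) * G_ u y + (k e y u - m u) * G_ u x.
have ig : itg g := itg_pair_target.
have rg u : `|r u| <= M * g u.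
  rewrite /r /g; apply: (le_trans (ler_normD _ _)).
  rewrite !normrM (ger0_norm (hx u)) (ger0_norm (hy u)).
  have := hphi u x; rewrite distrC => h2.
  rewrite mulrDr; apply: lerD; rewrite [leRHS]mulrCA; apply: ler_wpM2l => //.
have ir : itg r.
  apply: itg_le (itgZ M ig) => //.
  by apply: measurable_funD; apply: measurable_funM; exact: measurable_funB.
have hI : \int[leb]_u (k e x u * (phi x - phi u)) - \int[leb]_u (k e y u * (phi y - phi u)) =
    D * \int[leb]_u sg u - \int[leb]_u r u.
  rewrite -RintB// -RintZ// -RintB//; last exact: itgZ.
  by apply: eq_Rintegral => u _; rewrite /sg /r /D; ring.
have hS : \int[leb]_u sg u <= 2 * rate P e.
  have [_ b1] := itg_kk P x he; have [_ b2] := itg_kk P y he.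
  have i0 : 0 <= \int[leb]_u m u by apply: Rintegral_ge0 => u _; exact: m0.
  rewrite /sg RintB; [|exact: itgD|exact: itg_m].
  rewrite RintD; [|exact: ikx|exact: iky].
  apply: (@le_trans _ _ (rate P e + rate P e - 0)).
    by apply: lerB i0; exact: lerD b1 b2.
  by rewrite subr0 mulr2n mulrDl mul1r.
have hs1 : 0 <= 1 - h * \int[leb]_u sg u.
  by rewrite subr_ge0 (le_trans _ hr)// ler_wpM2l.
have hr2 : `|\int[leb]_u r u| <= M * \int[leb]_u g u.
  by rewrite -RintZ//; apply: Rint_norm_le => //; exact: itgZ.
have hg : \int[leb]_u pair_gain u = \int[leb]_u g u - G_ x y * \int[leb]_u sg u.
  rewrite -RintZ// -RintB//; last exact: itgZ.
  by apply: eq_Rintegral => u _; exact: pair_gainE.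
rewrite [X in `|X|](_ : _ = D * (1 - h * \int[leb]_u sg u) + h * \int[leb]_u r u); last first.
  transitivity (D - h * (\int[leb]_u (k e x u * (phi x - phi u)) -
                         \int[leb]_u (k e y u * (phi y - phi u)))); first by rewrite /D; ring.
  by rewrite hI; ring.
rewrite hg; apply: (contract_arith (hphi x y) hs1 h0 hr2).
Qed.
End pair.

Lemma pair_gain_far x y : d <= `|x - y| ->
  \int[leb]_u pair_gain (fun=> 0) x y u <= 2 * drift_cst * n * G_ x y.
Proof.
move=> far; have Gxy : G_ x y = G x y by rewrite /Gs Bs_far// mulr1.
have kx0 u : 0 <= k e x u by exact: kk_ge0 (ltW e0).
have ky0 u : 0 <= k e y u by exact: kk_ge0 (ltW e0).
have iD v w : itg (fun u => k e v u * (G u w - G v w)).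
  have := itgB (itg_kkG P v w he) (itgZ (G v w) (itg_kk P v he).1).
  by apply: eq_ind; congr itg; apply/funext => u; ring.
have ip : itg (pair_gain (fun=> 0) x y) by apply: itg_pair_gain.
apply: (le_trans (Rint_le ip (itgD (iD x y) (iD y x)) _)).
  move=> u; rewrite /pair_gain !subr0 mul0r subr0 Gxy [G y x]G_sym.
  have h1 := Gs_le P e0 ed gam0 u y th0; have h2 := Gs_le P e0 ed gam0 u x th0.
  by apply: lerD; rewrite ler_wpM2l// lerD2r.
rewrite RintD//; have h1 := drift_Gc x y he; have h2 := drift_Gc y x he.
apply: (le_trans (lerD h1 h2)); rewrite Gxy [G y x]G_sym.
by rewrite le_eqVlt; apply/orP; left; apply/eqP; move: drift_cst (G _ _) => c g; ring.
Qed.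

(** The common rate is taken as large as possible, so that after a coupled move at most one of the
    two points jumps alone to any given target. *)
Lemma pair_gain_near x y : x != y -> `|x - y| < d ->
  1 + 2 * loss_cst <= ln (1 / 100 / d) ->
  \int[leb]_u pair_gain (fun u => Num.min (k e x u) (k e y u)) x y u <=
  - ((qq P e x + qq P e y) * Lam e d `|x - y|) * G_ x y.
Proof.
move=> xy near hd.
set m := fun u => Num.min (k e x u) (k e y u).
have kx0 u : 0 <= k e x u by exact: kk_ge0 (ltW e0).
have ky0 u : 0 <= k e y u by exact: kk_ge0 (ltW e0).
have mm_ : measurable_fun setT m by apply: measurable_minr; exact: measurable_kk.
have m0 u : 0 <= m u by rewrite le_min kx0 ky0.
have mx u : m u <= k e x u by rewrite ge_min lexx.
have my u : m u <= k e y u by rewrite ge_min lexx orbT.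
have G0 := Gs_ge0 P e d gam th x y.
have sub a b : a - Num.min a b = Num.max 0 (a - b) :> R.
  by rewrite /Num.min /Num.max; case: ltP => h1; case: ltP => h2; lra.
pose T x y := fun u => Num.max 0 (k e x u - k e y u) * Num.max 0 (G_ u y - G_ x y).
have iT v w : itg (T v w).
  apply: (@itg_kk_Gs _ P e d e0 ed d1 _ v w 1) => //.
    apply: measurable_funM; apply: measurable_maxr => //; apply: measurable_funB => //;
      by [exact: measurable_kk|exact: measurable_Gs].
  move=> u; rewrite mul1r ger0_norm; last by apply: mulr_ge0; rewrite le_max lexx.
  have kv0 := kk_ge0 P v u (ltW e0); have kw0 := kk_ge0 P w u (ltW e0).
  apply: ler_pM; rewrite ?le_max ?lexx// ge_max.
    by rewrite kv0/= gerBl.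
  rewrite G_ge0/=; have := Gs_ge0 P e d gam th v w; have := Gs_le P e0 ed gam0 u w th0; lra.
have ip := itg_pair_gain mm_ m0 mx my.
have im := itg_m mm_ m0 mx.
apply: (le_trans (Rint_le ip (itgB (itgD (iT x y) (iT y x)) (itgZ (G_ x y) im)) _)).
  move=> u; rewrite /pair_gain {1 2}/m sub [Num.min (k e x u) _]minC sub.
  rewrite [m u * _]mulrC lerD2r /T [G_ y x]GsC.
  by apply: lerD; rewrite ler_wpM2l ?le_max ?lexx ?orbT.
have nxy := near; rewrite distrC in nxy.
have yx : y != x by rewrite eq_sym.
rewrite RintB ?RintD ?RintZ//; last 2 first.
- exact: itgD.
- exact: itgZ.
have l1 := loss_integral P e0 ed d1 gam0 gam1 hth xy (ltW near).
have l2 := loss_integral P e0 ed d1 gam0 gam1 hth yx (ltW nxy).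
rewrite [X in _ <= _ * X]GsC in l2.
have g := gain_integral P e0 ed d1 near.
have rx := rho_gt0 x (ltW e0); have ry := rho_gt0 y (ltW e0).
have L0 := Lam_ge0 e d `|x - y|.
exact: (near_arith n0 (ltW rx) (ltW ry) L0 G0 (ltW (@loss_cst_gt0 R)) hd l1 l2 g
  (qq_rho P e0 x) (qq_rho P e0 y)).
Qed.

Definition euler h (phi : R -> R) v :=
  phi v - h * \int[leb]_u (k e v u * (phi v - phi u)).

(** The number [- q * G_] is the derivative of [Gs] in [th], so [1 + t <= exp t] turns the linear
    bound into the weight at [th + h]. Far pairs fit the same formula because [Lam] vanishes
    there. *)
Lemma euler_Gs (phi : R -> R) M h x y : 1 + 2 * loss_cst <= ln (1 / 100 / d) ->
  measurable_fun setT phi -> 0 <= M ->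
  (forall v w, `|phi v - phi w| <= M * G_ v w) -> 0 <= h -> h * (2 * rate P e) <= 1 ->
  `|euler h phi x - euler h phi y| <=
  M * (expR (2 * drift_cst * n * h) * Gs P e d gam (th + h) x y).
Proof.
move=> hd mphi M0 hphi h0 hr.
have [->|xy] := eqVneq x y.
  by rewrite subrr normr0 mulr_ge0// mulr_ge0 ?expR_ge0 ?Gs_ge0.
have kx0 u : 0 <= k e x u by exact: kk_ge0 (ltW e0).
have ky0 u : 0 <= k e y u by exact: kk_ge0 (ltW e0).
set q : R := (qq P e x + qq P e y) * Lam e d `|x - y|.
have G0 := Gs_ge0 P e d gam th x y.
have dn0 : 0 <= 2 * drift_cst * n by rewrite !mulr_ge0 ?drift_cst_ge0.
suff key : `|euler h phi x - euler h phi y| <=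
    M * (G_ x y + h * ((2 * drift_cst * n - q) * G_ x y)).
  apply: (le_trans key); apply: ler_wpM2l => //.
  have -> : expR (2 * drift_cst * n * h) * Gs P e d gam (th + h) x y =
      expR (2 * drift_cst * n * h - h * q) * G_ x y.
    rewrite /Gs /Bs expRD (_ : (th + h) * _ * _ = th * (qq P e x + qq P e y) *
      Lam e d `|x - y| + h * q); last by rewrite /q; ring.
    by rewrite opprD expRD; ring.
  have := ler_wpM2r G0 (expR_ge1Dx (2 * drift_cst * n * h - h * q)).
  apply: le_trans; rewrite le_eqVlt; apply/orP; left; apply/eqP.
  by move: drift_cst (G_ _ _) (q) => c g q'; ring.
have fin (I : R) : I <= (2 * drift_cst * n - q) * G_ x y ->
    M * (G_ x y + h * I) <= M * (G_ x y + h * ((2 * drift_cst * n - q) * G_ x y)).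
  by move=> hI; apply: ler_wpM2l => //; rewrite lerD2l; apply: ler_wpM2l.
have [far|near] := leP d `|x - y|.
  have m00 (u : R) : (0 : R) <= 0 by [].
  have mz : measurable_fun setT (fun _ : R => 0 : R) by exact: measurable_cst.
  have h1 := euler_contract mz m00 kx0 ky0 mphi M0 hphi h0 hr.
  apply: (le_trans h1); apply: fin.
  have q0 : q = 0.
    rewrite /q /Lam max_l ?mulr0// ln_le0// ler_pdivrMr ?mul1r; last first.
      exact: ltr_wpDl (normr_ge0 _) e0.
    by rewrite (le_trans far)// lerDl ltW.
  by rewrite q0 subr0; exact: pair_gain_far.
pose m := fun u => Num.min (k e x u) (k e y u).
have mm_ : measurable_fun setT m by apply: measurable_minr; exact: measurable_kk.
have m0 u : 0 <= m u by rewrite le_min kx0 ky0.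
have mx u : m u <= k e x u by rewrite ge_min lexx.
have my u : m u <= k e y u by rewrite ge_min lexx orbT.
have h1 := euler_contract mm_ m0 mx my mphi M0 hphi h0 hr.
apply: (le_trans h1); apply: fin; apply: (le_trans (pair_gain_near xy near hd)).
by apply: ler_wpM2r => //; rewrite -/q lerDr.
Qed.
End params.
End step.

(** * Semigroups on a seminormed space *)

Section real_induction.
Context {R : realType}.
Implicit Types s h K : R.

(** Continuous induction on the set of [s] with [g 0 s <= (K + e) * s]: left continuity puts its
    supremum in the set, and the bound on right increments pushes it further. No derivative of the
    norm along a path is required. *)
Lemma growth_bound (g : R -> R -> R) (h K : R) : 0 <= h -> 0 <= K ->
  (forall s, g s s = 0) ->
  (forall r s t, g r t <= g r s + g s t) ->
  (forall s, 0 < s <= h -> forall eps : R, 0 < eps ->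
     exists2 r, r < s & forall u, r < u -> 0 <= u <= s -> g u s <= eps) ->
  (forall s, 0 <= s < h -> forall eps : R, 0 < eps ->
     exists2 r, s < r & forall u, s <= u -> u < r -> u <= h -> g s u <= (K + eps) * (u - s)) ->
  g 0 h <= K * h.
Proof.
move=> h0 K0 g0 gt left right.
apply/ler_addgt0Pl => e e0.
suff : g 0 h <= (K + e / (h + 1)) * h.
  move=> /le_trans; apply; rewrite mulrDl addrC lerD2r.
  by rewrite mulrAC ler_pdivrMr ?ltr_wpDl//; nra.
have : 0 < e / (h + 1) by rewrite divr_gt0// ltr_wpDl.
move: (e / (h + 1)) => {e0}{}e e0.
pose A := [set s | 0 <= s <= h /\ g 0 s <= (K + e) * s].
have A0 : A 0 by split; rewrite ?lexx//= g0 mulr0.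
have Ah s : A s -> s <= h by case=> /andP[].
have supA : has_sup A by split; [exists 0|exists h => s /Ah].
set z := sup A.
have z0 : 0 <= z by exact: sup_upper_bound.
have zh : z <= h by apply: sup_le_ub => //; exists 0.
have Az : A z.
  split; first by rewrite z0.
  apply/ler_addgt0Pl => eps eps0.
  move: z0; rewrite le_eqVlt => /predU1P[<-|z0].
    by rewrite g0 mulr0 addr0 ltW.
  have [|r rz hr] := left z _ eps eps0; first by rewrite z0.
  have zr : 0 < z - r by rewrite subr_gt0.
  have [s [/andP[s0 sh] gs] zs] := sup_adherent zr supA.
  have {}zs : r < s by move: zs; rewrite opprB addrC subrK.
  have sz : s <= z by apply: sup_upper_bound => //; split => //; rewrite s0.
  apply: (le_trans (gt 0 s z)).
  rewrite addrC; apply: lerD; first by apply: hr => //; rewrite s0.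
  by apply: (le_trans gs); rewrite ler_wpM2l// addr_ge0// ltW.
move: zh; rewrite le_eqVlt => /predU1P[<-|zh]; first by case: Az.
have [|r zr hr] := right z _ e e0; first by rewrite z0.
pose u := Num.min h ((z + r) / 2).
have zu : z < u by rewrite lt_min zh/= ltr_pdivlMr//; lra.
have ur : u < r by rewrite gt_min; apply/orP; right; rewrite ltr_pdivrMr//; lra.
have uh : u <= h by rewrite ge_min lexx.
have : A u.
  split; first by rewrite uh (le_trans z0 (ltW zu)).
  apply: (le_trans (gt 0 z u)).
  apply: (le_trans (lerD (proj2 Az) (hr u (ltW zu) ur uh))).
  by rewrite -mulrDr [z + _]addrC subrK.
by move/(sup_upper_bound supA); rewrite leNgt zu.
Qed.
End real_induction.

Section seminormed_semigroup.
Context {R : realType} {V : lmodType R}.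
(** The predicate [P] selects the square integrable functions among all functions. Functions equal
    almost everywhere are not identified, so [N] is only a seminorm and the semigroup laws hold up
    to distance 0. *)
Variables (P : V -> Prop) (N : V -> R) (S : R -> V -> V).
Hypothesis PB : forall a x y, P x -> P y -> P (a *: x + y).
Hypothesis P0 : P 0.
Hypothesis N0 : forall x, 0 <= N x.
Hypothesis ND : forall x y, P x -> P y -> N (x + y) <= N x + N y.
Hypothesis NZ : forall a x, P x -> N (a *: x) = `|a| * N x.
Hypothesis complete : forall x : nat -> V, (forall n, P (x n)) ->
  (forall n, N (x n.+1 - x n) <= 4^-1 ^+ n.+1) ->
  exists2 y, P y & forall n, N (y - x n) <= 3^-1 * 4^-1 ^+ n.
Hypothesis SP : forall t x, 0 <= t -> P x -> P (S t x).
Hypothesis Slin : forall t a x y, 0 <= t -> P x -> P y ->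
  N (S t (a *: x + y) - (a *: S t x + S t y)) = 0.
Hypothesis Sbnd : forall t, 0 <= t ->
  exists M, forall x, P x -> N (S t x) <= M * N x.
Hypothesis S0 : forall x, P x -> N (S 0 x - x) = 0.
Hypothesis SD : forall s t x, 0 <= s -> 0 <= t -> P x ->
  N (S (s + t) x - S s (S t x)) = 0.
Hypothesis Scont : forall x, P x -> forall eps, 0 < eps ->
  exists2 d, 0 < d & forall t, 0 < t -> t < d -> N (S t x - x) <= eps.

Let PD x y : P x -> P y -> P (x + y).
Proof. by move=> Px Py; rewrite -[x]scale1r; exact: PB. Qed.

Let PZ a x : P x -> P (a *: x).
Proof. by move=> Px; rewrite -[_ *: _]addr0; exact: PB. Qed.

Let PN x : P x -> P (- x).
Proof. by move=> Px; rewrite -scaleN1r; exact: PZ. Qed.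

Let PBB x y : P x -> P y -> P (x - y).
Proof. by move=> Px Py; apply: PD => //; exact: PN. Qed.

Let NN x : P x -> N (- x) = N x.
Proof. by move=> Px; rewrite -scaleN1r NZ// normrN normr1 mul1r. Qed.

Let NBC x y : P x -> P y -> N (x - y) = N (y - x).
Proof. by move=> Px Py; rewrite -opprB NN//; exact: PBB. Qed.

Let N_dist x y z : P x -> P y -> P z -> N (x - z) <= N (x - y) + N (y - z).
Proof.
move=> Px Py Pz; rewrite [x - z](_ : _ = (x - y) + (y - z)); last by rewrite addrA subrK.
by apply: ND; exact: PBB.
Qed.

Let N_le x y : P x -> P y -> N x <= N y + N (x - y).
Proof.
move=> Px Py; rewrite [in leLHS](_ : x = y + (x - y)); last by rewrite addrC subrK.
by apply: ND => //; exact: PBB.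
Qed.

Let N_sim x y : P x -> P y -> N (x - y) = 0 -> N x = N y.
Proof.
move=> Px Py h; apply/eqP; rewrite eq_le.
by rewrite (le_trans (N_le Px Py)) ?h ?addr0// (le_trans (N_le Py Px))// NBC// h addr0.
Qed.

Let S_lin t a x y w : 0 <= t -> P x -> P y -> P w ->
  N (S t (a *: x + y) + w) = N (a *: S t x + S t y + w).
Proof.
move=> t0 Px Py Pw; apply: N_sim.
- by apply: PD => //; apply: SP => //; exact: PB.
- by apply: PD => //; apply: PB; exact: SP.
- by rewrite opprD addrACA subrr addr0; exact: Slin.
Qed.

Let S_sub t x y : 0 <= t -> P x -> P y -> N (S t x - S t y) = N (S t (x - y)).
Proof.
move=> t0 Px Py.
have := S_lin (-1) t0 Py Px P0.
by rewrite !addr0 !scaleN1r [- y + x]addrC => ->; rewrite addrC.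
Qed.

Lemma semigroup_opnorm t : 0 <= t -> exists L, [/\ 0 <= L,
  forall x, P x -> N (S t x) <= L * N x &
  forall L', L' < L -> exists x, [/\ P x, N x <= 1 & L' < N (S t x)]].
Proof.
move=> t0; have [M hM] := Sbnd t0.
have M0 x : P x -> N x <= 1 -> N (S t x) <= `|M|.
  move=> Px x1; apply: (le_trans (hM _ Px)).
  apply: (le_trans (ler_wpM2r (N0 x) (ler_norm M))).
  by rewrite -[leRHS]mulr1 ler_wpM2l.
pose A := [set r | exists x, [/\ P x, N x <= 1 & r = N (S t x)]].
have N00 : N 0 = 0 by rewrite -(scale0r (0 : V)) NZ// normr0 mul0r.
have supA : has_sup A.
  split; first by exists (N (S t 0)), 0; rewrite N00.
  by exists `|M| => _ [x [Px x1 ->]]; exact: M0.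
have ub x : P x -> N x <= 1 -> N (S t x) <= sup A.
  by move=> Px x1; apply: sup_upper_bound => //; exists x.
exists (sup A); split.
- apply: le_trans (ub _ P0 _); rewrite ?N0//.
  by rewrite N00.
(* A vector of seminorm 0 cannot be normalised, but the bound [Sbnd] already sends it to seminorm
   0. *)
- move=> x Px; have := N0 x; rewrite le_eqVlt => /predU1P[x0|x0].
    by rewrite -x0 mulr0 -(mulr0 M) x0 hM.
  have Pc : P ((N x)^-1 *: x) by exact: PZ.
  have h1 : N ((N x)^-1 *: x) <= 1.
    by rewrite NZ// normfV ger0_norm// mulVf// gt_eqF.
  have h2 := ub _ Pc h1.
  have PS0 := SP t0 P0; have PSx := SP t0 Px.
  have S00 : N (S t 0) = 0.
    by apply/eqP; rewrite eq_le N0 andbT (le_trans (hM _ P0))// N00 mulr0.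
  rewrite -ler_pdivrMr// mulrC.
  have -> : (N x)^-1 * N (S t x) = N ((N x)^-1 *: S t x).
    by rewrite NZ// normfV ger0_norm.
  have := S_lin (N x)^-1 t0 Px P0 (PN PS0).
  rewrite addrK addr0 => <-; apply: (le_trans _ h2).
  have PSc := SP t0 Pc.
  by apply: (le_trans (ND PSc (PN PS0))); rewrite NN// S00 addr0.
- move=> L' hL; have [|_ [x [Px x1 ->]] hx] := @sup_adherent _ A (sup A - L') _ supA.
    by rewrite subr_gt0.
  by exists x; split => //; move: hx; rewrite opprB addrC subrK.
Qed.

(* Sokal's gliding hump: one of the two signs keeps S (t n) large along the series. *)
Lemma semigroup_locally_bounded : exists d M, [/\ 0 < d, 0 <= M &
  forall t x, 0 <= t -> t <= d -> P x -> N (S t x) <= M * N x].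
Proof.
apply: contrapT => hno.
(* A time at most [1/(n+1)] with operator norm [L] at least [8^(n+1)], and a vector of the unit ball
   that almost attains it. The hump built from it will have size [4^-(n+1)]. *)
have bad n : exists tLx : R * R * V, [/\ 0 <= tLx.1.1 /\ tLx.1.1 <= n.+1%:R^-1,
    8 ^+ n.+1 <= tLx.1.2 /\ (forall x, P x -> N (S tLx.1.1 x) <= tLx.1.2 * N x),
    P tLx.2, N tLx.2 <= 1 & 2 / 3 * tLx.1.2 <= N (S tLx.1.1 tLx.2)].
  apply: contrapT => hn; apply: hno.
  exists n.+1%:R^-1, (8 ^+ n.+1); split; rewrite ?invr_gt0 ?exprn_ge0//.
  move=> t x t0 t1 Px; rewrite leNgt; apply/negP => hlt; apply: hn.
  have [L [L0 hL hsup]] := semigroup_opnorm t0.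
  have h8 : 8 ^+ n.+1 <= L.
    rewrite leNgt; apply/negP => hlt'.
    have := lt_le_trans hlt (hL x Px); rewrite ltNge.
    by rewrite (ler_wpM2r (N0 x) (ltW hlt')).
  have Lp : 0 < L by apply: lt_le_trans h8; rewrite exprn_gt0.
  have [|y [Py y1 hy]] := hsup (2 / 3 * L).
    by rewrite -[ltRHS]mul1r ltr_pM2r// ltr_pdivrMr//; lra.
  by exists (t, L, y); split=> //=; exact: ltW.
have /choice[T hT] := bad.
pose q : R := 4^-1.
have q0 : 0 < q by rewrite invr_gt0.
(* Since [S t (x + z) - S t (x - z)] represents [2 S t z], failure of the test for the plus sign
   forces the minus sign to pass it. *)
pose step n x := if 2 / 3 * q ^+ n.+1 * (T n).1.2 <= N (S (T n).1.1 (x + q ^+ n.+1 *: (T n).2))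
  then x + q ^+ n.+1 *: (T n).2 else x - q ^+ n.+1 *: (T n).2.
pose fix xs n := if n is m.+1 then step m (xs m) else 0.
have Pxi n : P (q ^+ n.+1 *: (T n).2) by apply: PZ; case: (hT n).
have Pxs n : P (xs n).
  elim: n => [|n IH] //=; rewrite /step; case: ifP => _; [exact: PD|exact: PBB].
have hxi n : N (q ^+ n.+1 *: (T n).2) <= q ^+ n.+1.
  case: (hT n) => _ _ PT T1 _; have qn := exprn_ge0 n.+1 (ltW q0).
  by rewrite NZ// (ger0_norm qn) -[leRHS]mulr1; apply: ler_wpM2l.
have [n|y Py hy] := complete Pxs.
  rewrite /= /step; case: ifP => _; rewrite addrC addKr; last rewrite NN//; exact: hxi.
have big n : 2 / 3 * q ^+ n.+1 * (T n).1.2 <= N (S (T n).1.1 (xs n.+1)).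
  rewrite /= /step; case: ifPn => //; rewrite -ltNge.
  case: (hT n) => -[t0 _] [L8 hL] PT T1 hbig hlt.
  set t := (T n).1.1 in t0 hL hbig hlt *; set L := (T n).1.2 in L8 hL hbig hlt *.
  set z := q ^+ n.+1 *: (T n).2 in hlt *.
  have Pz : P z by exact: Pxi.
  have Px := Pxs n.
  have P1 : P (xs n + z) by exact: PD.
  have P2 : P (xs n - z) by exact: PBB.
  have e1 : N (S t (2 *: z)) = N (S t (xs n + z - (xs n - z))).
    by congr (N (S t _)); rewrite opprB [xs n + z]addrC addrACA subrr addr0 scaler_nat mulr2n.
  have e2 : N (S t (2 *: z)) <= N (S t (xs n + z)) + N (S t (xs n - z)).
    rewrite e1 -S_sub//; apply: (le_trans (ND (SP t0 P1) (PN (SP t0 P2)))).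
    by rewrite NN//; exact: SP.
  have PSt := SP t0 PT; have PS0 := SP t0 P0.
  have N00 : N 0 = 0 by rewrite -(scale0r (0 : V)) NZ// normr0 mul0r.
  have S00 : N (S t 0) = 0.
    by apply/eqP; rewrite eq_le N0 andbT (le_trans (hL _ P0))// N00 mulr0.
  have P2z : P (S t (2 *: z)) by apply: SP => //; exact: PZ.
  have e3 : 2 * q ^+ n.+1 * N (S t (T n).2) <= N (S t (2 *: z)).
    have -> : 2 * q ^+ n.+1 * N (S t (T n).2) = N ((2 * q ^+ n.+1) *: S t (T n).2).
      by rewrite NZ// ger0_norm// mulr_ge0// exprn_ge0// ltW.
    have := S_lin (2 * q ^+ n.+1) t0 PT P0 (PN PS0).
    have -> : (2 * q ^+ n.+1) *: (T n).2 + 0 = 2 *: z by rewrite addr0 -scalerA.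
    rewrite addrK => <-; apply: (le_trans (ND P2z (PN PS0))).
    by rewrite NN// S00 addr0.
  have e4 : 2 * q ^+ n.+1 * (2 / 3 * L) <= 2 * q ^+ n.+1 * N (S t (T n).2).
    by rewrite ler_wpM2l// mulr_ge0// exprn_ge0// ltW.
  have e5 := le_trans e4 (le_trans e3 e2).
  move: e5 hlt; set X := N _; set Y := N _; set Q := q ^+ n.+1 => e5 hlt.
  by lra.
have [dl dl0 hdl] := Scont Py ltr01.
have q1 n : 8 ^+ n.+1 * q ^+ n.+1 = 2 ^+ n.+1 :> R.
  by rewrite -exprMn /q; congr (_ ^+ _); lra.
(* The later humps add up to at most [4^-(n+1) / 3], half of the 2/3 secured at step [n]; what is
   left is at least [8^(n+1) * 4^-(n+1) / 3]. *)
have lowb n : 2 ^+ n.+1 <= 3 * N (S (T n).1.1 y).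
  case: (hT n) => -[t0 _] [L8 hL] PT T1 _.
  have hb := big n.
  set t := (T n).1.1 in t0 hL hb *; set L := (T n).1.2 in L8 hL hb *.
  have P1 : P (y - xs n.+1) by exact: PBB.
  have h1 := hL _ P1.
  have L0 : 0 <= L by apply: le_trans L8; rewrite exprn_ge0.
  have h2 := le_trans h1 (ler_wpM2l L0 (hy n.+1)).
  have h3 := N_le (SP t0 (Pxs n.+1)) (SP t0 Py).
  rewrite S_sub// in h3.
  have h4 : N (S t (xs n.+1 - y)) = N (S t (y - xs n.+1)).
    by rewrite -S_sub// NBC ?S_sub//; exact: SP.
  rewrite h4 in h3.
  have h5 := ler_wpM2r (exprn_ge0 n.+1 (ltW q0)) L8.
  rewrite q1 in h5; rewrite -/q in h2.
  move: hb h2 h3 h5; set X := N _; set Y := N _; set Z := N _; set Q := q ^+ n.+1.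
  by lra.
have upb n : n.+1%:R^-1 < dl -> N (S (T n).1.1 y) <= N y + 1.
  move=> hn; case: (hT n) => -[t0 t1] _ _ _ _.
  set t := (T n).1.1 in t0 t1 *.
  have PSy := SP t0 Py.
  apply: (le_trans (N_le PSy Py)); rewrite lerD2l.
  move: t0; rewrite le_eqVlt => /predU1P[<-|t0]; first by rewrite S0.
  by apply: hdl => //; exact: le_lt_trans hn.
(* This [n] makes [1/(n+1)] smaller than [dl], where strong continuity at [y] bounds the norm by
   [N y + 1], and at the same time makes [2^(n+1)] exceed [3 * (N y + 1)]. *)
pose n := Num.Def.truncn (dl^-1 + 3 * (N y + 1)).
have hn : dl^-1 + 3 * (N y + 1) < n.+1%:R by exact: truncnS_gt.
have h2n : n.+1%:R <= 2 ^+ n.+1 :> R by rewrite -natrX ler_nat ltnW// ltn_expl.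
have dl1 : 0 < dl^-1 by rewrite invr_gt0.
have := N0 y => Ny0.
have hn1 : n.+1%:R^-1 < dl.
  rewrite -[ltRHS]invrK ltf_pV2 ?posrE ?ltr0n//; lra.
have := lowb n; have := upb n hn1; lra.
Qed.

(* [- a] represents the derivative of [S _ x] at [0]. *)
Definition generates x a := P a /\ forall eps, 0 < eps ->
  exists2 d, 0 < d & forall t, 0 < t -> t < d -> N (t^-1 *: (S t x - x) + a) <= eps.

Section local.
Variables (d M : R).
Hypothesis M0 : 0 <= M.
Hypothesis Mbnd : forall t x, 0 <= t -> t <= d -> P x -> N (S t x) <= M * N x.

(* The path [s |-> S (h - s) (x - s *: b)] joins [S h x] to [x - h *: b]. *)
Lemma semigroup_step x b h eta : 0 <= h <= d -> P x -> P b -> 0 <= eta ->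
  (forall s, 0 <= s <= h -> exists2 a, generates (x - s *: b) a & N (a - b) <= eta) ->
  N (S h x - (x - h *: b)) <= M * eta * h.
Proof.
move=> /andP[h0 hd] Px Pb eta0 hgen.
(* The truncation at [h] keeps the semigroup time nonnegative, so that the path is defined for every
   [s]. *)
pose F s := S (h - Num.min s h) (x - Num.min s h *: b).
have Py s : P (x - s *: b) by apply: PBB => //; exact: PZ.
have hm s : 0 <= h - Num.min s h by rewrite subr_ge0 ge_min lexx orbT.
have PF s : P (F s) by exact: SP.
have Fe s : s <= h -> F s = S (h - s) (x - s *: b) by move=> sh; rewrite /F min_l.
have ME0 : 0 <= M * eta by exact: mulr_ge0.
have M1 : 0 < M + 1 by rewrite ltr_wpDl.
suff : N (F 0 - F h) <= M * eta * h.
  apply: le_trans; rewrite !Fe// subr0 subrr scale0r subr0.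
  have P1 := SP h0 Px; have P2 := SP (lexx 0) (Py h).
  apply: le_trans (N_dist P1 P2 (Py h)) _.
  by rewrite S0// addr0.
apply: (@growth_bound _ (fun r t => N (F r - F t))) => //.
- by move=> s; rewrite subrr -(scale0r (0 : V)) NZ// normr0 mul0r.
- by move=> r s t; exact: N_dist.
- move=> s /andP[s0 sh] eps eps0.
  have e1 : 0 < eps / (2 * (M + 1)) by rewrite divr_gt0// mulr_gt0.
  have [dl dl0 hdl] := Scont (Py s) e1.
  have Nb0 := N0 b; have MNb : 0 < M * N b + 1 by rewrite ltr_wpDl// mulr_ge0.
  have e2 : 0 < eps / (2 * (M + 1)) / (M * N b + 1) by rewrite divr_gt0.
  exists (s - Num.min dl (eps / (2 * (M + 1)) / (M * N b + 1))).
    by rewrite ltrBlDr ltrDl lt_min dl0.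
  move=> u; rewrite ltrBlDr -ltrBlDl lt_min => /andP[u1 u2] /andP[u0].
  rewrite le_eqVlt => /predU1P[->|us].
    by rewrite subrr -(scale0r (0 : V)) NZ// normr0 mul0r ltW.
  set t := s - u in u1 u2 *.
  have t0 : 0 < t by rewrite subr_gt0.
  have td : t <= d by rewrite /t; lra.
  have hs0 : 0 <= h - s by rewrite subr_ge0.
  have uh : u <= h by lra.
  rewrite !Fe// (_ : h - u = (h - s) + t); last by rewrite /t addrA subrK.
  have Pt := SP (ltW t0) (Py u).
  have P1 := SP (addr_ge0 hs0 (ltW t0)) (Py u).
  have P2 := SP hs0 Pt; have P3 := SP hs0 (Py s).
  apply: le_trans (N_dist P1 P2 P3) _.
  rewrite SD ?(ltW t0)// add0r S_sub//.
  have hsd : h - s <= d by lra.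
  apply: le_trans (Mbnd hs0 hsd (PBB Pt (Py s))) _.
  have -> : x - u *: b = t *: b + (x - s *: b).
    by rewrite /t scalerBl [RHS]addrC addrA subrK.
  have PS := SP (ltW t0) (Py s); have PSb := SP (ltW t0) Pb.
  rewrite S_lin ?(ltW t0)//; last exact: PN.
  rewrite -addrA.
  have h1 := ND (PZ t PSb) (PBB PS (Py s)).
  have h2 := hdl t t0 u1.
  have h3 := Mbnd (ltW t0) td Pb.
  rewrite NZ// (ger0_norm (ltW t0)) in h1.
  have h4 : t * (M * N b) <= eps / (2 * (M + 1)).
    have := ltW u2; rewrite ler_pdivlMr// => /(le_trans _); apply.
    by rewrite ler_wpM2l ?(ltW t0)// lerDl.
  have h5 := ler_wpM2l (ltW t0) h3.
  have h6 : N (t *: S t b + (S t (x - s *: b) - (x - s *: b))) <= eps / (M + 1).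
    have -> : eps / (M + 1) = eps / (2 * (M + 1)) + eps / (2 * (M + 1)).
      by field; rewrite gt_eqF.
    by lra.
  apply: le_trans (ler_wpM2l M0 h6) _.
  by rewrite mulrA ler_pdivrMr// mulrDr mulr1 mulrC lerDl ltW.
- move=> s /andP[s0 sh] eps eps0.
  have [|a [Pa ha] hab] := hgen s; first by rewrite s0 ltW.
  have e1 : 0 < eps / (M + 1) by rewrite divr_gt0.
  have [dl dl0 hdl] := ha _ e1.
  exists (s + dl); first by rewrite ltrDl.
  move=> u su ur uh.
  move: su; rewrite le_eqVlt => /predU1P[<-|su].
    by rewrite !subrr mulr0 -(scale0r (0 : V)) NZ// normr0 mul0r.
  set t := u - s; have t0 : 0 < t by rewrite subr_gt0.
  have tdl : t < dl by rewrite /t ltrBlDl.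
  rewrite !Fe ?(ltW sh)// (_ : h - s = (h - u) + t); last by rewrite /t addrA subrK.
  have hu0 : 0 <= h - u by rewrite subr_ge0.
  have Pt := SP (ltW t0) (Py s).
  have P1 := SP (addr_ge0 hu0 (ltW t0)) (Py s).
  have P2 := SP hu0 Pt; have P3 := SP hu0 (Py u).
  apply: le_trans (N_dist P1 P2 P3) _.
  rewrite SD ?(ltW t0)// add0r S_sub//.
  have hud : h - u <= d by lra.
  apply: le_trans (Mbnd hu0 hud (PBB Pt (Py u))) _.
  (* Per unit time, the increment is the error of the difference quotient, which is small because
     [x - s *: b] is in the domain, minus [a - b]. *)
  have e2 : S t (x - s *: b) - (x - u *: b) =
      t *: ((t^-1 *: (S t (x - s *: b) - (x - s *: b)) + a) - (a - b)).
    rewrite [- (a - b)]opprB addrACA subrr addr0 scalerDr scalerA divff ?gt_eqF// scale1r.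
    by rewrite /t scalerBl !opprB -addrA; congr (_ + _); rewrite [RHS]addrC addrA subrK.
  have P4 : P (t^-1 *: (S t (x - s *: b) - (x - s *: b)) + a) by apply: PB => //; exact: PBB.
  have P5 : P (a - b) by exact: PBB.
  rewrite e2 NZ ?(ger0_norm (ltW t0)); last exact: PBB.
  have h1 := ND P4 (PN P5); rewrite NN// in h1.
  have h2 := hdl t t0 tdl.
  have h3 := le_trans h1 (lerD h2 hab).
  rewrite mulrCA mulrC ler_wpM2r ?(ltW t0)//.
  apply: le_trans (ler_wpM2l M0 h3) _.
  rewrite mulrDr addrC lerD2l mulrA ler_pdivrMr// mulrDr mulr1 mulrC lerDl ltW//.
Qed.

(** Telescoping: each one-step defect is carried to the final time by a single operator [S] over a
    time at most [d]. The constant [M] therefore enters squared, once from the step and once from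
    the transport, and not to the power [n]. *)
Lemma semigroup_euler (phi b : nat -> V) n h eta : 0 <= h -> n%:R * h <= d -> 0 <= eta ->
  (forall j, P (phi j)) -> (forall j, P (b j)) ->
  (forall j, phi j.+1 = phi j - h *: b j) ->
  (forall j s, (j < n)%N -> 0 <= s <= h ->
     exists2 a, generates (phi j - s *: b j) a & N (a - b j) <= eta) ->
  N (S (n%:R * h) (phi 0%N) - phi n) <= M ^+ 2 * eta * (n%:R * h).
Proof.
move=> h0 nh eta0 Pp Pb hphi hgen.
suff H m : (m <= n)%N ->
    N (S (n%:R * h) (phi 0%N) - S ((n - m)%:R * h) (phi m)) <= M ^+ 2 * eta * (m%:R * h).
  have := H n (leqnn _); rewrite subnn mul0r => H0.
  have t0 : 0 <= n%:R * h by rewrite mulr_ge0.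
  have P1 := SP t0 (Pp 0%N); have P2 := SP (lexx 0) (Pp n).
  apply: le_trans (N_dist P1 P2 (Pp n)) _.
  by rewrite S0// addr0.
elim: m => [_|m IH mn].
  by rewrite subn0 subrr mul0r mulr0 -(scale0r (0 : V)) NZ// normr0 mul0r.
have t0 k : 0 <= k%:R * h by rewrite mulr_ge0.
have P0' := SP (t0 n) (Pp 0%N).
have P1 := SP (t0 (n - m)%N) (Pp m).
have P2 := SP (t0 (n - m.+1)%N) (Pp m.+1).
apply: le_trans (N_dist P0' P1 P2) _.
rewrite -addn1 natrD mulrDl mul1r mulrDr.
apply: lerD; first by apply: IH; exact: ltnW.
rewrite addn1.
have Ph := SP h0 (Pp m).
have e1 : (n - m)%:R * h = (n - m.+1)%:R * h + h.
  by rewrite -subSS subSn// -addn1 natrD mulrDl mul1r.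
have P3 := SP (t0 (n - m.+1)%N) Ph.
rewrite e1 in P1 *.
apply: le_trans (N_dist P1 P3 P2) _.
rewrite SD// add0r S_sub//.
have hd : h <= d.
  apply: le_trans nh; rewrite -[leLHS]mul1r ler_wpM2r// ler1n.
  exact: leq_trans mn.
apply: le_trans (Mbnd (t0 _) _ (PBB Ph (Pp _))) _.
  apply: le_trans nh; rewrite ler_wpM2r// ler_nat; exact: leq_subr.
rewrite expr2 -!mulrA ler_wpM2l// mulrA hphi.
apply: semigroup_step => //; rewrite ?h0//.
by move=> s hs; exact: hgen.
Qed.
End local.
End seminormed_semigroup.

(** * The space L2(nu) *)

Section nu_integral.
Context {R : realType}.
Local Notation leb := (@lebesgue_measure R).
Local Notation dn := (@nu_density R).
Import HBNNSimple.

Lemma nu_density_gt0 (w : R) : 0 < dn w.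
Proof. by rewrite mulr_gt0 ?expR_gt0// powR_gt0// ln_gt0// ltrDl expR_gt0. Qed.

Lemma nuE (A : set R) : nu A = (\int[leb]_(w in A) (dn w)%:E)%E.
Proof. by []. Qed.

Lemma measurable_EFin_density (D : set (measurableTypeR R)) : measurable_fun D (EFin \o dn).
Proof. by apply: measurable_funTS; apply/measurable_EFinP; exact: measurable_nu_density. Qed.

(** For indicators this is the definition of [nu]; simple functions and monotone convergence do the
    rest. *)
Lemma ge0_integral_nu (f : R -> \bar R) : (forall x, 0 <= f x)%E ->
  measurable_fun setT f ->
  (\int[nu]_x f x = \int[leb]_x (f x * (dn x)%:E))%E.
Proof.
move=> f0 mf; set g := EFin \o dn.
have mg := @measurable_EFin_density setT.
have g0 x : (0 <= g x)%E by rewrite lee_fin nu_density_ge0.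
pose h := nnsfun_approx measurableT mf.
have hx x : (EFin \o h n) x @[n --> \oo] --> f x by exact: cvg_nnsfun_approx.
have ndh x a b : (a <= b)%N -> ((h a x)%:E <= (h b x)%:E)%E.
  by move=> ab; rewrite lee_fin; exact/lefP/nd_nnsfun_approx.
have mh n D : measurable_fun D (EFin \o h n).
  by apply: measurable_funTS; exact/measurable_EFinP.
have -> : (\int[nu]_x f x = lim (\int[nu]_x (EFin \o h n) x @[n --> \oo]))%E.
  under eq_integral => x _ do rewrite -(cvg_lim _ (hx x))//.
  apply: monotone_convergence => //.
    by move=> n x _ /=; rewrite lee_fin.
  by move=> x _ a b ab; exact: ndh.
have -> : (\int[leb]_x (f x * g x) =
    lim (\int[leb]_x ((EFin \o h n) x * g x) @[n --> \oo]))%E.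
  have fg x : (((EFin \o h n) \* g) x @[n --> \oo] --> f x * g x)%E.
    by apply: cvgeZr.
  under eq_integral => x _ do rewrite -(cvg_lim _ (fg x))//.
  apply: monotone_convergence => //.
  - by move=> n; apply: emeasurable_funM; [exact: mh|exact: mg].
  - by move=> n x _ /=; rewrite mule_ge0 ?lee_fin ?nu_density_ge0.
  - move=> x _ a b ab /=; rewrite lee_wpmul2r//.
    exact: ndh.
suff E n : (\int[nu]_x (EFin \o h n) x = \int[leb]_x ((EFin \o h n) x * g x))%E.
  by under eq_fun do rewrite E.
transitivity (\int[nu]_x (\sum_(y \in range (h n)) (y * \1_(h n @^-1` [set y]) x)%:E))%E.
  by apply: eq_integral => t _; rewrite /= fimfunE -fsumEFin.
have indich r : measurable_fun setT (fun x => (r * \1_(h n @^-1` [set r]) x)%:E).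
  exact/measurable_EFinP/measurable_funM.
have mi r : measurable_fun setT (EFin \o \1_(h n @^-1` [set r]) : _ -> \bar R).
  by apply/measurable_EFinP; exact: measurable_indic.
rewrite ge0_integral_fsum//; last by move=> m y _; exact: nnfun_muleindic_ge0.
transitivity (\int[leb]_x (\sum_(y \in range (h n))
    (y * \1_(h n @^-1` [set y]) x)%:E * g x))%E; last first.
  apply: eq_integral => x _.
  rewrite -ge0_mule_fsuml => [|y]; last exact: nnfun_muleindic_ge0.
  by congr (_ * _)%E; rewrite /= [in RHS]fimfunE -fsumEFin.
rewrite ge0_integral_fsum//; last 2 first.
  - by move=> y; apply: emeasurable_funM; [exact: indich|exact: mg].
  - by move=> m y _; rewrite mule_ge0// nnfun_muleindic_ge0.
apply: eq_fsbigr => r rhn.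
have r0 : 0 <= r by move: rhn; rewrite inE => -[t _ <-].
under eq_integral do rewrite EFinM.
rewrite integralZl_indic_nnsfun//.
under [RHS]eq_integral do rewrite EFinM -muleA.
rewrite ge0_integralZl//.
- congr (_ * _)%E; rewrite integral_indic//= setIT nuE.
  rewrite integral_mkcond; apply: eq_integral => x _.
  by rewrite epatch_indic muleC.
- apply: emeasurable_funM; [exact: mi|exact: mg].
- by move=> t _; apply: mule_ge0 => //; rewrite lee_fin.
Qed.

Lemma nu_negligible (A : set R) : nu.-negligible A -> leb.-negligible A.
Proof.
move=> [B [mB B0 AB]]; exists B; split => //.
have mg : measurable_fun B (EFin \o dn) by exact: measurable_EFin_density.
have [+ _] := ae_eq_integral_abs (@lebesgue_measure R : {measure set _ -> \bar R}) mB mg.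
under eq_integral do rewrite /= ger0_norm ?nu_density_ge0//.
rewrite -nuE => /(_ B0) [C [mC C0 BC]].
apply/eqP; rewrite eq_le measure_ge0 andbT -C0.
apply: le_measure; rewrite ?inE//.
by move=> x Bx; apply: BC => /= /(_ Bx) [] /eqP; rewrite gt_eqF// nu_density_gt0.
Qed.

Lemma ae_nu (Q : R -> Prop) : {ae nu, forall x, Q x} -> {ae leb, forall x, Q x}.
Proof. exact: nu_negligible. Qed.

End nu_integral.

Section L2_space.
Context {R : realType}.
Implicit Types (phi psi x y z : R -> R[i]) (c : R[i]).
Local Notation Re := (@complex.Re R).
Local Notation Im := (@complex.Im R).
Local Notation cabs := (@cabs R).

Lemma cabsE (c : R[i]) : cabs c = Num.sqrt (Re c ^+ 2 + Im c ^+ 2).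
Proof. by case: c. Qed.

Lemma cabs_ge0 (c : R[i]) : 0 <= cabs c.
Proof. by rewrite cabsE sqrtr_ge0. Qed.

Lemma cabs_sqr (c : R[i]) : cabs c ^+ 2 = Re c ^+ 2 + Im c ^+ 2.
Proof. by rewrite cabsE sqr_sqrtr// addr_ge0// sqr_ge0. Qed.

Lemma cabsD (c1 c2 : R[i]) : cabs (c1 + c2) <= cabs c1 + cabs c2.
Proof. by rewrite -lecR rmorphD /=; exact: (ler_normD c1 c2). Qed.

Lemma cabsN (c : R[i]) : cabs (- c) = cabs c.
Proof. by case: c => a b; rewrite !cabsE /= !sqrrN. Qed.

Lemma cabsR (r : R) : cabs (r%:C)%C = `|r|.
Proof. by rewrite cabsE /= expr0n addr0 sqrtr_sqr. Qed.

Lemma Re_le_cabs (c : R[i]) : `|Re c| <= cabs c.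
Proof. by rewrite cabsE -sqrtr_sqr ler_wsqrtr// lerDl sqr_ge0. Qed.

Lemma Im_le_cabs (c : R[i]) : `|Im c| <= cabs c.
Proof. by rewrite cabsE -sqrtr_sqr ler_wsqrtr// lerDr sqr_ge0. Qed.

Lemma cabs_le (c : R[i]) : cabs c <= `|Re c| + `|Im c|.
Proof.
rewrite -ler_sqr ?nnegrE ?cabs_ge0 ?addr_ge0// cabs_sqr sqrrD !real_normK ?num_real//.
by rewrite -addrA lerD2l lerDr mulrn_wge0// mulr_ge0.
Qed.

Lemma cabs_eq0 (c : R[i]) : cabs c = 0 -> c = 0.
Proof. exact: ComplexField.Normc.eq0_normc. Qed.

Definition cmeasurable d (T : measurableType d) (f : T -> R[i]) :=
  measurable_fun setT (Re \o f) /\ measurable_fun setT (Im \o f).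

Lemma measurable_cabs d (T : measurableType d) (f : T -> R[i]) :
  cmeasurable f -> measurable_fun setT (cabs \o f).
Proof.
move=> [mr mi].
have -> : cabs \o f = Num.sqrt \o (fun v => Re (f v) ^+ 2 + Im (f v) ^+ 2).
  by apply/funext => v /=; rewrite cabsE.
apply: measurableT_comp; first exact: measurable_sqrt.
by apply: measurable_funD; apply: measurable_funX.
Qed.

Lemma in_L2_measurable psi : in_L2 psi -> cmeasurable psi.
Proof. by case. Qed.

Lemma L2norm_sqr psi :
  (L2norm psi ^+ 2 = \int[nu]_v ((cabs (psi v)) ^+ 2)%:E)%E.
Proof.
rewrite /L2norm unlock.
have -> : (\int[nu]_v `|(EFin \o (cabs \o psi)) v| `^ 2 =
    \int[nu]_v ((cabs (psi v)) ^+ 2)%:E)%E.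
  apply: eq_integral => v _ /=.
  by rewrite ger0_norm ?cabs_ge0// powR_mulrn ?cabs_ge0.
set I := (\int[nu]_v _)%E.
have I0 : (0 <= I)%E by apply: integral_ge0 => v _; rewrite lee_fin sqr_ge0.
rewrite poweR12_sqrt//; case: I I0 => [r r0| |] //=.
by rewrite -EFinM -expr2 sqr_sqrtr.
Qed.

Lemma L2norm_ge0 psi : (0 <= L2norm psi)%E.
Proof. exact: Lnorm_ge0. Qed.

Definition L2n psi : R := fine (L2norm psi).

Lemma L2n_ge0 psi : 0 <= L2n psi.
Proof. by rewrite fine_ge0// L2norm_ge0. Qed.

Lemma L2norm_L2n psi : in_L2 psi -> L2norm psi = (L2n psi)%:E.
Proof.
by case=> _ _ h; rewrite /L2n fineK// ge0_fin_numE ?L2norm_ge0.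
Qed.

Lemma L2n_sqr psi : in_L2 psi ->
  (\int[nu]_v ((cabs (psi v)) ^+ 2)%:E)%E = (L2n psi ^+ 2)%:E.
Proof. by move=> /L2norm_L2n h; rewrite -L2norm_sqr h expr2 EFinM. Qed.

Lemma L2norm_le psi (c : R) : 0 <= c ->
  (\int[nu]_v ((cabs (psi v)) ^+ 2)%:E <= (c ^+ 2)%:E)%E -> (L2norm psi <= c%:E)%E.
Proof.
move=> c0; rewrite -L2norm_sqr; have := L2norm_ge0 psi.
case: (L2norm psi) => [r| |]//=.
by rewrite -EFinM -expr2 !lee_fin => r0; rewrite ler_sqr.
Qed.

Lemma in_L2_le psi (c : R) : cmeasurable psi -> 0 <= c ->
  (\int[nu]_v ((cabs (psi v)) ^+ 2)%:E <= (c ^+ 2)%:E)%E -> in_L2 psi /\ L2n psi <= c.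
Proof.
move=> [mr mi] c0 h; have hc := L2norm_le c0 h.
have hin : in_L2 psi by split => //; apply: le_lt_trans hc _; rewrite ltry.
by split => //; rewrite -lee_fin -L2norm_L2n.
Qed.

Lemma L2norm_dom phi psi : cmeasurable phi -> cmeasurable psi ->
  (forall v, cabs (phi v) <= cabs (psi v)) -> (L2norm phi <= L2norm psi)%E.
Proof.
move=> mphi mpsi h; have := L2norm_ge0 psi.
case E : (L2norm psi) => [r| |]//= r0; last by rewrite leey.
rewrite lee_fin in r0; apply: L2norm_le => //.
have <- : (\int[nu]_v (cabs (psi v) ^+ 2)%:E = (r ^+ 2)%:E)%E.
  by rewrite -L2norm_sqr E expr2 EFinM.
apply: ge0_le_integral => //.
- by move=> v _; rewrite lee_fin sqr_ge0.
- by apply/measurable_EFinP; apply: measurable_funX; exact: measurable_cabs.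
- by apply/measurable_EFinP; apply: measurable_funX; exact: measurable_cabs.
- by move=> v _; rewrite lee_fin ler_sqr ?nnegrE ?cabs_ge0.
Qed.

Lemma in_L2_dom phi psi : cmeasurable phi -> in_L2 psi ->
  (forall v, cabs (phi v) <= cabs (psi v)) -> in_L2 phi /\ L2n phi <= L2n psi.
Proof.
move=> mphi hpsi h.
have h1 := L2norm_dom mphi (in_L2_measurable hpsi) h.
have hin : in_L2 phi.
  by case: mphi => ? ?; split => //; apply: le_lt_trans h1 _; case: hpsi.
by split => //; rewrite -lee_fin -!L2norm_L2n.
Qed.

Lemma cmeasurableD d (T : measurableType d) (f g : T -> R[i]) :
  cmeasurable f -> cmeasurable g -> cmeasurable (fun v => f v + g v).
Proof.
move=> [fr fi] [gr gi]; split.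
- by rewrite (_ : _ \o _ = (Re \o f) \+ (Re \o g)); [exact: measurable_funD|apply/funext => v /=; rewrite raddfD].
- by rewrite (_ : _ \o _ = (Im \o f) \+ (Im \o g)); [exact: measurable_funD|apply/funext => v /=; rewrite raddfD].
Qed.

Lemma cmeasurableZ d (T : measurableType d) (c : R[i]) (f : T -> R[i]) :
  cmeasurable f -> cmeasurable (fun v => c * f v).
Proof.
case: c => a b [fr fi]; split.
- rewrite (_ : _ \o _ = (fun v => a * (Re \o f) v - b * (Im \o f) v)).
    by apply: measurable_funB; apply: measurable_funM.
  by apply/funext => v /=; case: (f v).
- rewrite (_ : _ \o _ = (fun v => a * (Im \o f) v + b * (Re \o f) v)).
    by apply: measurable_funD; apply: measurable_funM.
  by apply/funext => v /=; case: (f v).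
Qed.

Lemma L2normD phi psi : cmeasurable phi -> cmeasurable psi ->
  (L2norm (fun v => phi v + psi v)%R <= L2norm phi + L2norm psi)%E.
Proof.
move=> mphi mpsi.
have m1 := measurable_cabs mphi; have m2 := measurable_cabs mpsi.
have := @minkowski_EFin _ _ _ nu _ _ 2 m1 m2 (ler1n _ 2).
apply: le_trans.
pose g v := ((cabs (phi v) + cabs (psi v))%:C)%C.
have -> : ('N[nu]_2%:E[EFin \o ((cabs \o phi) \+ (cabs \o psi))%R] = L2norm g)%E.
  by apply: eq_Lnorm => v; rewrite /comp /g cabsR ger0_norm// addr_ge0 ?cabs_ge0.
apply: L2norm_dom.
- exact: cmeasurableD.
- split; first exact: measurable_funD.
  rewrite (_ : _ \o _ = cst 0); first exact: measurable_cst.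
  by apply/funext.
- move=> v; rewrite /g cabsR [leRHS]ger0_norm ?addr_ge0 ?cabs_ge0//.
  exact: cabsD.
Qed.

Lemma in_L2D phi psi : in_L2 phi -> in_L2 psi ->
  in_L2 (fun v => phi v + psi v) /\ L2n (fun v => phi v + psi v) <= L2n phi + L2n psi.
Proof.
move=> h1 h2; have m1 := in_L2_measurable h1; have m2 := in_L2_measurable h2.
have hD := L2normD m1 m2; have [mr mi] := cmeasurableD m1 m2.
have hin : in_L2 (fun v => phi v + psi v).
  split => //; apply: le_lt_trans hD _.
  by rewrite (L2norm_L2n h1) (L2norm_L2n h2) -EFinD ltry.
by split => //; rewrite -lee_fin EFinD -!L2norm_L2n.
Qed.

Lemma in_L2Z c phi : in_L2 phi ->
  in_L2 (fun v => c * phi v) /\ L2n (fun v => c * phi v) = cabs c * L2n phi.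
Proof.
move=> h; have [mr mi] := cmeasurableZ c (in_L2_measurable h).
have e : (\int[nu]_v (cabs (c * phi v)%R ^+ 2)%:E = ((cabs c * L2n phi) ^+ 2)%:E)%E.
  under eq_integral do rewrite ComplexField.Normc.normcM exprMn EFinM.
  rewrite ge0_integralZl ?L2n_sqr ?exprMn ?EFinM// ?lee_fin ?sqr_ge0//.
    apply/measurable_EFinP; apply: measurable_funX; apply: measurable_cabs.
    exact: in_L2_measurable.
  by move=> v _; rewrite lee_fin sqr_ge0.
have c0 : 0 <= cabs c * L2n phi by rewrite mulr_ge0 ?cabs_ge0 ?L2n_ge0.
have [|hin _] := @in_L2_le (fun v => c * phi v) _ (conj mr mi) c0.
  by rewrite e.
split => //; have := L2n_sqr hin; rewrite e => -[] /eqP.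
by rewrite eqrXn2 ?L2n_ge0// => /eqP ->.
Qed.

Lemma in_L2_0 : in_L2 (fun _ : R => 0 : R[i]) /\ L2n (fun _ : R => 0 : R[i]) = 0.
Proof.
have m : cmeasurable (fun _ : R => 0 : R[i]) by split; exact: measurable_cst.
have [|hin h] := in_L2_le m (lexx 0).
  by under eq_integral do rewrite cabsE /= expr0n addr0 sqrtr0 expr0n; rewrite integral0 expr0n.
by split => //; apply/eqP; rewrite eq_le h L2n_ge0.
Qed.

Lemma L2n_eq0 psi : in_L2 psi -> (L2n psi = 0 <-> {ae nu, forall v, psi v = 0}).
Proof.
move=> h; have m := measurable_cabs (in_L2_measurable h).
have m2 : measurable_fun setT (fun v => (cabs (psi v) ^+ 2)%:E).
  by apply/measurable_EFinP; exact: measurable_funX.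
have := ae_eq_integral_abs nu measurableT m2.
under eq_integral do rewrite gee0_abs ?lee_fin ?sqr_ge0//.
rewrite L2n_sqr// => -[h1 h2]; split => [h0|hae].
  rewrite h0 expr0n in h1; apply: filterS (h1 erefl) => v /(_ I) /= -[] /eqP.
  by rewrite sqrf_eq0 => /eqP /cabs_eq0.
suff /h2[/eqP] : ae_eq nu setT (fun v => (cabs (psi v) ^+ 2)%:E) (cst 0%E).
  by rewrite sqrf_eq0 => /eqP.
by apply: filterS hae => v /= -> _; rewrite ComplexField.Normc.normc0 expr0n.
Qed.
End L2_space.

Section L2_complete.
Context {R : realType}.
Local Notation Re := (@complex.Re R).
Local Notation Im := (@complex.Im R).
Local Notation cabs := (@cabs R).

(** The series of [4^k |z k|^2] has integral at most the sum of [4^-k], so it is finite almost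
    everywhere, and its value bounds each of its terms. *)
Lemma ae_geometric (z : nat -> R -> R[i]) :
  (forall k, in_L2 (z k)) -> (forall k, L2n (z k) <= 4^-1 ^+ k) ->
  {ae nu, forall v, exists C, forall k, cabs (z k v) <= C * 2^-1 ^+ k}.
Proof.
move=> hz hn.
pose f k v := (4 ^+ k * cabs (z k v) ^+ 2)%:E.
have f0 k v : (0 <= f k v)%E by rewrite lee_fin; apply: mulr_ge0; [exact: exprn_ge0|exact: sqr_ge0].
have mf k : measurable_fun setT (f k).
  apply/measurable_EFinP/measurable_funM => //; apply: measurable_funX.
  by apply: measurable_cabs; exact: in_L2_measurable.
have hI : (\int[nu]_v (\sum_(k <oo) f k v) <= 2%:E)%E.
  rewrite integral_nneseries//.
  have hk k : (\int[nu]_v f k v <= (4^-1 ^+ k)%:E)%E.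
    under eq_integral do rewrite /f EFinM.
    rewrite ge0_integralZl ?lee_fin ?exprn_ge0//; last 2 first.
    - apply/measurable_EFinP; apply: measurable_funX; apply: measurable_cabs.
      exact: in_L2_measurable.
    - by move=> v _; rewrite lee_fin sqr_ge0.
    rewrite L2n_sqr// -EFinM lee_fin.
    have h : L2n (z k) ^+ 2 <= (4^-1 ^+ k) ^+ 2.
      by rewrite ler_sqr ?nnegrE ?L2n_ge0 ?exprn_ge0 ?invr_ge0.
    apply: le_trans (ler_wpM2l _ h) _; first by rewrite exprn_ge0.
    by rewrite expr2 mulrA -exprMn mulfV// expr1n mul1r.
  have hg n : \sum_(0 <= k < n) 4^-1 ^+ k = 4 / 3 * (1 - 4^-1 ^+ n) :> R.
    elim: n => [|n IH]; first by rewrite big_nil expr0 subrr mulr0.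
    by rewrite big_nat_recr//= IH exprS; field.
  apply: lime_le; first by apply: is_cvg_nneseries => k _ _; exact: integral_ge0.
  apply: nearW => n.
  apply: (@le_trans _ _ (\sum_(0 <= k < n) (4^-1 ^+ k)%:E)%E).
    by apply: lee_sum => k _; exact: hk.
  rewrite sumEFin lee_fin hg.
  have : 0 <= 4^-1 ^+ n :> R by rewrite exprn_ge0// invr_ge0.
  by set q : R := _ ^+ n; lra.
have F0 v : (0 <= \sum_(k <oo) f k v)%E by apply: nneseries_ge0.
have iF : nu.-integrable setT (fun v => (\sum_(k <oo) f k v)%E).
  apply/integrableP; split.
    by apply: ge0_emeasurable_sum => // k v _ _; exact: f0.
  under eq_integral do rewrite gee0_abs//.
  by apply: le_lt_trans hI _; rewrite ltry.
have := integrable_ae measurableT iF.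
apply: filterS => v /(_ I) /fineK.
set r := fine _ => hr; exists (Num.sqrt r) => k.
have h1 : (f k v <= r%:E)%E.
  rewrite hr; apply: le_trans (nneseries_lim_ge k.+1 _) => //.
  rewrite big_nat_recr//= leeDr// sume_ge0//.
rewrite /f lee_fin in h1.
have c0 := cabs_ge0 (z k v).
rewrite exprVn ler_pdivlMr ?exprn_gt0//.
have p0 : 0 <= cabs (z k v) * 2 ^+ k by rewrite mulr_ge0// exprn_ge0.
rewrite -(ger0_norm p0) -sqrtr_sqr ler_wsqrtr//.
apply: le_trans h1; rewrite exprMn mulrC ler_wpM2r ?sqr_ge0//.
by rewrite -exprM mulnC exprM (_ : 2 ^+ 2 = 4 :> R)//; ring.
Qed.


Lemma cvgn_geometric_steps (u : nat -> R) (C : R) :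
  (forall k, `|u k.+1 - u k| <= C * 2^-1 ^+ k) -> cvgn u.
Proof.
move=> h.
have hs : cvgn (series (telescope u)).
  apply: normed_cvg; apply: (@series_le_cvg _ _ (geometric C 2^-1)).
  - by move=> n; exact: normr_ge0.
  - by move=> n; rewrite /geometric /=; exact: le_trans (normr_ge0 _) (h n).
  - by move=> n; exact: h.
  - by apply: is_cvg_geometric_series; rewrite ger0_norm ?invr_ge0// invf_lt1// ltr1n.
have -> : u = (fun n => u 0%N + series (telescope u) n).
  by apply/funext => n; exact: eq_sum_telescope.
by apply: is_cvgD => //; exact: is_cvg_cst.
Qed.

Lemma cvg_cabs (u : nat -> R[i]) (y : R[i]) (c : R[i]) :
  Re (u n) @[n --> \oo] --> Re y -> Im (u n) @[n --> \oo] --> Im y ->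
  cabs (u n - c) ^+ 2 @[n --> \oo] --> cabs (y - c) ^+ 2.
Proof.
move=> hr hi; rewrite cabs_sqr.
under eq_fun do rewrite cabs_sqr.
apply: cvgD; apply: cvgM; rewrite raddfB; under eq_fun do rewrite raddfB;
  by apply: cvgB => //; exact: cvg_cst.
Qed.

(** Riesz-Fischer. The candidate is a pointwise upper limit, measurable even where the sequence
    diverges, and Fatou's lemma bounds its distance to [x n] by the sum of the later steps,
    [4^-n / 3]. *)
Lemma L2_complete (x : nat -> R -> R[i]) : (forall n, in_L2 (x n)) ->
  (forall n, L2n (fun v => x n.+1 v - x n v) <= 4^-1 ^+ n.+1) ->
  exists2 y, in_L2 y & forall n, L2n (fun v => y v - x n v) <= 3^-1 * 4^-1 ^+ n.
Proof.
move=> hx hs.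
have hB (f g : R -> R[i]) : in_L2 f -> in_L2 g -> in_L2 (fun v => f v - g v).
  move=> hf hg; have [h _] := in_L2Z (-1) hg; have [h' _] := in_L2D hf h.
  by rewrite (_ : (fun v => _) = (fun v => f v + -1 * g v))//; apply/funext => v; rewrite mulN1r.
pose y v : R[i] := (fine (limn_esup (fun n => (Re (x n v))%:E)) +i*
  fine (limn_esup (fun n => (Im (x n v))%:E)))%C.
have my : cmeasurable y.
  by split; apply: measurableT_comp => //; apply: measurable_fun_limn_esup => n;
    apply/measurable_EFinP; have [] := in_L2_measurable (hx n).
have ae := @ae_geometric (fun k v => x k.+1 v - x k v) (fun k => hB _ _ (hx k.+1) (hx k)).
have {ae} : {ae nu, forall v, Re (x n v) @[n --> \oo] --> Re (y v) /\
    Im (x n v) @[n --> \oo] --> Im (y v)}.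
  have /ae : forall k, L2n (fun v => x k.+1 v - x k v) <= 4^-1 ^+ k.
    move=> k; apply: le_trans (hs k) _; by rewrite exprS ler_piMl// invf_le1// ler1n.
  apply: filterS => v [C hC].
  have hlim (u : nat -> R) : (forall k, `|u k.+1 - u k| <= C * 2^-1 ^+ k) ->
      u n @[n --> \oo] --> fine (limn_esup (fun n => (u n)%:E)).
    move=> /cvgn_geometric_steps cu.
    suff -> : limn_esup (fun n => (u n)%:E) = (limn u)%:E by [].
    have cE : ((u n)%:E @[n --> \oo] --> (limn u)%:E)%E by apply: cvg_EFin => //; exact: nearW.
    rewrite is_cvg_limn_esupE; last by apply/cvg_ex; eexists; exact: cE.
    exact/cvg_lim.
  split; apply: hlim => k; apply: le_trans (hC k); rewrite -raddfB.
    exact: Re_le_cabs.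
  exact: Im_le_cabs.
move=> hae.
have hstep n m : L2n (fun v => x (m + n)%N v - x n v) <= 3^-1 * 4^-1 ^+ n * (1 - 4^-1 ^+ m).
  elim: m => [|m IH].
    rewrite expr0 subrr mulr0 add0n (_ : (fun v => _) = (fun _ => 0)) ?in_L2_0.2//.
    by apply/funext => v; rewrite subrr.
  have [_ h] := in_L2D (hB _ _ (hx (m + n).+1) (hx (m + n)%N)) (hB _ _ (hx (m + n)%N) (hx n)).
  rewrite addSn (_ : (fun v => _) = (fun v => x (m + n).+1 v - x (m + n)%N v + (x (m + n)%N v - x n v))); last first.
    by apply/funext => v; rewrite addrA subrK.
  apply: le_trans h _; apply: le_trans (lerD (hs _) IH) _.
  rewrite !exprS exprD; set a : R := _ ^+ m; set b : R := _ ^+ n.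
  by rewrite le_eqVlt; apply/orP; left; apply/eqP; field.
have hstep' n m : L2n (fun v => x (m + n)%N v - x n v) <= 3^-1 * 4^-1 ^+ n.
  apply: le_trans (hstep n m) _; by rewrite ler_piMr// lerBlDr lerDl exprn_ge0// invr_ge0.
have mcab n m : measurable_fun setT (fun v => (cabs (x (m + n)%N v - x n v) ^+ 2)%:E).
  apply/measurable_EFinP; apply: measurable_funX; apply: measurable_cabs.
  by apply: in_L2_measurable; exact: hB.
have key n : (\int[nu]_v ((cabs (y v - x n v)) ^+ 2)%:E <= ((3^-1 * 4^-1 ^+ n) ^+ 2)%:E)%E.
  have -> : (\int[nu]_v ((cabs (y v - x n v)) ^+ 2)%:E =
      \int[nu]_v limn_einf (fun m => (cabs (x (m + n)%N v - x n v) ^+ 2)%:E))%E.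
    apply: ge0_ae_eq_integral => //.
    - apply/measurable_EFinP; apply: measurable_funX; apply: measurable_cabs.
      have h1 := cmeasurableZ (-1) (in_L2_measurable (hx n)).
      rewrite (_ : (fun v => _) = (fun v => y v + -1 * x n v)); first exact: cmeasurableD.
      by apply/funext => v; rewrite mulN1r.
    - rewrite /limn_einf; apply: measurableT_comp => //.
      apply: measurable_fun_limn_esup => m.
      by apply: measurableT_comp => //; exact: mcab.
    - by move=> v _; rewrite lee_fin sqr_ge0.
    - move=> v _; rewrite limn_einf_lim; apply: lime_ge; first exact: is_cvg_einfs.
      by apply: nearW => m; apply: le_ereal_inf_tmp => _ [k _ <-]; rewrite lee_fin sqr_ge0.
    - apply: filterS hae => v [hr hi] _; apply/esym.
      have hc : ((cabs (x (m + n)%N v - x n v) ^+ 2)%:E @[m --> \oo] -->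
          (cabs (y v - x n v) ^+ 2)%:E)%E.
        apply: cvg_EFin; first exact: nearW.
        apply: (@cvg_cabs (fun m => x (m + n)%N v)).
          by move: hr; rewrite -(cvg_shiftn n).
        by move: hi; rewrite -(cvg_shiftn n).
      rewrite is_cvg_limn_einfE; last by apply/cvg_ex; eexists; exact: hc.
      exact/cvg_lim.
  apply: le_trans (fatou _ _ _ _) _ => //.
    by move=> m v _; rewrite lee_fin sqr_ge0.
  rewrite limn_einf_lim; apply: lime_le; first exact: is_cvg_einfs.
  apply: nearW => m; apply: (@le_trans _ _ (\int[nu]_v (cabs (x (m + n)%N v - x n v) ^+ 2)%:E)%E).
    by apply: ereal_inf_lbound; exists m => //=.
  rewrite L2n_sqr; last exact: hB.
  by rewrite lee_fin ler_sqr ?nnegrE ?L2n_ge0// (le_trans (L2n_ge0 _) (hstep' n m)).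
have c0 n : 0 <= 3^-1 * 4^-1 ^+ n :> R.
  by rewrite mulr_ge0 ?invr_ge0// exprn_ge0// invr_ge0.
have hy n : in_L2 (fun v => y v - x n v) /\ L2n (fun v => y v - x n v) <= 3^-1 * 4^-1 ^+ n.
  apply: in_L2_le => //.
  have h1 := cmeasurableZ (-1) (in_L2_measurable (hx n)).
  rewrite (_ : (fun v => _) = (fun v => y v + -1 * x n v)); first exact: cmeasurableD.
  by apply/funext => v; rewrite mulN1r.
exists y; last by move=> n; have [] := hy n.
have [h _] := in_L2D (hy 0%N).1 (hx 0%N).
by rewrite (_ : y = (fun v => y v - x 0%N v + x 0%N v))//; apply/funext => v; rewrite subrK.
Qed.
End L2_complete.

(** * Consistency of the regularisation *)

Section consistency.
Context {R : realType}.
Local Notation leb := (@lebesgue_measure R).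
Variable P : model R.
Local Notation n := (nb P).
Local Notation G := (Ginf (al P) (me P) (mu_ P)).
Local Notation k := (kk P).
Implicit Types (s e g v u y r d : R).

(* Used to trade the factor [e * rho 0 v], unbounded as [v] tends to [-oo], for a small
   power of [e] times a weight that is still in [L^2(nu)]. *)
Lemma min1_le_powR y r : 0 <= y -> 0 <= r <= 1 -> Num.min 1 y <= y `^ r.
Proof.
move=> y0 /andP[r0 r1]; have [y1|y1] := leP 1 y.
  apply: (@le_trans _ _ (1 `^ r)); first by rewrite powR1.
  by apply: ge0_ler_powR; rewrite ?nnegrE.
move: y0; rewrite le_eqVlt => /predU1P[<-|y0]; first exact: powR_ge0.
by rewrite -{1}[y]powRr1 ?(ltW y0)//; apply: ger_powR; rewrite ?y0 ?(ltW y1).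
Qed.

Lemma cube_expRN_le s : 0 <= s -> (1 + s) ^+ 3 * expR (- (s / 10)) <= 30 ^+ 3.
Proof.
move=> s0.
have h : 1 + s <= 30 * expR (s / 30) by have := expR_ge1Dx (s / 30); lra.
have h3 : (1 + s) ^+ 3 <= (30 * expR (s / 30)) ^+ 3.
  by apply: lerXn2r; rewrite ?nnegrE; [lra|rewrite mulr_ge0 ?expR_ge0|].
apply: le_trans (ler_wpM2r (expR_ge0 _) h3) _.
rewrite exprMn -expRM_natl -mulrA -expRD.
by rewrite (_ : _ + _ = 0) ?expR0 ?mulr1//; field.
Qed.

Section scalar.
Variables (d g : R).
Hypothesis d01 : 0 < d <= 1.
Hypothesis g01 : 0 < g <= 1.

Let d0 : 0 < d. Proof. by case/andP: d01. Qed.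
Let g0 : 0 < g. Proof. by case/andP: g01. Qed.

Let p s := s / (1 + s).

Let p_gt0 s : 0 < s -> 0 < p s.
Proof. by move=> s0; rewrite divr_gt0//; lra. Qed.

Let p_le s : 0 < s -> p s <= 1 /\ p s <= s.
Proof.
move=> s0; have s1 : 0 < 1 + s by lra.
by split; rewrite /p ler_pdivrMr//; nra.
Qed.

Let hh_p s : 0 < s -> (1 + s^-1) * hh d g s <= 2 / d * p s `^ (g - 1).
Proof.
move=> s0; have p0 := p_gt0 s0; have [p1 ps] := p_le s0.
have e1 : 1 + s^-1 = (p s)^-1.
  by rewrite /p invf_div mulrDl mul1r mulfV ?gt_eqF// addrC.
have d1 : d <= 1 by case/andP: d01.
have h1 : Num.min 1 (s / d) <= 2 / d * p s.
  have [s1|s1] := leP s 1.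
    rewrite ge_min; apply/orP; right.
    rewrite mulrAC ler_pM2r ?invr_gt0// /p mulrA ler_pdivlMr; last lra.
    by nra.
  rewrite ge_min; apply/orP; left.
  rewrite /p mulrA ler_pdivlMr; last lra.
  have : 1 <= d^-1 by rewrite invf_ge1.
  by nra.
have m0 : 0 <= Num.min 1 (s / d) by rewrite le_min ler01 divr_ge0// ltW.
have h2 : hh d g s <= (2 / d) `^ g * p s `^ g.
  have c0 : 0 <= 2 / d by rewrite divr_ge0// ltW.
  rewrite -powRM// ?(ltW p0)// /hh; apply: ge0_ler_powR; rewrite ?nnegrE ?(ltW g0)//.
  by rewrite mulr_ge0// ltW.
have h3 : (2 / d) `^ g <= 2 / d.
  have c1 : 1 <= 2 / d by rewrite ler_pdivlMr// mul1r; lra.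
  rewrite -[leRHS]powRr1 ?(le_trans ler01)//; apply: ler_powR => //.
  by case/andP: g01.
have h4 := le_trans h2 (ler_wpM2r (powR_ge0 (p s) g) h3).
rewrite e1; apply: le_trans (ler_wpM2l _ h4) _; first by rewrite invr_ge0 ltW.
rewrite mulrCA; apply: ler_wpM2l; first by rewrite divr_ge0// ltW.
rewrite powRD; last by rewrite (gt_eqF p0) implybT.
by rewrite powR_inv1 ?(ltW p0)// mulrC.
Qed.

Let p_g s : 0 < s -> p s `^ (g - 1) <= p s `^ (g / 2 - 1).
Proof.
move=> s0; have [p1 _] := p_le s0.
apply: ger_powR; first by rewrite p_gt0.
by have := g0; lra.
Qed.

Let p_e s e : 0 < s -> 0 < e -> e / (s + e) * p s `^ (g - 1) <= e `^ (g / 2) * p s `^ (g / 2 - 1).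
Proof.
move=> s0 e0; have p0 := p_gt0 s0; have [p1 ps] := p_le s0.
have -> : p s `^ (g / 2 - 1) = p s `^ (- (g / 2)) * p s `^ (g - 1).
  rewrite -powRD; last by rewrite (gt_eqF p0) implybT.
  by congr (_ `^ _); field.
rewrite mulrA; apply: ler_wpM2r; first exact: powR_ge0.
have -> : e `^ (g / 2) * p s `^ (- (g / 2)) = (e / p s) `^ (g / 2).
  have pne : p s != 0 by rewrite gt_eqF.
  have q0 : 0 <= e / p s by rewrite divr_ge0// ltW.
  by rewrite -{1}[e](divfK pne) (powRM _ q0 (ltW p0)) powRN mulfK// gt_eqF// powR_gt0.
have se : 0 < s + e by exact: addr_gt0.
have h : e / (s + e) <= Num.min 1 (e / p s).
  rewrite le_min ler_pdivrMr// mul1r lerDr (ltW s0)/=.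
  rewrite ler_pM2l// lef_pV2 ?posrE//; lra.
apply: le_trans h _; apply: min1_le_powR; first by rewrite divr_ge0// ltW.
by case/andP: g01 => ? ?; apply/andP; split; lra.
Qed.

Definition sing_cst : R := 2 / d * 30 ^+ 3.

Lemma sing_cst_ge0 : 0 <= sing_cst.
Proof. by rewrite mulr_ge0 ?exprn_ge0// divr_ge0// ltW. Qed.

Let pe s : 0 < s -> p s `^ (g / 2 - 1) = powint (g / 2) s * (1 + s) ^+ 2.
Proof.
move=> s0; rewrite /powint divfK//.
by rewrite expf_neq0// gt_eqF//; lra.
Qed.

Lemma sing_le s : 0 < s ->
  (1 + s^-1) * expR (- (s / 10)) * hh d g s <= sing_cst * powint (g / 2) s.
Proof.
move=> s0; rewrite mulrAC.
apply: le_trans (ler_wpM2r (expR_ge0 _) (hh_p s0)) _.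
have c0 : 0 <= 2 / d by rewrite divr_ge0// ltW.
apply: le_trans (ler_wpM2r (expR_ge0 _) (ler_wpM2l c0 (p_g s0))) _.
rewrite pe// /sing_cst; have P0 := powint_ge0 (g / 2) s.
set w : R := powint _ _ in P0 *.
have h : (1 + s) ^+ 2 * expR (- (s / 10)) <= 30 ^+ 3.
  apply: le_trans (cube_expRN_le (ltW s0)); apply: ler_wpM2r; first exact: expR_ge0.
  by apply: ler_weXn2l; rewrite ?lerDl ?(ltW s0).
have h2 := ler_wpM2l (mulr_ge0 c0 P0) h.
rewrite [leLHS](_ : _ = 2 / d * w * ((1 + s) ^+ 2 * expR (- (s / 10)))); last by ring.
by apply: le_trans h2 _; rewrite mulrAC.
Qed.

(** The Hölder exponent is split in two. One half keeps the singularity at 0 integrable, the other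
    trades [e / (s + e)] for [e ^ (g/2)]. The factors [1 + s] are absorbed by [exp(-s/10)]. *)
Lemma sing_consistent_le s e : 0 < s -> 0 < e <= 1 ->
  (1 + s^-1) * expR (- (s / 10)) * hh d g s * (e * (1 + s) + e / (s + e)) <=
  2 * e `^ (g / 2) * (sing_cst * powint (g / 2) s).
Proof.
move=> s0 /andP[e0 e1].
have t0 : 0 <= e * (1 + s) + e / (s + e).
  by rewrite addr_ge0 ?mulr_ge0 ?invr_ge0 ?addr_ge0// ltW.
have s1 : 1 <= 1 + s by rewrite lerDl ltW.
rewrite [leLHS](_ : _ = (1 + s^-1) * hh d g s * (expR (- (s / 10)) * (e * (1 + s) + e / (s + e)))); last by ring.
have c0 : 0 <= 2 / d by rewrite divr_ge0// ltW.
have q0 : 0 <= expR (- (s / 10)) * (e * (1 + s) + e / (s + e)) by rewrite mulr_ge0 ?expR_ge0.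
apply: le_trans (ler_wpM2r q0 (hh_p s0)) _.
have ee : e <= e `^ (g / 2).
  rewrite -{1}[e]powRr1 ?(ltW e0)//; apply: ger_powR; rewrite ?e0//.
  by case/andP: g01 => ? ?; lra.
have E0 := powR_ge0 e (g / 2); have p0 := powR_ge0 (p s) (g / 2 - 1).
have h1 : p s `^ (g - 1) * (e * (1 + s) + e / (s + e)) <=
    2 * e `^ (g / 2) * p s `^ (g / 2 - 1) * (1 + s).
  have a1 := p_g s0; have a2 := p_e s0 e0.
  have b1 : p s `^ (g - 1) * (e * (1 + s)) <= p s `^ (g / 2 - 1) * (e `^ (g / 2) * (1 + s)).
    apply: ler_pM => //; first exact: powR_ge0.
      by apply: mulr_ge0; [exact: ltW|exact: le_trans s1].
    by apply: ler_wpM2r; [exact: le_trans s1|].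
  have b2 : e `^ (g / 2) * p s `^ (g / 2 - 1) <= e `^ (g / 2) * p s `^ (g / 2 - 1) * (1 + s).
    by rewrite ler_peMr// mulr_ge0.
  rewrite mulrDr [X in _ + X]mulrC.
  apply: le_trans (lerD b1 (le_trans a2 b2)) _.
  by rewrite le_eqVlt; apply/orP; left; apply/eqP; ring.
have c1 : 0 <= 2 / d * expR (- (s / 10)) by rewrite mulr_ge0 ?expR_ge0.
have h2 := ler_wpM2l c1 h1.
rewrite [leLHS](_ : _ = 2 / d * expR (- (s / 10)) * (p s `^ (g - 1) * (e * (1 + s) + e / (s + e)))); last by ring.
apply: le_trans h2 _; rewrite pe// /sing_cst.
have h3 := cube_expRN_le (ltW s0).
have c2 : 0 <= 2 / d * (2 * e `^ (g / 2)) * powint (g / 2) s.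
  apply: mulr_ge0; last exact: powint_ge0.
  by apply: mulr_ge0 => //; exact: mulr_ge0.
have P0 := powint_ge0 (g / 2) s; set w : R := powint (g / 2) s in c2 P0 *.
have h4 := ler_wpM2l c2 h3.
rewrite [leLHS](_ : _ = 2 / d * (2 * e `^ (g / 2)) * w * ((1 + s) ^+ 3 * expR (- (s / 10)))); last by rewrite exprS; ring.
by apply: le_trans h4 _; rewrite le_eqVlt; apply/orP; left; apply/eqP; ring.
Qed.
End scalar.

(** The relative error has two sources: [e * (1 + s)] from exponential factors and [e / (s + e)]
    from the shift of the singularity. *)
Lemma bose_jr e s : 0 <= e -> 0 < s -> bose s - jr e s <= bose s * (e * (1 + s) + e / (s + e)).
Proof.
move=> e0 s0; have se : 0 < s + e by rewrite ltr_pwDl.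
have h1 := bose_shift s0 e0.
have h2 := expRN_ge_sub (e * s + e).
have B0 := bose_gt0 s0.
have -> : e / (s + e) = 1 - s / (s + e) by field; rewrite gt_eqF.
set q : R := s / (s + e); have q1 : 0 <= q <= 1.
  by rewrite /q divr_ge0 ?(ltW s0) ?(ltW se)// ler_pdivrMr// mul1r lerDl.
have h3 : expR (- (e * s)) * (expR (- e) * q * bose s) <= jr e s.
  by apply: ler_wpM2l => //; exact: expR_ge0.
have h4 : expR (- (e * s + e)) * (q * bose s) <= jr e s.
  by apply: le_trans h3; rewrite opprD expRD; rewrite le_eqVlt; apply/orP; left; apply/eqP; ring.
have qB : 0 <= q * bose s by case/andP: q1 => ? _; rewrite mulr_ge0// ltW.
have h5 := ler_wpM2r qB h2.
have q1' : 0 <= 1 - q by case/andP: q1 => _; rewrite subr_ge0.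
have z0 : 0 <= e * (1 + s) by rewrite mulr_ge0// addr_ge0// ltW.
have h6 : 0 <= e * (1 + s) * (1 - q) * bose s by apply: mulr_ge0; [exact: mulr_ge0|exact: ltW].
have {h5}h5 := le_trans h5 h4.
move: h5 h6; set J : R := jr e s; set B : R := bose s.
by move=> h5 h6; lra.
Qed.

Section kernel_difference.
Variables (d g e : R).
Hypothesis d01 : 0 < d <= 1.
Hypothesis g01 : 0 < g <= 1.

(** The exponential stands for [rho ^ (1/8)]: the relative error [e * rho e v] is at most
    [(e * rho 0 v) ^ (1/8)], and [rho 0 v] is at most [2 exp(max(0, -v) / 2)]. *)
Definition tail_weight v := rho 0 v * expR (Num.max 0 (- v) / 16) * G v v.

Lemma tail_weight_ge0 v : 0 <= tail_weight v.
Proof. by apply: mulr_ge0; [apply: mulr_ge0; [exact: ltW (rho_gt0 _ (lexx 0))|exact: expR_ge0]|exact: G_ge0]. Qed.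

Lemma rho_G_le v : rho 0 v * G v v <= tail_weight v.
Proof.
apply: ler_wpM2r; first exact: G_ge0.
by rewrite ler_peMr ?(ltW (rho_gt0 _ _))// -expR0 ler_expR divr_ge0// le_max lexx.
Qed.

Definition kk_cst : R := 4 * n * (45 * sing_cst d).

Lemma kk_cst_ge0 : 0 <= kk_cst.
Proof.
have n0 := nb_ge0 P; have s0 := sing_cst_ge0 d01.
by rewrite /kk_cst; apply: mulr_ge0; apply: mulr_ge0.
Qed.

Let sym_mm v u c : u != v -> 0 <= c ->
  mm v u * bose `|u - v| * G v u * c <=
  45 * G v v * ((1 + `|u - v|^-1) * expR (- (`|u - v| / 10)) * c).
Proof.
move=> uv c0.
have h := mm_bose_Ginf (al_bnd P) (me_bnd P) (mu_bnd P) uv.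
rewrite [G v u]G_sym; apply: le_trans (ler_wpM2r c0 h) _.
by rewrite le_eqVlt; apply/orP; left; apply/eqP; ring.
Qed.

Lemma kk0_hh_le v u : 
  k 0 v u * (G v u * hh d g `|u - v|) <=
  kk_cst * (rho 0 v * G v v) * powint (g / 2) `|u - v|.
Proof.
have n0 := nb_ge0 P.
have r0 : 0 <= rho 0 v by exact: ltW (rho_gt0 _ (lexx 0)).
have C0 : 0 <= kk_cst * (rho 0 v * G v v) * powint (g / 2) `|u - v|.
  apply: mulr_ge0; last exact: powint_ge0.
  by apply: mulr_ge0; [exact: kk_cst_ge0|apply: mulr_ge0 => //; exact: G_ge0].
have [uv|uv] := eqVneq u v.
  have -> : hh d g `|u - v| = 0.
    by rewrite uv subrr normr0 /hh mul0r min_r// powR0//; case/andP: g01 => /gt_eqF ->.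
  by rewrite !mulr0.
have s0 : 0 < `|u - v| by rewrite normr_gt0 subr_eq0.
have hh0 : 0 <= hh d g `|u - v| by exact: powR_ge0.
have h1 := sym_mm uv hh0.
have h2 := sing_le d01 g01 s0.
have G0 : 0 <= 45 * G v v by apply: mulr_ge0 => //; exact: G_ge0.
have h3 := le_trans h1 (ler_wpM2l G0 h2).
have c0 : 0 <= 4 * n * rho 0 v by apply: mulr_ge0 => //; exact: mulr_ge0.
have h4 := ler_wpM2l c0 h3.
rewrite /kk /jr mul0r oppr0 expR0 mul1r addr0.
rewrite [leLHS](_ : _ = 4 * n * rho 0 v * (mm v u * bose `|u - v| * G v u * hh d g `|u - v|)); last by ring.
apply: le_trans h4 _; rewrite /kk_cst.
by rewrite le_eqVlt; apply/orP; left; apply/eqP; ring.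
Qed.

Hypothesis e01 : 0 < e <= 1.
Hypothesis g8 : g <= 1 / 8.

Let rho_diff v : 0 <= rho 0 v - rho e v <= rho 0 v * (2 * e `^ (g / 2) * expR (Num.max 0 (- v) / 16)).
Proof.
have [e0 e1] := andP e01; have [g0 g1] := andP g01.
rewrite subr_ge0 rho_le0 ?(ltW e0)//=.
have r0 : 0 < rho 0 v by exact: rho_gt0.
have re : 0 < rho e v by exact: rho_gt0 (ltW e0).
have h1 : rho 0 v - rho e v = rho 0 v * (e * rho e v).
  have := rho_den_gt0 v (ltW e0); have := rho_den_gt0 v (lexx 0).
  rewrite /rho addr0; set q : R := Num.sqrt _ => q0 q1.
  by field; rewrite !gt_eqF.
rewrite h1; apply: ler_wpM2l; first exact: ltW.
have h2 : e * rho e v <= Num.min 1 (e * rho 0 v).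
  rewrite le_min; apply/andP; split; last by apply: ler_wpM2l; [exact: ltW|exact: rho_le0 (ltW e0)].
  by rewrite mulrC -ler_pdivlMr// div1r; exact: rho_le_inv.
apply: le_trans h2 _.
have h3 : Num.min 1 (e * rho 0 v) <= (e * rho 0 v) `^ (1 / 8).
  apply: min1_le_powR; first by apply: mulr_ge0; exact: ltW.
  by apply/andP; split; lra.
apply: le_trans h3 _.
rewrite powRM ?(ltW e0) ?(ltW r0)// -mulrA mulrCA; apply: ler_pM; rewrite ?powR_ge0//.
  by apply: ger_powR; [rewrite e0 e1|have := g8; lra].
apply: (@le_trans _ _ ((2 * expR (Num.max 0 (- v) / 2)) `^ (1 / 8))).
  by apply: ge0_ler_powR; [lra|rewrite nnegrE ltW|rewrite nnegrE mulr_ge0 ?expR_ge0|exact: rho_le_expR].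
rewrite powRM ?expR_ge0//; apply: ler_pM; rewrite ?powR_ge0//.
  by rewrite -[leRHS]powRr1//; apply: ler_powR; [rewrite ler1n|lra].
by rewrite -expRM ler_expR le_eqVlt; apply/orP; left; apply/eqP; field.
Qed.

(** Replacing [rho 0] by [rho e] costs the exponential in [tail_weight]; replacing the Bose factor
    by [jr] costs half of the Hölder exponent. Both errors are of order [e ^ (g/2)], the first
    because [g <= 1/8] makes [g/2] smaller than 1/8. *)
Lemma kk_diff_le v u :
  `|k e v u - k 0 v u| * (G v u * hh d g `|u - v|) <=
  4 * kk_cst * e `^ (g / 2) * (tail_weight v * powint (g / 2) `|u - v|).
Proof.
have [e0 e1] := andP e01; have [g0 g1] := andP g01.
have n0 := nb_ge0 P.
have r0 : 0 <= rho 0 v by exact: ltW (rho_gt0 _ (lexx 0)).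
have E0 := powR_ge0 e (g / 2).
have C0 : 0 <= 4 * kk_cst * e `^ (g / 2) * (tail_weight v * powint (g / 2) `|u - v|).
  apply: mulr_ge0; last by apply: mulr_ge0; [exact: tail_weight_ge0|exact: powint_ge0].
  by apply: mulr_ge0 => //; apply: mulr_ge0 => //; exact: kk_cst_ge0.
have [uv|uv] := eqVneq u v.
  have -> : hh d g `|u - v| = 0.
    by rewrite uv subrr normr0 /hh mul0r min_r// powR0// gt_eqF.
  by rewrite !mulr0.
have s0 : 0 < `|u - v| by rewrite normr_gt0 subr_eq0.
have hh0 : 0 <= hh d g `|u - v| by exact: powR_ge0.
have m0 := mm_ge0 v u; have B0 := bose_gt0 s0; have G0 := G_ge0 P v v; have G0' := G_ge0 P v u.
have J1 := jr_le (ltW e0) s0; have J0 := jr_ge0 (ltW e0) (ltW s0).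
have J2 := bose_jr (ltW e0) s0.
have /andP[r1 r2] := rho_diff v.
have re : 0 <= rho e v by exact: ltW (rho_gt0 _ (ltW e0)).
set s : R := `|u - v| in s0 hh0 B0 J0 J1 J2 *.
set th : R := e * (1 + s) + e / (s + e) in J2 *.
set W : R := expR (Num.max 0 (- v) / 16) in r2 *.
have W1 : 1 <= W by rewrite -expR0 ler_expR divr_ge0// le_max lexx.
have J00 : jr 0 s = bose s by rewrite /jr mul0r oppr0 expR0 mul1r addr0.
have d1 : `|k e v u - k 0 v u| <=
    4 * n * (rho 0 v * (2 * e `^ (g / 2) * W) * (mm v u * bose s) + rho 0 v * (mm v u * (bose s * th))).
  rewrite ler0_norm; last first.
    rewrite subr_le0 /kk -/s J00; apply: ler_wpM2l; first exact: mulr_ge0.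
    apply: ler_pM => //; first exact: mulr_ge0.
    by apply: ler_wpM2r => //; lra.
  rewrite opprB /kk -/s J00 -mulrBr; apply: ler_wpM2l; first exact: mulr_ge0.
  have -> : rho 0 v * mm v u * bose s - rho e v * mm v u * jr e s =
      (rho 0 v - rho e v) * (mm v u * bose s) + rho e v * (mm v u * (bose s - jr e s)).
    by ring.
  apply: lerD.
    by apply: ler_wpM2r => //; apply: mulr_ge0 => //; exact: ltW.
  apply: ler_pM => //; first by apply: mulr_ge0 => //; rewrite subr_ge0.
    by rewrite -subr_ge0.
  exact: ler_wpM2l.
have GH0 : 0 <= G v u * hh d g s by exact: mulr_ge0.
apply: le_trans (ler_wpM2r GH0 d1) _.
have th0 : 0 <= th by rewrite addr_ge0 ?mulr_ge0 ?invr_ge0 ?addr_ge0// ltW.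
have h1 := sym_mm uv hh0; rewrite -/s in h1.
have h1' := le_trans h1 (ler_wpM2l (mulr_ge0 (ler0n _ 45) G0) (sing_le d01 g01 s0)).
have h2 := sym_mm uv (mulr_ge0 hh0 th0); rewrite -/s in h2.
have h2' : mm v u * bose s * G v u * (hh d g s * th) <=
    45 * G v v * (2 * e `^ (g / 2) * (sing_cst d * powint (g / 2) s)).
  apply: le_trans h2 _; apply: ler_wpM2l; first exact: mulr_ge0 (ler0n _ 45) G0.
  have := sing_consistent_le d01 g01 s0 e01; rewrite -/th; apply: le_trans.
  by rewrite [leLHS]mulrA.
have c1 : 0 <= rho 0 v * (2 * e `^ (g / 2) * W).
  by apply: mulr_ge0 => //; apply: mulr_ge0; [exact: mulr_ge0|exact: expR_ge0].
have h5 := lerD (ler_wpM2l c1 h1') (ler_wpM2l r0 h2').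
have h6 := ler_wpM2l (mulr_ge0 (ler0n _ 4) n0) h5.
rewrite [leLHS](_ : _ = 4 * n * (rho 0 v * (2 * e `^ (g / 2) * W) * (mm v u * bose s * G v u * hh d g s) +
   rho 0 v * (mm v u * bose s * G v u * (hh d g s * th)))); last by ring.
apply: le_trans h6 _.
have X0 : 0 <= 4 * n * (45 * sing_cst d) * (2 * e `^ (g / 2)) * (rho 0 v * G v v * powint (g / 2) s).
  apply: mulr_ge0; first by apply: mulr_ge0; [exact: kk_cst_ge0|exact: mulr_ge0].
  by apply: mulr_ge0; [exact: mulr_ge0|exact: powint_ge0].
have h7 := ler_wpM2r X0 W1; rewrite mul1r in h7.
rewrite /tail_weight -/W /kk_cst.
rewrite [leLHS](_ : _ = W * (4 * n * (45 * sing_cst d) * (2 * e `^ (g / 2)) * (rho 0 v * G v v * powint (g / 2) s)) + 4 * n * (45 * sing_cst d) * (2 * e `^ (g / 2)) * (rho 0 v * G v v * powint (g / 2) s)); last by ring.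
apply: le_trans (lerD (lexx _) h7) _.
by rewrite le_eqVlt; apply/orP; left; apply/eqP; ring.
Qed.
End kernel_difference.
End consistency.

(** * The generator on regular functions *)

Section parametric_integral.
Context {R : realType}.
Local Notation leb := (@lebesgue_measure R).
Local Notation T := (measurableTypeR R).

Lemma measurable_Rintegral (f : T * T -> R) : measurable_fun setT f ->
  measurable_fun setT (fun x : T => \int[leb]_y f (x, y)).
Proof.
move=> mf.
have mE : measurable_fun setT (EFin \o f) by exact/measurable_EFinP.
have mp := measurable_funepos mE; have mn := measurable_funeneg mE.
have := @measurable_fun_fubini_tonelli_F _ _ T T R leb _ mp (fun z => funepos_ge0 _ z).
have := @measurable_fun_fubini_tonelli_F _ _ T T R leb _ mn (fun z => funeneg_ge0 _ z).
move=> m2 m1; apply: measurableT_comp => //.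
rewrite (_ : (fun x => _) = (fun x => fubini_F leb ((EFin \o f)^\+)%E x - fubini_F leb ((EFin \o f)^\-)%E x)%E).
  exact: emeasurable_funB.
apply/funext => x; rewrite [LHS]integralE /fubini_F.
by congr (_ - _)%E; apply: eq_integral => y _; rewrite ?funeposE ?funenegE.
Qed.

Lemma measurable_euler (P : model R) e h (phi : R -> R) : measurable_fun setT phi ->
  measurable_fun setT (euler P e h phi).
Proof.
move=> mphi; apply: measurable_funB => //; apply: measurable_funM => //.
apply: (@measurable_Rintegral (fun z => kk P e z.1 z.2 * (phi z.1 - phi z.2))).
apply: measurable_funM; first by apply: measurable_kk.
by apply: measurable_funB; apply: measurableT_comp.
Qed.
End parametric_integral.

Section nu_signed.
Context {R : realType}.
Local Notation leb := (@lebesgue_measure R).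

Lemma integral_nu (f : R -> R) : measurable_fun setT f ->
  (\int[nu]_x (f x)%:E = \int[leb]_x (f x * nu_density x)%:E)%E.
Proof.
move=> mf; have mE : measurable_fun setT (EFin \o f) by exact/measurable_EFinP.
rewrite integralE [RHS]integralE.
rewrite ge0_integral_nu//; [|exact: measurable_funepos].
rewrite ge0_integral_nu//; [|exact: measurable_funeneg].
congr (_ - _)%E; apply: eq_integral => x _; have d0 := nu_density_ge0 x.
  rewrite !funeposE /= -!EFin_max -EFinM; congr EFin.
  by rewrite maxr_pMl// mul0r.
rewrite !funenegE /= -!EFin_max -EFinM; congr EFin.
by rewrite maxr_pMl// mul0r mulNr.
Qed.

Lemma cauchy_schwarz_nu (p q : R -> R[i]) : cmeasurable p -> cmeasurable q ->
  (\int[nu]_v (cabs (p v) * cabs (q v))%:E <= L2norm p * L2norm q)%E.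
Proof.
move=> mp mq; have m1 := measurable_cabs mp; have m2 := measurable_cabs mq.
have h2 : 2^-1 + 2^-1 = 1 :> R by field.
have := @hoelder _ _ _ nu _ _ 2 2 m1 m2 (ltr0n R 2) (ltr0n R 2) h2; apply: le_trans.
rewrite Lnorm1 le_eqVlt; apply/orP; left; apply/eqP; apply: eq_integral => v _.
by rewrite /= ger0_norm// mulr_ge0 ?cabs_ge0.
Qed.
End nu_signed.

(** * A dominating weight in [L^2(nu)] *)

Section weight_L2.
Context {R : realType}.
Variable P : model R.
Local Notation n := (nb P).
Local Notation G := (Ginf (al P) (me P) (mu_ P)).
Implicit Types v u : R.
Hypothesis mu716 : mu_ P <= 7 / 16.

(** A single weight above both [G v v] and [tail_weight]. Every function of the scheme, its image
    under the generators and the consistency errors are bounded by multiples of it. *)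
Definition l2_weight v := (1 + rho 0 v) * expR (Num.max 0 (- v) / 16) * G v v.

Lemma l2_weight_ge0 v : 0 <= l2_weight v.
Proof.
apply: mulr_ge0; last exact: G_ge0.
by apply: mulr_ge0; [rewrite addr_ge0// ltW// rho_gt0|exact: expR_ge0].
Qed.

Lemma tail_weight_le v : tail_weight P v <= l2_weight v.
Proof.
apply: ler_wpM2r; first exact: G_ge0.
by apply: ler_wpM2r; [exact: expR_ge0|rewrite lerDr].
Qed.

Lemma G_le_l2_weight v : G v v <= l2_weight v.
Proof.
rewrite /l2_weight -[leLHS]mul1r; apply: ler_wpM2r; first exact: G_ge0.
rewrite -[leLHS]mul1r; apply: ler_pM => //; first by rewrite lerDl ltW// rho_gt0.
by rewrite -expR0 ler_expR divr_ge0// le_max lexx.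
Qed.

Lemma nu_densityE v : nu_density v = expR (- v) * softplus v `^ (5 / 2).
Proof. by []. Qed.

Lemma rho_density v : (1 + rho 0 v) ^+ 2 * nu_density v =
  expR (- v) * ((Num.sqrt (softplus v) + 1) ^+ 2 * softplus v `^ (3 / 2)).
Proof.
have l0 := softplus_gt0 v.
rewrite nu_densityE /rho addr0.
have q0 : 0 < Num.sqrt (softplus v) by rewrite sqrtr_gt0.
have qq : softplus v = Num.sqrt (softplus v) ^+ 2 by rewrite sqr_sqrtr// ltW.
have -> : softplus v `^ (5 / 2) = softplus v `^ (3 / 2) * Num.sqrt (softplus v) ^+ 2.
  rewrite -qq -{3}[softplus v]powRr1 ?(ltW l0)// -powRD; last by rewrite (gt_eqF l0) implybT.
  by congr (_ `^ _); field.
move: q0; set q : R := Num.sqrt _ => q0; set w : R := _ `^ (3 / 2).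
by field; rewrite gt_eqF.
Qed.

Lemma l2_weight_arith (q L w D : R) : 0 <= q -> 1 <= q -> 0 <= L -> L ^+ 2 <= q -> 0 <= w -> w <= q ^+ 2 ->
  0 <= D -> D * ((L + 1) ^+ 2 * w) <= D * (4 * q ^+ 3).
Proof.
move=> q0 q1 L0 Lq w0 wq D0; apply: ler_wpM2l => //.
have h1 : (L + 1) ^+ 2 <= 4 * q by have := sqr_ge0 (L - 1); rewrite !expr2 in Lq *; nra.
rewrite (_ : 4 * q ^+ 3 = 4 * q * q ^+ 2); last by rewrite !exprS expr0; ring.
by apply: ler_pM => //; rewrite sqr_ge0.
Qed.

Definition l2_cst : R := 100 * 32 ^+ 3.

(** At [-oo] the exponents add up to [1/2 - 1/8 - 1/3 = 1/24], with [alpha <= 1/6] giving the last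
    term. At [+oo] they give [-1 + 3/32 + 7/8 = -1/32], where 7/8 is twice the largest [mu] and 3/32
    pays for the powers of [softplus]. *)
Lemma l2_weight_sqr v : l2_weight v ^+ 2 * nu_density v <= l2_cst * expR (- (1 / 32 * `|v|)).
Proof.
have [m0 m1] := andP (me_bnd P); have [a0 a1] := andP (al_bnd P); have [u0 u1] := andP (mu_bnd P).
have l0 := softplus_gt0 v.
have e0 (x : R) : 0 <= expR x := expR_ge0 x.
have w0 : 0 <= softplus v `^ (3 / 2) by exact: powR_ge0.
have L2 : Num.sqrt (softplus v) ^+ 2 = softplus v by rewrite sqr_sqrtr// ltW.
rewrite /l2_weight.
rewrite [leLHS](_ : _ = (1 + rho 0 v) ^+ 2 * nu_density v * (expR (Num.max 0 (- v) / 16) * G v v) ^+ 2); last by ring.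
rewrite rho_density.
have GG : G v v = 2 * (ff (al P) v * EE (me P) v) + EE (mu_ P) v.
  by rewrite /Ginf minxx; ring.
have [v0|v0] := leP v 0.
  have lv : softplus v <= expR v by exact: softplus_le_expR.
  have l1 : softplus v <= 1 by apply: le_trans lv _; rewrite -expR0 ler_expR.
  have w1 : softplus v `^ (3 / 2) <= expR (v * (3 / 2)).
    by rewrite expRM; apply: ge0_ler_powR; rewrite ?nnegrE ?(ltW l0)//; lra.
  have h1 : (Num.sqrt (softplus v) + 1) ^+ 2 <= 4.
    have q0 := sqrtr_ge0 (softplus v); have q1 : Num.sqrt (softplus v) <= 1.
      by rewrite -sqrtr1 ler_wsqrtr.
    by rewrite expr2; nra.
  have h2 : (Num.sqrt (softplus v) + 1) ^+ 2 * softplus v `^ (3 / 2) <= 4 * expR (v * (3 / 2)).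
    by apply: ler_pM => //; exact: sqr_ge0.
  have h3 : expR (Num.max 0 (- v) / 16) * G v v <= expR (- v / 16) * (5 * expR (- v / 6)).
    rewrite max_r ?oppr_ge0//; apply: ler_wpM2l => //.
    rewrite GG /EE max_l// !mulr0 expR0 mulr1 /ff.
    have f1 : expR (- (al P * v)) <= expR (- v / 6) by rewrite ler_expR; nra.
    have f2 : 1 <= expR (- v / 6) by rewrite -[leLHS]expR0 ler_expR; lra.
    by lra.
  have G0 : 0 <= expR (Num.max 0 (- v) / 16) * G v v by rewrite mulr_ge0// G_ge0.
  have h4 : (expR (Num.max 0 (- v) / 16) * G v v) ^+ 2 <= (expR (- v / 16) * (5 * expR (- v / 6))) ^+ 2.
    by apply: lerXn2r; rewrite ?nnegrE// mulr_ge0// mulr_ge0.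
  have h5 : expR (- v) * ((Num.sqrt (softplus v) + 1) ^+ 2 * softplus v `^ (3 / 2)) <= expR (- v) * (4 * expR (v * (3 / 2))).
    exact: ler_wpM2l.
  apply: le_trans (ler_pM _ _ h5 h4) _; rewrite ?sqr_ge0// ?mulr_ge0 ?sqr_ge0//.
  rewrite ler0_norm//.
  have -> : expR (- v) * (4 * expR (v * (3 / 2))) * (expR (- v / 16) * (5 * expR (- v / 6))) ^+ 2 =
      100 * expR (v / 24).
    transitivity (100 * (expR (- v) * expR (v * (3 / 2)) * expR (- v / 16) * expR (- v / 16) * expR (- v / 6) * expR (- v / 6))); first by ring.
    by rewrite -!expRD; congr (_ * expR _); field.
  rewrite /l2_cst -mulrA; apply: ler_wpM2l => //.
  apply: (@le_trans _ _ (expR (- (1 / 32 * - v)))); first by rewrite ler_expR; lra.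
  by rewrite ler_peMl// exprn_ege1// ler1n.
have lv : softplus v <= 32 * expR (v / 32).
  by have := softplus_le_add (ltW v0); have := expR_ge1Dx (v / 32); lra.
set q : R := 32 * expR (v / 32) in lv *.
have q1 : 1 <= q.
  have : 1 <= expR (v / 32) by rewrite -[leLHS]expR0 ler_expR; lra.
  by rewrite /q; lra.
have w1 : softplus v `^ (3 / 2) <= q ^+ 2.
  apply: (@le_trans _ _ (q `^ (3 / 2))).
    by apply: ge0_ler_powR; rewrite ?nnegrE ?(ltW l0)//; lra.
  by rewrite -powR_mulrn ?(le_trans ler01)//; apply: ler_powR => //; lra.
have h5 := l2_weight_arith (le_trans ler01 q1) q1 (sqrtr_ge0 (softplus v)) _ w0 w1 (e0 (- v)).
rewrite L2 in h5; have {}h5 := h5 lv.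
have h3 : expR (Num.max 0 (- v) / 16) * G v v <= 5 * expR (7 / 16 * v).
  rewrite max_l ?oppr_le0 ?(ltW v0)// mul0r expR0 mul1r GG /EE max_r ?(ltW v0)// /ff.
  have f1 : expR (- (al P * v)) <= 1 by apply: expRN_le1; nra.
  have f2 : expR (me P * v) <= expR (7 / 16 * v) by rewrite ler_expR; nra.
  have f3 : expR (mu_ P * v) <= expR (7 / 16 * v) by rewrite ler_expR ler_pM2r.
  have f4 : expR (- (al P * v)) * expR (me P * v) <= expR (me P * v) by rewrite ler_piMl.
  by rewrite mulrDl mul1r; lra.
have G0 : 0 <= expR (Num.max 0 (- v) / 16) * G v v by rewrite mulr_ge0// G_ge0.
have h4 : (expR (Num.max 0 (- v) / 16) * G v v) ^+ 2 <= (5 * expR (7 / 16 * v)) ^+ 2.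
  by apply: lerXn2r; rewrite ?nnegrE// mulr_ge0.
apply: le_trans (ler_pM _ _ h5 h4) _; rewrite ?sqr_ge0// ?mulr_ge0 ?sqr_ge0//.
rewrite gtr0_norm// /q /l2_cst.
rewrite [leLHS](_ : _ = 100 * 32 ^+ 3 * (expR (- v) * (expR (v / 32) ^+ 3) * expR (7 / 16 * v) ^+ 2)); last by ring.
apply: ler_wpM2l; first by rewrite mulr_ge0// exprn_ge0.
rewrite -!expRM_natl -!expRD le_eqVlt; apply/orP; left; apply/eqP.
by congr expR; field.
Qed.

Lemma measurable_l2_weight : measurable_fun setT l2_weight.
Proof.
apply: measurable_funM; last exact: measurable_Ginf.
apply: measurable_funM; first by apply: measurable_funD => //; exact: measurable_rho.
apply: measurableT_comp => //; apply: measurable_funM => //.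
by apply: measurable_maxr => //; exact: measurable_funN.
Qed.

Lemma cmeasurable_real d (T : measurableType d) (f : T -> R) : measurable_fun setT f ->
  cmeasurable (fun z => ((f z)%:C)%C).
Proof. by move=> mf; split => //; exact: measurable_cst. Qed.

Lemma in_L2_weight : in_L2 (fun v => ((l2_weight v)%:C)%C).
Proof.
have m := cmeasurable_real measurable_l2_weight.
have l0 : 0 <= l2_cst by rewrite mulr_ge0// exprn_ge0.
have c32 : 0 < 1 / 32 :> R by lra.
have [i1 b1] := itg_expRN 0 c32.
have B0 : 0 <= l2_cst * (2 / (1 / 32)) by rewrite mulr_ge0.
suff h : (\int[nu]_v (cabs ((l2_weight v)%:C)%C ^+ 2)%:E <= (Num.sqrt (l2_cst * (2 / (1 / 32))) ^+ 2)%:E)%E.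
  by have [] := in_L2_le m (sqrtr_ge0 _) h.
rewrite sqr_sqrtr// ge0_integral_nu; last 2 first.
- by move=> v; rewrite lee_fin sqr_ge0.
- by apply/measurable_EFinP; apply: measurable_funX; exact: measurable_cabs.
apply: (@le_trans _ _ (\int[lebesgue_measure]_v (l2_cst * expR (- (1 / 32 * `|v - 0|)))%:E)%E).
  apply: ge0_le_integral => //.
  - by move=> v _; rewrite mule_ge0// lee_fin ?sqr_ge0 ?nu_density_ge0.
  - apply: emeasurable_funM; last exact: measurable_EFin_density.
    by apply/measurable_EFinP; apply: measurable_funX; exact: measurable_cabs.
  - by apply: (measurable_int (@lebesgue_measure R)); exact: itgZ i1.
  - move=> v _; rewrite -EFinM lee_fin cabsR ger0_norm ?l2_weight_ge0// subr0.
    exact: l2_weight_sqr.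
rewrite -EFin_Rint; last exact: itgZ i1.
by rewrite lee_fin RintZ//; apply: ler_wpM2l.
Qed.

Lemma in_L2_bounded (f : R -> R) (c : R) : measurable_fun setT f -> 0 <= c ->
  (forall v, `|f v| <= c * l2_weight v) ->
  in_L2 (fun v => ((f v)%:C)%C) /\ L2n (fun v => ((f v)%:C)%C) <= c * L2n (fun v => ((l2_weight v)%:C)%C).
Proof.
move=> mf c0 h.
have [i1 e1] := in_L2Z (c%:C)%C in_L2_weight.
have hd v : cabs ((f v)%:C)%C <= cabs ((c%:C)%C * ((l2_weight v)%:C)%C).
  rewrite cabsR ComplexField.Normc.normcM; apply: le_trans (h v) _.
  by rewrite !cabsR !ger0_norm ?l2_weight_ge0.
have [i2 b2] := in_L2_dom (cmeasurable_real mf) i1 hd.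
by split => //; apply: le_trans b2 _; rewrite e1 cabsR ger0_norm.
Qed.
End weight_L2.

Section kernel_identity.
Context {R : realType}.
Variable P : model R.

Lemma K3_sym (v u : R) : K3 (nb P) v u = K3 (nb P) u v.
Proof. by rewrite /K3 minC maxC distrC [ln _ * ln _]mulrC. Qed.

Lemma K3_ge0 (v u : R) : 0 <= K3 (nb P) v u.
Proof.
have n0 := nb_ge0 P; rewrite /K3.
apply: mulr_ge0; first apply: mulr_ge0.
- by rewrite mulr_ge0 ?powR_ge0// mulr_ge0.
- by rewrite divr_ge0 ?expR_ge0// !addr_ge0 ?expR_ge0.
- by apply: divr_ge0; [rewrite addr_ge0 ?expR_ge0|rewrite subr_ge0 expRN_le1].
Qed.

Lemma powR_kernel (x y : R) : 0 < x -> 0 < y ->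
  (x * y) `^ (- (3 / 2)) * y `^ (5 / 2) = y / (Num.sqrt x * x).
Proof.
move=> x0 y0; rewrite (powRM _ (ltW x0) (ltW y0)) -mulrA -powRD; last by rewrite (gt_eqF y0) implybT.
rewrite (_ : - (3 / 2) + 5 / 2 = 1); last by field.
rewrite powRr1 ?(ltW y0)// mulrC; congr (_ * _); rewrite powRN; congr (_^-1).
have e : x `^ (3 / 2) = x `^ 2^-1 * x `^ 1.
  by rewrite -powRD; [congr (_ `^ _); field|rewrite (gt_eqF x0) implybT].
by rewrite e powR12_sqrt ?(ltW x0)// powRr1// ltW.
Qed.

(** The powers [-3/2] of the kernel and [5/2] of the density combine to [softplus u] over the power
    [3/2] of [softplus v]. On the diagonal both sides are 0, since the inverse of 0 is 0. As [K3] is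
    symmetric, the jump rates [kk P 0] are reversible with respect to [nu]. *)
Lemma K3_density (v u : R) : K3 (nb P) v u * nu_density u = kk P 0 v u.
Proof.
have lv := softplus_gt0 v; have lu := softplus_gt0 u.
rewrite nu_densityE /kk /jr mul0r oppr0 expR0 mul1r addr0 /K3 -/(softplus v) -/(softplus u).
have [->|uv] := eqVneq u v.
  by rewrite subrr normr0 oppr0 expR0 subrr /bose expR0 subrr !invr0 !mulr0 mul0r.
have s0 : 0 < `|u - v| by rewrite normr_gt0 subr_eq0.
have E1 : 0 < 1 - expR (- `|u - v|) by rewrite subr_gt0 -expR0 ltr_expR oppr_lt0.
rewrite [`|v - u|]distrC.
have p1 : (softplus v * softplus u) `^ (- (3 / 2)) * softplus u `^ (5 / 2) =
    softplus u / (Num.sqrt (softplus v) * softplus v).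
  exact: powR_kernel.
have p2 : expR (- `|u - v|) / (1 - expR (- `|u - v|)) = bose `|u - v|.
  have E2 : 0 < expR `|u - v| - 1 by exact: expRB1_gt0.
  have := expRN `|u - v|; rewrite /bose; move: E1 E2 => E1 E2 h.
  rewrite h in E1 *; field; rewrite !gt_eqF ?expR_gt0//.
have p3 : 1 + expR (- Num.min v u) + expR (- Num.max v u) = 1 + expR (- u) + expR (- v).
  by case: (leP v u) => _; ring.
rewrite p3 /rho addr0 /mm [Num.max v u]maxC.
transitivity (4 * nb P * expR (- u) * ((softplus v * softplus u) `^ (- (3 / 2)) * softplus u `^ (5 / 2)) *
  ((2 + expR (Num.max u v)) / (1 + expR (- u) + expR (- v))) *
  (expR (- `|u - v|) / (1 - expR (- `|u - v|)))); first by ring.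
by rewrite p1 p2 invfM; ring.
Qed.
End kernel_identity.

Section generator_graph.
Context {R : realType}.
Local Notation leb := (@lebesgue_measure R).
Variable P : model R.
Local Notation n := (nb P).
Local Notation G := (Ginf (al P) (me P) (mu_ P)).
Local Notation K := (K3 (nb P)).
Local Notation Re := (@complex.Re R).
Local Notation Im := (@complex.Im R).
Implicit Types v u : R.
Hypothesis mu716 : mu_ P <= 7 / 16.
Variables (d g : R).
Hypothesis d01 : 0 < d <= 1.
Hypothesis g01 : 0 < g <= 1.

Lemma measurable_pairl v : measurable_fun setT (fun u : R => (v, u)).
Proof. by apply: measurable_fun_pair. Qed.

Lemma measurable_K3 : measurable_fun setT (fun z : R * R => K z.1 z.2).
Proof.
rewrite (_ : (fun z => _) = (fun z : R * R => kk P 0 z.1 z.2 / nu_density z.2)).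
  apply: measurable_funM; first exact: measurable_kk.
  by apply: measurable_funV; apply: (measurableT_comp (@measurable_nu_density R)).
by apply/funext => z; rewrite -K3_density mulfK// gt_eqF// nu_density_gt0.
Qed.

Definition gen_fun (psi : R -> R) v := \int[leb]_u (kk P 0 v u * (psi v - psi u)).

Definition gen_cst : R := kk_cst P d * (2 * (g / 2)^-1).

Lemma gen_cst_ge0 : 0 <= gen_cst.
Proof.
case/andP: g01 => g0 _.
by rewrite mulr_ge0 ?kk_cst_ge0// mulr_ge0// invr_ge0 divr_ge0// ltW.
Qed.

Variables (psi : R -> R) (M : R).
Hypothesis mpsi : measurable_fun setT psi.
Hypothesis M0 : 0 <= M.
Hypothesis hpsi : forall v u, `|psi v - psi u| <= M * (G v u * hh d g `|u - v|).

Lemma itg_gen v : itg (fun u => kk P 0 v u * `|psi v - psi u|) /\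
  \int[leb]_u (kk P 0 v u * `|psi v - psi u|) <= M * gen_cst * l2_weight P v.
Proof.
case/andP: g01 => g0 _; have g2 : 0 < g / 2 by rewrite divr_gt0.
have [ip bp] := itg_powint v g2.
have k0 u : 0 <= kk P 0 v u by exact: kk_ge0.
have r0 : 0 <= rho 0 v * G v v.
  by apply: mulr_ge0; [exact: ltW (rho_gt0 _ (lexx 0))|exact: G_ge0].
have C0 : 0 <= kk_cst P d by exact: kk_cst_ge0.
have h u : kk P 0 v u * `|psi v - psi u| <= M * (kk_cst P d * (rho 0 v * G v v)) * powint (g / 2) `|u - v|.
  apply: le_trans (ler_wpM2l (k0 u) (hpsi v u)) _.
  rewrite mulrCA -[leRHS]mulrA; apply: ler_wpM2l => //.
  exact: kk0_hh_le.
have ik : itg (fun u => kk P 0 v u * `|psi v - psi u|).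
  apply: itg_le (itgZ _ ip); last by move=> u; rewrite ger0_norm; [exact: h|exact: mulr_ge0].
  apply: measurable_funM; first exact: measurable_kk.
  by apply: measurableT_comp => //; exact: measurable_funB.
split => //.
apply: le_trans (Rint_le ik (itgZ _ ip) h) _; rewrite RintZ//.
have c0 : 0 <= M * (kk_cst P d * (rho 0 v * G v v)) by apply: mulr_ge0 => //; exact: mulr_ge0.
apply: le_trans (ler_wpM2l c0 bp) _.
rewrite /gen_cst [leLHS](_ : _ = M * (kk_cst P d * (2 * (g / 2)^-1)) * (rho 0 v * G v v)); last by ring.
apply: ler_wpM2l; first by apply: mulr_ge0 => //; exact: gen_cst_ge0.
by apply: le_trans (rho_G_le P v) _; exact: tail_weight_le.
Qed.

Lemma itg_gen_signed v : itg (fun u => kk P 0 v u * (psi v - psi u)).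
Proof.
apply: itg_le (itg_gen v).1.
  apply: measurable_funM; first exact: measurable_kk.
  exact: measurable_funB.
by move=> u; rewrite normrM ger0_norm ?kk_ge0.
Qed.

Lemma gen_fun_le v : `|gen_fun psi v| <= M * gen_cst * l2_weight P v.
Proof.
apply: le_trans (itg_gen v).2; apply: Rint_norm_le; [exact: itg_gen_signed|exact: (itg_gen v).1|].
by move=> u; rewrite normrM ger0_norm ?kk_ge0.
Qed.

Lemma measurable_gen_fun : measurable_fun setT (gen_fun psi).
Proof.
apply: (@measurable_Rintegral _ (fun z => kk P 0 z.1 z.2 * (psi z.1 - psi z.2))).
apply: measurable_funM; first exact: measurable_kk.
by apply: measurable_funB; apply: measurableT_comp.
Qed.

Lemma in_L2_gen_fun : in_L2 (fun v => ((gen_fun psi v)%:C)%C).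
Proof.
have c0 : 0 <= M * gen_cst by rewrite mulr_ge0// gen_cst_ge0.
exact: (in_L2_bounded mu716 measurable_gen_fun c0 gen_fun_le).1.
Qed.

Lemma psi_le v : `|psi v| <= (`|psi 0| + 3 * M * G 0 0) * l2_weight P v.
Proof.
have h1 : `|psi v| <= `|psi 0| + `|psi v - psi 0|.
  by rewrite -{1}[psi v](subrK (psi 0)) addrC; exact: ler_normD.
apply: le_trans h1 _; rewrite mulrDl.
have G1 := G_ge1 P v v; have GV := G_le_l2_weight P v.
apply: lerD; first by rewrite ler_peMr// (le_trans G1).
apply: le_trans (hpsi v 0) _.
have h2 : G v 0 * hh d g `|0 - v| <= G v 0.
  rewrite ler_piMr ?G_ge0//.
  have d0 : 0 < d by case/andP: d01.
  have g0 : 0 < g by case/andP: g01.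
  apply: (@le_trans _ _ (1 `^ g)); last by rewrite powR1.
  apply: ge0_ler_powR; rewrite ?nnegrE ?(ltW g0)//.
    by rewrite le_min ler01 divr_ge0// ltW.
  by rewrite ge_min lexx.
have G00 : 0 <= 3 * G 0 0 by apply: mulr_ge0 => //; exact: G_ge0.
have h3 : G v 0 * hh d g `|0 - v| <= 3 * G 0 0 * l2_weight P v.
  apply: le_trans h2 _; apply: le_trans (G_le_diag_cst P v 0) _.
  exact: ler_wpM2l.
apply: le_trans (ler_wpM2l M0 h3) _.
by rewrite le_eqVlt; apply/orP; left; apply/eqP; ring.
Qed.

Lemma in_L2_psi : in_L2 (fun v => ((psi v)%:C)%C).
Proof.
have c0 : 0 <= `|psi 0| + 3 * M * G 0 0.
  by rewrite addr_ge0// mulr_ge0 ?G_ge0// mulr_ge0.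
exact: (in_L2_bounded mu716 mpsi c0 psi_le).1.
Qed.

Lemma inner_gen v : (\int[nu]_u (K v u * `|psi v - psi u|)%:E <= (M * gen_cst * l2_weight P v)%:E)%E.
Proof.
rewrite ge0_integral_nu; last 2 first.
- by move=> u; rewrite lee_fin mulr_ge0// K3_ge0.
- apply/measurable_EFinP; apply: measurable_funM.
    exact: (measurableT_comp measurable_K3 (measurable_pairl v)).
  by apply: measurableT_comp => //; exact: measurable_funB.
rewrite (_ : (\int[leb]_x _)%E = (\int[leb]_u (kk P 0 v u * `|psi v - psi u|)%:E)%E).
  by rewrite -EFin_Rint ?lee_fin; [exact: (itg_gen v).2|exact: (itg_gen v).1].
by apply: eq_integral => u _; rewrite -EFinM -K3_density mulrAC.
Qed.

Section test_function.
Variable p : R -> R.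
Hypothesis mp : measurable_fun setT p.
Hypothesis ip : (\int[nu]_v (`|p v| * l2_weight P v)%:E < +oo)%E.

Let F (z : R * R) : R := K z.1 z.2 * (p z.1 * (psi z.1 - psi z.2)).

Let mF : measurable_fun setT F.
Proof.
apply: measurable_funM; first exact: measurable_K3.
apply: measurable_funM; first by apply: measurableT_comp.
by apply: measurable_funB; apply: measurableT_comp.
Qed.

Let F_int : (\int[nu]_v \int[nu]_u `|(F (v, u))%:E| < +oo)%E.
Proof.
have c0 : 0 <= M * gen_cst by rewrite mulr_ge0// gen_cst_ge0.
apply: (@le_lt_trans _ _ (\int[nu]_v ((M * gen_cst)%:E * (`|p v| * l2_weight P v)%:E))%E); last first.
  rewrite ge0_integralZl//.
  - by rewrite lte_mul_pinfty// lee_fin.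
  - apply/measurable_EFinP; apply: measurable_funM; last exact: measurable_l2_weight.
    exact: measurableT_comp.
  - by move=> v _; rewrite lee_fin mulr_ge0// l2_weight_ge0.
apply: ge0_le_integral => //.
- by move=> v _; exact: integral_ge0.
- apply: (@measurable_fun_fubini_tonelli_F _ _ _ _ _ nu (fun z => `|(F z)%:E|%E)) => //.
  by apply: measurableT_comp => //; exact/measurable_EFinP.
- apply/measurable_EFinP; apply: measurable_funM => //.
  apply: measurable_funM; last exact: measurable_l2_weight.
  exact: measurableT_comp.
- move=> v _.
  have -> : (\int[nu]_u `|(F (v, u))%:E| = `|p v|%:E * \int[nu]_u (K v u * `|psi v - psi u|)%:E)%E.
    rewrite -ge0_integralZl//.
    + apply: eq_integral => u _; rewrite /F /= normrM (ger0_norm (K3_ge0 P _ _)) normrM -EFinM.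
      by rewrite mulrCA.
    + apply/measurable_EFinP; apply: measurable_funM.
        exact: (measurableT_comp measurable_K3 (measurable_pairl v)).
      by apply: measurableT_comp => //; exact: measurable_funB.
    + by move=> u _; rewrite lee_fin mulr_ge0// K3_ge0.
  apply: (@le_trans _ _ (`|p v|%:E * (M * gen_cst * l2_weight P v)%:E)%E).
    by apply: lee_wpmul2l; [rewrite lee_fin|exact: inner_gen].
  by rewrite -!EFinM lee_fin le_eqVlt; apply/orP; left; apply/eqP; ring.
Qed.

Let iF : (nu \x nu)%E.-integrable setT (EFin \o F).
Proof. by apply/integrable12ltyP => //; exact/measurable_EFinP. Qed.

Let inner (c : R) v : (\int[nu]_u (K v u * (c * (psi v - psi u)))%:E = (c * gen_fun psi v)%:E)%E.
Proof.
rewrite integral_nu; last first.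
  apply: measurable_funM; first exact: (measurableT_comp measurable_K3 (measurable_pairl v)).
  by apply: measurable_funM => //; exact: measurable_funB.
rewrite (_ : (\int[leb]_x _)%E = (\int[leb]_u (c * (kk P 0 v u * (psi v - psi u)))%:E)%E).
  by rewrite -EFin_Rint ?RintZ//; [exact: itg_gen_signed|apply: itgZ; exact: itg_gen_signed].
by apply: eq_integral => u _; rewrite -K3_density; congr EFin; ring.
Qed.

Lemma integrable_gen_fun : nu.-integrable setT (fun v => (p v * gen_fun psi v)%:E).
Proof.
have := integrable_fubini_F iF; apply: eq_integrable => // v _.
by rewrite /fubini_F /= /F /= inner.
Qed.

Lemma integral_gen_fun :
  (\int[nu \x nu]_z (F z)%:E = \int[nu]_v (p v * gen_fun psi v)%:E)%E.
Proof.
rewrite -(integral12_prod_meas1 iF); apply: eq_integral => v _.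
by rewrite /fubini_F /= /F /= inner.
Qed.

(** Minus [F] with its variables exchanged. By symmetry of [K3] the integrand of the form is
    [F - F'], and the integrals of [F] and [F'] are opposite. *)
Let F' (z : R * R) : R := - F (z.2, z.1).

Let mF' : measurable_fun setT F'.
Proof.
apply: measurable_funN => //; apply: (measurableT_comp mF).
exact: measurable_swap.
Qed.

Let iF' : (nu \x nu)%E.-integrable setT (EFin \o F').
Proof.
apply/integrable21ltyP; first exact/measurable_EFinP.
by under eq_integral do under eq_integral do rewrite /F' /= normrN.
Qed.

Let int_F' : (\int[nu \x nu]_z (F' z)%:E = - \int[nu \x nu]_z (F z)%:E)%E.
Proof.
rewrite -(integral21_prod_meas1 iF') integral_gen_fun -mulN1e -integralZl//; last exact: integrable_gen_fun.
apply: eq_integral => v _; rewrite /fubini_G /F' /F /= -EFinM mulN1r -mulNr -inner.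
by apply: eq_integral => u _; congr EFin; ring.
Qed.

Let formE z : K z.1 z.2 * ((p z.1 - p z.2) * (psi z.1 - psi z.2)) = F z - F' z.
Proof. by rewrite /F' /F /= (K3_sym P z.2 z.1); ring. Qed.

Lemma integrable_form_gen_fun : (nu \x nu)%E.-integrable setT
  (fun z : R * R => (K z.1 z.2 * ((p z.1 - p z.2) * (psi z.1 - psi z.2)))%:E).
Proof.
have := integrableB measurableT iF iF'; apply: eq_integrable => // z _.
by rewrite formE EFinB.
Qed.

(** The jump analogue of integration by parts; the 2 cancels the 1/2 in [Qtilde]. Fubini applies
    because [gen_fun psi] converges absolutely with a bound by [l2_weight], against which [p] is
    integrable. *)
Lemma integral_form_gen_fun :
  \int[(nu \x nu)%E]_z (K z.1 z.2 * ((p z.1 - p z.2) * (psi z.1 - psi z.2))) =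
  2 * \int[nu]_v (p v * gen_fun psi v).
Proof.
rewrite /Rintegral -integral_gen_fun.
have -> : (\int[nu \x nu]_z (K z.1 z.2 * ((p z.1 - p z.2) * (psi z.1 - psi z.2)))%:E =
    \int[nu \x nu]_z (F z)%:E - \int[nu \x nu]_z (F' z)%:E)%E.
  by rewrite -integralB//; apply: eq_integral => z _; rewrite formE EFinB.
rewrite int_F' oppeK fineD ?integrable_fin_num//.
by rewrite mulr2n mulrDl mul1r.
Qed.
End test_function.
End generator_graph.

Section L2dot_bound.
Context {R : realType}.
Local Notation Re := (@complex.Re R).
Local Notation Im := (@complex.Im R).
Implicit Types (phi chi : R -> R[i]).
Local Open Scope complex_scope.

Lemma cabs_conj (a : R[i]) : cabs a^* = cabs a.
Proof. by case: a => x y; rewrite !cabsE /= sqrrN. Qed.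

(** Cauchy-Schwarz is applied to the real and imaginary parts separately, hence the factor 2. *)
Lemma L2dot_le phi chi : in_L2 phi -> in_L2 chi ->
  cabs (L2dot phi chi) <= 2 * (L2n phi * L2n chi).
Proof.
move=> hp hc.
have [mpr mpi] := in_L2_measurable hp; have [mcr mci] := in_L2_measurable hc.
have cs := cauchy_schwarz_nu (in_L2_measurable hp) (in_L2_measurable hc).
rewrite (L2norm_L2n hp) (L2norm_L2n hc) -EFinM in cs.
have b (f : R -> R) : measurable_fun setT f -> (forall v, `|f v| <= cabs (phi v) * cabs (chi v)) ->
    `|\int[nu]_v f v| <= L2n phi * L2n chi.
  move=> mf hf.
  have h : (\int[nu]_v `|(f v)%:E| <= (L2n phi * L2n chi)%:E)%E.
    apply: le_trans cs; apply: ge0_le_integral => //.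
    - by apply: measurableT_comp => //; exact/measurable_EFinP.
    - apply/measurable_EFinP; apply: measurable_funM; apply: measurable_cabs;
        exact: in_L2_measurable.
    - by move=> v _; rewrite lee_fin.
  have i : nu.-integrable setT (EFin \o f).
    by apply/integrableP; split; [exact/measurable_EFinP|apply: le_lt_trans h _; rewrite ltry].
  apply: le_trans (le_normr_Rintegral measurableT i) _.
  rewrite -lee_fin /Rintegral fineK//.
  by apply: integrable_fin_num => //; exact: (integrable_norm i).
apply: le_trans (cabs_le _) _; rewrite mulr2n mulrDl mul1r.
have hc2 (a c : R[i]) : cabs (a^* * c) = cabs a * cabs c.
  by rewrite ComplexField.Normc.normcM cabs_conj.
apply: lerD; apply: b.
- rewrite (_ : (fun v => _) = (fun v => Re (phi v) * Re (chi v) + Im (phi v) * Im (chi v))).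
    by apply: measurable_funD; apply: measurable_funM.
  by apply/funext => v; case: (phi v) => ? ?; case: (chi v) => ? ? /=; ring.
- by move=> v; rewrite -hc2; exact: Re_le_cabs.
- rewrite (_ : (fun v => _) = (fun v => Re (phi v) * Im (chi v) - Im (phi v) * Re (chi v))).
    by apply: measurable_funB; apply: measurable_funM.
  by apply/funext => v; case: (phi v) => ? ?; case: (chi v) => ? ? /=; ring.
- by move=> v; rewrite -hc2; exact: Im_le_cabs.
Qed.
End L2dot_bound.

Section graph.
Context {R : realType}.
Variable P : model R.
Local Notation n := (nb P).
Local Notation G := (Ginf (al P) (me P) (mu_ P)).
Local Notation K := (K3 (nb P)).
Local Notation Re := (@complex.Re R).
Local Notation Im := (@complex.Im R).
Local Open Scope complex_scope.
Hypothesis mu716 : mu_ P <= 7 / 16.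
Variables (d g : R).
Hypothesis d01 : 0 < d <= 1.
Hypothesis g01 : 0 < g <= 1.
Variables (psi : R -> R) (M : R).
Hypothesis mpsi : measurable_fun setT psi.
Hypothesis M0 : 0 <= M.
Hypothesis hpsi : forall v u, `|psi v - psi u| <= M * (G v u * hh d g `|u - v|).

Let psiC v : R[i] := (psi v)%:C.
Let eta v : R[i] := (gen_fun P psi v)%:C.

Let l2psi : in_L2 psiC. Proof. exact: (in_L2_psi mu716 d01 g01 mpsi M0 hpsi). Qed.
Let l2eta : in_L2 eta. Proof. exact: (in_L2_gen_fun mu716 d01 g01 mpsi M0 hpsi). Qed.

Lemma weight_integrable (phi : R -> R[i]) (p : R -> R) : in_L2 phi -> measurable_fun setT p ->
  (forall v, `|p v| <= cabs (phi v)) -> (\int[nu]_v (`|p v| * l2_weight P v)%:E < +oo)%E.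
Proof.
move=> hphi mp hp; have hw := in_L2_weight mu716.
have cs := cauchy_schwarz_nu (in_L2_measurable hphi) (in_L2_measurable hw).
rewrite (L2norm_L2n hphi) (L2norm_L2n hw) -EFinM in cs.
apply: (@le_lt_trans _ _ (L2n phi * L2n (fun v => (l2_weight P v)%:C))%:E); last by rewrite ltry.
apply: le_trans cs; apply: ge0_le_integral => //.
- by move=> v _; rewrite lee_fin mulr_ge0// l2_weight_ge0.
- apply/measurable_EFinP; apply: measurable_funM; last exact: measurable_l2_weight.
  exact: measurableT_comp.
- by apply/measurable_EFinP; apply: measurable_funM; apply: measurable_cabs; exact: in_L2_measurable.
- move=> v _; rewrite lee_fin cabsR (ger0_norm (l2_weight_ge0 P v)).
  by apply: ler_wpM2r; [exact: l2_weight_ge0|exact: hp].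
Qed.

Let Re_form (k : R) (a b : R[i]) (x y : R) :
  Re (k%:C * ((a - b)^* * (x%:C - y%:C))) = k * ((Re a - Re b) * (x - y)).
Proof. by case: a => ? ?; case: b => ? ? /=; ring. Qed.

Let Im_form (k : R) (a b : R[i]) (x y : R) :
  Im (k%:C * ((a - b)^* * (x%:C - y%:C))) = k * ((- Im a - - Im b) * (x - y)).
Proof. by case: a => ? ?; case: b => ? ? /=; ring. Qed.

Lemma L2dot_gen_fun phi : in_L2 phi -> L2dot phi eta = Qtilde n phi psiC.
Proof.
move=> hphi; have [mr mi] := in_L2_measurable hphi.
have mNi : measurable_fun setT (fun v => - Im (phi v)) by exact: measurable_funN.
have ir := weight_integrable hphi mr (fun v => Re_le_cabs _).
have ii : (\int[nu]_v (`|- Im (phi v)| * l2_weight P v)%:E < +oo)%E.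
  by apply: (weight_integrable hphi mNi) => v; rewrite normrN; exact: Im_le_cabs.
have er := integral_form_gen_fun d01 g01 mpsi M0 hpsi mr ir.
have ei := integral_form_gen_fun d01 g01 mpsi M0 hpsi mNi ii.
rewrite /Qtilde /L2dot /cintegral.
have -> : \int[(nu \x nu)%E]_z Re ((K z.1 z.2)%:C * ((phi z.1 - phi z.2)^* * (psiC z.1 - psiC z.2))) =
    2 * \int[nu]_v (Re (phi v) * gen_fun P psi v).
  by rewrite -er; apply: eq_Rintegral => z _; rewrite Re_form.
have -> : \int[(nu \x nu)%E]_z Im ((K z.1 z.2)%:C * ((phi z.1 - phi z.2)^* * (psiC z.1 - psiC z.2))) =
    2 * \int[nu]_v (- Im (phi v) * gen_fun P psi v).
  by rewrite -ei; apply: eq_Rintegral => z _; rewrite Im_form.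
have -> : \int[nu]_v Re ((phi v)^* * eta v) = \int[nu]_v (Re (phi v) * gen_fun P psi v).
  by apply: eq_Rintegral => v _; rewrite /eta; case: (phi v) => ? ? /=; ring.
have -> : \int[nu]_v Im ((phi v)^* * eta v) = \int[nu]_v (- Im (phi v) * gen_fun P psi v).
  by apply: eq_Rintegral => v _; rewrite /eta; case: (phi v) => ? ? /=; ring.
set A : R := (\int[nu]_v (Re _ * _))%R; set B : R := (\int[nu]_v (- Im _ * _))%R.
by apply/eqP; rewrite eq_complex /=; apply/andP; split; apply/eqP; field.
Qed.

(** On functions with the Hölder-type bound the form is represented by an element of [L^2(nu)],
    which gives both membership in the domain and the value of the operator. This is what places the
    Euler iterates in the domain of the generator. *)
Lemma L3_gen_fun : L3 n psiC eta.
Proof.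
have iw : (\int[nu]_v (`|psi v| * l2_weight P v)%:E < +oo)%E.
  by apply: (weight_integrable l2psi mpsi) => v; rewrite cabsR.
split => //; last first.
  by move=> phi [hphi _]; rewrite L2dot_gen_fun// /Q addrK.
split.
  split => //; rewrite /Qdiag.
  have : (\int[nu \x nu]_z (K z.1 z.2 * cabs (psiC z.1 - psiC z.2)%R ^+ 2)%:E < +oo)%E.
    rewrite (_ : (\int[_]_z _)%E = (\int[nu \x nu]_z (K z.1 z.2 * ((psi z.1 - psi z.2) * (psi z.1 - psi z.2)))%:E)%E).
      have := integrable_form_gen_fun d01 g01 mpsi M0 hpsi mpsi iw.
      by move=> /integrable_fin_num -/(_ measurableT); rewrite fin_numE ltey => /andP[].
    apply: eq_integral => z _.
    have -> : psiC z.1 - psiC z.2 = (psi z.1 - psi z.2)%:C by rewrite /psiC rmorphB.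
    by rewrite cabsR real_normK ?num_real// expr2.
  move=> h; apply: lte_add_pinfty; first by rewrite lte_mul_pinfty// lee_fin.
  by rewrite L2norm_sqr L2n_sqr// ltry.
exists (2 * (L2n eta + L2n psiC)) => phi [hphi _].
rewrite (L2norm_L2n hphi) -EFinM lee_fin /Q -L2dot_gen_fun//.
apply: le_trans (cabsD _ _) _.
apply: le_trans (lerD (L2dot_le hphi l2eta) (L2dot_le hphi l2psi)) _.
by rewrite le_eqVlt; apply/orP; left; apply/eqP; ring.
Qed.
End graph.

(** * Convergence of the Euler scheme *)

Section exp_semigroup.
Context {R : realType}.
Local Open Scope complex_scope.
(** Through [Rcomplex] the scalars are restricted to the reals, so that complex functions form a
    real vector space as in the abstract section. *)
Local Notation V := (R -> Rcomplex R).

Lemma fct_scaleE (a : R) (x : R -> R[i]) : (a *: (x : V) : V) = (fun v => a%:C * x v).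
Proof.
apply/funext => v; change (scalec a (x v) = a%:C * x v).
by case: (x v) => b c /=; apply/eqP; rewrite eq_complex /= !mul0r subr0 addr0 !eqxx.
Qed.

Lemma L2norm_cvg0 (f : R -> R -> R[i]) : L2norm (f t) @[t --> 0^'+] --> 0%E ->
  forall eps, 0 < eps -> exists2 d, 0 < d & forall t, 0 < t -> t < d -> L2n (f t) <= eps.
Proof.
move=> h eps eps0.
have : \forall t \near 0^'+, (L2norm (f t) < eps%:E)%E.
  have hn : nbhs (0 : \bar R)%E (fun u => (u < eps%:E)%E) by apply: open_ereal_lt'; rewrite lte_fin.
  exact: (h _ hn).
rewrite /at_right /within /= => /nbhs_ballP [d /= d0 hd].
exists d => // t t0 td.
have := hd t; rewrite /ball /= sub0r normrN gtr0_norm// => /(_ td t0).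
have := L2norm_ge0 (f t); rewrite /L2n; case: (L2norm _) => //= r _.
by rewrite lte_fin => /ltW.
Qed.

Variables (A : (R -> R[i]) -> (R -> R[i]) -> Prop) (S : R -> (R -> R[i]) -> R -> R[i]).
Hypothesis hS : is_exp_semigroup A S.

Let L2_lin (a : R) (x y : V) : in_L2 x -> in_L2 y -> in_L2 (a *: x + y).
Proof.
move=> hx hy; rewrite fct_scaleE.
exact: (in_L2D (in_L2Z a%:C hx).1 hy).1.
Qed.

Let L2_sub (x y : V) : in_L2 x -> in_L2 y -> in_L2 (x - y).
Proof.
move=> hx hy; have := L2_lin (-1) hy hx.
by rewrite scaleN1r addrC.
Qed.

Let ND (x y : V) : in_L2 x -> in_L2 y -> L2n (x + y) <= L2n x + L2n y.
Proof. by move=> hx hy; exact: (in_L2D hx hy).2. Qed.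

Let NZ (a : R) (x : V) : in_L2 x -> L2n (a *: x) = `|a| * L2n x.
Proof. by move=> hx; rewrite fct_scaleE (in_L2Z a%:C hx).2 cabsR. Qed.

Let ae0 (x y : V) : in_L2 x -> in_L2 y -> {ae nu, forall v, x v = y v} -> L2n (x - y) = 0.
Proof.
move=> hx hy h; apply/(L2n_eq0 (L2_sub hx hy)).
by apply: filterS h => v e; rewrite /= !fctE e subrr.
Qed.

Let SP t (x : V) : 0 <= t -> in_L2 x -> in_L2 (S t x : V).
Proof. by case: hS => -[h _] _; exact: h. Qed.

Let Slin t (a : R) (x y : V) : 0 <= t -> in_L2 x -> in_L2 y ->
  L2n ((S t (a *: x + y) : V) - (a *: (S t x : V) + S t y)) = 0.
Proof.
move=> t0 hx hy; apply: ae0.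
- by apply: SP => //; exact: L2_lin.
- by apply: L2_lin; exact: SP.
case: hS => -[_ [h _]] _; have := h t a%:C x y t0 hx hy.
by rewrite !fct_scaleE; apply: filterS => v ->.
Qed.

Let Sbnd t : 0 <= t -> exists M, forall x : V, in_L2 x -> L2n (S t x) <= M * L2n x.
Proof.
move=> t0; case: hS => -[_ [_ [h _]]] _; have [M hM] := h t t0.
exists M => x hx; have := hM x hx.
by rewrite (L2norm_L2n hx) (L2norm_L2n (SP t0 hx)) -EFinM lee_fin.
Qed.

Let S0 (x : V) : in_L2 x -> L2n ((S 0 x : V) - x) = 0.
Proof.
move=> hx; apply: ae0 => //; first exact: SP.
by case: hS => -[_ [_ [_ [h _]]]] _; exact: h.
Qed.

Let SD s t (x : V) : 0 <= s -> 0 <= t -> in_L2 x ->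
  L2n ((S (s + t) x : V) - S s (S t x)) = 0.
Proof.
move=> s0 t0 hx; apply: ae0.
- by apply: SP => //; exact: addr_ge0.
- by apply: SP => //; exact: SP.
by case: hS => -[_ [_ [_ [_ [h _]]]]] _; exact: h.
Qed.

Let Scont (x : V) : in_L2 x -> forall eps, 0 < eps ->
  exists2 d, 0 < d & forall t, 0 < t -> t < d -> L2n ((S t x : V) - x) <= eps.
Proof.
move=> hx; case: hS => -[_ [_ [_ [_ [_ h]]]]] _.
exact: (@L2norm_cvg0 (fun t v => S t x v - x v) (h x hx)).
Qed.

Let complete (x : nat -> V) : (forall n, in_L2 (x n)) ->
  (forall n, L2n (x n.+1 - x n) <= 4^-1 ^+ n.+1) ->
  exists2 y : V, in_L2 y & forall n, L2n (y - x n) <= 3^-1 * 4^-1 ^+ n.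
Proof. by move=> hx hs; exact: (L2_complete hx hs). Qed.

Lemma exp_semigroup_bounded : exists d M, [/\ 0 < d, 0 <= M &
  forall t (x : R -> R[i]), 0 <= t -> t <= d -> in_L2 x -> L2n (S t x) <= M * L2n x].
Proof.
have [d [M [d0 M0 h]]] := @semigroup_locally_bounded R V in_L2 L2n S L2_lin in_L2_0.1 L2n_ge0 ND NZ complete SP Slin Sbnd S0 Scont.
by exists d, M; split => // t x t0 td hx; exact: (h t x t0 td hx).
Qed.

Lemma exp_semigroup_generates (x a : R -> R[i]) : in_L2 x -> A x a -> in_L2 a ->
  @generates R V in_L2 L2n S x a.
Proof.
move=> hx hA ha; split => // eps eps0.
have /(hS.2 x a hx ha) := hA => /L2norm_cvg0 /(_ eps eps0)[d d0 hd].
exists d => // t t0 td; have := hd t t0 td.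
by rewrite fct_scaleE.
Qed.

Lemma exp_semigroup_euler (d M : R) (phi b : nat -> R -> R[i]) n h eta :
  0 <= M -> (forall t (x : R -> R[i]), 0 <= t -> t <= d -> in_L2 x -> L2n (S t x) <= M * L2n x) ->
  0 <= h -> n%:R * h <= d -> 0 <= eta ->
  (forall j, in_L2 (phi j)) -> (forall j, in_L2 (b j)) ->
  (forall j, phi j.+1 = (fun v => phi j v - h%:C * b j v)) ->
  (forall j s, (j < n)%N -> 0 <= s <= h -> exists a,
     [/\ in_L2 a, A (fun v => phi j v - s%:C * b j v) a & L2n (fun v => a v - b j v) <= eta]) ->
  L2n (fun v => S (n%:R * h) (phi 0%N) v - phi n v) <= M ^+ 2 * eta * (n%:R * h).
Proof.
move=> M0 Mb h0 nh eta0 hp hb hphi hA.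
apply: (@semigroup_euler R V in_L2 L2n S L2_lin in_L2_0.1 L2n_ge0 ND NZ SP Slin S0 SD Scont
  d M M0 Mb phi b n h eta) => //.
- by move=> j; rewrite hphi fct_scaleE.
- move=> j s jn hs; have [a [ha hAa hab]] := hA j s jn hs.
  exists a => //; rewrite fct_scaleE; apply: exp_semigroup_generates => //.
  have := L2_sub (hp j) (in_L2Z s%:C (hb j)).1.
  by [].
Qed.
End exp_semigroup.

Section approximation.
Context {R : realType}.
Local Notation leb := (@lebesgue_measure R).
Variable P : model R.
Local Notation n := (nb P).
Local Notation G := (Ginf (al P) (me P) (mu_ P)).
Local Notation k := (kk P).
Local Open Scope complex_scope.
Implicit Types (v u s h e t : R).
Hypothesis mu716 : mu_ P <= 7 / 16.
Variables (d g : R).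
Hypotheses (d0 : 0 < d) (d1 : d <= 1 / 100) (g0 : 0 < g) (g8 : g <= 1 / 8).

Let d01 : 0 < d <= 1. Proof. by rewrite d0 (le_trans d1)//; lra. Qed.
Let g01 : 0 < g <= 1. Proof. by rewrite g0 (le_trans g8)//; lra. Qed.

Let hh1 (r : R) : 0 <= r -> hh d g r <= 1. Proof. exact: (hh_le1 d0 (lexx d) g0). Qed.

Let dc0 : 0 <= 2 * drift_cst * n.
Proof. exact: mulr_ge0 (mulr_ge0 (ler0n R 2) (@drift_cst_ge0 R)) (nb_ge0 P). Qed.

Definition reg_gen e (phi : R -> R) v := \int[leb]_u (k e v u * (phi v - phi u)).

Lemma measurable_reg_gen e (phi : R -> R) : measurable_fun setT phi ->
  measurable_fun setT (reg_gen e phi).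
Proof.
move=> mphi.
apply: (@measurable_Rintegral _ (fun z => k e z.1 z.2 * (phi z.1 - phi z.2))).
apply: measurable_funM; first by apply: measurable_kk.
by apply: measurable_funB; apply: measurableT_comp.
Qed.

Lemma Gs_le_hh e th v u : 0 < e -> e <= d -> 0 <= th ->
  Gs P e d g th v u <= G v u * hh d g `|u - v|.
Proof.
move=> e0 ed th0; rewrite /Gs /Bs distrC; apply: ler_wpM2l; first exact: G_ge0.
rewrite ler_piMr ?hh_ge0//; apply: expRN_le1; apply: mulr_ge0; last exact: Lam_ge0.
by rewrite mulr_ge0// addr_ge0// qq_ge0 ?(ltW e0).
Qed.

Lemma Gs0E e v u : Gs P e d g 0 v u = G v u * hh d g `|u - v|.
Proof. by rewrite /Gs /Bs distrC !mul0r oppr0 expR0 mulr1. Qed.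

Section one_function.
Variables (e M : R) (phi : R -> R).
Hypotheses (e0 : 0 < e) (e1 : e <= 1) (mphi : measurable_fun setT phi) (M0 : 0 <= M).

Let he : 0 < e <= 1. Proof. by rewrite e0. Qed.
Let k0 v u : 0 <= k e v u. Proof. exact: kk_ge0 (ltW e0). Qed.

Lemma itg_reg_gen v : (forall v u, `|phi v - phi u| <= M * G v u) ->
  itg (fun u => k e v u * (phi v - phi u)).
Proof.
move=> hphi; apply: itg_le (itgZ M (itg_kkG P v v he)).
  by apply: measurable_funM; [exact: measurable_kk|exact: measurable_funB].
move=> u; rewrite normrM ger0_norm// mulrCA [G u v]G_sym.
by apply: ler_wpM2l.
Qed.

Definition reg_cst : R := rate P e + drift_cst * n.

Lemma reg_cst_ge0 : 0 <= reg_cst.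
Proof. by apply: addr_ge0; [exact: rate_ge0|apply: mulr_ge0; [exact: drift_cst_ge0|exact: nb_ge0]]. Qed.

Lemma reg_gen_le v : (forall v u, `|phi v - phi u| <= M * G v u) ->
  `|reg_gen e phi v| <= M * (reg_cst * G v v).
Proof.
move=> hphi; have iG := itg_kkG P v v he; have [ik bk] := itg_kk P v he.
apply: (@le_trans _ _ (\int[leb]_u (M * (k e v u * G u v)))).
  apply: Rint_norm_le; [exact: itg_reg_gen|exact: itgZ|].
  move=> u; rewrite normrM ger0_norm// mulrCA [G u v]G_sym.
  by apply: ler_wpM2l.
rewrite RintZ//; apply: ler_wpM2l => //.
have h1 := drift_Gc P v v he.
have e2 : \int[leb]_u (k e v u * (G u v - G v v)) = \int[leb]_u (k e v u * G u v) - G v v * \int[leb]_u k e v u.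
  rewrite -RintZ// -RintB//; last exact: itgZ.
  by apply: eq_Rintegral => u _; ring.
have h2 := ler_wpM2l (G_ge0 P v v) bk.
rewrite e2 lerBlDr in h1; apply: (le_trans h1).
by rewrite /reg_cst [leRHS]mulrDl addrC lerD2r [leRHS]mulrC.
Qed.

(** Meant for the second application of the regularised generator: its first image obeys a pointwise
    bound but no bound on differences, so the rate is not compensated. *)
Lemma reg_gen_diag (c : R) v : 0 <= c -> (forall v, `|phi v| <= c * G v v) ->
  itg (fun u => k e v u * (phi v - phi u)) /\
  `|reg_gen e phi v| <= c * ((rate P e + rateG P e) * G v v).
Proof.
move=> c0 hphi; have [ik bk] := itg_kk P v he.
have iD : itg (fun u => k e v u * G u u).
  apply: (@itg_kk_le _ P _ e v 1) => //.
    by apply: measurable_funM; [exact: measurable_kk|exact: measurable_Ginf].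
  by move=> u; rewrite mul1r ger0_norm// mulr_ge0 ?G_ge0.
have bD := Rint_kk_G_diag P v he.
have iS : itg (fun u => c * (G v v * k e v u + k e v u * G u u)).
  by apply: itgZ; apply: itgD => //; exact: itgZ.
have h u : `|k e v u * (phi v - phi u)| <= c * (G v v * k e v u + k e v u * G u u).
  rewrite normrM ger0_norm//.
  have h1 : `|phi v - phi u| <= c * G v v + c * G u u.
    by apply: le_trans (ler_normB _ _) _; exact: lerD.
  apply: le_trans (ler_wpM2l (k0 v u) h1) _.
  by rewrite le_eqVlt; apply/orP; left; apply/eqP; ring.
have i : itg (fun u => k e v u * (phi v - phi u)).
  apply: itg_le iS => //.
  by apply: measurable_funM; [exact: measurable_kk|exact: measurable_funB].
split => //; apply: le_trans (Rint_norm_le i iS h) _.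
rewrite RintZ; last by apply: itgD => //; exact: itgZ.
apply: ler_wpM2l => //; rewrite RintD//; last exact: itgZ.
rewrite RintZ// [leRHS]mulrDl [X in _ <= X + _]mulrC; apply: lerD => //.
by apply: ler_wpM2l => //; exact: G_ge0.
Qed.

Definition consist_cst : R := 4 * kk_cst P d * (2 * (g / 2)^-1).

Lemma consist_cst_ge0 : 0 <= consist_cst.
Proof.
apply: mulr_ge0; first by apply: mulr_ge0 => //; exact: kk_cst_ge0.
by rewrite mulr_ge0// invr_ge0 divr_ge0// ltW.
Qed.

Lemma reg_gen_consistent v : (forall v u, `|phi v - phi u| <= M * (G v u * hh d g `|u - v|)) ->
  `|gen_fun P phi v - reg_gen e phi v| <= M * (consist_cst * e `^ (g / 2) * tail_weight P v).
Proof.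
move=> hphi.
have hphi1 x y : `|phi x - phi y| <= M * G x y.
  apply: le_trans (hphi x y) _; apply: ler_wpM2l => //.
  by rewrite ler_piMr ?G_ge0// hh1.
have g2 : 0 < g / 2 by rewrite divr_gt0.
have [ip bp] := itg_powint v g2.
have i1 := itg_gen_signed d01 g01 mphi M0 hphi v.
have i2 := itg_reg_gen v hphi1.
rewrite /gen_fun /reg_gen -RintB//.
have C0 : 0 <= kk_cst P d by exact: kk_cst_ge0.
have c0 : 0 <= M * (4 * kk_cst P d * e `^ (g / 2) * tail_weight P v).
  apply: mulr_ge0 => //; apply: mulr_ge0; last exact: tail_weight_ge0.
  by apply: mulr_ge0; [exact: mulr_ge0|exact: powR_ge0].
apply: (@le_trans _ _ (\int[leb]_u (M * (4 * kk_cst P d * e `^ (g / 2) * tail_weight P v) * powint (g / 2) `|u - v|))).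
  apply: Rint_norm_le; [exact: itgB|exact: itgZ|].
  move=> u; rewrite -mulrBl normrM distrC.
  apply: le_trans (ler_wpM2l (normr_ge0 _) (hphi v u)) _.
  have := kk_diff_le P d01 g01 he g8 v u => h.
  rewrite mulrCA; apply: le_trans (ler_wpM2l M0 h) _.
  by rewrite le_eqVlt; apply/orP; left; apply/eqP; ring.
rewrite RintZ//; apply: le_trans (ler_wpM2l c0 bp) _.
by rewrite /consist_cst le_eqVlt; apply/orP; left; apply/eqP; ring.
Qed.
End one_function.

Hypothesis dloss : 1 + 2 * loss_cst <= ln (1 / 100 / d).

Section euler_iterates.
Variables (e M h : R) (psi : R -> R) (N : nat).
Hypotheses (e0 : 0 < e) (ed : e <= d) (mpsi : measurable_fun setT psi) (M0 : 0 <= M).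
Hypothesis hpsi : forall v u, `|psi v - psi u| <= M * (G v u * hh d g `|u - v|).
Hypotheses (h0 : 0 <= h) (hr : h * (2 * rate P e) <= 1) (hN : N%:R * h <= 1 / 2).

Definition euler_seq j := iter j (euler P e h) psi.

Lemma measurable_euler_seq j : measurable_fun setT (euler_seq j).
Proof. by elim: j => [|j IH] //=; exact: measurable_euler. Qed.

Let hj j : (j <= N)%N -> 0 <= j%:R * h <= 1 / 2.
Proof.
move=> jN; rewrite mulr_ge0//=; apply: le_trans hN; apply: ler_wpM2r => //.
by rewrite ler_nat.
Qed.

Lemma euler_seq_Gs j : (j <= N)%N -> forall v u, `|euler_seq j v - euler_seq j u| <=
  M * expR (2 * drift_cst * n * (j%:R * h)) * Gs P e d g (j%:R * h) v u.
Proof.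
elim: j => [|j IH] jN v u /=.
  by rewrite mul0r mulr0 expR0 mulr1 Gs0E.
have ME : 0 <= M * expR (2 * drift_cst * n * (j%:R * h)) by rewrite mulr_ge0 ?expR_ge0.
have := euler_Gs e0 ed d1 g0 g8 (hj (ltnW jN)) v u dloss (measurable_euler_seq j) ME (IH (ltnW jN)) h0 hr.
move/le_trans; apply.
have jE : j.+1%:R * h = j%:R * h + h by rewrite -addn1 natrD mulrDl mul1r.
rewrite jE (mulrDr (2 * drift_cst * n)) expRD.
by rewrite le_eqVlt; apply/orP; left; apply/eqP; ring.
Qed.

Let M1 := M * expR (2 * drift_cst * n * (N%:R * h)).

Let M10 : 0 <= M1. Proof. by rewrite mulr_ge0 ?expR_ge0. Qed.

(** The points between two iterates are themselves Euler steps, of length [s <= h], hence as regular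
    as the iterates and in the domain of the generator. *)
Lemma euler_substep j s : (j < N)%N -> 0 <= s <= h -> forall v u,
  `|euler P e s (euler_seq j) v - euler P e s (euler_seq j) u| <= M1 * (G v u * hh d g `|u - v|).
Proof.
move=> jN /andP[s0 sh] v u.
have ME : 0 <= M * expR (2 * drift_cst * n * (j%:R * h)) by rewrite mulr_ge0 ?expR_ge0.
have sr : s * (2 * rate P e) <= 1.
  by apply: le_trans hr; apply: ler_wpM2r => //; rewrite mulr_ge0// rate_ge0.
have jh0 : 0 <= j%:R * h by rewrite mulr_ge0.
have := euler_Gs e0 ed d1 g0 g8 (hj (ltnW jN)) v u dloss (measurable_euler_seq j) ME (euler_seq_Gs (ltnW jN)) s0 sr.
move/le_trans; apply.
rewrite [leLHS](_ : _ = M * expR (2 * drift_cst * n * (j%:R * h)) * expR (2 * drift_cst * n * s) *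
  Gs P e d g (j%:R * h + s) v u); last by ring.
apply: ler_pM.
- by apply: mulr_ge0; [exact: ME|exact: expR_ge0].
- exact: Gs_ge0.
- rewrite /M1 -mulrA -expRD; apply: ler_wpM2l => //; rewrite ler_expR -mulrDr.
  apply: (ler_wpM2l dc0).
  apply: (@le_trans _ _ (j.+1%:R * h)); last by apply: ler_wpM2r => //; rewrite ler_nat.
  by rewrite -addn1 natrD mulrDl mul1r lerD2l.
- by apply: Gs_le_hh => //; exact: addr_ge0.
Qed.

Let e1 : e <= 1. Proof. by apply: le_trans ed _; case/andP: d01. Qed.

(** The first term is the error of replacing the generator by its regularisation. The second comes
    from freezing the regularised generator at the start of a step, which costs at most [h] times
    its second iterate. *)
Definition euler_err : R := M1 * (consist_cst * e `^ (g / 2) +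
  h * (reg_cst e * (rate P e + rateG P e))).

Lemma rateG_ge0 : 0 <= rateG P e.
Proof.
have i0 : 0 <= e^-1 by rewrite invr_ge0 ltW.
apply: mulr_ge0; last by rewrite mulr_ge0.
by apply: mulr_ge0; [rewrite mulr_ge0 ?nb_ge0|rewrite mulr_ge0// mulr_ge0// addr_ge0].
Qed.

Lemma euler_err_ge0 : 0 <= euler_err.
Proof.
apply: mulr_ge0 => //; apply: addr_ge0.
  by apply: mulr_ge0; [exact: consist_cst_ge0|exact: powR_ge0].
apply: mulr_ge0 => //; apply: mulr_ge0; first exact: reg_cst_ge0.
by rewrite addr_ge0 ?rate_ge0 ?rateG_ge0.
Qed.

Lemma euler_defect j s v : (j < N)%N -> 0 <= s <= h ->
  `|gen_fun P (euler P e s (euler_seq j)) v - reg_gen e (euler_seq j) v| <= euler_err * l2_weight P v.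
Proof.
move=> jN hs; have /andP[s0 sh] := hs.
set phi := euler_seq j; set chi := euler P e s phi.
have mphi : measurable_fun setT phi by exact: measurable_euler_seq.
have mchi : measurable_fun setT chi by exact: measurable_euler.
have hchi := euler_substep jN hs.
have hphi x y : `|phi x - phi y| <= M1 * G x y.
  have hz : 0 <= (0 : R) <= h by rewrite lexx.
  have := euler_substep jN hz x y; rewrite /euler !mul0r !subr0 => /le_trans; apply.
  by apply: ler_wpM2l => //; rewrite ler_piMr ?G_ge0// hh1.
have b1 := reg_gen_consistent e0 e1 mchi M10 v hchi.
have mb := measurable_reg_gen e mphi.
have c0 : 0 <= M1 * reg_cst e by rewrite mulr_ge0 ?reg_cst_ge0.
have hb x : `|reg_gen e phi x| <= M1 * reg_cst e * G x x.
  by rewrite -mulrA; exact: reg_gen_le.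
have [ib b2] := reg_gen_diag e0 e1 mb v c0 hb.
have i1 := itg_reg_gen e0 e1 mphi v hphi.
have e2 : reg_gen e chi v = reg_gen e phi v - s * reg_gen e (reg_gen e phi) v.
  rewrite {1}/reg_gen -RintZ// -RintB//; last exact: itgZ.
  by apply: eq_Rintegral => u _; rewrite /chi /euler -/(reg_gen e phi v) -/(reg_gen e phi u); ring.
rewrite (_ : _ - _ = (gen_fun P chi v - reg_gen e chi v) - s * reg_gen e (reg_gen e phi) v); last first.
  by rewrite e2; ring.
apply: le_trans (ler_normB _ _) _.
rewrite normrM (ger0_norm s0).
have TW := tail_weight_le P v; have GW := G_le_l2_weight P v.
have E0 : 0 <= consist_cst * e `^ (g / 2) by apply: mulr_ge0; [exact: consist_cst_ge0|exact: powR_ge0].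
have b3 : M1 * (consist_cst * e `^ (g / 2) * tail_weight P v) <= M1 * (consist_cst * e `^ (g / 2) * l2_weight P v).
  by apply: ler_wpM2l => //; apply: ler_wpM2l.
have r0 : 0 <= rate P e + rateG P e by rewrite addr_ge0 ?rate_ge0 ?rateG_ge0.
have b4 : s * `|reg_gen e (reg_gen e phi) v| <= h * (M1 * reg_cst e * ((rate P e + rateG P e) * l2_weight P v)).
  apply: ler_pM => //; apply: le_trans b2 _; apply: ler_wpM2l => //.
  exact: ler_wpM2l.
apply: le_trans (lerD (le_trans b1 b3) b4) _.
by rewrite /euler_err le_eqVlt; apply/orP; left; apply/eqP; ring.
Qed.

Variables (S : R -> (R -> R[i]) -> R -> R[i]) (dS MS : R).
Hypothesis hS : is_exp_semigroup (L3 n) S.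
Hypothesis MS0 : 0 <= MS.
Hypothesis SM : forall t (x : R -> R[i]), 0 <= t -> t <= dS -> in_L2 x -> L2n (S t x) <= MS * L2n x.
Hypothesis hdS : N%:R * h <= dS.

Lemma euler_seq_error :
  L2n (fun v => S (N%:R * h) (fun v => (psi v)%:C) v - (euler_seq N v)%:C) <=
  MS ^+ 2 * (euler_err * L2n (fun v => (l2_weight P v)%:C)) * (N%:R * h).
Proof.
(* The bounds on the iterates hold only up to index [N], whereas the abstract scheme is indexed by
   all integers; so the sequence is kept constant from [N] on. *)
pose f j := euler_seq (minn j N).
pose b j v := if (j < N)%N then reg_gen e (euler_seq j) v else 0.
have fl2 j : in_L2 (fun v => (f j v)%:C).
  have jN : (minn j N <= N)%N by exact: geq_minr.
  have MJ : 0 <= M * expR (2 * drift_cst * n * ((minn j N)%:R * h)) by rewrite mulr_ge0 ?expR_ge0.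
  apply: (in_L2_psi mu716 d01 g01 (measurable_euler_seq _) MJ) => v u.
  apply: le_trans (euler_seq_Gs jN v u) _; apply: ler_wpM2l => //.
  by apply: Gs_le_hh => //; rewrite mulr_ge0.
have bl2 j : in_L2 (fun v => (b j v)%:C).
  rewrite /b; case: ltnP => jN; last exact: in_L2_0.1.
  have c0 : 0 <= M1 * reg_cst e by rewrite mulr_ge0 ?reg_cst_ge0.
  apply: (in_L2_bounded mu716 (measurable_reg_gen e (measurable_euler_seq j)) c0 _).1 => v.
  apply: (@le_trans _ _ (M1 * (reg_cst e * G v v))).
    apply: reg_gen_le => //; first exact: measurable_euler_seq.
    move=> x y; have hz : 0 <= (0 : R) <= h by rewrite lexx.
    have := euler_substep jN hz x y; rewrite /euler !mul0r !subr0 => /le_trans; apply.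
    by apply: ler_wpM2l => //; rewrite ler_piMr ?G_ge0// hh1.
  by rewrite mulrA; apply: ler_wpM2l => //; exact: G_le_l2_weight.
have W0 := L2n_ge0 (fun v => (l2_weight P v)%:C).
have eta0 : 0 <= euler_err * L2n (fun v => (l2_weight P v)%:C) by rewrite mulr_ge0 ?euler_err_ge0.
have := @exp_semigroup_euler R _ S hS dS MS (fun j v => (f j v)%:C) (fun j v => (b j v)%:C) N h _
  MS0 SM h0 hdS eta0 fl2 bl2.
rewrite /f min0n minnn; apply.
- move=> j; apply/funext => v; rewrite -rmorphM -rmorphB; congr (_%:C).
  rewrite /b; case: (ltnP j N) => jN.
    by rewrite (minn_idPl jN).
  by rewrite mulr0 subr0 (minn_idPr (leqW jN)).
- move=> j s jN hs.
  have hchi := euler_substep jN hs.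
  have mchi := measurable_euler P e s (measurable_euler_seq j).
  exists (fun v => (gen_fun P (euler P e s (euler_seq j)) v)%:C); split.
  + exact: (in_L2_gen_fun mu716 d01 g01 mchi M10 hchi).
  + rewrite (_ : (fun v => _) = (fun v => (euler P e s (euler_seq j) v)%:C)).
      exact: (L3_gen_fun mu716 d01 g01 mchi M10 hchi).
    apply/funext => v; rewrite -rmorphM -rmorphB /b jN (minn_idPl (ltnW jN)).
    by [].
  + rewrite (_ : (fun v => _) = (fun v => (gen_fun P (euler P e s (euler_seq j)) v - reg_gen e (euler_seq j) v)%:C)).
      apply: (in_L2_bounded mu716 _ euler_err_ge0 _).2.
        apply: measurable_funB; first by apply: measurable_gen_fun.
        by apply: measurable_reg_gen; exact: measurable_euler_seq.
      by move=> v; exact: euler_defect.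
    by apply/funext => v; rewrite -rmorphB /b jN.
Qed.
End euler_iterates.
End approximation.

(** * Passage to the limit in the scheme *)

Section limit.
Context {R : realType}.
Variable P : model R.
Local Notation n := (nb P).
Local Notation G := (Ginf (al P) (me P) (mu_ P)).
Local Open Scope complex_scope.
Implicit Types (v u w s h e t : R).
Hypothesis mu716 : mu_ P <= 7 / 16.
Variables (d g : R).
Hypotheses (d0 : 0 < d) (d1 : d <= 1 / 100) (g0 : 0 < g) (g8 : g <= 1 / 8).
Hypothesis dloss : 1 + 2 * loss_cst <= ln (1 / 100 / d).
Variables (S : R -> (R -> R[i]) -> R -> R[i]) (dS MS : R).
Hypothesis hS : is_exp_semigroup (L3 n) S.
Hypothesis MS0 : 0 <= MS.
Hypothesis SM : forall t (x : R -> R[i]), 0 <= t -> t <= dS -> in_L2 x -> L2n (S t x) <= MS * L2n x.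
Variables (M : R) (psi : R -> R).
Hypotheses (mpsi : measurable_fun setT psi) (M0 : 0 <= M).
Hypothesis hpsi : forall v u, `|psi v - psi u| <= M * (G v u * hh d g `|u - v|).

Let d01 : 0 < d <= 1. Proof. by rewrite d0 (le_trans d1)//; lra. Qed.
Let g01 : 0 < g <= 1. Proof. by rewrite g0 (le_trans g8)//; lra. Qed.

Definition growth t : R := M * expR (2 * drift_cst * n * t).

Lemma growth_ge0 t : 0 <= growth t.
Proof. by apply: mulr_ge0; [exact: M0|exact: expR_ge0]. Qed.

Lemma scale_split (A B c e h eps : R) : 0 <= c ->
  c * (A * e) <= eps / 2 -> c * (h * B) <= eps / 2 -> c * (A * e + h * B) <= eps.
Proof. by move=> c0 h1 h2; rewrite mulrDr; lra. Qed.

(** The order of the choices matters: [e] is fixed first, from the consistency error, and only then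
    the number of steps, since the constants multiplying [h] blow up as [e] tends to 0. *)
Lemma euler_approx t eps : 0 <= t <= 1 / 2 -> t <= dS -> 0 < eps ->
  exists ephi : R * (R -> R), [/\ 0 < ephi.1 <= eps, ephi.1 <= d,
    in_L2 (fun v => (ephi.2 v)%:C),
    forall v u, `|ephi.2 v - ephi.2 u| <= growth t * Gs P ephi.1 d g t v u &
    L2n (fun v => S t (fun v => (psi v)%:C) v - (ephi.2 v)%:C) <= eps].
Proof.
move=> /andP[t0 t1] tS eps0.
set W := L2n (fun v => (l2_weight P v)%:C).
have W0 : 0 <= W by exact: L2n_ge0.
have gr0 := growth_ge0 t.
pose c := MS ^+ 2 * (growth t * W) * t.
have c0 : 0 <= c.
  by apply: mulr_ge0 => //; apply: mulr_ge0; [exact: sqr_ge0|exact: mulr_ge0].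
set CC := consist_cst P d g; have CC0 : 0 <= CC by exact: consist_cst_ge0.
pose x := eps / (2 * (c * CC + 1)).
have cc0 : 0 <= c * CC by exact: mulr_ge0.
have x0 : 0 < x by rewrite divr_gt0// mulr_gt0// ltr_wpDl.
pose e := Num.min (Num.min eps d) (x `^ (2 / g)).
have e0 : 0 < e by rewrite !lt_min eps0 d0 powR_gt0.
have ed : e <= d by rewrite !ge_min lexx orbT.
have ee : e <= eps by rewrite !ge_min lexx.
have eg : e `^ (g / 2) <= x.
  have h : e `^ (g / 2) <= (x `^ (2 / g)) `^ (g / 2).
    apply: ge0_ler_powR; rewrite ?nnegrE ?powR_ge0 ?(ltW e0)//.
      by rewrite divr_ge0// ltW.
    by rewrite ge_min lexx orbT.
  apply: le_trans h _; rewrite -powRrM (_ : 2 / g * (g / 2) = 1); last by field; rewrite gt_eqF.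
  by rewrite powRr1// ltW.
have b1 : c * (CC * e `^ (g / 2)) <= eps / 2.
  rewrite mulrA; apply: le_trans (ler_wpM2l cc0 eg) _.
  rewrite /x mulrA ler_pdivrMr; last by rewrite mulr_gt0// ltr_wpDl.
  rewrite (_ : eps / 2 * (2 * (c * CC + 1)) = c * CC * eps + eps); last by field.
  by rewrite lerDl ltW.
set B := reg_cst P e * (rate P e + rateG P e).
have B0 : 0 <= B.
  apply: mulr_ge0; first by apply: reg_cst_ge0.
  by apply: addr_ge0; [exact: rate_ge0|exact: rateG_ge0].
(* The first summand secures the restriction [h * (2 * rate) <= 1], the second makes the term of
   order [h] in the error at most [eps / 2]. *)
pose z := t * (2 * rate P e) + c * t * B * (2 / eps).
have [N N0 zN] : exists2 N : nat, 0 < N%:R :> R & z <= N%:R.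
  by exists (Num.Def.truncn z).+1; [rewrite ltr0n|apply: ltW; exact: truncnS_gt].
have r0 : 0 <= t * (2 * rate P e).
  by apply: mulr_ge0 => //; apply: mulr_ge0 => //; exact: rate_ge0.
have q0 : 0 <= c * t * B * (2 / eps).
  by apply: mulr_ge0; [apply: mulr_ge0 => //; exact: mulr_ge0|rewrite divr_ge0// ltW].
pose h := t / N%:R.
have h0 : 0 <= h by rewrite divr_ge0// ltW.
have Nh : N%:R * h = t by rewrite /h mulrC divfK// gt_eqF.
have hr : h * (2 * rate P e) <= 1.
  rewrite /h mulrAC ler_pdivrMr// mul1r; apply: le_trans zN; rewrite lerDl//.
have b2 : c * (h * B) <= eps / 2.
  rewrite (_ : c * (h * B) = c * t * B / N%:R); last by rewrite /h; ring.
  rewrite ler_pdivrMr// -ler_pdivrMl; last by rewrite divr_gt0.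
  rewrite invf_div mulrC; apply: le_trans zN; rewrite lerDr//.
have hN : N%:R * h <= 1 / 2 by rewrite Nh.
have jN : (N <= N)%N by [].
exists (e, euler_seq P e h psi N) => /=; split.
- by rewrite e0 ee.
- exact: ed.
- have := euler_seq_Gs d1 g0 g8 dloss e0 ed mpsi M0 hpsi h0 hr hN jN => hG.
  have MJ : 0 <= M * expR (2 * drift_cst * n * (N%:R * h)).
    by apply: mulr_ge0; [exact: M0|exact: expR_ge0].
  have me : measurable_fun setT (euler_seq P e h psi N) by apply: measurable_euler_seq.
  apply: (in_L2_psi mu716 d01 g01 me MJ) => v u.
  apply: le_trans (hG v u) _; apply: (ler_wpM2l MJ).
  by apply: Gs_le_hh => //; rewrite Nh.
- move=> v u.
  have := euler_seq_Gs d1 g0 g8 dloss e0 ed mpsi M0 hpsi h0 hr hN jN v u.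
  by rewrite Nh.
- have hdS : N%:R * h <= dS by rewrite Nh.
  have := euler_seq_error mu716 d0 d1 g0 g8 dloss e0 ed mpsi M0 hpsi h0 hr hN hS MS0 SM hdS.
  rewrite /euler_err Nh -/(growth t) -/W -/B -/CC => h1.
  apply: le_trans h1 _; apply: le_trans (scale_split c0 b1 b2).
  by rewrite le_eqVlt; apply/orP; left; apply/eqP; rewrite /c; ring.
Qed.

Lemma qq_e_ge e v : 0 <= e -> qq P 0 v - e <= qq P e v.
Proof.
move=> e0; rewrite /qq addr0.
set m := 1 / 4 * Num.min 1 n; set X := expR v; have X0 : 0 < X by exact: expR_gt0.
have m0 : 0 <= m.
  by apply: mulr_ge0; [lra|rewrite le_min ler01 nb_ge0].
have m1 : m <= 1.
  have : Num.min 1 n <= 1 by rewrite ge_min lexx.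
  by rewrite /m; lra.
have A1 : 0 < 1 + X by lra.
have A2 : 0 < 1 + e + X by lra.
rewrite lerBlDr -subr_ge0.
have -> : m / (1 + e + X) + e - m / (1 + X) = e * ((1 + X) * (1 + e + X) - m) / ((1 + X) * (1 + e + X)).
  by field; rewrite !gt_eqF.
apply: divr_ge0; last by rewrite mulr_ge0// ltW.
apply: mulr_ge0 => //; nra.
Qed.

Lemma Lam_e_ge e r : 0 <= e -> 0 < r -> Lam 0 d r - e / r <= Lam e d r.
Proof.
move=> e0 r0; rewrite /Lam addr0.
have re : 0 < r + e by rewrite ltr_pwDl.
have er : 0 <= e / r by rewrite divr_ge0// ltW.
have h : ln (d / r) - e / r <= ln (d / (r + e)).
  have -> : d / r = d / (r + e) * (1 + e / r) by field; rewrite !gt_eqF.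
  rewrite lnM ?posrE ?divr_gt0//; last by rewrite ltr_pwDl.
  rewrite -addrA gerDl subr_le0; apply: le_ln1Dx.
  by apply: lt_le_trans er; lra.
rewrite lerBlDr ge_max; apply/andP; split.
  by rewrite addr_ge0// le_max lexx.
rewrite -lerBlDr; apply: le_trans h _; by rewrite le_max lexx orbT.
Qed.

Lemma exponent_arith (Q Qe L Le e r t : R) : 0 <= t -> t <= 1 -> 0 <= e -> 0 < r -> 0 <= L -> 0 <= Qe -> Qe <= 1 ->
  Q - 2 * e <= Qe -> L - e / r <= Le -> 
  - (t * Qe * Le) <= - (t * Q * L) + e * (2 * L + r^-1).
Proof.
move=> t0 t1 e0 r0 L0 Qe0 Qe1 h1 h2.
have er : 0 <= e / r by rewrite divr_ge0// ltW.
have a1 : Qe * (L - e / r) <= Qe * Le by apply: ler_wpM2l.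
have a2 : Qe * (e / r) <= e / r by rewrite ler_piMl.
have a3 : (Q - 2 * e) * L <= Qe * L by apply: ler_wpM2r.
have a4 : Q * L - Qe * Le <= e * (2 * L + r^-1).
  have -> : e * (2 * L + r^-1) = 2 * e * L + e / r by ring.
  by rewrite mulrBr in a1; rewrite mulrBl in a3; lra.
have b0 : 0 <= e * (2 * L + r^-1).
  by rewrite mulr_ge0// addr_ge0 ?mulr_ge0// invr_ge0 ltW.
have a5 : t * (Q * L - Qe * Le) <= t * (e * (2 * L + r^-1)) by apply: ler_wpM2l.
have a6 : t * (e * (2 * L + r^-1)) <= e * (2 * L + r^-1) by rewrite ler_piMl.
by rewrite -!mulrA; lra.
Qed.

(** The factor tends to 1 with [e] for each pair, though not uniformly near the diagonal. This
    suffices, because the limit is taken at a fixed pair. *)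
Lemma Gs_e_le e t v w : 0 < e -> e <= d -> 0 <= t <= 1 / 2 -> v != w ->
  Gs P e d g t v w <= Gs P 0 d g t v w * expR (e * (2 * Lam 0 d `|v - w| + `|v - w|^-1)).
Proof.
move=> e0 ed /andP[t0 t1] vw.
have r0 : 0 < `|v - w| by rewrite normr_gt0 subr_eq0.
rewrite /Gs -[leRHS]mulrA; apply: ler_wpM2l; first exact: G_ge0.
rewrite /Bs -[leRHS]mulrA; apply: ler_wpM2l; first exact: powR_ge0.
rewrite -expRD ler_expR.
have q1 := qq_e_ge v (ltW e0); have q2 := qq_e_ge w (ltW e0).
have p1 := qq_ge0 P e0 v; have p2 := qq_ge0 P e0 w.
have p3 := qq_le P e0 v; have p4 := qq_le P e0 w.
apply: exponent_arith => //.
- by lra.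
- exact: ltW.
- by rewrite le_max lexx.
- exact: addr_ge0.
- by lra.
- by lra.
- exact: Lam_e_ge (ltW e0) r0.
Qed.

Lemma limit_arith (a b c B : R) : (forall j : nat, a <= b * expR (4^-1 ^+ j * B) + c * 2^-1 ^+ j) -> a <= b.
Proof.
move=> h.
have c4 : (4^-1 : R) ^+ j @[j --> \oo] --> (0 : R) by apply: cvg_expr; rewrite ger0_norm; lra.
have c2 : (2^-1 : R) ^+ j @[j --> \oo] --> (0 : R) by apply: cvg_expr; rewrite ger0_norm; lra.
have cB : expR (4^-1 ^+ j * B) @[j --> \oo] --> expR (0 * B).
  have cx : (4^-1 ^+ j * B) @[j --> \oo] --> 0 * B by apply: cvgM => //; exact: cvg_cst.
  exact: (cvg_comp _ _ cx (@continuous_expR R (0 * B))).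
have : (b * expR (4^-1 ^+ j * B) + c * 2^-1 ^+ j) @[j --> \oo] --> b * expR (0 * B) + c * 0.
  by apply: cvgD; apply: cvgM => //; exact: cvg_cst.
rewrite mul0r expR0 mulr1 mulr0 addr0 => hc.
rewrite -(cvg_lim _ hc)//; apply: limr_ge; first by apply/cvg_ex; exists b.
by apply: nearW.
Qed.

(** Errors [4^-j] in [L^2(nu)] become errors of order [2^-j] at almost every point by
    [ae_geometric]. The exceptional set consists of points and not of pairs: the bound holds for all
    distinct points of [Q]. *)
Lemma semigroup_difference_bound t : 0 <= t <= 1 / 2 -> t <= dS -> exists Q : R -> Prop,
  {ae nu, forall v, Q v} /\ forall v w, Q v -> Q w -> v != w ->
  cabs (S t (fun v => (psi v)%:C) v - S t (fun v => (psi v)%:C) w) <= growth t * Gs P 0 d g t v w.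
Proof.
move=> ht tS; have t0 : 0 <= t by case/andP: ht.
have ex j : exists ephi : R * (R -> R), [/\ 0 < ephi.1 <= 4^-1 ^+ j, ephi.1 <= d,
    in_L2 (fun v => (ephi.2 v)%:C),
    forall v u, `|ephi.2 v - ephi.2 u| <= growth t * Gs P ephi.1 d g t v u &
    L2n (fun v => S t (fun v => (psi v)%:C) v - (ephi.2 v)%:C) <= 4^-1 ^+ j].
  by apply: euler_approx => //; rewrite exprn_gt0// invr_gt0.
have /choice[F hF] := ex.
set Y := S t (fun v => (psi v)%:C) in hF *.
have lpsi : in_L2 (fun v => (psi v)%:C) by exact: (in_L2_psi mu716 d01 g01 mpsi M0 hpsi).
have lY : in_L2 Y by case: hS => -[h _] _; exact: h.
pose z j v := Y v - ((F j).2 v)%:C.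
have lz j : in_L2 (z j).
  have [_ _ l _ _] := hF j.
  have [h _] := in_L2D lY (in_L2Z (-1) l).1.
  by rewrite (_ : z j = (fun v => Y v + -1 * ((F j).2 v)%:C))//; apply/funext => v; rewrite mulN1r.
have nz j : L2n (z j) <= 4^-1 ^+ j by have [] := hF j.
exists (fun v => exists C, forall j, cabs (z j v) <= C * 2^-1 ^+ j).
split; first exact: ae_geometric.
move=> v w [C1 h1] [C2 h2] vw.
set B := 2 * Lam 0 d `|v - w| + `|v - w|^-1.
have B0 : 0 <= B by rewrite addr_ge0 ?mulr_ge0 ?le_max ?lexx// invr_ge0.
apply: (@limit_arith _ _ (C1 + C2) B) => j.
have [/andP[e0 e4] ed _ hphi _] := hF j.
have gr0 := growth_ge0 t.
have G0 : 0 <= Gs P 0 d g t v w.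
  by apply: mulr_ge0; [exact: G_ge0|apply: mulr_ge0; [exact: powR_ge0|exact: expR_ge0]].
have -> : Y v - Y w = z j v + (- z j w + (((F j).2 v - (F j).2 w)%:C)).
  by rewrite /z rmorphB; ring.
apply: le_trans (cabsD _ _) _.
have b1 := cabsD (- z j w) (((F j).2 v - (F j).2 w)%:C).
rewrite cabsN cabsR in b1.
have b2 : `|(F j).2 v - (F j).2 w| <= growth t * Gs P 0 d g t v w * expR (4^-1 ^+ j * B).
  apply: le_trans (hphi v w) _; rewrite -mulrA; apply: ler_wpM2l => //.
  apply: le_trans (Gs_e_le e0 ed ht vw) _; apply: ler_wpM2l => //.
  by rewrite ler_expR; apply: ler_wpM2r.
have b3 := h1 j; have b4 := h2 j.
have b5 := le_trans b1 (lerD b4 b2).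
apply: le_trans (lerD b3 b5) _.
by rewrite le_eqVlt; apply/orP; left; apply/eqP; ring.
Qed.
End limit.

(** * Comparison with the weights Gamma *)

Section weight_arith.
Context {R : realType}.
Implicit Types p q r s x : R.

Lemma weight_arith1 p q r s : p <= 3 / 2 * r -> q <= 3 / 2 * s -> r <= s -> p + q <= 3 * s.
Proof. lra. Qed.

Lemma weight_arith2 p q r : 0 <= p -> 1 <= q -> 1 <= r -> (p <= 2 \/ r = 1) -> p * r <= 2 * r + p * q.
Proof. by move=> p0 q1 r1 [p2|->]; nra. Qed.

Lemma weight_arith3 p q r s : 0 <= p -> 0 <= r -> q <= 2 * s + r -> 3 * (r + q) <= 6 * (p + r + s).
Proof. lra. Qed.

Lemma weight_arith4 p q r s x : p <= s -> q <= s -> r <= s -> s <= 2 * x ->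
  p + q + r <= 6 * x.
Proof. lra. Qed.
End weight_arith.

Section weight_comparison.
Context {R : realType}.
Variables (nbar alpha mu a g0 kappa beta : R).
Hypotheses (hn : 0 < nbar) (ha1 : 1 / 9 < alpha) (ha2 : alpha < 1 / (65 / 10)).
Hypotheses (hmu1 : 1 / 3 <= mu) (hmu2 : mu <= 7 / 16) (ha : 9 <= a).
Hypotheses (hg1 : 0 < g0) (hg2 : g0 <= 1 / 8) (hk : 7 <= kappa) (hb1 : 1 <= beta).
Implicit Types (v w x r t : R).
Local Notation c0 := (@c0 R).
Local Notation F := (f_weight alpha).
Local Notation f := (ff alpha).
Local Notation G := (Ginf alpha (mu * c0) mu).

Let al0 : 0 <= alpha <= 1. Proof. by have := ha1; have := ha2; move=> h1 h2; apply/andP; split; lra. Qed.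

Let ln2_ge : 2 / 3 <= ln 2 :> R.
Proof. by have := @softplus0_ge R; rewrite /softplus expR0. Qed.

Let ln2_le : ln 2 <= 1 :> R.
Proof. by have := @softplus_le_expR R 0; rewrite /softplus expR0. Qed.

Lemma powR_Nle (b c : R) : 0 < c -> c <= b -> b `^ (- alpha) <= c `^ (- alpha).
Proof.
move=> cp cb; have bp := lt_le_trans cp cb; have /andP[a0 _] := al0.
rewrite !powRN lef_pV2 ?posrE ?powR_gt0//.
by apply: ge0_ler_powR; rewrite ?nnegrE ?(ltW cp) ?(ltW bp).
Qed.

Let pow_23 : (2 / 3) `^ (- alpha) <= 3 / 2 :> R.
Proof.
have /andP[a0 a1] := al0.
have h : (2 / 3) `^ 1 <= (2 / 3) `^ alpha :> R by apply: ger_powR; [apply/andP; split; lra|].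
rewrite powRr1 in h; last lra.
have p0 : 0 < (2 / 3) `^ alpha :> R by apply: powR_gt0; lra.
by rewrite powRN invf_ple ?posrE ?invf_div//; lra.
Qed.

Lemma f_weight_le x : F x <= 3 / 2 * f x.
Proof.
have /andP[a0 a1] := al0.
have e0 := expR_ge0 (- (alpha * x)).
rewrite /f_weight ge_max; apply/andP; split; last first.
  apply: (@le_trans _ _ (3 / 2)); last by rewrite /ff; lra.
  by apply: le_trans pow_23; apply: powR_Nle => //; lra.
have [x0|x0] := leP x 0; last first.
  apply: (@le_trans _ _ (3 / 2)); last by rewrite /ff; lra.
  apply: le_trans pow_23; apply: powR_Nle; first lra.
  apply: le_trans ln2_ge _; rewrite ler_ln ?posrE ?expR1_gt0// lerD2l.
  by rewrite -[leLHS]expR0 ler_expR ltW.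
have X1 : expR x <= 1 by rewrite -[leRHS]expR0 ler_expR.
have X0 : 0 < expR x by exact: expR_gt0.
have h : 2 / 3 * expR x <= ln (1 + expR x).
  apply: le_trans (softplus_ge x); rewrite -[X in _ <= X]/(2 * expR x / (2 + expR x)).
  by rewrite ler_pdivlMr; nra.
have p0 : 0 < 2 / 3 * expR x by rewrite mulr_gt0//; lra.
apply: le_trans (powR_Nle p0 h) _.
rewrite powRM ?expR_ge0//.
have -> : expR x `^ (- alpha) = expR (- (alpha * x)) by rewrite -expRM mulrN mulrC.
apply: ler_pM => //; rewrite ?powR_ge0//.
by rewrite /ff; lra.
Qed.

Lemma f_weight_ge x : f x <= 2 * F x.
Proof.
have /andP[a0 a1] := al0.
have h1 : 1 <= F x.
  apply: (@le_trans _ _ (1 `^ (- alpha))); first by rewrite powR1.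
  by rewrite /f_weight le_max; apply/orP; right; apply: powR_Nle => //; have := ln2_ge; lra.
have h2 : expR (- (alpha * x)) <= F x.
  have [x0|x0] := leP x 0; last first.
    by apply: le_trans h1; apply: expRN_le1; rewrite mulr_ge0// ltW.
  rewrite /f_weight le_max; apply/orP; left.
  have -> : expR (- (alpha * x)) = expR x `^ (- alpha) by rewrite -expRM mulrN mulrC.
  by apply: powR_Nle; [exact: softplus_gt0|exact: softplus_le_expR].
by rewrite /ff; lra.
Qed.

Local Notation X v w := (expR (mu * Num.max a (Num.max (c0 * v) w))).

Let mu0 : 0 <= mu. Proof. by have := hmu1; lra. Qed.
Let c00 : 0 <= c0. Proof. by rewrite /c0; lra. Qed.

Lemma EE_le_X v w : EE (mu * c0) v <= X v w.
Proof.
rewrite /EE ler_expR -mulrA; apply: ler_wpM2l => //.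
have [v0|v0] := leP 0 v.
  by rewrite le_max; apply/orP; right; rewrite le_max; apply/orP; left.
by rewrite mulr0 le_max; apply/orP; left; have := ha; lra.
Qed.

Lemma EE_le_X2 v w : EE mu w <= X v w.
Proof.
rewrite /EE ler_expR; apply: ler_wpM2l => //.
rewrite ge_max; apply/andP; split; rewrite le_max; apply/orP; [left; have := ha; lra|right].
by rewrite le_max; apply/orP; right.
Qed.

Lemma X_le v w : X v w <= expR (mu * a) * (EE (mu * c0) v + EE mu w).
Proof.
have h : Num.max a (Num.max (c0 * v) w) <= a + Num.max (c0 * Num.max 0 v) (Num.max 0 w).
  have a9 := ha.
  have h1 : 0 <= c0 * Num.max 0 v by rewrite mulr_ge0// le_max lexx.
  have h2 : c0 * v <= c0 * Num.max 0 v by apply: ler_wpM2l => //; rewrite le_max lexx orbT.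
  have h3 : c0 * Num.max 0 v <= Num.max (c0 * Num.max 0 v) (Num.max 0 w) by rewrite le_max lexx.
  have h4 : w <= Num.max (c0 * Num.max 0 v) (Num.max 0 w).
    by rewrite le_max; apply/orP; right; rewrite le_max; apply/orP; right.
  by rewrite !ge_max; apply/and3P; split; lra.
apply: (@le_trans _ _ (expR (mu * (a + Num.max (c0 * Num.max 0 v) (Num.max 0 w))))).
  by rewrite ler_expR; apply: ler_wpM2l.
rewrite mulrDr expRD; apply: ler_wpM2l; first exact: expR_ge0.
have e1 := expR_ge0 (mu * c0 * Num.max 0 v); have e2 := expR_ge0 (mu * Num.max 0 w).
rewrite /EE; case: (leP (c0 * Num.max 0 v) (Num.max 0 w)) => _; last rewrite mulrA; lra.
Qed.

(** The maximum in the exponent produces [ff w * EE mu w], which does not occur in [G]. It is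
    absorbed because [ff w <= 2] for [w >= 0] and [EE mu w = 1] for [w < 0]. *)
Lemma initial_weight v w : w <= v -> (F v + F w) * X v w <= 6 * expR (mu * a) * G v w.
Proof.
move=> wv.
have f1 := ff_ge1 alpha v; have f2 : f v <= f w.
  by rewrite lerD2l ler_expR lerN2; apply: ler_wpM2l => //; case/andP: al0.
have h1 : F v + F w <= 3 * f w.
  exact: weight_arith1 (f_weight_le v) (f_weight_le w) f2.
have E1 : 1 <= EE (mu * c0) v by apply: EE_ge1; exact: mulr_ge0.
have E2 : 1 <= EE (mu * c0) w by apply: EE_ge1; exact: mulr_ge0.
have E3 : 1 <= EE mu w by exact: EE_ge1.
have fw1 : 0 <= f w by exact: le_trans ler01 (ff_ge1 alpha w).
have fv1 : 0 <= f v by exact: le_trans ler01 f1.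
have h2 : f w * EE mu w <= 2 * EE mu w + f w * EE (mu * c0) v.
  apply: weight_arith2 => //; have [w0|w0] := leP 0 w; [left|right].
    have h : expR (- (alpha * w)) <= 1 by apply: expRN_le1; rewrite mulr_ge0//; case/andP: al0.
    by rewrite /ff -[leRHS]/(1 + 1) lerD2l.
  by rewrite /EE max_l ?(ltW w0)// mulr0 expR0.
have XL := X_le v w; have X0 := expR_ge0 (mu * Num.max a (Num.max (c0 * v) w)).
have e0 := expR_ge0 (mu * a).
apply: le_trans (ler_wpM2r X0 h1) _.
have fw0 : 0 <= 3 * f w by exact: mulr_ge0.
apply: le_trans (ler_wpM2l fw0 XL) _.
rewrite [leLHS](_ : _ = expR (mu * a) * (3 * (f w * EE (mu * c0) v + f w * EE mu w))); last by ring.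
rewrite [leRHS](_ : _ = expR (mu * a) * (6 * G v w)); last by ring.
apply: ler_wpM2l => //; rewrite /Ginf min_r//.
apply: weight_arith3 => //; apply: mulr_ge0 => //; exact: le_trans ler01 _.
Qed.

Lemma final_weight v w : w <= v -> G v w <= 6 * ((F v + F w) * X v w).
Proof.
move=> wv.
have f1 := ff_ge1 alpha v; have f2 : f v <= f w.
  by rewrite lerD2l ler_expR lerN2; apply: ler_wpM2l => //; case/andP: al0.
have E1 : EE (mu * c0) w <= EE (mu * c0) v by apply: EE_nd => //; exact: mulr_ge0.
have XX := EE_le_X v w; have XX2 := EE_le_X2 v w.
set x : R := X v w in XX XX2 *; have x0 : 0 <= x by exact: expR_ge0.
have e1 : 1 <= EE (mu * c0) w by apply: EE_ge1; exact: mulr_ge0.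
have f0 : 0 <= f w by exact: le_trans (le_trans ler01 f1) f2.
have h1 : f v * EE (mu * c0) w <= f w * x.
  apply: ler_pM => //; [exact: le_trans ler01 f1|exact: le_trans ler01 e1|exact: le_trans XX].
have h2 : f w * EE (mu * c0) v <= f w * x by exact: ler_wpM2l.
have h3 : EE mu w <= f w * x.
  by apply: le_trans XX2 _; rewrite ler_peMl//; exact: le_trans f2.
have h4 : f w * x <= 2 * ((F v + F w) * x).
  rewrite mulrA; apply: ler_wpM2r => //; apply: le_trans (f_weight_ge w) _.
  by apply: ler_wpM2l => //; rewrite lerDr /f_weight le_max powR_ge0.
by rewrite /Ginf min_r//; exact: (weight_arith4 h1 h2 h3 h4).
Qed.

Lemma one_sub_le r : 0 <= r -> 1 - expR (- (kappa * r)) <= Num.min 1 (kappa * r).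
Proof.
move=> r0; rewrite le_min; apply/andP; split.
  by rewrite gerBl expR_ge0.
by have := expRN_ge_sub (kappa * r); lra.
Qed.

Variable d : R.
Hypotheses (d0 : 0 < d) (d1 : d <= 1 / 100).

Lemma initial_factor r : 0 < r -> (1 - expR (- (kappa * r))) `^ g0 <= kappa * hh d g0 r.
Proof.
move=> r0; have h := one_sub_le (ltW r0).
have k1 : 1 <= kappa by have := hk; lra.
have kr : 0 < kappa * r by rewrite mulr_gt0//; lra.
have rd : r <= r / d by rewrite ler_peMr ?(ltW r0)// invf_ge1//; have := d1; lra.
have m0 : 0 <= Num.min 1 (r / d) by rewrite le_min ler01 divr_ge0// ltW.
have h2 : 1 - expR (- (kappa * r)) <= kappa * Num.min 1 (r / d).
  apply: le_trans h _; case: (leP 1 (r / d)) => _.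
    by rewrite mulr1 ge_min k1.
  rewrite ge_min; apply/orP; right; apply: ler_wpM2l => //; lra.
have h3 : 0 <= 1 - expR (- (kappa * r)) by rewrite subr_ge0 expRN_le1// ltW.
have gg := ltW hg1.
apply: (@le_trans _ _ ((kappa * Num.min 1 (r / d)) `^ g0)).
  by apply: ge0_ler_powR; rewrite ?nnegrE ?mulr_ge0//; lra.
rewrite powRM//; last lra.
apply: ler_wpM2r; first exact: powR_ge0.
rewrite -[leRHS]powRr1; last lra.
by apply: ler_powR => //; have := hg2; lra.
Qed.

Variable P : model R.
Hypothesis Pn : nb P = nbar.

(** The term [qq P 0 w] alone suffices: [beta >= 1] gives [1 + exp w <= 2 * (1 + exp(beta w))], and
    1/4 is twice 1/8. *)
Lemma rate_weight t v w : 0 <= t -> gamma nbar g0 beta t v (v - w) <= g0 + t * (qq P 0 v + qq P 0 w).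
Proof.
move=> t0; rewrite /gamma lerD2l /abar subKr.
have m0 : 0 <= Num.min 1 nbar by rewrite le_min ler01 ltW.
have qv : 0 <= qq P 0 v.
  rewrite /qq Pn addr0; apply: divr_ge0; first by apply: mulr_ge0 => //; lra.
  by rewrite addr_ge0// expR_ge0.
have b0 : 0 < 1 + expR (beta * w) by rewrite ltr_wpDr ?expR_ge0.
have w0 : 0 < 1 + expR w by rewrite ltr_wpDr ?expR_ge0.
have h1 : 1 + expR w <= 2 * (1 + expR (beta * w)).
  have [p|p] := leP 0 w.
    have : expR w <= expR (beta * w) by rewrite ler_expR; have := hb1; nra.
    by have := expR_ge0 (beta * w); lra.
  have : expR w <= 1 by rewrite -[leRHS]expR0 ler_expR ltW.
  by have := expR_ge0 (beta * w); lra.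
have h2 : t / (1 + t) <= t by rewrite ler_pdivrMr; nra.
apply: (@le_trans _ _ (t * qq P 0 w)); last by rewrite mulrDr lerDr mulr_ge0.
rewrite /qq Pn addr0 ler_pdivrMr// (_ : t * _ * _ = t * (1 / 4 * Num.min 1 nbar) * ((1 + expR (beta * w)) / (1 + expR w))); last by ring.
have h3 : 1 / 2 <= (1 + expR (beta * w)) / (1 + expR w) by rewrite ler_pdivlMr//; lra.
have c1 : 0 <= t * (1 / 4 * Num.min 1 nbar) by rewrite mulr_ge0// mulr_ge0//; lra.
apply: le_trans (ler_wpM2l c1 h3).
have c2 : 0 <= 1 / 8 * Num.min 1 nbar by rewrite mulr_ge0//; lra.
apply: le_trans (ler_wpM2l c2 h2) _.
by rewrite le_eqVlt; apply/orP; left; apply/eqP; field.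
Qed.

Lemma final_factor t v w : 0 <= t <= 1 / 2 -> w < v ->
  Bs P 0 d g0 t v w <= 2 / d * (1 - expR (- (kappa * (v - w)))) `^ gamma nbar g0 beta t v (v - w).
Proof.
move=> /andP[t0 t1] wv; set r : R := v - w; have r0 : 0 < r by rewrite subr_gt0.
have rn : `|v - w| = r by rewrite gtr0_norm.
set gm := gamma nbar g0 beta t v r.
have gm1 : gm <= g0 + t * (qq P 0 v + qq P 0 w) by exact: rate_weight.
have b0 : 0 < 1 + expR (beta * w) by rewrite ltr_wpDr ?expR_ge0.
(* An exponent at most 1 allows the power of the constant [2 / d] to be replaced by [2 / d]
   itself. *)
have gm0 : 0 <= gm <= 1.
  rewrite /gm /gamma /abar /r subKr.
  have m0 : 0 <= Num.min 1 nbar <= 1 by rewrite le_min ler01 (ltW hn) ge_min lexx.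
  have h2 : 0 <= t / (1 + t) <= 1 by rewrite divr_ge0 ?addr_ge0//= ler_pdivrMr; nra.
  have h3 : 0 <= Num.min 1 nbar * (t / (1 + t)) <= 1.
    have /andP[? ?] := m0; have /andP[? ?] := h2.
    by rewrite mulr_ge0//= -[leRHS]mulr1; apply: ler_pM.
  have h4 : 0 <= 1 / 8 * Num.min 1 nbar * (t / (1 + t)) / (1 + expR (beta * w)) <= 1 / 8.
    have /andP[p q] := h3.
    set A : R := Num.min 1 nbar * (t / (1 + t)) in p q.
    rewrite (_ : 1 / 8 * Num.min 1 nbar * (t / (1 + t)) / (1 + expR (beta * w)) = 1 / 8 * (A / (1 + expR (beta * w)))); last by rewrite /A; ring.
    have A0 : 0 <= A / (1 + expR (beta * w)) by rewrite divr_ge0 ?(ltW b0).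
    have A1 : A / (1 + expR (beta * w)) <= 1.
      by rewrite ler_pdivrMr// mul1r; apply: le_trans q _; rewrite lerDl expR_ge0.
    by apply/andP; split; lra.
  have /andP[p q] := h4.
  by have := hg1; have := hg2; move=> ? ?; apply/andP; split; lra.
set x : R := Num.min 1 (r / d).
have rd : 0 < r / d by exact: divr_gt0.
have x0 : 0 < x by rewrite lt_min ltr01.
have x1 : x <= 1 by rewrite ge_min lexx.
(* At [e = 0] the function [Lam] is [- ln x], so the exponential is a power of [x] and the smoothing
   weight a pure power, like the last factor of [Gamma]. *)
have BE : Bs P 0 d g0 t v w = x `^ (g0 + t * (qq P 0 v + qq P 0 w)).
  rewrite /Bs rn /hh -/x powRD; last by rewrite (gt_eqF x0) implybT.
  congr (_ * _); rewrite -[x]lnK ?posrE// -expRM; congr expR.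
  rewrite [ln x * _]mulrC -mulrN; congr (_ * _).
  rewrite /Lam addr0 -[d / r]invf_div lnV ?posrE// /x.
  have [h|h] := leP 1 (r / d).
    by rewrite ln1 max_l ?oppr0// oppr_le0 ln_ge0.
  by rewrite max_r ?opprK// oppr_ge0 ln_le0// ltW.
set y : R := 1 - expR (- (kappa * r)).
have y1 : r / (1 + r) <= y.
  have r1 : 0 < 1 + r by lra.
  have k1 : expR (- (kappa * r)) <= expR (- r) by rewrite ler_expR lerN2 ler_peMl ?(ltW r0)//; have := hk; lra.
  have k2 : expR (- r) <= (1 + r)^-1.
    by rewrite expRN lef_pV2 ?posrE ?expR_gt0//; exact: expR_ge1Dx.
  have -> : r / (1 + r) = 1 - (1 + r)^-1 by field; rewrite gt_eqF.
  by rewrite /y; lra.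
have xy : x <= 2 / d * y.
  apply: le_trans (_ : 2 / d * (r / (1 + r)) <= _); last first.
    by apply: ler_wpM2l => //; rewrite divr_ge0// ltW.
  have r1 : 0 < 1 + r by lra.
  have [h|h] := leP r 1.
    apply: (@le_trans _ _ (r / d)); first by rewrite ge_min lexx orbT.
    rewrite (_ : 2 / d * (r / (1 + r)) = r / d * (2 / (1 + r))); last by ring.
    by rewrite ler_peMr ?(ltW rd)// ler_pdivlMr//; lra.
  apply: le_trans x1 _.
  have : 1 / 2 <= r / (1 + r) by rewrite ler_pdivlMr//; lra.
  have : 2 <= 2 / d by rewrite ler_pdivlMr//; have := d1; lra.
  by nra.
have /andP[gm00 gm11] := gm0.
have y0 : 0 <= y by apply: le_trans y1; rewrite divr_ge0 ?(ltW r0)//; lra.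
have D1 : 1 <= 2 / d by rewrite ler_pdivlMr//; have := d1; lra.
rewrite BE; apply: (@le_trans _ _ (x `^ gm)).
  by apply: ger_powR; rewrite ?x0.
apply: (@le_trans _ _ ((2 / d * y) `^ gm)).
  apply: ge0_ler_powR; rewrite ?nnegrE ?(ltW x0)//.
  by rewrite mulr_ge0// (le_trans ler01).
rewrite powRM//; last exact: le_trans D1.
apply: ler_wpM2r; first exact: powR_ge0.
by rewrite -[leRHS]powRr1 ?(le_trans ler01)//; apply: ler_powR.
Qed.
End weight_comparison.

Section product_ae.
Context {R : realType}.
Local Notation leb := (@lebesgue_measure R).

(** For each [v], the set of [r] with [v - r] exceptional is a reflection of a null set. It must be
    null for Lebesgue measure, which [ae_nu] provides. *)
Lemma ae_difference (Q : R -> Prop) : {ae (@nu R), forall v, Q v} ->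
  {ae ((@nu R) \x leb)%E, forall z : R * R, Q z.1 /\ Q (z.1 - z.2)}.
Proof.
move=> hQ; have [B [mB B0 QB]] := hQ.
have [B' [mB' B'0 QB']] := ae_nu hQ.
have mD : measurable_fun setT (fun z : measurableTypeR R * measurableTypeR R => z.1 - z.2).
  exact: measurable_funB.
have mA1 : measurable (B `*` setT : set (R * R)) by exact: measurableX.
have mA2 : measurable ((fun z : R * R => z.1 - z.2) @^-1` B').
  by rewrite -[X in measurable X]setTI; exact: mD.
have n1 : ((@nu R) \x leb)%E.-negligible (B `*` setT : set (R * R)).
  exists (B `*` setT); split => //.
  transitivity (nu B * leb setT)%E; first exact: product_measure1E.
  by have -> : nu B = 0%E; [exact: B0|rewrite mul0e].
have n2 : ((@nu R) \x leb)%E.-negligible ((fun z : R * R => z.1 - z.2) @^-1` B').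
  exists ((fun z : R * R => z.1 - z.2) @^-1` B'); split => //.
  rewrite /product_measure1; apply: integral0_eq => v _ /=.
  have -> : xsection ((fun z : R * R => z.1 - z.2) @^-1` B') v = (fun r => v - r) @^-1` B'.
    by apply/seteqP; split => r; rewrite /xsection /= inE.
  by have := refl_measureE v mB'; rewrite /refl_measure B'0.
apply: negligibleS (negligibleU n1 n2) => z /= /not_andP[h|h]; [left|right].
  by split => //; exact: QB.
exact: QB'.
Qed.
End product_ae.

(** Written as a scalar multiple plus a function, the form in which linearity of the semigroup is
    stated. *)
Lemma complex_split (R : realType) (psi : R -> R[i]) :
  psi = (fun x => (0 +i* 1)%C * ((complex.Im (psi x))%:C)%C + ((complex.Re (psi x))%:C)%C).
Proof.
apply/funext => x; case: (psi x) => a b /=; apply/eqP; rewrite eq_complex /=.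
by apply/andP; split; apply/eqP; ring.
Qed.

Lemma ae_product_sub (R : realType) (Q Q' : R * R -> Prop) : (forall z, Q z -> Q' z) ->
  {ae (@nu R \x lebesgue_measure)%E, forall z, Q z} ->
  {ae (@nu R \x lebesgue_measure)%E, forall z, Q' z}.
Proof. by move=> h; apply: negligibleS => z /= hz hq; apply: hz; exact: h. Qed.

(** * From real bounds to complex data and the original weights *)

Section main.
Context {R : realType}.
Variables (nbar alpha mu a g0 kappa beta : R).
Hypotheses (hn : 0 < nbar) (ha1 : 1 / 9 < alpha) (ha2 : alpha < 1 / (65 / 10)).
Hypotheses (hmu1 : 1 / 3 <= mu) (hmu2 : mu <= 7 / 16) (ha : 9 <= a).
Hypotheses (hg1 : 0 < g0) (hg2 : g0 <= 1 / 8) (hk : 7 <= kappa) (hb1 : 1 <= beta).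
Implicit Types (v w x r t : R).
Local Notation c0 := (@c0 R).
Local Notation F := (f_weight alpha).
Local Notation G := (Ginf alpha (mu * c0) mu).
Local Notation Gam := (Gamma nbar alpha mu a g0 kappa beta).
Local Notation Y := (Ynorm nbar alpha mu a g0 kappa beta).
Local Open Scope complex_scope.

Lemma paper_al : 1 / 10 <= alpha <= 1 / 6.
Proof. by apply/andP; split; have := ha1; have := ha2; lra. Qed.

Lemma paper_me : 0 <= mu * c0 <= 1 / 4.
Proof. by rewrite /c0; apply/andP; split; have := hmu1; have := hmu2; lra. Qed.

Lemma paper_mu : mu * c0 + 1 / 10 <= mu <= 1 / 2.
Proof. by rewrite /c0; apply/andP; split; have := hmu1; have := hmu2; lra. Qed.

Definition paper_model : model R := Model hn paper_al paper_me paper_mu.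
Local Notation P := paper_model.

(** The solution of [ln(1 / (100 d)) = 1 + 2 * loss_cst]: the largest scale at which the coupling
    gain covers the loss. It is an absolute constant. *)
Definition scale_d : R := 1 / 100 / expR (1 + 2 * loss_cst).

Lemma scale_d_gt0 : 0 < scale_d.
Proof. by rewrite /scale_d divr_gt0 ?expR_gt0//; lra. Qed.

Lemma scale_d_loss : 1 + 2 * loss_cst <= ln (1 / 100 / scale_d).
Proof.
rewrite /scale_d; set E := expR _; have E0 : 0 < E by exact: expR_gt0.
by rewrite (_ : 1 / 100 / (1 / 100 / E) = E) ?expRK//; field; rewrite gt_eqF.
Qed.

Lemma scale_d_le : scale_d <= 1 / 100.
Proof.
rewrite /scale_d ler_pdivrMr ?expR_gt0// ler_peMr//.
rewrite -[leLHS]expR0 ler_expR; apply: addr_ge0 => //; apply: mulr_ge0 => //.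
exact: ltW loss_cst_gt0.
Qed.

Lemma gamma0E v r : gamma nbar g0 beta 0 v r = g0.
Proof. by rewrite /gamma /abar mul0r mulr0 mul0r addr0. Qed.

Lemma Gamma_gt0 t v r : 0 < r -> 0 < Gam t v r.
Proof.
move=> r0; have k0 : 0 < kappa by have := hk; lra.
have f0 x : 0 < F x by rewrite /f_weight lt_max; apply/orP; left; rewrite powR_gt0// softplus_gt0.
rewrite /Gamma; apply: mulr_gt0; first by apply: mulr_gt0; [rewrite addr_gt0|exact: expR_gt0].
by rewrite powR_gt0// subr_gt0 -[ltRHS]expR0 ltr_expR oppr_lt0 mulr_gt0.
Qed.

Lemma Ynorm_ge0 (D : R * R -> R[i]) : (0 <= Y D)%E.
Proof.
apply: le_trans (ereal_sup_ubound (_ : [set _ | _ in _] _)); last by exists (0, 1) => //=; exact: ltr01.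
by rewrite lee_fin divr_ge0 ?cabs_ge0// ltW// Gamma_gt0.
Qed.

Variable psi0 : R -> R[i].
Hypothesis hX : in_X nbar alpha mu a g0 kappa beta psi0.

Definition data_norm : R := fine (Y (difference psi0)).

Lemma data_normE : Y (difference psi0) = data_norm%:E.
Proof.
rewrite /data_norm fineK// ge0_fin_numE ?Ynorm_ge0//.
have [_] := hX; rewrite /Xnorm; set A := ereal_sup _ => h.
have A0 : (0 <= A)%E.
  apply: le_trans (ereal_sup_ubound (_ : [set _ | _ in _] _)); last by exists 0.
  rewrite lee_fin divr_ge0 ?cabs_ge0// /Gamma_tilde mulr_ge0 ?expR_ge0//.
  by rewrite /f_weight le_max powR_ge0.
apply: le_lt_trans h; exact: leeDr.
Qed.

Lemma data_norm_ge0 : 0 <= data_norm.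
Proof. by rewrite -lee_fin -data_normE Ynorm_ge0. Qed.

Lemma data_difference v w : w < v -> cabs (psi0 v - psi0 w) <= data_norm * Gam 0 v (v - w).
Proof.
move=> wv; have r0 : 0 < v - w by rewrite subr_gt0.
have G0 := Gamma_gt0 0 v r0.
rewrite -ler_pdivrMr// -lee_fin -data_normE; apply: ereal_sup_ubound.
by exists (v, v - w) => //=; rewrite /difference /= subKr.
Qed.

Definition initial_cst : R := 6 * expR (mu * a) * kappa.

Lemma initial_cst_ge0 : 0 <= initial_cst.
Proof. by apply: mulr_ge0; [apply: mulr_ge0 => //; exact: expR_ge0|have := hk; lra]. Qed.

Lemma data_bound v w : cabs (psi0 v - psi0 w) <=
  data_norm * initial_cst * (G v w * hh scale_d g0 `|w - v|).
Proof.
have G0 x y : 0 <= G x y by exact: (G_ge0 P).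
have y0 := data_norm_ge0; have i0 := initial_cst_ge0.
wlog wv : v w / w <= v.
  move=> h; have [wv|wv] := leP w v; first exact: h.
  by rewrite -cabsN opprB distrC GinfC; exact/h/ltW.
move: wv; rewrite le_eqVlt => /predU1P[->|wv].
  rewrite subrr cabsE /= expr0n addr0 sqrtr0; apply: mulr_ge0; first exact: mulr_ge0.
  by apply: mulr_ge0; [exact: G0|exact: powR_ge0].
have r0 : 0 < v - w by rewrite subr_gt0.
apply: le_trans (data_difference wv) _; rewrite -mulrA; apply: ler_wpM2l => //.
rewrite /Gamma gamma0E subKr.
have h1 := initial_weight ha1 ha2 hmu1 ha (ltW wv).
have h2 := initial_factor hg1 hg2 hk scale_d_gt0 scale_d_le r0.
rewrite distrC gtr0_norm//.
have f0 x : 0 <= F x by rewrite /f_weight le_max powR_ge0.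
apply: le_trans (ler_pM _ _ h1 h2) _; rewrite ?powR_ge0//.
  by apply: mulr_ge0; [exact: addr_ge0|exact: expR_ge0].
by rewrite [leLHS]mulrACA.
Qed.

Lemma measurable_part (p : R[i] -> R) : (forall z1 z2 : R[i], p (z1 - z2) = p z1 - p z2) ->
  (forall z, `|p z| <= cabs z) -> measurable_fun setT (p \o psi0).
Proof.
move=> pB pn; have [hc _] := hX.
apply: continuous_measurable_fun => v.
apply/cvgrPdist_lt => e e0.
have ec : 0 < e%:C :> R[i] by rewrite ltcR.
have /cvgrPdist_lt /(_ _ ec) := hc v.
apply: filterS => w hw; rewrite /= -pB; apply: le_lt_trans (pn _) _.
by rewrite -ltcR.
Qed.

(** The leading 2 adds real and imaginary parts, the exponential is the growth up to time 1/2, and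
    the other factors compare the weights at time 0 and at time [t]. *)
Definition bound_cst : R :=
  2 * (initial_cst * expR (2 * drift_cst * nbar * (1 / 2)) * (6 * (2 / scale_d))).

Lemma Gs_le_Gamma t v w : 0 <= t <= 1 / 2 -> w < v ->
  Gs P 0 scale_d g0 t v w <= 6 * (2 / scale_d) * Gam t v (v - w).
Proof.
move=> ht wv.
have h1 := final_weight ha1 ha2 hmu1 ha (ltW wv).
have h2 := final_factor hn hg1 hg2 hk hb1 scale_d_gt0 scale_d_le (erefl : nb P = nbar) ht wv.
rewrite /Gs /Gamma subKr; apply: le_trans (ler_pM _ _ h1 h2) _.
- exact: (G_ge0 P).
- by apply: mulr_ge0; [exact: powR_ge0|exact: expR_ge0].
- by rewrite [leLHS]mulrACA.
Qed.

Variables (S : R -> (R -> R[i]) -> R -> R[i]).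
Hypothesis hS : is_exp_semigroup (L3 nbar) S.

Lemma semigroup_bound : exists T : R, 0 < T /\ forall t, 0 <= t <= T ->
  {ae (@nu R \x lebesgue_measure)%E, forall z : R * R, 0 < z.2 ->
    cabs (difference (S t psi0) z) <= bound_cst * Gam t z.1 z.2 * data_norm}.
Proof.
have [dS [MS [dS0 MS0 SM]]] := exp_semigroup_bounded hS.
(* The limit 1/2 is the range of [th] in which [Bs_ratio] holds, and [dS] is the time up to which
   the semigroup is known to be bounded. *)
exists (Num.min (1 / 2) dS); split; first by rewrite lt_min dS0 andbT; lra.
move=> t /andP[t0]; rewrite le_min => /andP[t1 tS].
have ht : 0 <= t <= 1 / 2 by rewrite t0.
have mu7 : mu_ P <= 7 / 16 by exact: hmu2.
pose pr v := complex.Re (psi0 v); pose pim v := complex.Im (psi0 v).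
have mr : measurable_fun setT pr.
  by apply: (@measurable_part (@complex.Re R)) => [z1 z2|z]; [rewrite raddfB|exact: Re_le_cabs].
have mi : measurable_fun setT pim.
  by apply: (@measurable_part (@complex.Im R)) => [z1 z2|z]; [rewrite raddfB|exact: Im_le_cabs].
have M0 : 0 <= data_norm * initial_cst by rewrite mulr_ge0 ?data_norm_ge0 ?initial_cst_ge0.
have br v u : `|pr v - pr u| <= data_norm * initial_cst * (Ginf (al P) (me P) (mu_ P) v u * hh scale_d g0 `|u - v|).
  by apply: le_trans (data_bound v u); rewrite -raddfB; exact: Re_le_cabs.
have bi v u : `|pim v - pim u| <= data_norm * initial_cst * (Ginf (al P) (me P) (mu_ P) v u * hh scale_d g0 `|u - v|).
  by apply: le_trans (data_bound v u); rewrite -raddfB; exact: Im_le_cabs.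
have [Q1 [ae1 hQ1]] := semigroup_difference_bound mu7 scale_d_gt0 scale_d_le hg1 hg2 scale_d_loss hS MS0 SM mr M0 br ht tS.
have [Q2 [ae2 hQ2]] := semigroup_difference_bound mu7 scale_d_gt0 scale_d_le hg1 hg2 scale_d_loss hS MS0 SM mi M0 bi ht tS.
have d01 : 0 < scale_d <= 1 by rewrite scale_d_gt0 (le_trans scale_d_le)//; lra.
have g01 : 0 < g0 <= 1 by rewrite hg1 (le_trans hg2)//; lra.
have lr : in_L2 (fun v => (pr v)%:C) by exact: (in_L2_psi mu7 d01 g01 mr M0 br).
have li : in_L2 (fun v => (pim v)%:C) by exact: (in_L2_psi mu7 d01 g01 mi M0 bi).
have ae3 : {ae (@nu R), forall v, S t psi0 v =
    (0 +i* 1) * S t (fun v => (pim v)%:C) v + S t (fun v => (pr v)%:C) v}.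
  have [[_ [h _]] _] := hS; have := h t (0 +i* 1) _ _ t0 li lr.
  by rewrite -complex_split.
have aeQ : {ae (@nu R), forall v, [/\ Q1 v, Q2 v & S t psi0 v =
    (0 +i* 1) * S t (fun v => (pim v)%:C) v + S t (fun v => (pr v)%:C) v]}.
  by apply: filterS3 ae1 ae2 ae3 => v q1 q2 q3; split.
apply: ae_product_sub (ae_difference aeQ) => -[v r] /= [[q1 q2 ev] [q1' q2' ew]] r0.
rewrite /difference /=; set w := v - r in q1' q2' ew *.
have wv : w < v by rewrite /w ltrBlDr ltrDl.
have vw : v != w by rewrite gt_eqF.
have vr : v - w = r by rewrite /w subKr.
have b1 := hQ1 v w q1 q1' vw; have b2 := hQ2 v w q2 q2' vw.
have b3 := Gs_le_Gamma ht wv; rewrite vr in b3.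
rewrite ev ew.
set z1 := S t (fun v => (pim v)%:C) v; set z2 := S t (fun v => (pim v)%:C) w.
set z3 := S t (fun v => (pr v)%:C) v; set z4 := S t (fun v => (pr v)%:C) w.
have -> : (0 +i* 1) * z1 + z3 - ((0 +i* 1) * z2 + z4) = (0 +i* 1) * (z1 - z2) + (z3 - z4) by ring.
apply: le_trans (cabsD _ _) _.
have ci : cabs (0 +i* 1 : R[i]) = 1 by rewrite cabsE /= expr0n add0r expr1n sqrtr1.
rewrite ComplexField.Normc.normcM ci mul1r.
apply: le_trans (lerD b2 b1) _.
have E0 : 0 <= 2 * drift_cst * nbar.
  exact: mulr_ge0 (mulr_ge0 (ler0n R 2) (@drift_cst_ge0 R)) (ltW hn).
have Gm0 := ltW (Gamma_gt0 t v r0).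
set GG : R := Gs P 0 scale_d g0 t v w in b3 *.
have GG0 : 0 <= GG.
  by apply: mulr_ge0; [exact: G_ge0|apply: mulr_ge0; [exact: powR_ge0|exact: expR_ge0]].
have b4 : growth P (data_norm * initial_cst) t <= data_norm * initial_cst * expR (2 * drift_cst * nbar * (1 / 2)).
  by apply: (ler_wpM2l M0); rewrite ler_expR; apply: (ler_wpM2l E0).
have g0' : 0 <= growth P (data_norm * initial_cst) t by exact: growth_ge0.
have b5 := ler_pM g0' GG0 b4 b3.
apply: le_trans (lerD b5 b5) _; rewrite /bound_cst.
set E : R := expR _; set D : R := 2 / scale_d; set H : R := Gam _ _ _.
by rewrite le_eqVlt; apply/orP; left; apply/eqP; ring.
Qed.
End main.

Local Open Scope complex_scope.

Theorem theorem3p2 (R : realType) (nbar alpha mu a gamma0 kappa beta : R)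
    (hnbar : 0 < nbar)
    (halpha : 1 / 9 < alpha < 1 / (65 / 10))
    (hmu : 1 / 3 <= mu <= 7 / 16)
    (ha : 9 <= a)
    (hgamma0 : 0 < gamma0 <= 1 / 8)
    (hkappa : 7 <= kappa)
    (hbeta : 1 <= beta <= kappa / 4) :
  exists C : R,
    forall S0 : R -> (R -> R[i]) -> R -> R[i],
      is_exp_semigroup (L3 nbar) S0 ->
    forall psi0 : R -> R[i],
      in_X nbar alpha mu a gamma0 kappa beta psi0 ->
    exists Tstar : R, 0 < Tstar /\
      forall t : R, 0 <= t <= Tstar ->
        {ae (nu \x lebesgue_measure)%E, forall z : R * R, 0 < z.2 ->
          ((cabs (difference (S0 t psi0) z))%:E <=
           (C * Gamma nbar alpha mu a gamma0 kappa beta t z.1 z.2)%:E *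
           Ynorm nbar alpha mu a gamma0 kappa beta (difference psi0))%E}.
Proof.
move: halpha hmu hgamma0 hbeta => /andP[ha1 ha2] /andP[hm1 hm2] /andP[hg1 hg2] /andP[hb1 _].
exists (bound_cst nbar mu a kappa) => S0 hS psi0 hX.
have [T [T0 hT]] := semigroup_bound hnbar ha1 ha2 hm1 hm2 ha hg1 hg2 hkappa hb1 hX hS.
exists T; split => // t ht; apply: ae_product_sub (hT t ht) => z hz z0.
rewrite (data_normE hkappa hX) -EFinM lee_fin.
exact: hz.
Qed.
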